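(* Let $(M,\omega)$ be a closed symplectic manifold of dimension $2n$ satisfying at least one of the following conditions: (a) $(M,\omega)$ is symplectically aspherical; (b) $(M,\omega)$ is spherically monotone; (c) $(M,\omega)$ has the weak Lefschetz property. Then every free symplectic circle action on $(M,\omega)$ must have non-contractible orbits.
   Context: $M$ is connected. A smooth action of $S^1=\mathbb{R}/\mathbb{Z}$ on $M$, generated by the vector field $X$, is symplectic if the $1$-form $\iota_X\omega$ is closed. An orbit is regarded as the loop $t\mapsto t\cdot x$, $t\in\mathbb{R}/\mathbb{Z}$, and it is contractible if this loop is null-homotopic in $M$. Symplectically aspherical means $[\omega]$ vanishes on the image of the Hurewicz map $\pi_2(M)\to H_2(M;\mathbb{Z})$. Spherically monotone means there is a constant $\lambda\in\mathbb{R}\setminus\{0\}$ with $[\omega]|_{\pi_2(M)}=\lambda\cdot c_1(M)|_{\pi_2(M)}$, where $c_1(M)$ is the first Chern class of $(M,\omega)$. Weak Lefschetz property means multiplication by $[\omega]^{n-1}$, $H^1(M;\mathbb{R})\to H^{2n-1}(M;\mathbb{R})$, is injective. *)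

(* Defs.v *)
From mathcomp Require Export all_boot all_order all_fingroup all_algebra.
From mathcomp Require Export all_classical all_reals all_analysis.
Export Order.TTheory GRing.Theory Num.Theory numFieldNormedType.Exports.

Set Implicit Arguments.
Unset Strict Implicit.
Unset Printing Implicit Defensive.

Local Open Scope classical_set_scope.
Local Open Scope ring_scope.

(* [U] is meant to be open.  In finite dimension, [f] is C^(k+1) on [U] iff it
   is differentiable there and all its directional derivatives are C^k. *)
Fixpoint Ck_on (R : realType) (V W : normedModType R) (k : nat)
    (U : set V) (f : V -> W) : Prop :=
  match k with
  | 0 => forall x, U x -> {for x, continuous f}
  | k'.+1 => (forall x, U x -> differentiable f x) /\
             (forall v : V, Ck_on k' U ('D_v f))
  end.

Definition smooth_on (R : realType) (V W : normedModType R)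
    (U : set V) (f : V -> W) : Prop :=
  forall k, Ck_on k U f.

(* [chart_inv] is only meaningful on [chart_img], and [chart_fun] on
   [chart_dom]; outside they take arbitrary values. *)
Record chart (R : realType) (m : nat) (T : topologicalType) := Chart {
  chart_dom : set T;
  chart_img : set 'rV[R]_m;
  chart_fun :> T -> 'rV[R]_m;
  chart_inv : 'rV[R]_m -> T;
  chart_dom_open : open chart_dom;
  chart_img_open : open chart_img;
  chart_funP : forall x, chart_dom x -> chart_img (chart_fun x);
  chart_invP : forall y, chart_img y -> chart_dom (chart_inv y);
  chart_funK : forall x, chart_dom x -> chart_inv (chart_fun x) = x;
  chart_invK : forall y, chart_img y -> chart_fun (chart_inv y) = y;
  chart_fun_cont : forall x, chart_dom x -> {for x, continuous chart_fun};
  chart_inv_cont : forall y, chart_img y -> {for y, continuous chart_inv}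
}.

Section Transition.
Variables (R : realType) (m : nat) (T : topologicalType).
Implicit Types c : chart R m T.

Definition overlap c c' : set 'rV[R]_m :=
  [set y | chart_img c y /\ chart_dom c' (chart_inv c y)].

Definition transition c c' (y : 'rV[R]_m) : 'rV[R]_m := c' (chart_inv c y).

End Transition.

(* Smooth manifolds without boundary; [chart_at] is a preferred chart around
   each point, so that the atlas covers the manifold. *)
Record manifold (R : realType) (m : nat) := Manifold {
  mpoint :> topologicalType;
  atlas : set (chart R m mpoint);
  chart_at : mpoint -> chart R m mpoint;
  chart_at_atlas : forall x, atlas (chart_at x);
  chart_at_dom : forall x, chart_dom (chart_at x) x;
  manifold_hausdorff : hausdorff_space mpoint;
  manifold_second_countable : @second_countable mpoint;
  transition_smooth : forall c c', atlas c -> atlas c' ->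
    smooth_on (overlap c c') (transition c c')
}.

Definition smooth_map (R : realType) (V : normedModType R) (m : nat)
    (M : manifold R m) (U : set V) (f : V -> M) : Prop :=
  (forall x, U x -> {for x, continuous f}) /\
  (forall c : chart R m M, atlas c ->
     smooth_on (U `&` f @^-1` chart_dom c) (fun x => c (f x))).

Section Forms.
Variables (R : realType) (m : nat) (M : manifold R m).

(* A k-form is given by its expression in every chart: [a c y v] is the value
   at the point of coordinates [y] on the [k] tangent vectors whose
   coordinates are the rows of [v]. *)
Definition preform (k : nat) :=
  chart R m M -> 'rV[R]_m -> 'M[R]_(k, m) -> R.

Definition multilinear k (f : 'M[R]_(k, m) -> R) : Prop :=
  forall (i : 'I_k) (a b : R) (u v w : 'M[R]_(k, m)),
    row i w = a *: row i u + b *: row i v ->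
    row' i u = row' i w -> row' i v = row' i w ->
    f w = a * f u + b * f v.

Definition alternating k (f : 'M[R]_(k, m) -> R) : Prop :=
  forall (v : 'M[R]_(k, m)) (i j : 'I_k),
    i != j -> row i v = row j v -> f v = 0.

(* The coordinates of a tangent vector are row vectors, hence transform by
   right multiplication by the Jacobian matrix of the transition map. *)
Definition is_form k (a : preform k) : Prop :=
  forall c, atlas c ->
  [/\ forall y, chart_img c y -> multilinear (a c y) /\ alternating (a c y),
      forall v, smooth_on (chart_img c) (fun y => a c y v) &
      forall c', atlas c' -> forall y, overlap c c' y ->
      forall v, a c y v =
        a c' (transition c c' y) (v *m 'J (transition c c') y)].

Definition form_eq k (a b : preform k) : Prop :=
  forall c, atlas c -> forall y, chart_img c y -> forall v, a c y v = b c y v.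

Definition form_zero k : preform k := fun _ _ _ => 0.

Definition form_sub k (a b : preform k) : preform k :=
  fun c y v => a c y v - b c y v.

Definition ext_d k (a : preform k) : preform k.+1 := fun c y v =>
  \sum_(i < k.+1) (-1) ^+ i * 'D_(row i v) (fun z => a c z (row' i v)) y.

Definition wedge p q (a : preform p) (b : preform q) : preform (p + q) :=
  fun c y v => (p`!%:R * q`!%:R)^-1 *
    \sum_(s : 'S_(p + q)) (-1) ^+ s *
      (a c y (usubmx (row_perm s v)) * b c y (dsubmx (row_perm s v))).

Fixpoint wedge_pow (w : preform 2) (k : nat) : preform k.*2 :=
  match k return preform k.*2 with
  | 0 => fun _ _ _ => 1
  | k'.+1 => wedge w (@wedge_pow w k')
  end.

Arguments wedge_pow w k : clear implicits.

Definition closed_form k (a : preform k) : Prop :=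
  form_eq (ext_d a) (@form_zero k.+1).

(* Equality of classes in de Rham cohomology, for closed forms of positive
   degree. *)
Definition cohomologous k (a b : preform k.+1) : Prop :=
  exists2 g : preform k, is_form g & form_eq (form_sub a b) (ext_d g).

Definition nondegenerate (w : preform 2) : Prop :=
  forall c, atlas c -> forall y, chart_img c y ->
  forall u : 'rV[R]_m, (forall v : 'rV[R]_m, w c y (col_mx u v) = 0) -> u = 0.

Definition symplectic_form (w : preform 2) : Prop :=
  [/\ is_form w, closed_form w & nondegenerate w].

(* Injectivity of [a] |-> [a] [w]^(n-1) from H^1 to H^(2n-1), where dim M = 2n
   and 2n-1 is written (n.-1).*2.+1. *)
Definition weak_lefschetz (n : nat) (w : preform 2) : Prop :=
  forall a b : preform 1,
    is_form a -> closed_form a -> is_form b -> closed_form b ->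
    @cohomologous (n.-1).*2
      (wedge a (wedge_pow w n.-1)) (wedge b (wedge_pow w n.-1)) ->
    cohomologous a b.

End Forms.

Arguments wedge_pow {R m M} w k.

Section Spheres.
Variables (R : realType) (m : nat) (M : manifold R m).

Definition spherical (a b : R) : 'rV[R]_3 :=
  \row_j [:: sin a * cos b; sin a * sin b; cos a]`_j.

(* A smooth map on S^2 is the same thing as the restriction to S^2 of a smooth
   map on R^3 minus the origin. *)
Definition smooth_sphere (u : 'rV[R]_3 -> M) : Prop :=
  smooth_map [set x | x != 0] u.

(* The integral over S^2 of the pullback of [s] by [u], in spherical
   coordinates. *)
Definition sphere_integral (s : preform M 2) (u : 'rV[R]_3 -> M) : R :=
  \int[lebesgue_measure]_(a in `[0, pi])
    \int[lebesgue_measure]_(b in `[0, 2 * pi])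
      (let c := chart_at (u (spherical a b)) in
       s c (c (u (spherical a b)))
         (col_mx (derive1 (fun a' : R => c (u (spherical a' b))) a)
                 (derive1 (fun b' : R => c (u (spherical a b'))) b))).

End Spheres.

Section ChernClass.
Variables (R : realType) (m : nat) (M : manifold R m).

(* Matrices act on row vectors on the right, so [J] is v |-> v *m J. *)
Definition compatible_acs (w : preform M 2)
    (J : chart R m M -> 'rV[R]_m -> 'M[R]_m) : Prop :=
  forall c, atlas c ->
  [/\ smooth_on (chart_img c) (J c),
      forall c', atlas c' -> forall y, overlap c c' y ->
        J c y *m 'J (transition c c') y =
        'J (transition c c') y *m J c' (transition c c' y) &
      forall y, chart_img c y ->
      [/\ J c y *m J c y = - 1%:M,
          forall v : 'M[R]_(2, m), w c y (v *m J c y) = w c y v &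
          forall v : 'rV[R]_m, v != 0 -> 0 < w c y (col_mx v (v *m J c y))]].

(* The affine connection whose covariant derivative, in the chart [c], is
   nabla_u s = 'D_u s + s *m G c y u; the third condition is the resulting
   transformation rule and the fourth one is nabla J = 0. *)
Definition complex_connection (J : chart R m M -> 'rV[R]_m -> 'M[R]_m)
    (G : chart R m M -> 'rV[R]_m -> 'rV[R]_m -> 'M[R]_m) : Prop :=
  forall c, atlas c ->
  [/\ forall y, chart_img c y -> linear (G c y),
      forall u, smooth_on (chart_img c) (fun y => G c y u),
      forall c', atlas c' -> forall y, overlap c c' y -> forall u,
        G c y u *m 'J (transition c c') y =
        'D_u (fun z => 'J (transition c c') z) y +
        'J (transition c c') y *m
          G c' (transition c c' y) (u *m 'J (transition c c') y) &
      forall y, chart_img c y -> forall u,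
        'D_u (J c) y + J c y *m G c y u - G c y u *m J c y = 0].

Definition curvature (G : chart R m M -> 'rV[R]_m -> 'rV[R]_m -> 'M[R]_m)
    (c : chart R m M) (y u v : 'rV[R]_m) : 'M[R]_m :=
  'D_u (fun z => G c z v) y - 'D_v (fun z => G c z u) y
  + G c y v *m G c y u - G c y u *m G c y v.

(* Chern-Weil: c_1(TM, J) is the class of i/(2 pi) tr_C F.  As
   tr_C F = (tr_R F - i tr_R (J F)) / 2, the real part of that form is
   tr_R (J F) / (4 pi); the imaginary part is exact. *)
Definition chern_form (J : chart R m M -> 'rV[R]_m -> 'M[R]_m)
    (G : chart R m M -> 'rV[R]_m -> 'rV[R]_m -> 'M[R]_m) : preform M 2 :=
  fun c y v =>
    (4 * pi)^-1 * \tr (curvature G c y (row 0 v) (row 1 v) *m J c y).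

(* c_1 is independent of the compatible [J] and of the connection. *)
Definition represents_c1 (w s : preform M 2) : Prop :=
  exists J G, [/\ compatible_acs w J, complex_connection J G &
                  s = chern_form J G].

Definition symplectically_aspherical (w : preform M 2) : Prop :=
  forall u : 'rV[R]_3 -> M, smooth_sphere u -> sphere_integral w u = 0.

Definition spherically_monotone (w : preform M 2) : Prop :=
  exists2 l : R, l != 0 &
  exists2 s : preform M 2, represents_c1 w s &
  forall u : 'rV[R]_3 -> M, smooth_sphere u ->
    sphere_integral w u = l * sphere_integral s u.

End ChernClass.

Section CircleActions.
Variables (R : realType) (m : nat) (M : manifold R m).

(* An action of R/Z is an action of R for which 1 acts trivially. *)
Definition smooth_circle_action (act : R -> M -> M) : Prop :=
  [/\ forall x, act 0 x = x,
      forall s t x, act (s + t) x = act s (act t x),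
      forall x, act 1 x = x &
      forall c : chart R m M, atlas c ->
        smooth_map (setT `*` chart_img c)
          (fun p : R^o * 'rV[R]_m => act p.1 (chart_inv c p.2))].

Definition action_field (act : R -> M -> M)
    (c : chart R m M) (y : 'rV[R]_m) : 'rV[R]_m :=
  derive1 (fun t : R => c (act t (chart_inv c y))) 0.

Definition contraction (X : chart R m M -> 'rV[R]_m -> 'rV[R]_m)
    (w : preform M 2) : preform M 1 :=
  fun c y v => w c y (col_mx (X c y) v).

Definition symplectic_action (w : preform M 2) (act : R -> M -> M) : Prop :=
  closed_form (contraction (action_field act) w).

Definition free_circle_action (act : R -> M -> M) : Prop :=
  forall t x, act t x = x -> t \is a Num.int.

(* Loops are 1-periodic maps on R. *)
Definition null_homotopic (g : R -> M) : Prop :=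
  exists (H : R * R -> M) (p : M),
  [/\ {within [set st | 0 <= st.1 <= 1], continuous H},
      forall s t : R, 0 <= s <= 1 -> H (s, t + 1) = H (s, t),
      forall t, H (0, t) = g t &
      forall t, H (1, t) = p].

Definition contractible_orbit (act : R -> M -> M) (x : M) : Prop :=
  null_homotopic (fun t => act t x).

End CircleActions.

(* Main.v *)
From HB Require Import structures.
Require Import Defs.
From mathcomp Require Import ring lra zify.

Set Implicit Arguments.
Unset Strict Implicit.
Unset Printing Implicit Defensive.

Local Open Scope classical_set_scope.
Local Open Scope ring_scope.

(** Suppose all orbits are contractible, let X generate the action and let
    alpha = i_X omega. It is enough to show that alpha is exact: at a maximum of a
    primitive X would vanish, and the action would not be free.

    In cases (a) and (b), let sigma be 0 or lambda times a form representing c_1, so that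
    omega and sigma have the same integrals over spheres. For each x choose a disc
    bounded by the orbit of x, and let h(x) be the integral of omega - sigma over
    it; this does not depend on the disc. Two discs and the torus swept by the
    orbits of the points of a path form a sphere, hence dh is, up to sign, the
    integral of i_X (omega - sigma) along the orbits, that is alpha minus the fibre
    integral of sigma. The latter is exact for the Chern form: it is the
    derivative of the integral over the orbit of the trace of J times the
    connection matrix, in the frame transported by the complex linear part of the
    action.

    In case (c), eta = i_X omega^n is a nonzero multiple of the product of alpha
    with omega^(n-1), and d(u eta) = (X u) omega^n for all functions u. If eta were
    not exact, then by Poincare duality, carried out here by a Cech argument for a
    finite cover by cubes, there would be a closed 1-form beta with beta(X) omega^n
    not exact. But the integrals of beta over the orbits vanish, so that
    beta(X) = X phi for the average phi(x) of t beta(X)(t x) over 0 <= t <= 1, and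
    beta(X) omega^n = d(phi eta). Hence eta is exact, and the weak Lefschetz
    property shows that alpha is exact. *)

(** * Smooth functions *)

(** The null-homotopies are only continuous, whereas h needs integrals of forms, so each disc is
    smoothed chart by chart away from its boundary. Every homotopy is kept constant near both ends:
    concatenations are then smooth, and a map F(s, b) with point ends descends to S^2 despite the
    singular angle at the poles. For the Chern form the obstacle is that the action need not
    preserve J, so its derivative does not commute with J. It is symplectic, however, and for a
    compatible J this makes its complex linear part invertible. That part intertwines the two copies
    of J and, J being parallel, the connection matrix in the resulting frame commutes with J in the
    orbit direction, which kills the commutator term of the curvature. In case (c) no integral over
    M is set up: one bump form spans the top cohomology, and the coefficient on it replaces the
    integral. If that bump form is exact, so is omega^n, and the fibre integral of a primitive
    yields one of eta. The dual closed 1-forms beta occur only as real cocycles on the nerve of the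
    cover, with primitives on its members. *)

Section CkBasics.
Context {R : realType}.
Implicit Types (V W Z : normedModType R) (k : nat).

Lemma near_eq_diff V W (f g : V -> W) (x : V) :
  (\near x, f x = g x) -> differentiable f x ->
  differentiable g x /\ 'd g x = 'd f x :> (V -> W).
Proof.
move=> fg df; have [cf ef] := (@diff_locallyP _ _ _ _ _).1 df.
have gx : f x = g x by exact: nbhs_singleton fg.
have eg : g \o shift x = cst (g x) + 'd f x +o_0 id.
  apply/eqaddoP => _ /posnumP[e].
  have /eqaddoP/(_ e%:num) He := ef.
  have fg0 : \forall h \near (0 : V), f (h + x) = g (h + x).
    have := fg; rewrite (near_shift 0) /=.
    by apply: filterS => h; rewrite /= subr0.
  have {}He := He [gt0 of e%:num]; near=> h.
  have E0 : f (h + x) = g (h + x) by near: h.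
  rewrite -gx -[(_ - _) h]/(g (h + x) - (f x + 'd f x h)) -E0.
  by near: h; exact: He.
have E := diff_unique cf eg.
split; last exact: E.
by apply/diff_locallyP; rewrite E; exact: (conj cf eg).
Unshelve. all: by end_near. Qed.

Lemma near_eq_differentiable V W (f g : V -> W) x :
  (\near x, f x = g x) -> differentiable f x -> differentiable g x.
Proof. by move=> fg df; have [] := near_eq_diff fg df. Qed.

Lemma Ck_on_sub k V W (U O : set V) (f : V -> W) :
  O `<=` U -> Ck_on k U f -> Ck_on k O f.
Proof.
elim: k f => [|k IH] f OU /=; first by move=> Hf x /OU; exact: Hf.
by move=> [df Df]; split=> [x /OU|v]; [exact: df | exact: IH (Df v)].
Qed.

Lemma Ck_onW k V W (U : set V) (f : V -> W) : Ck_on k.+1 U f -> Ck_on k U f.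
Proof.
elim: k f => [|k IH] f [df Df].
  by move=> x Ux; apply: differentiable_continuous; exact: df.
by split=> // v; apply: IH; exact: Df.
Qed.

Lemma Ck_on_le k l V W (U : set V) (f : V -> W) : (l <= k)%N ->
  Ck_on k U f -> Ck_on l U f.
Proof.
elim: k => [|k IH]; first by rewrite leqn0 => /eqP ->.
by rewrite leq_eqVlt ltnS => /orP[/eqP -> //|/IH H /Ck_onW]; exact: H.
Qed.

Lemma Ck_on_ext k V W (U : set V) (f g : V -> W) : open U -> {in U, f =1 g} ->
  Ck_on k U f -> Ck_on k U g.
Proof.
move=> oU; elim: k f g => [|k IH] f g fg /=.
  move=> Hf x Ux.
  have Hn : \near x, f x = g x.
    by near=> y; apply: fg; rewrite inE; near: y; exact: open_nbhs_nbhs.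
  rewrite /prop_for /continuous_at -(fg x) ?inE//.
  by apply: cvg_trans (Hf x Ux); apply: near_eq_cvg; near=> y; near: y.
have Hn x : U x -> \near x, f x = g x.
  by move=> Ux; near=> y; apply: fg; rewrite inE; near: y; exact: open_nbhs_nbhs.
move=> [df Df]; split.
  by move=> x Ux; apply: near_eq_differentiable (df x Ux); exact: Hn.
move=> v; apply: IH (Df v) => x; rewrite inE => Ux.
by apply: near_eq_derive; exact: Hn.
Unshelve. all: by end_near. Qed.

Lemma Ck_on_pt k V W (U : set V) (f : V -> W) :
  (forall x, U x -> exists2 O, O x & Ck_on k O f) -> Ck_on k U f.
Proof.
elim: k f => [|k IH] f Hf /=; first by move=> x /Hf [N Nx H]; exact: H.
split; first by move=> x /Hf [N Nx [H _]]; exact: H.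
by move=> v; apply: IH => x /Hf [N Nx [_ H]]; exists N => //; exact: H.
Qed.

Lemma Ck_on_cst k V W (U : set V) (a : W) : Ck_on k U (fun _ : V => a).
Proof.
elim: k a => [|k IH] a /=; first by move=> x _; exact: cvg_cst.
split=> [x _|v]; first exact: differentiable_cst.
rewrite (_ : 'D_v _ = cst 0); first exact: IH.
by apply/funext => x; rewrite derive_cst.
Qed.

Lemma Ck_onD k V W (U : set V) (f g : V -> W) : open U ->
  Ck_on k U f -> Ck_on k U g -> Ck_on k U (fun x => f x + g x).
Proof.
move=> oU; elim: k f g => [|k IH] f g /=.
  by move=> cf cg x Ux; apply: cvgD; [exact: cf|exact: cg].
move=> [df Df] [dg Dg]; split=> [x Ux|v].
  by apply: differentiableD; [exact: df|exact: dg].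
apply: Ck_on_ext (IH _ _ (Df v) (Dg v)) => // x; rewrite inE => Ux.
by rewrite deriveD//; apply: diff_derivable; [exact: df|exact: dg].
Qed.

(** Registering scaling as a bilinear map makes the general differential of bilinear maps yield the
    Leibniz rule [diff_scale]. *)
Lemma scale_is_bilinear W :
  bilinear_for
    (GRing.Scale.Law.clone _ _ *:%R _) (GRing.Scale.Law.clone _ _ *:%R _)
    (@GRing.scale R W).
Proof.
split=> [u'|u] a x y /=; first by rewrite scalerDl scalerA.
by rewrite scalerDr !scalerA mulrC.
Qed.

HB.instance Definition _ W := bilinear_isBilinear.Build R R W W _ _
  (@GRing.scale R W) (@scale_is_bilinear W).

Lemma diff_scale V W (a : V -> R) (f : V -> W) x :
  differentiable a x -> differentiable f x ->
  differentiable (fun x => a x *: f x) x /\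
  forall v, 'D_v (fun x => a x *: f x) x = 'D_v a x *: f x + a x *: 'D_v f x.
Proof.
move=> da df.
have cs : continuous (fun p : R * W => p.1 *: p.2) by exact: scale_continuous.
have dp := differentiable_pair da df.
have ds := @differentiable_bilin R R W W
  (@GRing.scale R W : {bilinear R -> W -> W}) (a x, f x) cs.
split; first exact: (differentiable_comp dp ds).
move=> v; rewrite !deriveE//; last exact: (differentiable_comp dp ds).
rewrite (_ : (fun x => _) = (fun p : R * W => p.1 *: p.2) \o
  (fun y => (a y, f y)))// diff_comp// diff_pair//=.
rewrite (@diff_bilin R R W W (@GRing.scale R W : {bilinear R -> W -> W}))//=.
by rewrite addrC.
Qed.

Lemma Ck_onZ k V W (U : set V) (a : V -> R) (f : V -> W) : open U ->
  Ck_on k U a -> Ck_on k U f -> Ck_on k U (fun x => a x *: f x).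
Proof.
move=> oU; elim: k a f => [|k IH] a f.
  by move=> cf cg x Ux; apply: cvgZ; [exact: cf|exact: cg].
move=> Ha Hf; have [da Da] := Ha; have [df Df] := Hf.
split=> [x Ux|v]; first by have [] := diff_scale (da x Ux) (df x Ux).
have := Ck_onD oU (IH _ _ (Da v) (Ck_onW Hf)) (IH _ _ (Ck_onW Ha) (Df v)).
apply: Ck_on_ext => // x; rewrite inE => Ux.
by have [_ ->] := diff_scale (da x Ux) (df x Ux).
Qed.

Lemma Ck_on_linear k V W Z (U : set V) (l : {linear W -> Z}) (f : V -> W) :
  open U -> continuous l -> Ck_on k U f -> Ck_on k U (fun x => l (f x)).
Proof.
move=> oU cl; elim: k f => [|k IH] f /=.
  by move=> cf x Ux; apply: continuous_comp; [exact: cf|exact: cl].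
move=> [df Df]; split=> [x Ux|v].
  by apply: differentiable_comp; [exact: df|exact: linear_differentiable].
apply: Ck_on_ext (IH _ (Df v)) => // x; rewrite inE => Ux.
rewrite [RHS]deriveE; last first.
  by apply: differentiable_comp; [exact: df|exact: linear_differentiable].
rewrite (diff_comp (g := l)) ?diff_lin//= ?deriveE//; try exact: df.
exact: linear_differentiable.
Qed.

Lemma Ck_on_id k V (U : set V) : Ck_on k U (fun x : V => x).
Proof.
case: k => [|k]; first by move=> x _; exact: cvg_id.
split=> [x _|v]; first exact: (@ex_diff _ _ _ _ _ _ _ (is_diff_id x)).
rewrite (_ : 'D_v _ = cst v); first exact: Ck_on_cst.
by apply/funext => x; rewrite derive_id.
Qed.

Lemma Ck_on_sum k V W (U : set V) (I : Type) (r : seq I) (P : pred I)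
  (f : I -> V -> W) : open U ->
  (forall i, P i -> Ck_on k U (f i)) ->
  Ck_on k U (fun x => \sum_(i <- r | P i) f i x).
Proof.
move=> oU Hf; elim: r => [|i r IH].
  rewrite (_ : (fun x => _) = (fun=> 0)); first exact: Ck_on_cst.
  by apply/funext => x; rewrite big_nil.
case Pi : (P i).
  rewrite (_ : (fun x => _) =
    (fun x => f i x + \sum_(i <- r | P i) f i x)).
    by apply: Ck_onD => //; exact: Hf.
  by apply/funext => x; rewrite big_cons Pi.
rewrite (_ : (fun x => _) = (fun x => \sum_(i <- r | P i) f i x))//.
by apply/funext => x; rewrite big_cons Pi.
Qed.

Lemma cont_sum (T : topologicalType) W (I : Type) (r : seq I)
    (f : I -> T -> W) (x : T) : (forall i, {for x, continuous (f i)}) ->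
  {for x, continuous (fun t => \sum_(i <- r) f i t)}.
Proof.
move=> cf; elim: r => [|i r IH].
  rewrite (_ : (fun t => _) = cst 0); first exact: cvg_cst.
  by apply/funext => y; rewrite big_nil.
rewrite (_ : (fun t => _) = (fun t => f i t + \sum_(i <- r) f i t)).
  by apply: cvgD; [exact: cf|exact: IH].
by apply/funext => y; rewrite big_cons.
Qed.

(** The chain rule differentiates g along a direction that moves with the point, while [Ck_on] only
    handles fixed directions; a finite basis with continuous coordinates reduces the former to the
    latter. *)
Definition fin_dim W := exists (n : nat) (e : 'I_n -> W)
  (l : 'I_n -> {linear W -> R}),
  (forall i, continuous (l i)) /\ forall w, w = \sum_i l i w *: e i.

Lemma diff_coord W Z (g : W -> Z) n (e : 'I_n -> W) (l : 'I_n -> {linear W -> R}) y w :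
  (forall w, w = \sum_i l i w *: e i) -> differentiable g y ->
  'd g y w = \sum_i l i w *: 'D_(e i) g y.
Proof.
move=> el dg; rewrite {1}(el w) linear_sum; apply: eq_bigr => i _.
by rewrite linearZ /= deriveE.
Qed.

Lemma derive_comp V W Z (g : W -> Z) (f : V -> W) x v :
  differentiable f x -> differentiable g (f x) ->
  'D_v (fun x => g (f x)) x = 'D_('D_v f x) g (f x).
Proof.
move=> df dg; rewrite !deriveE//; last exact: (differentiable_comp df dg).
by rewrite (diff_comp df dg).
Qed.

Lemma Ck_on_comp k V W Z (U : set V) (O : set W) (f : V -> W) (g : W -> Z) :
  fin_dim W -> open U -> (forall x, U x -> O (f x)) ->
  Ck_on k U f -> Ck_on k O g -> Ck_on k U (fun x => g (f x)).
Proof.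
move=> [n [e [l [cl el]]]] oU fUO; elim: k g => [|k IH] g.
  move=> cf cg x Ux; apply: continuous_comp; first exact: cf.
  by apply: cg; exact: fUO.
move=> Hf [dg Dg]; have [df Df] := Hf; split=> [x Ux|v].
  by apply: differentiable_comp; [exact: df | apply: dg; exact: fUO].
(* The derivative of the composite, written with the fixed directions [e i]: the coefficients are
   C^k by the regularity of f, the other factors by induction. *)
have H : Ck_on k U (fun x => \sum_i l i ('D_v f x) *: 'D_(e i) g (f x)).
  apply: Ck_on_sum => // i _; apply: Ck_onZ => //.
    by apply: Ck_on_linear => //; exact: Df.
  by apply: (IH ('D_(e i) g)); [exact: Ck_onW|exact: Dg].
apply: Ck_on_ext H => // x; rewrite inE => Ux.
have dgx : differentiable g (f x) by apply: dg; exact: fUO.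
by rewrite (derive_comp _ (df x Ux) dgx) [RHS]deriveE// -(diff_coord _ el).
Qed.

Lemma Ck_on_pair k V W Z (U : set V) (f : V -> W) (g : V -> Z) : open U ->
  Ck_on k U f -> Ck_on k U g -> Ck_on k U (fun x => (f x, g x) : W * Z).
Proof.
move=> oU; elim: k f g => [|k IH] f g.
  by move=> cf cg x Ux; apply: cvg_pair; [exact: cf|exact: cg].
move=> [df Df] [dg Dg]; split=> [x Ux|v].
  by apply: differentiable_pair; [exact: df|exact: dg].
apply: Ck_on_ext (IH _ _ (Df v) (Dg v)) => // x; rewrite inE => Ux.
rewrite [RHS]deriveE; last by apply: differentiable_pair; [exact: df|exact: dg].
by rewrite diff_pair ?deriveE//; by [exact: df|exact: dg].
Qed.

Lemma Ck_onV k V (U : set V) (f : V -> R) : open U ->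
  (forall x, U x -> f x != 0) -> Ck_on k U f -> Ck_on k U (fun x => (f x)^-1).
Proof.
move=> oU f0; elim: k => [|k IH].
  by move=> cf x Ux; apply: cvgV; [exact: f0|exact: cf].
move=> Hf; have [df Df] := Hf; split=> [x Ux|v].
  by apply: differentiableV; [exact: df|exact: f0].
have Hi := IH (Ck_onW Hf).
have := Ck_onZ oU (Ck_onZ oU (@Ck_on_cst k V R U (-1)) (Ck_onZ oU Hi Hi)) (Df v).
apply: Ck_on_ext => // x; rewrite inE => Ux.
rewrite deriveV ?f0//; last by apply: diff_derivable; exact: df.
by rewrite scaleN1r /GRing.scale /= expr2 invfM.
Qed.

End CkBasics.

Section FinDim.
Context {R : realType}.

Lemma fin_dim_scalar : fin_dim (R : normedModType R).
Proof.
exists 1%N, (fun=> 1), (fun=> (@idfun R : {linear R -> R})); split.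
  by move=> _ x; exact: cvg_id.
by move=> w; rewrite big_ord1 /= /GRing.scale /= mulr1.
Qed.

Lemma fin_dim_mx m n : fin_dim ('M[R]_(m, n) : normedModType R).
Proof.
pose e (p : 'I_#|{: 'I_m * 'I_n}|) : 'M[R]_(m, n) :=
  delta_mx (enum_val p).1 (enum_val p).2.
have lin (p : 'I_m * 'I_n) : linear (fun M : 'M[R]_(m, n) => M p.1 p.2 : R).
  by move=> a u v; rewrite !mxE.
pose l (p : 'I_#|{: 'I_m * 'I_n}|) : {linear 'M[R]_(m, n) -> R} :=
  HB.pack (fun M : 'M[R]_(m, n) => M (enum_val p).1 (enum_val p).2 : R)
    (GRing.isLinear.Build R _ _ _ _ (lin (enum_val p))).
exists #|{: 'I_m * 'I_n}|, e, l; split; first by move=> i x; exact: coord_continuous.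
move=> w; rewrite [LHS]matrix_sum_delta pair_big /=.
rewrite (reindex (fun i : 'I_#|{: 'I_m * 'I_n}| => enum_val i))//=.
by exists enum_rank => i _; [exact: enum_valK|exact: enum_rankK].
Qed.

Lemma fin_dim_prod (V W : normedModType R) :
  fin_dim V -> fin_dim W -> fin_dim (V * W : normedModType R)%type.
Proof.
move=> [n [e [l [cl el]]]] [p [e' [l' [cl' el']]]].
pose E (i : 'I_(n + p)) : V * W :=
  match fintype.split i with inl j => (e j, 0) | inr j => (0, e' j) end.
have lin1 j : linear (fun x : V * W => l j x.1) by move=> a u v; rewrite /= linearP.
have lin2 j : linear (fun x : V * W => l' j x.2) by move=> a u v; rewrite /= linearP.
pose L (i : 'I_(n + p)) : {linear (V * W)%type -> R} :=
  match fintype.split i with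
  | inl j => HB.pack (fun x : V * W => l j x.1) (GRing.isLinear.Build R _ _ _ _ (lin1 j))
  | inr j => HB.pack (fun x : V * W => l' j x.2) (GRing.isLinear.Build R _ _ _ _ (lin2 j))
  end.
exists (n + p)%N, E, L; split.
  move=> i; rewrite /L; case: (fintype.split i) => j x.
    by apply: (@continuous_comp _ _ _ fst (l j)); [exact: cvg_fst|exact: cl].
  by apply: (@continuous_comp _ _ _ snd (l' j)); [exact: cvg_snd|exact: cl'].
move=> w; rewrite big_split_ord /=.
have -> : \sum_(i < n) L (lshift p i) w *: E (lshift p i) = (w.1, 0).
  transitivity (\sum_i (l i w.1 *: e i, 0 : W)).
    apply: eq_bigr => i _; rewrite /L /E (unsplitK (inl _ i)) /=.
    by congr pair; rewrite /= ?scaler0.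
  rewrite [in RHS](el w.1).
  by apply: (big_ind2 (fun (y : V * W) (x : V) => y = (x, 0))) => // x y x' y' -> ->;
    rewrite -[LHS]/(_, _) /= addr0.
have -> : \sum_(i < p) L (rshift n i) w *: E (rshift n i) = (0, w.2).
  transitivity (\sum_i (0 : V, l' i w.2 *: e' i)).
    apply: eq_bigr => i _; rewrite /L /E (unsplitK (inr _ i)) /=.
    by congr pair; rewrite /= ?scaler0.
  rewrite [in RHS](el' w.2).
  by apply: (big_ind2 (fun (y : V * W) (x : W) => y = (0, x))) => // x y x' y' -> ->;
    rewrite -[LHS]/(_, _) /= addr0.
by rewrite -[RHS]/(_, _) /= addr0 add0r; case: w.
Qed.

End FinDim.

Section SmoothAt.
Context {R : realType}.
Implicit Types V W Z : normedModType R.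

(** The neighbourhood may shrink as k grows. This pointwise notion still recovers [smooth_on] on
    open sets, and spares the bookkeeping of domains in compositions. *)
Definition smooth_at V W (f : V -> W) (x : V) :=
  forall k, exists U, [/\ open U, U x & Ck_on k U f].

Lemma smooth_onP V W (U : set V) (f : V -> W) : open U ->
  smooth_on U f <-> forall x, U x -> smooth_at f x.
Proof.
move=> oU; split=> [Hf x Ux k|Hf k]; first by exists U; split=> //; exact: Hf.
by apply: Ck_on_pt => x Ux; have [N [_ Nx H]] := Hf x Ux k; exists N.
Qed.

Lemma smooth_on_at V W (U : set V) (f : V -> W) x : open U -> U x ->
  smooth_on U f -> smooth_at f x.
Proof. by move=> oU Ux /(smooth_onP _ oU); exact. Qed.

Lemma smooth_at_near V W (f g : V -> W) x :
  (\near x, f x = g x) -> smooth_at f x -> smooth_at g x.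
Proof.
rewrite -[(\near x, _)]/(nbhs x _) nbhsE => -[N [oN Nx] fg] Hf k.
have [U [oU Ux H]] := Hf k; exists (U `&` N); split=> //; first exact: openI.
apply: Ck_on_ext (Ck_on_sub _ H); first exact: openI.
  by move=> y; rewrite inE => -[_ Ny]; exact: fg.
exact: subIsetl.
Qed.

Lemma smooth_at_cst V W (a : W) x : smooth_at (fun _ : V => a) x.
Proof. by move=> k; exists setT; split=> //; [exact: openT|exact: Ck_on_cst]. Qed.

Lemma smooth_at_id V x : smooth_at (fun x : V => x) x.
Proof. by move=> k; exists setT; split=> //; [exact: openT|exact: Ck_on_id]. Qed.

Let binary V W Z (T : normedModType R) (F : (V -> W) -> (V -> Z) -> V -> T) :
  (forall k U f g, open U -> Ck_on k U f -> Ck_on k U g -> Ck_on (R := R) k U (F f g)) ->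
  forall f g x, smooth_at f x -> smooth_at g x -> smooth_at (F f g) x.
Proof.
move=> H f g x Hf Hg k; have [U [oU Ux fU]] := Hf k; have [N [oN Nx gN]] := Hg k.
exists (U `&` N); split=> //; first exact: openI.
by apply: H; [exact: openI|apply: Ck_on_sub fU; exact: subIsetl|
  apply: Ck_on_sub gN; exact: subIsetr].
Qed.

Lemma smooth_atD V W (f g : V -> W) x :
  smooth_at f x -> smooth_at g x -> smooth_at (fun x => f x + g x) x.
Proof.
by move: f g x; apply: (binary (F := fun f g x => f x + g x)) => k U f g; exact: Ck_onD.
Qed.

Lemma smooth_atZ V W (a : V -> R) (f : V -> W) x :
  smooth_at a x -> smooth_at f x -> smooth_at (fun x => a x *: f x) x.
Proof.
by move: a f x; apply: (binary (F := fun (a : V -> R) f x => a x *: f x)) => k U f g; exact: Ck_onZ.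
Qed.

Lemma smooth_atM V (f g : V -> R) x :
  smooth_at f x -> smooth_at g x -> smooth_at (fun x => f x * g x) x.
Proof. exact: smooth_atZ. Qed.

Lemma smooth_at_pair V W Z (f : V -> W) (g : V -> Z) x :
  smooth_at f x -> smooth_at g x -> smooth_at (fun x => (f x, g x) : W * Z) x.
Proof.
by move: f g x; apply: (binary (F := fun f g x => (f x, g x) : W * Z)) => k U f g; exact: Ck_on_pair.
Qed.

Lemma smooth_at_linear V W Z (l : {linear W -> Z}) (f : V -> W) x :
  continuous l -> smooth_at f x -> smooth_at (fun x => l (f x)) x.
Proof.
move=> cl Hf k; have [U [oU Ux fU]] := Hf k.
by exists U; split=> //; exact: Ck_on_linear.
Qed.

Lemma smooth_atN V W (f : V -> W) x : smooth_at f x -> smooth_at (fun x => - f x) x.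
Proof.
move=> Hf; have := smooth_atZ (smooth_at_cst (-1 : R) x) Hf.
by under eq_fun do rewrite scaleN1r.
Qed.

Lemma smooth_atB V W (f g : V -> W) x :
  smooth_at f x -> smooth_at g x -> smooth_at (fun x => f x - g x) x.
Proof. by move=> Hf Hg; apply: smooth_atD => //; exact: smooth_atN. Qed.

Lemma smooth_at_sum V W (I : Type) (r : seq I) (P : pred I)
  (f : I -> V -> W) x : (forall i, P i -> smooth_at (f i) x) ->
  smooth_at (fun x => \sum_(i <- r | P i) f i x) x.
Proof.
move=> Hf; elim: r => [|i r IH].
  under eq_fun do rewrite big_nil; exact: smooth_at_cst.
case Pi : (P i); last by under eq_fun do rewrite big_cons Pi.
by under eq_fun do rewrite big_cons Pi; apply: smooth_atD => //; exact: Hf.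
Qed.

Lemma smooth_at_prod V (I : Type) (r : seq I) (P : pred I)
  (f : I -> V -> R) x : (forall i, P i -> smooth_at (f i) x) ->
  smooth_at (fun x => \prod_(i <- r | P i) f i x) x.
Proof.
move=> Hf; elim: r => [|i r IH].
  under eq_fun do rewrite big_nil; exact: smooth_at_cst.
case Pi : (P i); last by under eq_fun do rewrite big_cons Pi.
by under eq_fun do rewrite big_cons Pi; apply: smooth_atM => //; exact: Hf.
Qed.

Lemma smooth_at_differentiable V W (f : V -> W) x : smooth_at f x -> differentiable f x.
Proof. by move=> /(_ 1%N)[U [_ Ux [df _]]]; exact: df. Qed.

Lemma smooth_at_continuous V W (f : V -> W) x : smooth_at f x -> {for x, continuous f}.
Proof. by move=> /(_ 0%N)[U [_ Ux]]; exact. Qed.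

Lemma smooth_at_derivable V W (f : V -> W) x v : smooth_at f x -> derivable f x v.
Proof. by move=> /smooth_at_differentiable; exact: diff_derivable. Qed.

Lemma smooth_at_near_differentiable V W (f : V -> W) x : smooth_at f x ->
  \near x, differentiable f x.
Proof.
move=> /(_ 1%N)[U [oU Ux [df _]]].
by rewrite -[(\near x, _)]/(nbhs x _) nbhsE; exists U.
Qed.

Lemma smooth_at_derive V W (f : V -> W) v x : smooth_at f x -> smooth_at ('D_v f) x.
Proof. by move=> Hf k; have [U [oU Ux [_ H]]] := Hf k.+1; exists U; split=> //; exact: H. Qed.

Lemma smooth_at_comp V W Z (f : V -> W) (g : W -> Z) x : fin_dim W ->
  smooth_at f x -> smooth_at g (f x) -> smooth_at (fun x => g (f x)) x.
Proof.
move=> fW Hf Hg k; have [U [oU Ux fU]] := Hf k; have [N [oN Nx gN]] := Hg k.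
have cf : forall y, U y -> {for y, continuous f} := Ck_on_le (leq0n k) fU.
have : nbhs x (U `&` f @^-1` N).
  apply: filterI; first exact: open_nbhs_nbhs.
  by apply: (cf x Ux); exact: open_nbhs_nbhs.
rewrite nbhsE => -[N' [oN' N'x] sub]; exists N'; split=> //.
apply: (@Ck_on_comp R k V W Z N' N) => //; first by move=> y /sub [].
by apply: Ck_on_sub fU => y /sub [].
Qed.

Lemma smooth_at_inv V (f : V -> R) x : f x != 0 -> smooth_at f x ->
  smooth_at (fun x => (f x)^-1) x.
Proof.
move=> fx0 Hf k; have [U [oU Ux fU]] := Hf k.
have cf : forall y, U y -> {for y, continuous f} := Ck_on_le (leq0n k) fU.
have : nbhs x (U `&` [set y | f y != 0]).
  apply: filterI; first exact: open_nbhs_nbhs.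
  have : nbhs (f x) [set z : R | z != 0].
    by apply: open_nbhs_nbhs; split => //; exact: open_neq.
  exact: (cf x Ux).
rewrite nbhsE => -[N' [oN' N'x] sub]; exists N'; split=> //.
apply: Ck_onV => //; first by move=> y /sub [].
by apply: Ck_on_sub fU => y /sub [].
Qed.

Lemma smooth_at_coord V m n (f : V -> 'M[R]_(m, n)) i j x :
  smooth_at f x -> smooth_at (fun x => f x i j : R) x.
Proof.
have lin : linear (fun M : 'M[R]_(m, n) => M i j : R) by move=> a u v; rewrite !mxE.
pose l : {linear 'M[R]_(m, n) -> R} := HB.pack (fun M : 'M[R]_(m, n) => M i j : R)
    (GRing.isLinear.Build R _ _ _ _ lin).
by apply: (@smooth_at_linear V _ _ l) => M; exact: coord_continuous.
Qed.

Lemma smooth_at_mx V m n (f : V -> 'M[R]_(m, n)) x :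
  (forall i j, smooth_at (fun x => f x i j : R) x) -> smooth_at f x.
Proof.
move=> Hf.
rewrite (_ : f = fun x => \sum_i \sum_j f x i j *: delta_mx i j); last first.
  by apply/funext => y; rewrite [LHS]matrix_sum_delta.
do 2 (apply: smooth_at_sum => ? _).
by apply: smooth_atZ; [exact: Hf|exact: smooth_at_cst].
Qed.

Lemma smooth_at_mulmx V m n p (f : V -> 'M[R]_(m, n)) (g : V -> 'M[R]_(n, p)) x :
  smooth_at f x -> smooth_at g x -> smooth_at (fun x => f x *m g x) x.
Proof.
move=> Hf Hg; apply: smooth_at_mx => i j; under eq_fun do rewrite mxE.
by apply: smooth_at_sum => k _; apply: smooth_atM; exact: smooth_at_coord.
Qed.

Lemma smooth_at_det V n (f : V -> 'M[R]_n) x :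
  smooth_at f x -> smooth_at (fun x => \det (f x)) x.
Proof.
move=> Hf; rewrite /determinant; apply: smooth_at_sum => s _.
apply: smooth_atM; first exact: smooth_at_cst.
by apply: smooth_at_prod => i _; exact: smooth_at_coord.
Qed.

Lemma smooth_at_invmx V n (f : V -> 'M[R]_n) x : f x \in unitmx ->
  smooth_at f x -> smooth_at (fun x => invmx (f x)) x.
Proof.
move=> ux Hf; have Hd := smooth_at_det Hf.
have near0 : \near x, f x \in unitmx.
  have cd := smooth_at_continuous Hd.
  have H : nbhs (\det (f x)) [set z : R | z != 0].
    by apply: open_nbhs_nbhs; split; [exact: open_neq|
      rewrite unitmxE unitfE in ux].
  have {}H : nbhs x [set y | \det (f y) != 0] by exact: (cd _ H).
  by apply: (@filterS _ _ _ [set y | \det (f y) != 0]) H => z /= z0;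
    rewrite unitmxE unitfE.
(* [invmx] is given by the adjugate formula only at invertible matrices, hence the passage to a
   neighbourhood. *)
apply: (@smooth_at_near _ _ (fun x => (\det (f x))^-1 *: \adj (f x))).
  by near do rewrite /invmx ifT//.
apply: smooth_atZ.
  by apply: smooth_at_inv => //; rewrite unitmxE unitfE in ux.
apply: smooth_at_mx => i j; under eq_fun do rewrite mxE /cofactor.
apply: smooth_atM; first exact: smooth_at_cst.
apply: smooth_at_det; apply: smooth_at_mx => i' j'; under eq_fun do rewrite !mxE.
exact: smooth_at_coord.
Unshelve. all: by end_near. Qed.

Lemma derive_linear V W Z (l : {linear W -> Z}) (f : V -> W) x v :
  continuous l -> differentiable f x -> 'D_v (fun x => l (f x)) x = l ('D_v f x).
Proof.
move=> cl df; rewrite derive_comp//; last exact: linear_differentiable.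
by rewrite deriveE ?diff_lin//; exact: linear_differentiable.
Qed.

Lemma derive_pair V W Z (f : V -> W) (g : V -> Z) x v :
  differentiable f x -> differentiable g x ->
  'D_v (fun x => (f x, g x) : W * Z) x = ('D_v f x, 'D_v g x).
Proof.
move=> df dg; rewrite deriveE; last exact: differentiable_pair.
by rewrite diff_pair// !deriveE.
Qed.

Lemma derive_coord V m n (f : V -> 'M[R]_(m, n)) i j x v : derivable f x v ->
  'D_v (fun x => f x i j : R) x = 'D_v f x i j.
Proof. by move=> /derive_mx ->; rewrite mxE. Qed.

End SmoothAt.

(** * Parametric integrals *)

Section OneVariable.
Context {R : realType}.
Implicit Types (f g F : R -> R) (a b : R).

Definition pint a b f := \int[lebesgue_measure]_(t in `[a, b]) f t.

(** Continuity is that of the ambient line, also at the end points: the integrands below are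
    restrictions of functions that are regular beyond the interval, and one-sided limits then come
    for free. *)
Definition cont_on a b f := forall t, a <= t <= b -> {for t, continuous f}.

Lemma cont_on_within a b f : cont_on a b f -> {within `[a, b], continuous f}.
Proof.
move=> cf; apply: continuous_in_subspaceT => t; rewrite inE /= in_itv /=.
exact: cf.
Qed.

Lemma cont_on_integrable a b f : cont_on a b f ->
  lebesgue_measure.-integrable `[a, b] (EFin \o f).
Proof.
move=> cf; apply: continuous_compact_integrable; first exact: segment_compact.
exact: cont_on_within.
Qed.

Lemma eq_pint a b f g : (forall t, a <= t <= b -> f t = g t) -> pint a b f = pint a b g.
Proof. by move=> fg; apply: eq_Rintegral => t; rewrite inE /= in_itv; exact: fg. Qed.

Lemma pintD a b f g : cont_on a b f -> cont_on a b g ->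
  pint a b (fun t => f t + g t) = pint a b f + pint a b g.
Proof. by move=> cf cg; apply: RintegralD => //; exact: cont_on_integrable. Qed.

Lemma pintB a b f g : cont_on a b f -> cont_on a b g ->
  pint a b (fun t => f t - g t) = pint a b f - pint a b g.
Proof. by move=> cf cg; apply: RintegralB => //; exact: cont_on_integrable. Qed.

Lemma pintZ a b k f : cont_on a b f -> pint a b (fun t => k * f t) = k * pint a b f.
Proof. by move=> cf; apply: RintegralZl => //; exact: cont_on_integrable. Qed.

Lemma cont_onM a b f g : cont_on a b f -> cont_on a b g -> cont_on a b (fun t => f t * g t).
Proof. by move=> cf cg t tab; apply: cvgM; [exact: cf|exact: cg]. Qed.

Lemma cont_on_cst a b k : cont_on a b (fun=> k).
Proof. by move=> t _; exact: cvg_cst. Qed.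

Lemma pint_sum a b n (f : 'I_n -> R -> R) : (forall i, cont_on a b (f i)) ->
  pint a b (fun t => \sum_i f i t) = \sum_i pint a b (f i).
Proof.
elim: n f => [|n IH] f cf.
  (* The zero function is written as a multiple, so that [pintZ] evaluates its integral. *)
  rewrite big_ord0 (@eq_pint _ _ _ (fun=> 0 * 0)); last by move=> t _; rewrite big_ord0 mul0r.
  by rewrite (@pintZ a b 0 (fun=> 0)) ?mul0r//; exact: cont_on_cst.
rewrite big_ord_recr /= -IH//.
have cs : cont_on a b (fun t => \sum_(i < n) f (widen_ord (leqnSn n) i) t).
  by move=> t tab; apply: cont_sum => i; exact: cf.
rewrite -pintD//; apply: eq_pint => t _; exact: big_ord_recr.
Qed.

Lemma pint_le a b f (e : R) : a <= b -> cont_on a b f ->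
  (forall t, a <= t <= b -> `|f t| <= e) -> `|pint a b f| <= e * (b - a).
Proof.
move=> ab cf fe.
have ci := cont_on_integrable cf.
apply: (le_trans (le_normr_Rintegral _ ci)) => //.
have -> : e * (b - a) = \int[lebesgue_measure]_(t in `[a, b]) e.
  rewrite Rintegral_cst//= lebesgue_measure_itv /= lte_fin.
  by case: ltgtP ab => //= -> _; rewrite subrr.
apply: le_Rintegral => //; first exact: (integrable_norm ci).
by apply: cont_on_integrable; exact: cont_on_cst.
Qed.

Lemma pint_FTC a b f F : a <= b -> cont_on a b f ->
  (forall t, a <= t <= b -> is_derive t 1 F (f t)) -> pint a b f = F b - F a.
Proof.
rewrite le_eqVlt => /orP[/eqP <- _ _|ab cf dF].
  by rewrite /pint set_itv1 Rintegral_set1 subrr.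
rewrite /pint /Rintegral (@continuous_FTC2 _ f F)//.
- exact: cont_on_within.
- have cF t : a <= t <= b -> {for t, continuous F}.
    move=> /dF dFt; apply: differentiable_continuous; apply/derivable1_diffP.
    exact: (@ex_derive _ _ _ _ _ _ _ dFt).
  split.
  + move=> t; rewrite in_itv => /andP[at' tb].
    by apply: (@ex_derive _ _ _ _ _ _ _ (dF t _)); rewrite !ltW.
  + apply: cvg_at_right_filter; apply: cF; by rewrite lexx ltW.
  + apply: cvg_at_left_filter; apply: cF; by rewrite lexx ltW.
- move=> t; rewrite in_itv => /andP[at' tb].
  by rewrite derive1E; apply: (@derive_val _ _ _ _ _ _ _ (dF t _)); rewrite !ltW.
Qed.

Lemma is_derive_zero_cst a b F : a <= b ->
  (forall t, a <= t <= b -> is_derive t 1 F 0) -> F b = F a.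
Proof.
move=> ab dF; apply/eqP; rewrite -subr_eq0.
rewrite -(@pint_FTC a b (fun=> 0) F)//; last exact: cont_on_cst.
rewrite (@eq_pint _ _ _ (fun=> 0 * 0)); last by move=> *; rewrite mul0r.
by rewrite (@pintZ a b 0 (fun=> 0)) ?mul0r//; exact: cont_on_cst.
Qed.

Lemma pint_deriv a b f x : a < x < b -> cont_on a b f ->
  is_derive x 1 (fun y => pint a y f) (f x).
Proof.
move=> /andP[ax xb] cf.
have cfx : {for x, continuous f} by apply: cf; rewrite !ltW.
have [dF vF] := @continuous_FTC1_closed _ f a x b xb (cont_on_integrable cf) ax cfx.
by split; [exact: dF|rewrite -derive1E; exact: vF].
Qed.

End OneVariable.

Section Parametric.
Context {R : realType} {V : normedModType R}.
Implicit Types (f : R^o * V -> R) (a b e : R) (U : set V).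

Lemma slice_cont a b f x : (forall t : R, a <= t <= b -> {for (t, x), continuous f}) ->
  cont_on a b (fun t => f (t, x)).
Proof.
move=> cf t tab.
have H : ((s, x) : R^o * V) @[s --> (t : R)] --> ((t, x) : R^o * V).
  apply: (@smooth_at_continuous R (R^o) _ (fun s : R^o => (s, x) : R^o * V)).
  by apply: smooth_at_pair; [exact: smooth_at_id|exact: smooth_at_cst].
exact: (cvg_comp _ _ H (cf t tab)).
Qed.

(** Tube lemma: continuity along the compact segment over x makes the variation in y uniform in
    t. *)
Lemma unif_near a b f x e : 0 < e ->
  (forall t : R, a <= t <= b -> {for (t, x), continuous f}) ->
  \forall y \near x, forall t, a <= t <= b -> `|f (t, y) - f (t, x)| < e.
Proof.
move=> e0 cf.
have /compact_near_coveringP H := @segment_compact R a b.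
have {}H := H _ (nbhs x) (fun y t => `|f (t, y) - f (t, x)| < e) _.
suff : \forall y \near x, [set` `[a, b]] `<=` (fun t => `|f (t, y) - f (t, x)| < e).
  by apply: filterS => y Hy t tab; apply: Hy; rewrite /= in_itv.
apply: H => t; rewrite /= in_itv /= => tab.
have e2 : 0 < e / 2 by rewrite divr_gt0.
have /cvgrPdist_lt/(_ _ e2) := cf t tab.
case=> -[A B] /= [At Bx] AB; exists (A, B) => // -[t' y] /= [At' By].
have H1 := AB (t', y) (conj At' By).
have H2 := AB (t', x) (conj At' (nbhs_singleton Bx)).
rewrite -[f (t', y)](subrK (f (t, x))) -addrA (splitr e).
by apply: (le_lt_trans (ler_normD _ _)); rewrite ltrD// distrC.
Qed.

Lemma pint_cont a b f x : a <= b ->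
  (forall t : R, a <= t <= b -> {for (t, x), continuous f}) ->
  (\forall y \near x, forall t : R, a <= t <= b -> {for (t, y), continuous f}) ->
  {for x, continuous (fun y => pint a b (fun t => f (t, y)))}.
Proof.
move=> ab cf ncf; apply/cvgrPdist_le => e e0.
(* The summand 1 keeps the denominator positive when a = b. *)
have d0 : 0 < e / (b - a + 1).
  by rewrite divr_gt0// ltr_wpDl// subr_ge0.
have H := unif_near d0 cf; near=> y.
have cfy : cont_on a b (fun t => f (t, y)).
  by apply: slice_cont; near: y.
rewrite -pintB//; last exact: slice_cont.
apply: (@le_trans _ _ (e / (b - a + 1) * (b - a))).
  apply: pint_le => //.
    move=> t tab; apply: cvgB; [exact: (slice_cont cf)|exact: cfy].
  have : forall t, a <= t <= b -> `|f (t, y) - f (t, x)| < e / (b - a + 1) by near: y.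
  by move=> Hy t tab; rewrite distrC ltW// Hy.
have ba : 0 <= b - a by rewrite subr_ge0.
by rewrite mulrAC ler_pdivrMr ?ltr_wpDl// ler_wpM2l ?lerDl// ltW.
Unshelve. all: by end_near. Qed.

Hypothesis fdV : fin_dim V.

Lemma coord_bound n (l : 'I_n -> {linear V -> R}) : (forall i, continuous (l i)) ->
  exists2 C : R, 0 < C & forall w i, `|l i w| <= C * `|w|.
Proof.
move=> cl.
have H i : {C : R | 0 < C & forall w, `|l i w| <= C * `|w|}.
  by apply: cid2; exact: (linear_lipschitz (cl i)).
pose C i := s2val (H i).
exists (1 + \sum_i C i).
  rewrite ltr_pwDl// sumr_ge0// => i _; exact/ltW/(s2valP (H i)).
move=> w i; apply: (le_trans (s2valP' (H i) w)).
apply: ler_wpM2r => //; rewrite (bigD1 i)//= addrCA lerDl.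
by rewrite addr_ge0// sumr_ge0// => j _; exact/ltW/(s2valP (H j)).
Qed.

Lemma slice_is_derive f t x v (h : R) :
  differentiable f (t, x + h *: v) ->
  is_derive h 1 (fun s : R => f (t, x + s *: v)) ('D_(0, v) f (t, x + h *: v)).
Proof.
move=> df.
pose g := fun s : R => ((t, x + s *: v) : R^o * V).
have sl : smooth_at (fun s : R => x + s *: v) h.
  apply: smooth_atD; first exact: smooth_at_cst.
  by apply: smooth_atZ; [exact: smooth_at_id|exact: smooth_at_cst].
have dl := smooth_at_differentiable sl.
have dgx : differentiable g h.
  by apply: differentiable_pair; [exact: differentiable_cst|].
split; first exact/diff_derivable/(differentiable_comp dgx df).
rewrite (@derive_comp R _ _ _ f g)//.
have -> // : 'D_1 g h = (0, v).
rewrite /g (derive_pair _ (differentiable_cst (t : R^o) h) dl) derive_cst.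
congr pair; rewrite deriveD; first last.
- by apply: smooth_at_derivable; apply: smooth_atZ; [exact: smooth_at_id|exact: smooth_at_cst].
- exact: derivable_cst.
rewrite derive_cst add0r.
have [_ ->] := diff_scale (smooth_at_differentiable (smooth_at_id h)) (differentiable_cst v h).
by rewrite derive_id derive_cst scaler0 addr0 scale1r.
Qed.

(** For fixed t the mean value theorem on the segment from x to x + w turns the increment into a
    derivative at an intermediate point. By [unif_near] for the finitely many partial derivatives,
    the error is o(w) uniformly in t, so it survives integration. *)
Lemma pint_diff a b f x : a <= b ->
  (\forall y \near x, forall t : R, a <= t <= b -> differentiable f (t, y)) ->
  (forall v, \forall y \near x, forall t : R, a <= t <= b -> {for (t, y), continuous ('D_(0, v) f)}) ->
  differentiable (fun y => pint a b (fun t => f (t, y))) x /\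
  forall v, 'D_v (fun y => pint a b (fun t => f (t, y))) x =
    pint a b (fun t => 'D_(0, v) f (t, x)).
Proof.
move=> ab df cD; have [n [e [l [cl el]]]] := fdV.
have [C C0 lC] := coord_bound cl.
pose F y := pint a b (fun t => f (t, y)).
pose c i := pint a b (fun t => 'D_(0, e i) f (t, x)).
(* The candidate differential is assembled from the integrals of the partial derivatives, which
   makes its linearity and continuity evident. *)
pose L w : R := \sum_i l i w * c i.
have linL : linear L.
  move=> k u v; rewrite /L scaler_sumr -big_split /=; apply: eq_bigr => i _.
  by rewrite linearP mulrDl /GRing.scale /= mulrA.
pose Ll : {linear V -> R} := HB.pack L (GRing.isLinear.Build R _ _ _ _ linL).
have cL : continuous Ll.
  move=> w; rewrite /Ll /= /L; apply: cont_sum => i.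
  by apply: cvgM; [exact: cl|exact: cvg_cst].
have Dexp t y v : differentiable f (t, y) ->
    'D_(0, v) f (t, y) = \sum_i l i v * 'D_(0, e i) f (t, y).
  move=> dfy; rewrite deriveE// {1}(el v).
  have -> : ((0, \sum_i l i v *: e i) : R^o * V) = \sum_i l i v *: ((0, e i) : R^o * V).
    apply: (big_ind2 (fun (w : V) (y : R^o * V) => (0, w) = y)) => //.
      by move=> w1 y1 w2 y2 <- <-; rewrite -[RHS]/(_, _) /= addr0.
    by move=> i _; rewrite -[RHS]/(_, _) /= scaler0.
  by rewrite linear_sum; apply: eq_bigr => i _; rewrite linearZ /= deriveE.
have dfx t : a <= t <= b -> differentiable f (t, x) by exact: (nbhs_singleton df).
have cDx v t : a <= t <= b -> {for (t, x), continuous ('D_(0, v) f)} by exact: (nbhs_singleton (cD v)).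
have DLE v : Ll v = pint a b (fun t => 'D_(0, v) f (t, x)).
  rewrite /Ll /= /L (@eq_pint _ a b _ (fun t => \sum_i l i v * 'D_(0, e i) f (t, x))).
    rewrite pint_sum; last first.
      by move=> i; apply: cont_onM; [exact: cont_on_cst|exact: (slice_cont (cDx _))].
    by apply: eq_bigr => i _; rewrite pintZ//; exact: (slice_cont (cDx _)).
  by move=> t tab; rewrite Dexp//; exact: dfx.
have E : F \o shift x = cst (F x) + Ll +o_0 id.
  apply/eqaddoP => eps eps0.
  (* Shares [eps] among the length of the interval, the n coordinates and their bound C; the added
     units avoid zero denominators. *)
  pose d := eps / ((b - a + 1) * (n%:R + 1) * C).
  have ba1 : 0 < b - a + 1 by rewrite ltr_wpDl// subr_ge0.
  have d0 : 0 < d by rewrite divr_gt0// !mulr_gt0// ltr_wpDl.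
  have unif i := unif_near d0 (cDx (e i)).
  have unif' : \forall y \near x, forall i, forall t, a <= t <= b ->
      `|'D_(0, e i) f (t, y) - 'D_(0, e i) f (t, x)| < d.
    by apply: filter_forall => i; exact: unif.
  have : \forall y \near x, (forall t : R, a <= t <= b -> differentiable f (t, y)) /\
     (forall i, forall t, a <= t <= b ->
      `|'D_(0, e i) f (t, y) - 'D_(0, e i) f (t, x)| < d).
    by near=> y; split; near: y.
  move=> /nbhs_ballP[r /= r0 Hr].
  apply/nbhs_ballP; exists r => //= w; rewrite -ball_normE /= sub0r normrN => wr.
  have Hseg s : 0 <= s <= 1 -> ball x r (x + s *: w).
    move=> /andP[s0 s1]; rewrite -ball_normE /= opprD addrA subrr sub0r normrN normrZ.
    by apply: le_lt_trans wr; rewrite ger0_norm// ler_piMl.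
  have key t : a <= t <= b ->
      `|f (t, w + x) - f (t, x) - 'D_(0, w) f (t, x)| <= eps / (b - a + 1) * `|w|.
    move=> tab.
    have dseg (s : R) : 0 <= s <= 1 -> is_derive s 1 (fun s => f (t, x + s *: w))
        ('D_(0, w) f (t, x + s *: w)).
      by move=> s01; apply: slice_is_derive; exact: (Hr _ (Hseg _ s01)).1.
    have dseg' (s : R) : s \in `]0, 1[ -> is_derive s 1 (fun s => f (t, x + s *: w))
        ('D_(0, w) f (t, x + s *: w)).
      by rewrite in_itv => /andP[s0 s1]; apply: dseg; rewrite !ltW.
    have cseg : {within `[0, 1], continuous (fun s => f (t, x + s *: w))}.
      apply: cont_on_within => s s01.
      apply: differentiable_continuous; apply/derivable1_diffP.
      exact: (@ex_derive _ _ _ _ _ _ _ (dseg s s01)).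
    have [s s01] := MVT ltr01 dseg' cseg.
    rewrite subr0 mulr1 scale1r scale0r addr0 [x + w]addrC => ->.
    have s01' : 0 <= s <= 1 by move: s01; rewrite in_itv => /andP[? ?]; rewrite !ltW.
    have [dfs Hs] := Hr _ (Hseg s s01').
    rewrite Dexp; last exact: dfs.
    rewrite Dexp; last exact: dfx.
    rewrite -sumrB.
    apply: (@le_trans _ _ (\sum_(i < n) (C * `|w| * d))).
      apply: (le_trans (ler_norm_sum _ _ _)); apply: ler_sum => i _.
      by rewrite -mulrBr normrM ler_pM// ltW// Hs.
    rewrite sumr_const card_ord -mulr_natr /d.
    have n0 : 0 <= n%:R :> R by [].
    have n1 : 0 < n%:R + 1 :> R by rewrite ltr_wpDl.
    have -> : C * `|w| * (eps / ((b - a + 1) * (n%:R + 1) * C)) * n%:R =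
              eps / (b - a + 1) * `|w| * (n%:R / (n%:R + 1)).
      by field; rewrite !gt_eqF.
    rewrite ler_piMr// ?mulr_ge0// ?divr_ge0// ?invr_ge0 ?(ltW eps0) ?(ltW ba1)//.
    by rewrite ler_pdivrMr// mul1r lerDl.
  rewrite -[_ w]/(F (w + x) - (F x + Ll w)) DLE opprD addrA.
  have cwx : cont_on a b (fun t => f (t, w + x)).
    apply: slice_cont => t tab; apply: differentiable_continuous.
    rewrite addrC -[w]scale1r; apply: (Hr _ (Hseg _ _)).1 => //.
    by rewrite ler01 lexx.
  have cx : cont_on a b (fun t => f (t, x)).
    by apply: slice_cont => t tab; apply: differentiable_continuous; exact: dfx.
  have cD' : cont_on a b (fun t => 'D_(0, w) f (t, x)) by exact: (slice_cont (cDx _)).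
  have cB' : cont_on a b (fun t => f (t, w + x) - f (t, x)).
    by move=> t tab; apply: cvgB; [exact: cwx|exact: cx].
  rewrite /F -!pintB//.
  apply: (@le_trans _ _ (eps / (b - a + 1) * `|w| * (b - a))).
    by apply: pint_le => // t tab; apply: cvgB; [exact: cB'|exact: cD'].
  have ba : 0 <= b - a by rewrite subr_ge0.
  have -> : eps / (b - a + 1) * `|w| * (b - a) = eps * `|w| * ((b - a) / (b - a + 1)).
    by field; rewrite gt_eqF.
  rewrite ler_piMr// ?mulr_ge0// ?(ltW eps0)//.
  by rewrite ler_pdivrMr// mul1r lerDl.
have dE := diff_unique cL E.
have dF : differentiable F x by apply/diff_locallyP; rewrite dE; exact: (conj cL E).
by split=> [|v]; [exact: dF|rewrite deriveE// dE].
Unshelve. all: by end_near. Qed.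

(** Induction on k: by [pint_diff], a directional derivative of the integral is again an integral of
    the same kind. *)
Lemma pint_Ck k a b (N : set (R^o * V)%type) U f : a <= b -> open U ->
  (forall t x, a <= t <= b -> U x -> N (t, x)) -> Ck_on k N f ->
  Ck_on k U (fun y => pint a b (fun t => f (t, y))).
Proof.
move=> ab oU NU.
elim: k f => [|k IH] f.
  move=> cf x Ux; apply: pint_cont => //.
    by move=> t tab; apply: cf; exact: NU.
  have : \near x, U x by exact: open_nbhs_nbhs.
  by apply: filterS => y Uy t tab; apply: cf; exact: NU.
move=> [df Df].
have H x : U x -> differentiable (fun y => pint a b (fun t => f (t, y))) x /\
  forall v, 'D_v (fun y => pint a b (fun t => f (t, y))) x =
    pint a b (fun t => 'D_(0, v) f (t, x)).
  move=> Ux; have nU : \near x, U x by exact: open_nbhs_nbhs.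
  apply: pint_diff => //.
    by apply: filterS nU => y Uy t tab; apply: df; exact: NU.
  move=> v; apply: filterS nU => y Uy t tab.
  by apply: (Ck_on_le (leq0n k) (Df (0, v))); exact: NU.
split; first by move=> x /H[].
move=> v; apply: Ck_on_ext (IH _ (Df (0, v))) => // x; rewrite inE => Ux.
by rewrite (H x Ux).2.
Qed.

Lemma pint_smooth a b U f : a <= b -> open U ->
  (forall t x, a <= t <= b -> U x -> smooth_at f (t, x)) ->
  smooth_on U (fun y => pint a b (fun t => f (t, y))) /\
  forall x v, U x -> 'D_v (fun y => pint a b (fun t => f (t, y))) x =
    pint a b (fun t => 'D_(0, v) f (t, x)).
Proof.
move=> ab oU sf; split.
  move=> k; apply: (@pint_Ck k a b [set p | a <= p.1 <= b /\ U p.2] U f) => //.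
  apply: Ck_on_pt => -[t x] [/= tab Ux].
  by have [N [_ Nx H]] := sf t x tab Ux k; exists N.
move=> x v Ux; have nU : \near x, U x by exact: open_nbhs_nbhs.
apply: (@pint_diff a b f x ab _ _).2.
  by apply: filterS nU => y Uy t tab; apply: smooth_at_differentiable; exact: sf.
move=> w; apply: filterS nU => y Uy t tab.
by apply: smooth_at_continuous; apply: smooth_at_derive; exact: sf.
Qed.

End Parametric.

(** * Symmetry of second derivatives *)

Section Schwarz.
Context {R : realType}.
Implicit Types V W : normedModType R.

Lemma line_is_derive V W (f : V -> W) x v (h : R) :
  differentiable f (x + h *: v) ->
  is_derive h 1 (fun s : R => f (x + s *: v)) ('D_v f (x + h *: v)).
Proof.
move=> df.
have sl : smooth_at (fun s : R => x + s *: v) h.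
  apply: smooth_atD; first exact: smooth_at_cst.
  by apply: smooth_atZ; [exact: smooth_at_id|exact: smooth_at_cst].
have dl := smooth_at_differentiable sl.
split; first exact/diff_derivable/(differentiable_comp dl df).
rewrite (@derive_comp R _ _ _ f (fun s : R => x + s *: v))//.
have -> // : 'D_1 (fun s : R => x + s *: v) h = v.
rewrite deriveD; first last.
- by apply: smooth_at_derivable; apply: smooth_atZ; [exact: smooth_at_id|exact: smooth_at_cst].
- exact: derivable_cst.
rewrite derive_cst add0r.
have [_ ->] := diff_scale (smooth_at_differentiable (smooth_at_id h)) (differentiable_cst v h).
by rewrite derive_id derive_cst scaler0 addr0 scale1r.
Qed.

(* Both mixed derivatives are values, at nearby points, of the second
   difference quotient [f(x+hu+hv) - f(x+hu) - f(x+hv) + f(x)] / h^2. *)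
Let second_diff V (f : V -> R) (U : set V) x u v (h : R) : 0 < h ->
  (forall s t, 0 <= s <= h -> 0 <= t <= h -> U (x + s *: u + t *: v)) ->
  Ck_on 2 U f ->
  exists s t, [/\ 0 <= s <= h, 0 <= t <= h &
   f (x + h *: u + h *: v) - f (x + h *: u) - (f (x + h *: v) - f x) =
   h * (h * 'D_v ('D_u f) (x + s *: u + t *: v))].
Proof.
move=> h0 HU [df Df].
have hh : 0 <= h <= h by rewrite lexx ltW.
have h00 : 0 <= (0 : R) <= h by rewrite lexx ltW.
pose g s := f (x + h *: v + s *: u) - f (x + s *: u).
have dg s : 0 <= s <= h -> is_derive s 1 g
    ('D_u f (x + h *: v + s *: u) - 'D_u f (x + s *: u)).
  move=> sh; apply: is_deriveB; apply: line_is_derive; apply: df.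
    by rewrite addrAC; exact: HU.
  by rewrite -[_ + _]addr0 -[0](scale0r v); exact: HU.
have dg' s : s \in `]0, h[ -> is_derive s 1 g
    ('D_u f (x + h *: v + s *: u) - 'D_u f (x + s *: u)).
  by rewrite in_itv => /andP[s0 s1]; apply: dg; rewrite !ltW.
have cg : {within `[0, h], continuous g}.
  apply: cont_on_within => s sh; apply: differentiable_continuous.
  by apply/derivable1_diffP; exact: (@ex_derive _ _ _ _ _ _ _ (dg s sh)).
have [s sh] := MVT h0 dg' cg; rewrite subr0 => Eg.
have {}sh : 0 <= s <= h by move: sh; rewrite in_itv => /andP[? ?]; rewrite !ltW.
have dk t : 0 <= t <= h -> is_derive t 1 (fun t => 'D_u f (x + s *: u + t *: v))
    ('D_v ('D_u f) (x + s *: u + t *: v)).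
  by move=> th; apply: line_is_derive; apply: (Df u).1; exact: HU.
have dk' t : t \in `]0, h[ -> is_derive t 1 (fun t => 'D_u f (x + s *: u + t *: v))
    ('D_v ('D_u f) (x + s *: u + t *: v)).
  by rewrite in_itv => /andP[s0 s1]; apply: dk; rewrite !ltW.
have ck : {within `[0, h], continuous (fun t => 'D_u f (x + s *: u + t *: v))}.
  apply: cont_on_within => t th; apply: differentiable_continuous.
  by apply/derivable1_diffP; exact: (@ex_derive _ _ _ _ _ _ _ (dk t th)).
have [t th] := MVT h0 dk' ck; rewrite subr0 scale0r addr0 => Ek.
have {}th : 0 <= t <= h by move: th; rewrite in_itv => /andP[? ?]; rewrite !ltW.
exists s, t; split=> //.
rewrite [h * 'D_v _ _]mulrC -Ek mulrC [x + s *: u + _]addrAC -Eg /g.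
by rewrite !scale0r !addr0 [x + h *: v + _]addrAC; ring.
Qed.

Let cont_agree V (F G : V -> R) x :
  {for x, continuous F} -> {for x, continuous G} ->
  (forall r : R, 0 < r -> exists y z, [/\ ball x r y, ball x r z & F y = G z]) ->
  F x = G x.
Proof.
move=> cF cG H; apply/eqP; rewrite -subr_eq0 -normr_le0; apply/ler_addgt0Pr => e e0.
rewrite add0r.
have e2 : 0 < e / 2 by rewrite divr_gt0.
have /cvgrPdist_lt/(_ _ e2)/nbhs_ballP[r1 /= r10 H1] := cF.
have /cvgrPdist_lt/(_ _ e2)/nbhs_ballP[r2 /= r20 H2] := cG.
have [|y [z [yx zx E]]] := H (Num.min r1 r2); first by rewrite lt_min r10.
have A1 : `|F x - F y| < e / 2.
  by apply: H1; apply: le_ball yx; rewrite ge_min lexx.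
have A2 : `|G x - G z| < e / 2.
  by apply: H2; apply: le_ball zx; rewrite ge_min lexx orbT.
have -> : F x - G x = (F x - F y) - (G x - G z) by rewrite E; ring.
by apply: (le_trans (ler_normB _ _)); rewrite (splitr e) lerD// ltW.
Qed.

Lemma Schwarz_scalar V (f : V -> R) x u v : smooth_at f x ->
  'D_u ('D_v f) x = 'D_v ('D_u f) x.
Proof.
move=> sf; apply: (@cont_agree V ('D_u ('D_v f)) ('D_v ('D_u f)) x).
- by apply: smooth_at_continuous; do 2 apply: smooth_at_derive.
- by apply: smooth_at_continuous; do 2 apply: smooth_at_derive.
move=> r0' r0'0.
have [U [oU Ux fU]] := sf 2.
have : nbhs x (U `&` ball x r0').
  by apply: filterI; [exact: open_nbhs_nbhs|exact: nbhsx_ballx].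
move=> /nbhs_ballP[r /= r0 Hr].
have nn : 0 < `|u| + `|v| + 1 by rewrite ltr_wpDl// addr_ge0.
(* Small enough for the whole parallelogram with sides h u and h v to lie in the ball; the factor
   1/2 makes the inequality strict. *)
pose h := r / (`|u| + `|v| + 1) / 2.
have h0 : 0 < h by rewrite !divr_gt0.
have Hb s t : 0 <= s <= h -> 0 <= t <= h -> ball x r (x + s *: u + t *: v).
  move=> /andP[s0 sh] /andP[t0 th].
  rewrite -ball_normE /= -addrA opprD addrA subrr sub0r normrN.
  apply: (le_lt_trans (ler_normD _ _)); rewrite !normrZ !ger0_norm//.
  apply: (@le_lt_trans _ _ (h * (`|u| + `|v| + 1))).
    by rewrite !mulrDr mulr1 -addrA lerD ?ler_wpM2r// ler_wpDr ?ler_wpM2r// ltW.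
  by rewrite /h mulrAC divfK ?gt_eqF// ltr_pdivrMr// ltr_pMr// ltr1n.
have Hb' s t : 0 <= s <= h -> 0 <= t <= h -> ball x r (x + s *: v + t *: u).
  by move=> sh th; rewrite addrAC; exact: Hb.
have [s [t [sh th E1]]] := second_diff h0 (fun s t sh th => (Hr _ (Hb s t sh th)).1) fU.
have [s' [t' [sh' th' E2]]] := second_diff h0 (fun s t sh th => (Hr _ (Hb' s t sh th)).1) fU.
exists (x + s' *: v + t' *: u), (x + s *: u + t *: v); split.
- exact: (Hr _ (Hb' s' t' sh' th')).2.
- exact: (Hr _ (Hb s t sh th)).2.
apply/esym/(mulfI (lt0r_neq0 h0))/(mulfI (lt0r_neq0 h0)).
apply: etrans (esym E1) (etrans _ E2).
by rewrite [x + h *: v + _]addrAC; ring.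
Qed.

Lemma Schwarz V m n (f : V -> 'M[R]_(m, n)) x u v : smooth_at f x ->
  'D_u ('D_v f) x = 'D_v ('D_u f) x.
Proof.
move=> sf; apply/matrixP => i j.
have H w z : 'D_w ('D_z f) x i j = 'D_w ('D_z (fun y => f y i j : R)) x.
  rewrite -derive_coord; last by apply: smooth_at_derivable; exact: smooth_at_derive.
  apply: near_eq_derive; have nd := smooth_at_near_differentiable sf.
  near=> y; rewrite -derive_coord//; apply: diff_derivable; near: y; exact: nd.
have E := @Schwarz_scalar V (fun y => f y i j) x u v (smooth_at_coord i j sf).
exact: etrans (H u v) (etrans E (esym (H v u))).
Unshelve. all: by end_near. Qed.

End Schwarz.

(** * A smooth step function *)

Section SmoothStep.
Context {R : realType}.

(* This family of functions is stable under derivation. *)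
Definition flat (p : {poly R}) (x : R) : R :=
  if 0 < x then p.[x^-1] * expR (- x^-1) else 0.

(** The derivative of p(1/x) exp(-1/x) is (p(1/x) - p'(1/x)) x^-2 exp(-1/x), of the same shape in
    1/x. *)
Definition flat_deriv (p : {poly R}) : {poly R} := 'X^2 * (p - p^`()).

(** The exponential dominates y^(n+1) / (n+1)! for y >= 0, which bounds each monomial; the summand 1
    in the witness keeps C positive when p = 0. *)
Lemma poly_expR_bound (p : {poly R}) :
  exists2 C : R, 0 < C & forall y, 1 <= y -> `|p.[y]| * expR (- y) <= C * y^-1.
Proof.
have H n y : 1 <= y -> y ^+ n * expR (- y) <= (n.+1)`!%:R * y^-1.
  move=> y1; have y0 : 0 < y by rewrite (lt_le_trans _ y1).
  rewrite ler_pdivlMr// mulrAC -exprSr expRN ler_pdivrMr ?expR_gt0//.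
  rewrite mulrC -ler_pdivrMr ?ltr0n ?fact_gt0//.
  by apply: le_trans (expR_ge1Dxn n (ltW y0)); rewrite lerDr.
exists (1 + \sum_(i < size p) `|p`_i| * (i.+1)`!%:R).
  by rewrite ltr_pwDl// sumr_ge0// => i _; rewrite mulr_ge0.
move=> y y1; have y0 : 0 < y by rewrite (lt_le_trans _ y1).
rewrite horner_coef.
apply: (@le_trans _ _ (\sum_(i < size p) `|p`_i| * (i.+1)`!%:R * y^-1)); last first.
  by rewrite -mulr_suml ler_wpM2r ?invr_ge0 ?(ltW y0)// lerDr.
apply: (@le_trans _ _ ((\sum_(i < size p) `|p`_i| * y ^+ i) * expR (- y))).
  rewrite ler_wpM2r ?expR_ge0//; apply: (le_trans (ler_norm_sum _ _ _)).
  by apply: ler_sum => i _; rewrite normrM [`|y ^+ i|]ger0_norm// exprn_ge0// ltW.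
rewrite mulr_suml; apply: ler_sum => i _.
by rewrite -!mulrA ler_wpM2l// H.
Qed.

Lemma flat_is_derive (p : {poly R}) (x : R) :
  is_derive x 1 (flat p) (flat (flat_deriv p) x).
Proof.
have [x0|x0|->] := ltgtP x 0.
- have E : \near x, cst 0 x = flat p x.
    near=> y; rewrite /flat ltNge ifF//; apply/negbF; rewrite ltW//.
    by near: y; exact: lt_nbhsl.
  rewrite [flat (flat_deriv p) x]/flat ltNge (ltW x0) /=.
  by apply: near_eq_is_derive E _; exact: is_derive_cst.
- have E : \near x, p.[x^-1] * expR (- x^-1) = flat p x.
    near=> y; rewrite /flat ifT//.
    by near: y; exact: lt_nbhsr.
  apply: near_eq_is_derive E _.
  have xn0 : x != 0 by rewrite gt_eqF.
  have dinv := is_deriveV xn0 (is_derive_id x 1).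
  have d1 := is_derive1_comp (is_derive_poly p x^-1) dinv.
  have d2 := @is_derive1_comp _ expR (fun y => - y^-1) x _ _
    (is_derive_expR (- x^-1)) (is_deriveN dinv).
  have [dd vd] := is_deriveM d1 d2.
  split; first exact: dd.
  apply: (etrans vd).
  rewrite /flat x0 /flat_deriv !hornerE /GRing.scale /= -!exprVn.
  by ring.
(* At 0 the difference quotient is the value of [flat] for the polynomial X p, which is O(h). *)
have [C C0 HC] := poly_expR_bound ('X * p).
have key (h : R) : `|h| <= 1 -> h != 0 -> `|h^-1 * flat p h| <= C * `|h|.
  move=> h1 hn0; rewrite /flat; case: ifPn => [h0|_]; last first.
    by rewrite mulr0 normr0 mulr_ge0// ltW.
  have hV : 1 <= h^-1 by rewrite invf_ge1// -(gtr0_norm h0).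
  have := HC _ hV; rewrite invrK (gtr0_norm h0); apply: le_trans.
  have e0 : 0 <= expR (- h^-1) by exact: expR_ge0.
  rewrite hornerM hornerX.
  by move: (expR _) e0 (p.[_]) => e e0 q; rewrite !normrM (ger0_norm e0) mulrA.
have cv : h^-1 *: (flat p (h *: 1 + 0) - flat p 0) @[h --> (0 : R)^'] --> (0 : R).
  apply/cvgrPdist_le => e e0; near=> h.
  have hn0 : h != 0 by near: h; exact: nbhs_dnbhs_neq.
  rewrite sub0r normrN [flat p 0]/flat ltxx subr0 addr0 [_ *: 1]mulr1.
  apply: (le_trans (key h _ hn0)).
    rewrite ltW//; near: h; apply: dnbhs0_lt; exact: ltr01.
  rewrite -ler_pdivlMl// ltW//; near: h; apply: dnbhs0_lt.
  by rewrite mulr_gt0// invr_gt0.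
rewrite [flat (flat_deriv p) 0]/flat ltxx.
split; first by apply/cvg_ex; exists 0.
exact: cvg_lim cv.
Unshelve. all: by end_near. Qed.

Lemma flat_Ck k (p : {poly R}) : Ck_on k setT (flat p).
Proof.
elim: k p => [|k IH] p.
  move=> x _; apply: differentiable_continuous; apply/derivable1_diffP.
  exact: (@ex_derive _ _ _ _ _ _ _ (flat_is_derive p x)).
split=> [x _|v].
  apply/derivable1_diffP; exact: (@ex_derive _ _ _ _ _ _ _ (flat_is_derive p x)).
have H := Ck_onZ openT (@Ck_on_cst R k R R setT v) (IH (flat_deriv p)).
apply: Ck_on_ext H; first exact: openT.
move=> x _; rewrite deriveE; last first.
  apply/derivable1_diffP; exact: (@ex_derive _ _ _ _ _ _ _ (flat_is_derive p x)).
rewrite -[v in RHS]mulr1 -[v * 1]/(v *: 1) linearZ /= -deriveE; last first.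
  apply/derivable1_diffP; exact: (@ex_derive _ _ _ _ _ _ _ (flat_is_derive p x)).
by rewrite (@derive_val _ _ _ _ _ _ _ (flat_is_derive p x)).
Qed.

Definition step0 (x : R) := flat 1 x / (flat 1 x + flat 1 (1 - x)).

Lemma flat1_ge0 x : 0 <= flat 1 x.
Proof. by rewrite /flat; case: ifP => // _; rewrite hornerE mul1r expR_ge0. Qed.

Lemma flat1_gt0 x : 0 < x -> 0 < flat 1 x.
Proof. by move=> x0; rewrite /flat x0 hornerE mul1r expR_gt0. Qed.

Lemma flat1_le0 x : x <= 0 -> flat 1 x = 0.
Proof. by move=> x0; rewrite /flat ltNge x0. Qed.

Lemma step0_den x : 0 < flat 1 x + flat 1 (1 - x).
Proof.
have [x0|x0] := lerP x 0.
  by rewrite ltr_wpDl ?flat1_ge0// flat1_gt0// subr_gt0 (le_lt_trans x0).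
by rewrite ltr_pwDl ?flat1_ge0// flat1_gt0.
Qed.

(** The affine change of variable sends 1/4 to 0 and 3/4 to 1. Being constant near both ends is what
    lets paths and cylinders reparametrised by [step] be concatenated smoothly. *)
Definition step (x : R) := step0 (2 * x - 1 / 2).

Lemma step_smooth x : smooth_at step x.
Proof.
have fl z : smooth_at (flat 1) z.
  by move=> k; exists setT; split=> //; [exact: openT|exact: flat_Ck].
have s0 z : smooth_at step0 z.
  apply: smooth_atM; first exact: fl.
  apply: smooth_at_inv; first by rewrite gt_eqF// step0_den.
  apply: smooth_atD; first exact: fl.
  apply: (@smooth_at_comp _ R R R (fun x => 1 - x)); first exact: fin_dim_scalar.
    by apply: smooth_atB; [exact: smooth_at_cst|exact: smooth_at_id].
  exact: fl.
apply: (@smooth_at_comp _ R R R (fun x => 2 * x - 1 / 2)); first exact: fin_dim_scalar.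
  apply: smooth_atB; last exact: smooth_at_cst.
  by apply: smooth_atM; [exact: smooth_at_cst|exact: smooth_at_id].
exact: s0.
Qed.

Lemma step_ge0 x : 0 <= step x.
Proof. by rewrite /step /step0 divr_ge0 ?flat1_ge0// ltW// step0_den. Qed.

Lemma step_le1 x : step x <= 1.
Proof.
have H := step0_den (2 * x - 1 / 2).
have := flat1_ge0 (1 - (2 * x - 1 / 2)).
rewrite /step /step0 (ler_pdivrMr _ _ H) mul1r.
by move: (flat _ _) (flat _ _) => a b b0; lra.
Qed.

Lemma step_eq0 x : x <= 1 / 4 -> step x = 0.
Proof. by move=> x0; rewrite /step /step0 flat1_le0 ?mul0r//; lra. Qed.

Lemma step_eq1 x : 3 / 4 <= x -> step x = 1.
Proof.
move=> x1; rewrite /step /step0 [flat 1 (1 - _)]flat1_le0 ?addr0; last lra.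
by rewrite divff// gt_eqF// flat1_gt0//; lra.
Qed.

End SmoothStep.

(** * Forms on manifolds *)

Section Charts.
Context {R : realType} {m : nat} (M : manifold R m).
Implicit Types (c : chart R m M) (x : M) (y : 'rV[R]_m).

Lemma overlap_open c c' : open (overlap c c').
Proof.
rewrite openE => y [cy c'y] /=.
have n1 : nbhs y (chart_img c) by apply: open_nbhs_nbhs; split=> //; exact: chart_img_open.
have n2 : nbhs (chart_inv c y) (chart_dom c').
  by apply: open_nbhs_nbhs; split=> //; exact: chart_dom_open.
have n3 : nbhs y [set z | chart_dom c' (chart_inv c z)] by exact: (chart_inv_cont cy n2).
exact: filterI n1 n3.
Qed.

Lemma overlap_self c y : chart_img c y -> overlap c c y.
Proof. by move=> cy; split=> //; exact: chart_invP. Qed.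

Lemma overlap_img c c' y : overlap c c' y -> chart_img c' (transition c c' y).
Proof. by move=> [_ H]; exact: chart_funP. Qed.

Lemma overlap_sym c c' y : overlap c c' y -> overlap c' c (transition c c' y).
Proof.
move=> H; split; first exact: overlap_img H.
by case: H => cy c'y; rewrite /transition chart_funK//; exact: chart_invP.
Qed.

Lemma transitionK c c' y : overlap c c' y -> transition c' c (transition c c' y) = y.
Proof. by move=> [cy c'y]; rewrite /transition chart_funK// chart_invK. Qed.

Lemma overlap_dom c c' x : chart_dom c x -> chart_dom c' x -> overlap c c' (c x).
Proof. by move=> cx c'x; split; [exact: chart_funP|rewrite chart_funK]. Qed.

Lemma transition_fun c c' x : chart_dom c x -> transition c c' (c x) = c' x.
Proof. by move=> cx; rewrite /transition chart_funK. Qed.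

Lemma transition_smooth_at c c' y : atlas c -> atlas c' -> overlap c c' y ->
  smooth_at (transition c c') y.
Proof.
move=> ac ac' H; apply: (smooth_on_at _ H (transition_smooth ac ac')).
exact: overlap_open.
Qed.

Lemma jacobianE c c' y (v : 'rV[R]_m) : atlas c -> atlas c' -> overlap c c' y ->
  v *m 'J (transition c c') y = 'D_v (transition c c') y.
Proof.
move=> ac ac' H; rewrite deriveEjacobian//; apply: smooth_at_differentiable.
exact: transition_smooth_at.
Qed.

Definition msmooth_at (V : normedModType R) (f : V -> M) (p : V) :=
  {for p, continuous f} /\ forall c, atlas c -> chart_dom c (f p) ->
     smooth_at (fun q => c (f q)) p.

Lemma near_dom (V : topologicalType) (f : V -> M) p c : {for p, continuous f} ->
  chart_dom c (f p) -> \near p, chart_dom c (f p).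
Proof.
move=> cf cp; have n : nbhs (f p) (chart_dom c).
  by apply: open_nbhs_nbhs; split=> //; exact: chart_dom_open.
exact: (cf _ n).
Qed.

Lemma near_img (V : topologicalType) (f : V -> 'rV[R]_m) p c : {for p, continuous f} ->
  chart_img c (f p) -> \near p, chart_img c (f p).
Proof.
move=> cf cp; have n : nbhs (f p) (chart_img c).
  by apply: open_nbhs_nbhs; split=> //; exact: chart_img_open.
exact: (cf _ n).
Qed.

Lemma msmooth_at_chart (V : normedModType R) (f : V -> M) p c :
  atlas c -> chart_dom c (f p) -> {for p, continuous f} ->
  smooth_at (fun q => c (f q)) p -> msmooth_at f p.
Proof.
move=> ac cp cf sf; split=> // c' ac' c'p.
have nd := near_dom cf cp.
apply: (@smooth_at_near _ _ _ (fun q => transition c c' (c (f q)))).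
  by apply: filterS nd => q cq; rewrite transition_fun.
apply: (@smooth_at_comp _ _ _ _ (fun q => c (f q))) => //; first exact: fin_dim_mx.
by apply: transition_smooth_at => //; exact: overlap_dom.
Qed.

Lemma msmooth_at_inv (V : normedModType R) (f : V -> 'rV[R]_m) p c :
  atlas c -> chart_img c (f p) -> smooth_at f p ->
  msmooth_at (fun q => chart_inv c (f q)) p.
Proof.
move=> ac cp sf; have cf := smooth_at_continuous sf.
have cc : {for p, continuous (fun q => chart_inv c (f q))}.
  by apply: continuous_comp => //; exact: chart_inv_cont.
apply: (@msmooth_at_chart _ _ _ c) => //; first exact: chart_invP.
apply: smooth_at_near sf; have := near_img cf cp.
by apply: filterS => q cq; rewrite chart_invK.
Qed.

Lemma smooth_mapP (V : normedModType R) (U : set V) (f : V -> M) : open U ->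
  smooth_map U f <-> forall p, U p -> msmooth_at f p.
Proof.
move=> oU; have oUc c : (forall x : V, U x -> {for x, continuous f}) ->
    open (U `&` f @^-1` chart_dom c).
  move=> cf; rewrite openE => q [Uq cq]; apply: filterI; first exact: open_nbhs_nbhs.
  exact: near_dom (cf q Uq) cq.
split=> [[cf sf] p Up|H].
  split; first exact: cf.
  move=> c ac cp; apply: smooth_on_at (sf c ac); first exact: oUc.
  by split.
have cf (x : V) : U x -> {for x, continuous f} by move=> /H[].
split=> // c ac; apply/smooth_onP; first exact: oUc.
by move=> q [Uq cq]; exact: (H q Uq).2.
Qed.

Lemma msmooth_at_near (V : normedModType R) (f g : V -> M) p :
  (\near p, f p = g p) -> msmooth_at f p -> msmooth_at g p.
Proof.
move=> fg [cf sf]; have E := nbhs_singleton fg.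
split.
  rewrite /prop_for /continuous_at -E; apply: cvg_trans cf.
  exact: near_eq_cvg.
move=> c ac cp; rewrite -E in cp; apply: smooth_at_near (sf c ac cp).
by apply: filterS fg => q ->.
Qed.

Lemma msmooth_at_comp (V W : normedModType R) (h : V -> W) (f : W -> M) p :
  fin_dim W -> smooth_at h p -> msmooth_at f (h p) -> msmooth_at (fun q => f (h q)) p.
Proof.
move=> fW sh [cf sf]; split.
  by apply: continuous_comp => //; exact: smooth_at_continuous.
move=> c ac cp; apply: (@smooth_at_comp _ _ _ _ h (fun q => c (f q))) => //.
exact: sf.
Qed.

Lemma msmooth_at_cst (V : normedModType R) (a : M) (p : V) : msmooth_at (fun=> a) p.
Proof. by split; [exact: cvg_cst|move=> c ac cp; exact: smooth_at_cst]. Qed.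

End Charts.

(** * Multilinear algebra in terms of the rows of a matrix *)

Section Multilinear.
Context {R : realType} {m : nat}.

(** [multilinear] compares matrices through [row] and [row']; replacement of one row turns it into
    the usual additivity in a slot, which suits expansion in a basis. *)
Definition set_row k (l : 'I_k) (x : 'rV[R]_m) (v : 'M[R]_(k, m)) : 'M[R]_(k, m) :=
  \matrix_(i, j) if i == l then x 0 j else v i j.

Lemma row_set_row k (l i : 'I_k) x v :
  row i (set_row l x v) = if i == l then x else row i v.
Proof. by apply/rowP => j; rewrite !mxE; case: eqP => // _; rewrite mxE. Qed.

Lemma set_row_id k (l : 'I_k) v : set_row l (row l v) v = v.
Proof. by apply/matrixP => i j; rewrite !mxE; case: eqP => // ->. Qed.

Lemma set_rowK k (l : 'I_k) x y v : set_row l x (set_row l y v) = set_row l x v.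
Proof. by apply/matrixP => i j; rewrite !mxE; case: eqP. Qed.

Lemma set_rowC k (l l' : 'I_k) x y v : l != l' ->
  set_row l x (set_row l' y v) = set_row l' y (set_row l x v).
Proof.
by move=> ll'; apply/matrixP => i j; rewrite !mxE; case: (i =P l) => // ->; rewrite (negbTE ll').
Qed.

Variables (k : nat) (f : 'M[R]_(k, m) -> R).
Hypothesis mf : multilinear f.

Lemma multilinear_set_row (l : 'I_k) (a b : R) (x y : 'rV[R]_m) v :
  f (set_row l (a *: x + b *: y) v) = a * f (set_row l x v) + b * f (set_row l y v).
Proof.
apply: (mf (i := l)); first by rewrite !row_set_row eqxx.
  by apply/matrixP => i j; rewrite !mxE eq_sym (negbTE (neq_lift _ _)).
by apply/matrixP => i j; rewrite !mxE eq_sym (negbTE (neq_lift _ _)).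
Qed.

Lemma multilinear_set_rowD (l : 'I_k) (x y : 'rV[R]_m) v :
  f (set_row l (x + y) v) = f (set_row l x v) + f (set_row l y v).
Proof. by rewrite -{1}[x]scale1r -{1}[y]scale1r multilinear_set_row !mul1r. Qed.

Lemma multilinear_set_rowZ (l : 'I_k) (a : R) (x : 'rV[R]_m) v :
  f (set_row l (a *: x) v) = a * f (set_row l x v).
Proof.
by rewrite -[a *: x]addr0 -(scale0r x) multilinear_set_row mul0r addr0.
Qed.

Lemma multilinear_set_row0 (l : 'I_k) v : f (set_row l 0 v) = 0.
Proof. by rewrite -(scale0r 0) multilinear_set_rowZ mul0r. Qed.

Lemma multilinear_set_row_sum (l : 'I_k) (I : Type) (r : seq I) (P : pred I)
    (x : I -> 'rV[R]_m) v :
  f (set_row l (\sum_(i <- r | P i) x i) v) = \sum_(i <- r | P i) f (set_row l (x i) v).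
Proof.
elim: r => [|i r IH]; first by rewrite !big_nil multilinear_set_row0.
by rewrite !big_cons; case: (P i); rewrite // multilinear_set_rowD IH.
Qed.

Lemma multilinear_set_row_expand (l : 'I_k) v :
  f v = \sum_j v l j * f (set_row l 'e_j v).
Proof.
rewrite -{1}(set_row_id l v) {1}(row_sum_delta (row l v)) multilinear_set_row_sum.
by apply: eq_bigr => j _; rewrite multilinear_set_rowZ mxE.
Qed.

Hypothesis af : alternating f.

Lemma alternating_swap (i j : 'I_k) (x y : 'rV[R]_m) v : i != j ->
  f (set_row i x (set_row j y v)) = - f (set_row i y (set_row j x v)).
Proof.
move=> ij; have ji : j != i by rewrite eq_sym.
have A z : f (set_row i z (set_row j z v)) = 0.
  by apply: (af (i := i) (j := j)) => //; rewrite !row_set_row eqxx (negbTE ji) eqxx.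
have := A (x + y); rewrite multilinear_set_rowD.
rewrite (set_rowC _ _ _ ij) multilinear_set_rowD -(set_rowC _ _ _ ij) A add0r.
rewrite [set_row i y _](set_rowC _ _ _ ij) multilinear_set_rowD.
rewrite -!(set_rowC _ _ _ ij) A addr0.
by move/eqP; rewrite addr_eq0 => /eqP.
Qed.

End Multilinear.

Section Pullback.
Context {R : realType} {m : nat}.

Lemma derive_sum_mul (V : normedModType R) (I : Type) (r : seq I) (f g : I -> V -> R) p w :
  (forall i, differentiable (f i) p) -> (forall i, differentiable (g i) p) ->
  'D_w (fun q => \sum_(i <- r) f i q * g i q) p =
  \sum_(i <- r) ('D_w (f i) p * g i p + f i p * 'D_w (g i) p).
Proof.
move=> df dg; suff [] : differentiable (fun q => \sum_(i <- r) f i q * g i q) p /\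
  'D_w (fun q => \sum_(i <- r) f i q * g i q) p =
  \sum_(i <- r) ('D_w (f i) p * g i p + f i p * 'D_w (g i) p) by [].
elim: r => [|i r [IH1 IH2]].
  rewrite (_ : (fun q => _) = cst 0); last by apply/funext => q; rewrite big_nil.
  by rewrite derive_cst big_nil; split=> //; exact: differentiable_cst.
have [dZ vZ] := diff_scale (df i) (dg i).
rewrite (_ : (fun q => _) = (fun q => f i q *: g i q) + (fun q => \sum_(i <- r) f i q * g i q)); last first.
  by apply/funext => q; rewrite big_cons.
split; first exact: differentiableD.
by rewrite deriveD ?vZ ?IH2 ?big_cons//; exact: diff_derivable.
Qed.

Variables (V : normedModType R).
Variables (k : nat) (a : 'rV[R]_m -> 'M[R]_(k, m) -> R) (phi : V -> 'rV[R]_m) (p : V).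
Hypothesis sa : forall v, smooth_at (a ^~ v) (phi p).
Hypothesis ma : \forall y \near phi p, multilinear (a y).
Hypothesis sphi : smooth_at phi p.

(** Product rule for a form whose base point and arguments all move. The induction is on the number
    t of leading rows allowed to vary: expanding the last of them over the standard basis moves its
    variation into scalar coefficients and leaves arguments with one moving row fewer. *)
Let pull_rec t (U : V -> 'M[R]_(k, m)) : smooth_at U p ->
  (forall q (i : 'I_k), (t <= i)%N -> row i (U q) = row i (U p)) ->
  smooth_at (fun q => a (phi q) (U q)) p /\
  forall w, 'D_w (fun q => a (phi q) (U q)) p =
    'D_('D_w phi p) (a ^~ (U p)) (phi p) +
    \sum_l a (phi p) (set_row l (row l ('D_w U p)) (U p)).
Proof.
have mp : multilinear (a (phi p)) by exact: nbhs_singleton ma.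
have ma' : \near p, multilinear (a (phi p)).
  have H := smooth_at_continuous sphi.
  exact: (H [set y | multilinear (a y)] ma).
elim: t U => [|t IH] U sU HU.
  have EU : U = cst (U p) by apply/funext => q; apply/row_matrixP => i; exact: HU.
  have dU w : 'D_w U p = 0 by rewrite EU derive_cst.
  have sc : smooth_at (fun q => a (phi q) (U p)) p.
    by apply: (@smooth_at_comp _ _ _ _ phi (a ^~ (U p))) => //; exact: fin_dim_mx.
  split; first by rewrite EU.
  move=> w; rewrite dU big1 ?addr0; last first.
    by move=> l _; rewrite (_ : row l 0 = 0) ?multilinear_set_row0//; apply/rowP => j; rewrite !mxE.
  rewrite {1}EU (@derive_comp _ _ _ _ (a ^~ (U p)) phi)//; exact: smooth_at_differentiable.
have [tk|kt] := ltnP t k; last first.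
  apply: IH => // q i ti.
  by have := leq_trans (ltn_ord i) (leq_trans kt ti); rewrite ltnn.
pose l := Ordinal tk.
pose W j q := set_row l 'e_j (U q).
have sW j : smooth_at (W j) p.
  apply: smooth_at_mx => i j'; rewrite /W /set_row; under eq_fun do rewrite mxE.
  case: (i == l); first exact: smooth_at_cst.
  exact: smooth_at_coord.
have HW j q (i : 'I_k) : (t <= i)%N -> row i (W j q) = row i (W j p).
  rewrite !row_set_row leq_eqVlt => /orP[/eqP ti|ti].
    by have -> : i == l by apply/eqP/val_inj.
  by case: eqP => // _; exact: HU.
have {}IH j := IH _ (sW j) (HW j).
have E q : multilinear (a (phi q)) ->
  a (phi q) (U q) = \sum_j U q l j * a (phi q) (W j q).
  by move=> mq; exact: multilinear_set_row_expand.
have nE : \near p, \sum_j U p l j * a (phi p) (W j p) = a (phi p) (U p).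
  by apply: filterS ma' => q /E ->.
split.
  apply: smooth_at_near nE _; apply: smooth_at_sum => j _.
  by apply: smooth_atM; [exact: smooth_at_coord|exact: (IH j).1].
move=> w; rewrite -(near_eq_derive _ nE) derive_sum_mul; last 2 first.
- by move=> j; apply: smooth_at_differentiable; exact: smooth_at_coord.
- by move=> j; apply: smooth_at_differentiable; exact: (IH j).1.
rewrite big_split /=.
have -> : 'D_('D_w phi p) (a^~ (U p)) (phi p) =
   \sum_j U p l j * 'D_('D_w phi p) (a^~ (W j p)) (phi p).
  have nE' : \forall y \near phi p, \sum_j U p l j * a y (W j p) = a y (U p).
    by apply: filterS ma => y my; rewrite (multilinear_set_row_expand my l).
  rewrite -(near_eq_derive _ nE').
  rewrite (@derive_sum_mul _ _ _ (fun j _ => U p l j) (fun j y => a y (W j p))).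
  - by apply: eq_bigr => j _; rewrite derive_cst mul0r add0r.
  - by move=> j; exact: differentiable_cst.
  - by move=> j; apply: smooth_at_differentiable; exact: sa.
under [X in _ + X = _]eq_bigr do rewrite (IH _).2 mulrDr.
rewrite big_split /= addrCA; congr (_ + _).
have DW j i : row i ('D_w (W j) p) = if i == l then 0 else row i ('D_w U p).
  apply/rowP => j'; rewrite mxE -derive_coord; last exact: smooth_at_derivable.
  rewrite /W /set_row; under eq_fun do rewrite mxE.
  case: (i == l); first by rewrite derive_cst mxE.
  by rewrite derive_coord ?mxE//; exact: smooth_at_derivable.
rewrite (bigD1 l) //=; congr (_ + _).
  rewrite (multilinear_set_row_expand mp l (set_row l _ _)); apply: eq_bigr => j _.
  by rewrite set_rowK !mxE eqxx derive_coord ?mxE//; exact: smooth_at_derivable.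
under eq_bigr do rewrite mulr_sumr.
rewrite exchange_big /= (bigD1 l)//= big1 ?add0r; last first.
  by move=> j _; rewrite DW eqxx multilinear_set_row0// mulr0.
apply: eq_bigr => i il; rewrite (multilinear_set_row_expand mp l (set_row i _ _)).
apply: eq_bigr => j _; rewrite DW (negbTE il) /W set_rowC//; congr (_ * _).
by rewrite !mxE eq_sym (negbTE il).
Qed.

Lemma smooth_at_pull (U : V -> 'M[R]_(k, m)) : smooth_at U p ->
  smooth_at (fun q => a (phi q) (U q)) p.
Proof. by move=> sU; apply: (pull_rec (t := k) sU _).1 => q i; rewrite leqNgt ltn_ord. Qed.

Lemma derive_pull (U : V -> 'M[R]_(k, m)) w : smooth_at U p ->
  'D_w (fun q => a (phi q) (U q)) p =
    'D_('D_w phi p) (a ^~ (U p)) (phi p) +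
    \sum_l a (phi p) (set_row l (row l ('D_w U p)) (U p)).
Proof. by move=> sU; apply: (pull_rec (t := k) sU _).2 => q i; rewrite leqNgt ltn_ord. Qed.

End Pullback.

Section ExteriorDerivative.
Context {R : realType} {m : nat}.

Lemma row'_set_row_lift k (i : 'I_k.+1) (l : 'I_k) x (v : 'M[R]_(k.+1, m)) :
  row' i (set_row (lift i l) x v) = set_row l x (row' i v).
Proof. by apply/matrixP => r j; rewrite !mxE (inj_eq lift_inj). Qed.

Lemma row'_set_row k (i : 'I_k.+1) x (v : 'M[R]_(k.+1, m)) :
  row' i (set_row i x v) = row' i v.
Proof. by apply/matrixP => r j; rewrite !mxE eq_sym (negbTE (neq_lift _ _)). Qed.

Variables (k : nat) (f : 'M[R]_(k, m) -> R).
Hypotheses (mf : multilinear f) (af : alternating f).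

(** When j = i + 1 the two deletions give the same matrix and only the signs differ. Otherwise rows
    j and j - 1 are exchanged: this changes the sign of [f (row' i v)] and turns the deletion of row
    j into that of row j - 1. *)
Lemma row'_equal_rows (v : 'M[R]_(k.+1, m)) (i j : 'I_k.+1) : (i < j)%N ->
  row i v = row j v -> (-1) ^+ i * f (row' i v) = - ((-1) ^+ j * f (row' j v)).
Proof.
elim: {j}(j : nat) {-2}j (erefl (j : nat)) v => [j ->//|d IH j Ej v].
rewrite Ej ltnS leq_eqVlt => /orP[/eqP Ei|lid] ij.
  have -> : row' i v = row' j v.
    apply/row_matrixP => r; apply/rowP => q; rewrite !mxE.
    have [Er|Er] := eqVneq (r : nat) i.
      have -> : lift i r = j.
        by apply: val_inj; rewrite /= /bump Er leqnn add1n Ej Ei.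
      have -> : lift j r = i.
        by apply: val_inj; rewrite /= /bump Er Ej Ei ltnn.
      by have /rowP/(_ q) := ij; rewrite !mxE.
    congr (v _ _); apply: val_inj; rewrite /= /bump Ej -Ei.
    by rewrite (leq_eqVlt i r) eq_sym (negbTE Er) /=.
  by rewrite Ei exprS mulN1r mulNr opprK.
have jk : (d < k.+1)%N by rewrite ltnW// -Ej.
pose j' := Ordinal jk.
pose v' := set_row j' (row j v) (set_row j (row j' v) v).
have j'j : j' != j by rewrite -(inj_eq val_inj) /= Ej neq_ltn leqnn.
have ij' : i != j' by rewrite -(inj_eq val_inj) /= neq_ltn lid.
have ij0 : i != j by rewrite -(inj_eq val_inj) /= Ej neq_ltn ltnW.
have Eij' : row i v' = row j' v'.
  by rewrite /v' !row_set_row eqxx (negbTE ij') (negbTE ij0).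
have := IH j' erefl v' lid Eij'.
have -> : row' j' v' = row' j v.
  rewrite /v' row'_set_row; apply/matrixP => r q; rewrite !mxE.
  case: eqP => [Hr|/eqP Hr].
    congr (v _ _); apply: val_inj; rewrite /=.
    have := congr1 val Hr; rewrite /= /bump Ej; lia.
  congr (v _ _); apply: val_inj; rewrite /= /bump Ej.
  have : bump d r != d.+1 by move: Hr; rewrite -(inj_eq val_inj) /= Ej.
  rewrite /bump (leq_eqVlt d r); have [->|//] := eqVneq d r.
  by rewrite add1n eqxx.
have -> : f (row' i v') = - f (row' i v).
  have [l1 El1|] := unliftP i j'; last by move/eqP; rewrite eq_sym (negbTE ij').
  have [l2 El2|] := unliftP i j; last by move/eqP; rewrite eq_sym (negbTE ij0).
  have l12 : l1 != l2 by apply: contraNneq j'j => E; rewrite El1 El2 E.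
  rewrite /v' {1}El1 {2}El2 !row'_set_row_lift alternating_swap//.
  congr (- f _); apply/row_matrixP => r; rewrite !row_set_row.
  case: eqP => [->|_]; first by rewrite El1; apply/rowP => q; rewrite !mxE.
  by case: eqP => [->|//]; rewrite El2; apply/rowP => q; rewrite !mxE.
by rewrite mulrN => /oppr_inj ->; rewrite exprS mulN1r mulNr opprK.
Qed.

(** A symmetric h is summed against coefficients that are antisymmetric by [row'_equal_rows]. With h
    the second derivatives of a map, this is why the exterior derivative commutes with pullback. *)
Lemma sum_second_derivative (u : 'M[R]_(k.+1, m)) (h : 'I_k.+1 -> 'I_k.+1 -> 'rV[R]_m) :
  (forall i j, h i j = h j i) ->
  \sum_(i < k.+1) (-1) ^+ i * \sum_(l < k) f (set_row l (h i (lift i l)) (row' i u)) = 0.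
Proof.
move=> hC.
pose c (i j : 'I_k.+1) := if i == j then 0 else
  (-1) ^+ i * f (row' i (set_row j (h i j) u)).
have cA i j : c i j = - c j i.
  have [->|ij0] := eqVneq i j; first by rewrite /c eqxx oppr0.
  wlog ij : i j ij0 / (i < j)%N.
    move=> H; have := ij0; rewrite neq_ltn => /orP[|ji]; first exact: H.
    by rewrite (H j i) ?opprK// eq_sym.
  rewrite /c (negbTE ij0) eq_sym (negbTE ij0).
  pose v := set_row i (h i j) (set_row j (h i j) u).
  have := @row'_equal_rows v i j ij; rewrite /v !row_set_row !eqxx eq_sym (negbTE ij0).
  move=> /(_ erefl); rewrite row'_set_row => ->.
  by rewrite set_rowC ?row'_set_row 1?hC// eq_sym.
transitivity (\sum_(i < k.+1) \sum_(j < k.+1) c i j).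
  apply: eq_bigr => i _; rewrite mulr_sumr [RHS](bigD1_ord i)//= {1}/c eqxx add0r.
  by apply: eq_bigr => l _; rewrite /c (negbTE (neq_lift _ _)) row'_set_row_lift.
have S0 : \sum_(i < k.+1) \sum_(j < k.+1) c i j =
   - (\sum_(i < k.+1) \sum_(j < k.+1) c i j).
  rewrite {1}exchange_big /= -sumrN; apply: eq_bigr => j _.
  by rewrite -sumrN; apply: eq_bigr => i _; rewrite cA.
by move/eqP: S0; rewrite -addr_eq0 -mulr2n mulrn_eq0 => /eqP.
Qed.

End ExteriorDerivative.

Section Naturality.
Context {R : realType} {m : nat} {V : normedModType R}.

(* [w] are constant vector fields on the source. *)
Lemma ext_d_pull k (a : 'rV[R]_m -> 'M[R]_(k, m) -> R) (phi : V -> 'rV[R]_m)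
    (p : V) (w : 'I_k.+1 -> V) :
  (forall v, smooth_at (a ^~ v) (phi p)) ->
  (\forall y \near phi p, multilinear (a y)) -> alternating (a (phi p)) ->
  smooth_at phi p ->
  \sum_(i < k.+1) (-1) ^+ i *
     'D_(w i) (fun q => a (phi q) (\matrix_(l, j) 'D_(w (lift i l)) phi q 0 j)) p =
  \sum_(i < k.+1) (-1) ^+ i *
     'D_('D_(w i) phi p) (a ^~ (\matrix_(l, j) 'D_(w (lift i l)) phi p 0 j)) (phi p).
Proof.
move=> sa ma aa sphi.
have sU (i : 'I_k.+1) : smooth_at (fun q => \matrix_(l < k, j < m) 'D_(w (lift i l)) phi q 0 j) p.
  apply: smooth_at_mx => l j; under eq_fun do rewrite mxE.
  by apply: smooth_at_coord; exact: smooth_at_derive.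
pose U (i : 'I_k.+1) p := \matrix_(l < k, j < m) 'D_(w (lift i l)) phi p 0 j.
transitivity (\sum_(i < k.+1) ((-1) ^+ i * 'D_('D_(w i) phi p) (a ^~ (U i p)) (phi p) +
  (-1) ^+ i * \sum_l a (phi p) (set_row l (row l ('D_(w i) (U i) p)) (U i p)))).
  apply: eq_bigr => i _; rewrite -mulrDr; congr (_ * _).
  exact: (derive_pull sa ma sphi _ (sU _)).
rewrite big_split /= -[RHS]addr0; congr (_ + _).
have ma' : multilinear (a (phi p)) by exact: nbhs_singleton ma.
pose u := \matrix_(i < k.+1, j < m) 'D_(w i) phi p 0 j.
pose h i j := 'D_(w i) ('D_(w j) phi) p.
have hC i j : h i j = h j i by exact: Schwarz.
apply: etrans (sum_second_derivative ma' aa u hC); apply: eq_bigr => i _.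
congr (_ * _); apply: eq_bigr => l _; congr (a _ _).
apply/matrixP => r j; rewrite !mxE; case: eqP => // _.
rewrite -derive_coord; last by apply: smooth_at_derivable; exact: sU.
under eq_fun do rewrite mxE.
by rewrite derive_coord//; apply: smooth_at_derivable; exact: smooth_at_derive.
Qed.

End Naturality.

Section FormsPull.
Context {R : realType} {m : nat} {M : manifold R m}.
Implicit Types (c : chart R m M) (y : 'rV[R]_m).

Lemma form_smooth k (a : preform M k) c y v : is_form a -> atlas c -> chart_img c y ->
  smooth_at (fun y => a c y v) y.
Proof.
move=> fa ac cy; have [_ sa _] := fa c ac.
by apply: smooth_on_at (sa v) => //; exact: chart_img_open.
Qed.

Lemma form_multilinear k (a : preform M k) c y : is_form a -> atlas c -> chart_img c y ->
  multilinear (a c y).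
Proof. by move=> fa ac cy; have [H _ _] := fa c ac; exact: (H y cy).1. Qed.

Lemma form_alternating k (a : preform M k) c y : is_form a -> atlas c -> chart_img c y ->
  alternating (a c y).
Proof. by move=> fa ac cy; have [H _ _] := fa c ac; exact: (H y cy).2. Qed.

Lemma form_near_multilinear k (a : preform M k) c y : is_form a -> atlas c ->
  chart_img c y -> \forall z \near y, multilinear (a c z).
Proof.
move=> fa ac cy; have : nbhs y (chart_img c).
  by apply: open_nbhs_nbhs; split=> //; exact: chart_img_open.
by apply: filterS => z; exact: form_multilinear.
Qed.

Lemma form_transition k (a : preform M k) c c' y v : is_form a -> atlas c -> atlas c' ->
  overlap c c' y ->
  a c y v = a c' (transition c c' y) (v *m 'J (transition c c') y).
Proof. by move=> fa ac ac' H; have [_ _ T] := fa c ac; exact: T. Qed.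

Lemma overlap_nbhs c c' y : overlap c c' y -> nbhs y (overlap c c').
Proof. by move=> H; apply: open_nbhs_nbhs; split=> //; exact: overlap_open. Qed.

Lemma row_row' k (i : 'I_k.+1) (l : 'I_k) (v : 'M[R]_(k.+1, m)) :
  row l (row' i v) = row (lift i l) v.
Proof. by apply/rowP => j; rewrite !mxE. Qed.

Lemma ext_d_transition k (a : preform M k) c c' y v : is_form a -> atlas c -> atlas c' ->
  overlap c c' y ->
  ext_d a c y v = ext_d a c' (transition c c' y) (v *m 'J (transition c c') y).
Proof.
move=> fa ac ac' H.
have st := transition_smooth_at ac ac' H.
have c'y := overlap_img H.
have E := @ext_d_pull R m 'rV[R]_m k (a c') (transition c c') y (fun i => row i v)
  (fun v => form_smooth v fa ac' c'y) (form_near_multilinear fa ac' c'y)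
  (form_alternating fa ac' c'y) st.
rewrite /ext_d; transitivity (\sum_(i < k.+1) (-1) ^+ i *
   'D_(row i v) (fun q => a c' (transition c c' q)
     (\matrix_(l, j) 'D_(row (lift i l) v) (transition c c') q 0 j)) y).
  apply: eq_bigr => i _; congr (_ * _); apply: near_eq_derive.
  have := overlap_nbhs H; apply: filterS => z Hz.
  apply: etrans (form_transition _ fa ac ac' Hz) _; congr (a c' _ _).
  by apply/row_matrixP => l; rewrite rowK row_mul row_row'; exact: jacobianE.
apply: etrans E _; apply: eq_bigr => i _.
rewrite row_mul (jacobianE _ ac ac' H).
suff -> : \matrix_(l < k, j < m) 'D_(row (lift i l) v) (transition c c') y 0 j =
  row' i (v *m 'J (transition c c') y) by [].
by apply/row_matrixP => l; rewrite rowK row_row' row_mul; apply/esym; exact: jacobianE.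
Qed.

Variable V : normedModType R.
Implicit Types (F : V -> M) (p q : V).

Definition mjac k (c : chart R m M) F (w : 'I_k -> V) q : 'M[R]_(k, m) :=
  \matrix_(l, j) 'D_(w l) (fun q => c (F q)) q 0 j.

(** The chart used for the evaluation depends on q, so regularity is not visible from the formula;
    [mpullE] and [mpull_near] replace it by any fixed chart around the point. *)
Definition mpull k (a : preform M k) F (w : 'I_k -> V) q : R :=
  a (chart_at (F q)) (chart_at (F q) (F q)) (mjac (chart_at (F q)) F w q).

Lemma derive_chart_change c c' F p w : atlas c -> atlas c' -> chart_dom c (F p) ->
  chart_dom c' (F p) -> msmooth_at F p ->
  'D_w (fun q => c' (F q)) p = 'D_w (fun q => c (F q)) p *m 'J (transition c c') (c (F p)).
Proof.
move=> ac ac' cp c'p [cF sF].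
have H : overlap c c' (c (F p)) by exact: overlap_dom.
rewrite jacobianE// -derive_comp; first last.
- by apply: smooth_at_differentiable; exact: transition_smooth_at.
- by apply: smooth_at_differentiable; exact: sF.
apply: near_eq_derive; have := near_dom cF cp; apply: filterS => q cq.
by rewrite transition_fun.
Qed.

Lemma mjac_change k c c' F p (w : 'I_k -> V) : atlas c -> atlas c' -> chart_dom c (F p) ->
  chart_dom c' (F p) -> msmooth_at F p ->
  mjac c' F w p = mjac c F w p *m 'J (transition c c') (c (F p)).
Proof.
move=> ac ac' cp c'p sF; apply/row_matrixP => l.
by rewrite row_mul !rowK (derive_chart_change _ ac ac' cp c'p sF).
Qed.

Lemma mpullE k (a : preform M k) F (w : 'I_k -> V) p c : is_form a -> atlas c ->
  chart_dom c (F p) -> msmooth_at F p -> mpull a F w p = a c (c (F p)) (mjac c F w p).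
Proof.
move=> fa ac cp sF; have ac' := chart_at_atlas (F p); have c'p := chart_at_dom (F p).
rewrite (form_transition _ fa ac ac'); last exact: overlap_dom.
by rewrite transition_fun// -mjac_change.
Qed.

Lemma mjac_smooth_at k c F p (w : 'I_k -> V) : smooth_at (fun q => c (F q)) p ->
  smooth_at (mjac c F w) p.
Proof.
move=> sF; apply: smooth_at_mx => l j; rewrite /mjac; under eq_fun do rewrite mxE.
by apply: smooth_at_coord; exact: smooth_at_derive.
Qed.

Lemma mpull_near k (a : preform M k) F (w : 'I_k -> V) p c : is_form a -> atlas c ->
  chart_dom c (F p) -> (\near p, msmooth_at F p) ->
  \near p, a c (c (F p)) (mjac c F w p) = mpull a F w p.
Proof.
move=> fa ac cp nF; have [cF _] := nbhs_singleton nF.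
have := near_dom cF cp; move: nF; apply: filterS2 => q sF cq.
by rewrite (mpullE _ fa ac cq sF).
Qed.

Lemma mpull_smooth_at k (a : preform M k) F (w : 'I_k -> V) p : is_form a ->
  (\near p, msmooth_at F p) -> smooth_at (mpull a F w) p.
Proof.
move=> fa nF; have ac := chart_at_atlas (F p); have cp := chart_at_dom (F p).
apply: smooth_at_near (mpull_near w fa ac cp nF) _.
have [_ sF] := nbhs_singleton nF; have {}sF := sF _ ac cp.
have cy := chart_funP cp.
apply: (@smooth_at_pull _ _ _ k (a (chart_at (F p))) (fun q => chart_at (F p) (F q))) => //.
- by move=> v; exact: form_smooth.
- exact: form_near_multilinear.
- exact: mjac_smooth_at.
Qed.

Lemma mpull_ext_d k (a : preform M k) F (w : 'I_k.+1 -> V) p : is_form a ->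
  (\near p, msmooth_at F p) ->
  \sum_(i < k.+1) (-1) ^+ i * 'D_(w i) (mpull a F (fun l => w (lift i l))) p =
  mpull (ext_d a) F w p.
Proof.
move=> fa nF; pose c := chart_at (F p).
have ac : atlas c := chart_at_atlas (F p); have cp : chart_dom c (F p) := chart_at_dom (F p).
have [_ sF] := nbhs_singleton nF; have {}sF := sF _ ac cp.
have cy := chart_funP cp.
have E := @ext_d_pull R m V k (a c) (fun q => c (F q)) p w
  (fun v => form_smooth v fa ac cy) (form_near_multilinear fa ac cy)
  (form_alternating fa ac cy) sF.
have E1 (i : 'I_k.+1) : 'D_(w i) (mpull a F (fun l => w (lift i l))) p =
    'D_(w i) (fun q => a c (c (F q)) (mjac c F (fun l => w (lift i l)) q)) p.
  exact: (esym (near_eq_derive _ (mpull_near (fun l => w (lift i l)) fa ac cp nF))).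
under eq_bigr do rewrite E1.
apply: etrans E _; rewrite /mpull -/c /ext_d; apply: eq_bigr => i _; rewrite rowK.
suff -> : \matrix_(l < k, j < m) 'D_(w (lift i l)) (fun q => c (F q)) p 0 j =
  row' i (mjac c F w p) by [].
by apply/row_matrixP => l; rewrite rowK row_row' rowK.
Qed.

End FormsPull.

Section TwoRows.
Context {R : realType} {m : nat}.
Implicit Types (u v : 'rV[R]_m).

Lemma col_mx2E u v :
  col_mx u v = \matrix_(i < 2, j < m) (if i == 0 then u 0 j else v 0 j).
Proof.
apply/matrixP => i j; rewrite [RHS]mxE.
case: (fintype.splitP i) => l; rewrite (ord1 l) => Ei.
  have -> : i = lshift 1 0 by exact: val_inj.
  by rewrite (col_mxEu u v).
have -> : i = rshift 1 0 by exact: val_inj.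
by rewrite (col_mxEd u v).
Qed.

Lemma row0_col_mx u v : row 0 (col_mx u v : 'M[R]_(2, m)) = u.
Proof. by rewrite col_mx2E; apply/rowP => j; rewrite !mxE. Qed.

Lemma row1_col_mx u v : row 1 (col_mx u v : 'M[R]_(2, m)) = v.
Proof. by rewrite col_mx2E; apply/rowP => j; rewrite !mxE. Qed.

Lemma set_row0_col_mx u v x : set_row (0 : 'I_2) x (col_mx u v) = col_mx x v.
Proof. by rewrite !col_mx2E; apply/matrixP => i j; rewrite !mxE; case: eqP. Qed.

Lemma set_row1_col_mx u v x : set_row (1 : 'I_2) x (col_mx u v) = col_mx u x.
Proof.
rewrite !col_mx2E; apply/matrixP => i j; rewrite !mxE.
by case: i => -[|[|//]] Hi.
Qed.

Lemma mx2_rows (v : 'M[R]_(2, m)) : v = col_mx (row 0 v) (row 1 v).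
Proof.
rewrite col_mx2E; apply/matrixP => i j; rewrite !mxE.
by case: i => -[|[|//]] Hi /=; congr (v _ _); exact: val_inj.
Qed.

End TwoRows.

Section TwoRowForms.
Context {R : realType} {m : nat}.
Implicit Types (u v : 'rV[R]_m).

Lemma mul_col_mx2 p u v (A : 'M[R]_(m, p)) :
  (col_mx u v : 'M[R]_(2, m)) *m A = col_mx (u *m A) (v *m A).
Proof.
apply/row_matrixP => i; rewrite row_mul; case: i => -[|[|//]] Hi.
  have -> : Ordinal Hi = 0 by exact: val_inj.
  by rewrite !row0_col_mx.
have -> : Ordinal Hi = 1 by exact: val_inj.
by rewrite !row1_col_mx.
Qed.

Variable f : 'M[R]_(2, m) -> R.
Hypotheses (mf : multilinear f).

Lemma bilinear_l a b u u' v :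
  f (col_mx (a *: u + b *: u') v) = a * f (col_mx u v) + b * f (col_mx u' v).
Proof.
have := multilinear_set_row mf 0 a b u u' (col_mx (0 : 'rV[R]_m) v).
by rewrite !set_row0_col_mx.
Qed.

Lemma bilinear_r a b u v v' :
  f (col_mx u (a *: v + b *: v')) = a * f (col_mx u v) + b * f (col_mx u v').
Proof.
have := multilinear_set_row mf 1 a b v v' (col_mx u (0 : 'rV[R]_m)).
by rewrite !set_row1_col_mx.
Qed.

Lemma bilinear_Zl a u v : f (col_mx (a *: u) v) = a * f (col_mx u v).
Proof. by have := bilinear_l a 0 u 0 v; rewrite scale0r addr0 mul0r addr0. Qed.

Lemma bilinear_Zr a u v : f (col_mx u (a *: v)) = a * f (col_mx u v).
Proof. by have := bilinear_r a 0 u v 0; rewrite scale0r addr0 mul0r addr0. Qed.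

Hypothesis af : alternating f.

Lemma alternating2C u v : f (col_mx u v) = - f (col_mx v u).
Proof.
have := alternating_swap mf af u v (col_mx u v) (isT : (0 : 'I_2) != 1).
by rewrite !set_row1_col_mx !set_row0_col_mx.
Qed.

End TwoRowForms.

(** * Circle actions *)

Section Action.
Context {R : realType} {m : nat} {M : manifold R m}.
Variable act : R -> M -> M.
Hypothesis sact : smooth_circle_action act.
Implicit Types (c : chart R m M) (y : 'rV[R]_m).

Lemma act0 x : act 0 x = x. Proof. by case: sact. Qed.
Lemma actD s t x : act (s + t) x = act s (act t x). Proof. by case: sact. Qed.
Lemma act1 x : act 1 x = x. Proof. by case: sact. Qed.

Lemma actDn s (n : nat) x : act (s + n%:R) x = act s x.
Proof.
elim: n => [|n IH]; first by rewrite addr0.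
by rewrite -addn1 natrD addrA actD act1.
Qed.

Lemma act_param_smooth c (p : R^o * 'rV[R]_m) : atlas c -> chart_img c p.2 ->
  msmooth_at (fun p : R^o * 'rV[R]_m => act p.1 (chart_inv c p.2)) p.
Proof.
move=> ac cp; have [_ _ _ H] := sact.
have /smooth_mapP := H c ac; apply => //.
suff -> : [set: R^o] `*` chart_img c = [set q : R^o * 'rV[R]_m | chart_img c q.2].
  apply: open_comp; last exact: chart_img_open.
  by move=> q _; exact: cvg_snd.
by apply/seteqP; split=> q //= [].
Qed.

Lemma msmooth_act (V : normedModType R) (t : V -> R) (F : V -> M) p :
  smooth_at t p -> msmooth_at F p -> msmooth_at (fun q => act (t q) (F q)) p.
Proof.
move=> st [cF sF]; pose c := chart_at (F p).
have ac : atlas c := chart_at_atlas (F p); have cp : chart_dom c (F p) := chart_at_dom (F p).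
apply: (@msmooth_at_near _ _ _ _ (fun q => act (t q) (chart_inv c (c (F q))))).
  by have := near_dom cF cp; apply: filterS => q cq; rewrite chart_funK.
apply: (@msmooth_at_comp _ _ _ V (R^o * 'rV[R]_m)%type (fun q => (t q, c (F q)))
   (fun p => act p.1 (chart_inv c p.2))).
- by apply: fin_dim_prod; [exact: fin_dim_scalar|exact: fin_dim_mx].
- by apply: smooth_at_pair => //; exact: sF.
by apply: act_param_smooth => //; exact: chart_funP.
Qed.

Notation X := (action_field act).

Lemma orbit_smooth x (t : R) : msmooth_at (fun t : R => act t x) t.
Proof. by apply: msmooth_act; [exact: smooth_at_id|exact: msmooth_at_cst]. Qed.

Lemma action_fieldE c x : chart_dom c x -> X c (c x) = 'D_1 (fun t : R => c (act t x)) 0.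
Proof. by move=> cx; rewrite /action_field derive1E chart_funK. Qed.

Lemma orbit_derive c x t : atlas c -> chart_dom c (act t x) ->
  'D_1 (fun t : R => c (act t x)) t = X c (c (act t x)).
Proof.
move=> ac ct; rewrite action_fieldE//.
have E : (fun s : R => c (act s (act t x))) = (fun s : R => c (act (s + t) x)).
  by apply/funext => s; rewrite actD.
rewrite E (@derive_comp _ _ _ _ (fun s : R => c (act s x)) (fun s : R => s + t)) ?add0r.
- by rewrite deriveD// derive_id derive_cst addr0.
- apply: smooth_at_differentiable; apply: smooth_atD; [exact: smooth_at_id|exact: smooth_at_cst].
- apply: smooth_at_differentiable; apply: (orbit_smooth x _).2 => //.
Qed.

Lemma action_field_change c c' x : atlas c -> atlas c' -> chart_dom c x -> chart_dom c' x ->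
  X c' (c' x) = X c (c x) *m 'J (transition c c') (c x).
Proof.
move=> ac ac' cx c'x; rewrite !action_fieldE//.
by have := @derive_chart_change _ _ _ _ c c' (fun t : R => act t x) 0 1; rewrite act0; apply => //; exact: orbit_smooth.
Qed.

Lemma action_field_smooth c y : atlas c -> chart_img c y -> smooth_at (X c) y.
Proof.
move=> ac cy.
pose f := fun p : R^o * 'rV[R]_m => c (act p.1 (chart_inv c p.2)).
have sf z : chart_img c z -> smooth_at f (0, z).
  move=> cz; apply: (act_param_smooth (p := (0, z)) ac _).2 => //=.
  by rewrite act0; exact: chart_invP.
have E z : chart_img c z -> 'D_(1, 0) f (0, z) = X c z.
  move=> cz; rewrite /action_field derive1E.
  rewrite (@derive_comp _ _ _ _ f (fun t : R => (t : R^o, z))).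
  - rewrite derive_pair; [|exact: smooth_at_differentiable (smooth_at_id _)|exact: differentiable_cst].
    by rewrite derive_id derive_cst.
  - by apply: smooth_at_differentiable; apply: smooth_at_pair; [exact: smooth_at_id|exact: smooth_at_cst].
  - by apply: smooth_at_differentiable; exact: sf.
apply: (@smooth_at_near _ _ _ (fun z => 'D_(1, 0) f (0, z))).
  have : nbhs y (chart_img c) by apply: open_nbhs_nbhs; split=> //; exact: chart_img_open.
  by apply: filterS => z; exact: E.
apply: (@smooth_at_comp _ _ _ _ (fun z => (0, z)) ('D_(1, 0) f)).
- by apply: fin_dim_prod; [exact: fin_dim_scalar|exact: fin_dim_mx].
- by apply: smooth_at_pair; [exact: smooth_at_cst|exact: smooth_at_id].
- by apply: smooth_at_derive; exact: sf.
Qed.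

Lemma contraction_form (w : preform M 2) : is_form w -> is_form (contraction X w).
Proof.
move=> fw c ac; split.
- move=> y cy; split.
    move=> i a b u v z; rewrite (ord1 i) => H _ _; rewrite /contraction.
    have mw := form_multilinear fw ac cy.
    by move: H; rewrite !row_id => ->; rewrite bilinear_r.
  by move=> v i j; rewrite (ord1 i) (ord1 j) eqxx.
- move=> v; apply/smooth_onP; first exact: chart_img_open.
  move=> y cy; apply: (@smooth_at_pull _ _ _ 2 (w c) id) => //.
  + by move=> u; exact: form_smooth.
  + exact: form_near_multilinear.
  + exact: smooth_at_id.
  + have sX := action_field_smooth ac cy.
    under eq_fun do rewrite col_mx2E.
    apply: smooth_at_mx => i j; under eq_fun do rewrite mxE.
    case: (i == 0); last exact: smooth_at_cst.
    exact: smooth_at_coord.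
- move=> c' ac' y H v; rewrite /contraction (form_transition _ fw ac ac' H); congr (w c' _ _).
  have [cy c'y] := H.
  have := action_field_change ac ac' (chart_invP cy) c'y.
  by rewrite chart_invK// mul_col_mx2 => <-.
Qed.

(* The maximum of [h] is a critical point, where [X] vanishes; the orbit
   through it is constant. *)
Lemma action_field_neq0 c x : free_circle_action act -> atlas c -> chart_dom c x ->
  X c (c x) != 0.
Proof.
move=> fr ac cx; apply/negP => /eqP X0.
(* The flow carries the zero of X at x to a zero at t x: the orbit near time t is the image under
   [act t] of the orbit near time 0. *)
have Xt t c' : atlas c' -> chart_dom c' (act t x) -> X c' (c' (act t x)) = 0.
  move=> ac' c't; rewrite -orbit_derive//.
  have E : (fun s : R => c' (act s x)) = (fun s : R => c' (act t (act (s - t) x))).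
    by apply/funext => s; rewrite -actD addrC subrK.
  pose g := fun y => c' (act t (chart_inv c y)).
  have sg : smooth_at g (c x).
    have := @msmooth_act _ (fun=> t) (chart_inv c) (c x) (smooth_at_cst _ _).
    move=> /(_ (msmooth_at_inv ac (chart_funP cx) (smooth_at_id _))) [_]; apply => //.
    by rewrite chart_funK.
  have shs : smooth_at (fun s : R => s - t) t.
    by apply: smooth_atB; [exact: smooth_at_id|exact: smooth_at_cst].
  have so : smooth_at (fun s : R => c (act s x)) 0.
    by apply: (orbit_smooth x 0).2; rewrite ?act0.
  have so' : smooth_at (fun s : R => c (act (s - t) x)) t.
    apply: (@smooth_at_comp _ _ _ _ (fun s : R => s - t) (fun s : R => c (act s x))) => //.
      exact: fin_dim_scalar.
    by rewrite subrr.
  have nE : \forall s \near t, g (c (act (s - t) x)) = c' (act s x).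
    have co : {for t, continuous (fun s : R => act (s - t) x)}.
      apply: (msmooth_at_comp (h := fun s : R => s - t) (f := fun s : R => act s x) _ _ _).1 => //.
        exact: fin_dim_scalar.
      exact: orbit_smooth.
    have : chart_dom c (act (t - t) x) by rewrite subrr act0.
    move=> /(near_dom co); apply: filterS => s cs.
    by rewrite /g chart_funK// -actD addrC subrK.
  rewrite -(near_eq_derive _ nE) (@derive_comp _ _ _ _ g)//.
  - have -> : 'D_1 (fun s : R => c (act (s - t) x)) t = 0.
      rewrite (@derive_comp _ _ _ _ (fun s : R => c (act s x)) (fun s : R => s - t)).
      + rewrite subrr deriveB// ?derive_id ?derive_cst ?subr0 ?orbit_derive ?act0//.
      + exact: smooth_at_differentiable.
      + by rewrite subrr; exact: smooth_at_differentiable.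
    by rewrite derive0.
  - exact: smooth_at_differentiable.
  - by apply: smooth_at_differentiable; rewrite subrr act0.
(* The velocity vanishes, so each coordinate is constant on a ball of times around t. *)
have loc t : \forall s \near t, act s x = act t x.
  pose c' := chart_at (act t x).
  have ac' : atlas c' := chart_at_atlas (act t x).
  have c't : chart_dom c' (act t x) := chart_at_dom (act t x).
  have := near_dom (orbit_smooth x t).1 c't.
  move=> /nbhs_ballP[r /= r0 Hr]; apply/nbhs_ballP; exists r => // s ts.
  have cs := Hr s ts; rewrite -(chart_funK cs) -(chart_funK c't); congr chart_inv.
  apply/rowP => j.
  have dz u : ball t r u -> is_derive u 1 (fun u => c' (act u x) 0 j) 0.
    move=> /Hr cu; have su := (orbit_smooth x u).2 _ ac' cu.
    split; first by apply: smooth_at_derivable; exact: (smooth_at_coord 0 j su).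
    rewrite derive_coord; last exact: smooth_at_derivable su.
    by rewrite orbit_derive// Xt// mxE.
  have bt u : Num.min s t <= u <= Num.max s t -> ball t r u.
    move: ts; rewrite -!ball_normE /= !ltr_distl => /andP[s1 s2] /andP[u1 u2].
    by move: u1 u2 s1 s2; rewrite ge_min le_max => /orP[] + /orP[]; lra.
  have [st|st] := leP s t.
    by apply/esym; apply: (@is_derive_zero_cst _ s t (fun u => c' (act u x) 0 j)) => // u ust;
      apply: dz; apply: bt; rewrite min_l ?max_r.
  apply: (@is_derive_zero_cst _ t s (fun u => c' (act u x) 0 j)); first exact: ltW.
  by move=> u ust; apply: dz; apply: bt; rewrite (min_r (ltW st)) (max_l (ltW st)).
have connT : connected [set: R] by apply/connected_intervalP.
pose B := [set t : R | act t x = x].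
have oB : open B.
  by rewrite openE => t Bt; have := loc t; apply: filterS => s; rewrite Bt.
have cB : closed B.
  rewrite -openC openE => t Bt; have := loc t; apply: filterS => s Es.
  by rewrite /B /= Es.
have BT : B = setT.
  apply: connT; first by exists 0; rewrite /B /= act0.
    by exists B; rewrite ?setTI.
  by exists B; rewrite ?setTI.
(* The times that fix x form an open and closed set containing 0. It therefore contains 1/2, which
   is no integer. *)
have : B (1 / 2) by rewrite BT.
move=> /fr /intrP[z Ez].
have /intr_inj : (1 : int)%:~R = (2 * z)%:~R :> R by rewrite intrM -Ez; field.
lia.
Qed.

Lemma exact_alpha_absurd (w : preform M 2) (g : preform M 0) :
  [set: M] !=set0 -> compact [set: M] -> symplectic_form w ->
  free_circle_action act -> is_form g ->
  form_eq (contraction X w) (ext_d g) -> False.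
Proof.
move=> M0 cM [fw _ nd] fr fg E.
(* The 0-form takes an empty matrix of vectors, here written 0; its values in different charts agree
   and define a continuous function on M. *)
pose h x := g (chart_at x) (chart_at x x) 0.
have hE c x : atlas c -> chart_dom c x -> h x = g c (c x) 0.
  move=> ac cx; rewrite /h (form_transition _ fg (chart_at_atlas x) ac).
    by rewrite transition_fun ?mul0mx//; exact: chart_at_dom.
  by apply: overlap_dom => //; exact: chart_at_dom.
have ch : continuous h.
  move=> x; pose c := chart_at x.
  have ac : atlas c := chart_at_atlas x; have cx : chart_dom c x := chart_at_dom x.
  have nd' : nbhs x (chart_dom c).
    by apply: open_nbhs_nbhs; split=> //; exact: chart_dom_open.
  rewrite /continuous_at {2}/h -/c.
  apply: (@cvg_trans _ ((fun z => g c (c z) 0) @ x)).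
    apply: near_eq_cvg; apply: filterS nd' => z cz; apply/esym; exact: hE.
  apply: (@continuous_comp _ _ _ c (fun y => g c y 0)); first exact: chart_fun_cont.
  by apply: smooth_at_continuous; apply: form_smooth => //; exact: chart_funP.
have [x _ xmax] := compact_EVT_max M0 cM (continuous_subspaceT ch).
pose c := chart_at x.
have ac : atlas c := chart_at_atlas x; have cx : chart_dom c x := chart_at_dom x.
have cy := chart_funP cx.
have := action_field_neq0 fr ac cx; apply/negP; rewrite negbK; apply/eqP.
apply: (nd c ac (c x) cy) => v.
have := E c ac (c x) cy v; rewrite /contraction => ->.
rewrite /ext_d big_ord1 expr0 mul1r row_id.
pose f (s : R) := g c (c x + s *: v) (row' ord0 v).
have sg : smooth_at (fun y => g c y (row' ord0 v)) (c x) by exact: form_smooth.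
have df : is_derive (0 : R) 1 f ('D_v (fun y => g c y (row' ord0 v)) (c x)).
  have := @line_is_derive _ _ _ (fun y => g c y (row' ord0 v)) (c x) v 0.
  by rewrite scale0r addr0; apply; exact: smooth_at_differentiable.
apply: etrans (esym (@derive_val _ _ _ _ _ _ _ df)) _.
have cl : {for (0 : R), continuous (fun s : R => c x + s *: v)}.
  apply: smooth_at_continuous; apply: smooth_atD; first exact: smooth_at_cst.
  by apply: smooth_atZ; [exact: smooth_at_id|exact: smooth_at_cst].
have : chart_img c (c x + 0 *: v) by rewrite scale0r addr0.
move=> /(near_img cl)/nbhs_ballP[r /= r0 Hr].
have r2 s : s \in `](- r), r[ -> chart_img c (c x + s *: v).
  rewrite in_itv /= => /andP[s1 s2]; apply: Hr; rewrite -ball_normE /= sub0r normrN.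
  by rewrite ltr_norml s1.
have fs s : s \in `](- r), r[ -> f s = h (chart_inv c (c x + s *: v)).
  move=> /r2 cs; rewrite (hE c)//; last exact: chart_invP.
  by rewrite chart_invK// /f; congr (g c _ _); apply/matrixP => -[].
have z0 : (0 : R) \in `](- r), r[ by rewrite in_itv /= oppr_lt0 r0.
suff d0 : is_derive (0 : R) 1 f 0 by exact: (@derive_val _ _ _ _ _ _ _ d0).
apply: (@derive1_at_max _ f (- r) r 0) => //.
- by rewrite ge0_cp ?ltW.
- move=> s sr; apply: (@ex_derive _ _ _ _ _ _ _ (@line_is_derive _ _ _ (fun y => g c y (row' ord0 v)) (c x) v s _)).
  by apply: smooth_at_differentiable; apply: form_smooth => //; exact: r2.
- move=> s sr; rewrite !fs// scale0r addr0 chart_funK//; apply: xmax; exact: in_setT.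
Qed.

End Action.

(** * Areas swept by loops *)

Section Primitive.
Context {R : realType}.

Lemma pint_split (a b c : R) f : a <= b -> b <= c -> cont_on a c f ->
  pint a c f = pint a b f + pint b c f.
Proof.
move=> ab bc cf; have ac := le_trans ab bc.
have ci : lebesgue_measure.-integrable `[a, c] (EFin \o f) by exact: cont_on_integrable.
have := @Rintegral_itvB _ f (BLeft a) (BRight c) b ci.
rewrite /= !bnd_simp ab bc => /(_ isT isT) E.
have E2 : \int[lebesgue_measure]_(x in `]b, c]) f x = pint b c f.
  by rewrite /pint Rintegral_itv_obnd_cbnd//; apply: integrableS ci => //;
     apply: subset_itvr; rewrite bnd_simp.
by rewrite -E2 -E /pint addrC subrK.
Qed.

Lemma exists_primitive (G : R -> R) : continuous G ->
  exists T : R -> R, forall s : R, is_derive s 1 T (G s).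
Proof.
move=> cG.
have co a b : cont_on a b G by move=> t _; exact: cG.
exists (fun s => if 0 <= s then pint 0 s G else - pint s 0 G) => s.
(* Near s the candidate differs by a constant from the integral that starts at a, a point to the
   left of both s and 0. *)
pose a := - (`|s| + 1).
have a0 : a < 0 by rewrite /a oppr_lt0 ltr_wpDl.
have as' : a < s by rewrite /a; have := ler_norm (- s); rewrite normrN; lra.
have sb : s < `|s| + 1 by have := ler_norm s; lra.
have H := @pint_deriv _ a (`|s| + 1) G s (introT andP (conj as' sb)) (co _ _).
have H2 := is_deriveB H (is_derive_cst (pint a 0 G) s 1).
rewrite subr0 in H2.
apply: near_eq_is_derive H2.
near=> u; have au : a <= u by apply/ltW; near: u; exact: lt_nbhsr.
rewrite !fctE; case: ifPn => [u0|]; last rewrite -ltNge => u0.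
  by rewrite (@pint_split a 0 u) ?(ltW a0)// addrC addKr.
by rewrite (@pint_split a u 0) ?(ltW u0)// opprD addrA subrr add0r.
Unshelve. all: by end_near. Qed.

End Primitive.

Section Cylinders.
Context {R : realType} {m : nat} {M : manifold R m}.
Implicit Types (F : R^o * R^o -> M) (L : R -> M) (I : preform M 2 -> R).

Definition dir2 (l : 'I_2) : R^o * R^o := if l == 0 then (1, 0) else (0, 1).

(* The coefficient of [ds db] in the pullback of a 2-form. *)
Definition density (a : preform M 2) F (p : R^o * R^o) : R := mpull a F dir2 p.

Definition slice_area (a : preform M 2) F (s : R) : R :=
  pint 0 (2 * pi) (fun b => density a F (s, b)).

(** Loops have period 2 pi, to match the longitude in [sphere_integral]. Being defined on the whole
    plane and independent of s near the ends, cylinders can be reversed and concatenated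
    smoothly. *)
Definition cylinder F L L' :=
  [/\ forall p, msmooth_at F p,
      forall s b : R, F (s, b + 2 * pi) = F (s, b),
      forall s b : R, s <= 1 / 4 -> F (s, b) = L b &
      forall s b : R, 3 / 4 <= s -> F (s, b) = L' b].

(** One functional records the areas of all forms on the same cylinder, so that omega and sigma are
    compared on the same disc. The area is the increment of a primitive defined on the whole line,
    which turns reparametrisation in s into a chain rule. *)
Definition sweeps L L' I := exists F, cylinder F L L' /\
  forall a, is_form a -> exists T : R -> R,
    (forall s : R, is_derive s 1 T (slice_area a F s)) /\ I a = T 1 - T 0.

Lemma fin_dim_R2 : fin_dim (R^o * R^o : normedModType R)%type.
Proof. by apply: fin_dim_prod; exact: fin_dim_scalar. Qed.

Lemma density_smooth a F : is_form a -> (forall p, msmooth_at F p) ->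
  forall p, smooth_at (density a F) p.
Proof.
move=> fa sF p; apply: mpull_smooth_at; first exact: fa.
exact: (@filterE _ (nbhs p) _ _ sF).
Qed.

Lemma slice_area_cont a F : is_form a -> (forall p, msmooth_at F p) ->
  continuous (slice_area a F).
Proof.
move=> fa sF s.
have pi0 : 0 <= 2 * pi :> R by rewrite mulr_ge0// pi_ge0.
have sw (p : R^o * R^o) : smooth_at (fun q : R^o * R^o => density a F (q.2, q.1)) p.
  apply: (@smooth_at_comp _ _ _ _ (fun q : R^o * R^o => ((q.2, q.1) : R^o * R^o))).
  - exact: fin_dim_R2.
  - apply: smooth_at_pair.
      apply: (@smooth_at_linear _ _ _ _ (@snd R^o R^o : {linear (R^o * R^o)%type -> R^o})) => //.
        by move=> q; exact: cvg_snd.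
      exact: smooth_at_id.
    apply: (@smooth_at_linear _ _ _ _ (@fst R^o R^o : {linear (R^o * R^o)%type -> R^o})) => //.
      by move=> q; exact: cvg_fst.
    exact: smooth_at_id.
  - exact: density_smooth.
have [H _] := @pint_smooth R R^o fin_dim_scalar 0 (2 * pi) setT
  (fun q : R^o * R^o => density a F (q.2, q.1)) pi0 openT (fun t x _ _ => sw (t, x)).
by have /= := H 0%N; apply.
Qed.

Lemma cylinder_sweeps F L L' : cylinder F L L' -> exists I, sweeps L L' I.
Proof.
move=> cF; have [sF _ _ _] := cF.
have H a : {T : R -> R | is_form a -> forall s : R, is_derive s 1 T (slice_area a F s)}.
  apply: cid; have [fa|nfa] := pselect (is_form a); last by exists (fun=> 0).
  by have [T HT] := exists_primitive (slice_area_cont fa sF); exists T.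
exists (fun a => sval (H a) 1 - sval (H a) 0), F; split=> // a fa.
by exists (sval (H a)); split=> //; exact: (svalP (H a)).
Qed.

Lemma density2E a F p c : is_form a -> (forall p, msmooth_at F p) -> atlas c ->
  chart_dom c (F p) -> density a F p = a c (c (F p))
    (col_mx ('D_((1, 0) : R^o * R^o) (fun q => c (F q)) p)
            ('D_((0, 1) : R^o * R^o) (fun q => c (F q)) p)).
Proof.
move=> fa sF ac cp; rewrite /density (mpullE _ fa ac cp (sF p)); congr (a c _ _).
by rewrite [LHS]mx2_rows !rowK.
Qed.

Lemma density_near a F F' p : is_form a -> (forall p, msmooth_at F p) ->
  (forall p, msmooth_at F' p) ->
  (\near p, F p = F' p) -> density a F p = density a F' p.
Proof.
move=> fa sF sF' E; have E0 := nbhs_singleton E.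
have ac := chart_at_atlas (F p); have cp := chart_at_dom (F p).
have cp' : chart_dom (chart_at (F p)) (F' p) by rewrite -E0.
rewrite (density2E fa sF ac cp) (density2E fa sF' ac cp') -E0.
have D (v : R^o * R^o) : 'D_v (fun q => chart_at (F p) (F q)) p =
    'D_v (fun q => chart_at (F p) (F' q)) p.
  by apply: near_eq_derive; apply: filterS E => q ->.
by rewrite (D (1, 0)) (D (0, 1)).
Qed.

Lemma derive_dirZ (V W : normedModType R) (f : V -> W) x v (k : R) :
  differentiable f x -> 'D_(k *: v) f x = k *: 'D_v f x.
Proof. by move=> df; rewrite !deriveE// linearZ. Qed.

Lemma smooth_fst (p : R^o * R^o) : smooth_at (fun q : R^o * R^o => q.1) p.
Proof.
apply: (@smooth_at_linear _ _ _ _ (@fst R^o R^o : {linear (R^o * R^o)%type -> R^o})) => //.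
  by move=> q; exact: cvg_fst.
exact: smooth_at_id.
Qed.

Lemma smooth_snd (p : R^o * R^o) : smooth_at (fun q : R^o * R^o => q.2) p.
Proof.
apply: (@smooth_at_linear _ _ _ _ (@snd R^o R^o : {linear (R^o * R^o)%type -> R^o})) => //.
  by move=> q; exact: cvg_snd.
exact: smooth_at_id.
Qed.

Lemma derive_fst (p v : R^o * R^o) : 'D_v (fun q : R^o * R^o => q.1) p = v.1.
Proof.
apply: etrans (@derive_linear _ _ _ _ (@fst R^o R^o : {linear (R^o * R^o)%type -> R^o}) (fun q => q) p v _ _) _.
- by move=> q; exact: cvg_fst.
- exact: smooth_at_differentiable (smooth_at_id _).
- by rewrite derive_id.
Qed.

Lemma derive_snd (p v : R^o * R^o) : 'D_v (fun q : R^o * R^o => q.2) p = v.2.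
Proof.
apply: etrans (@derive_linear _ _ _ _ (@snd R^o R^o : {linear (R^o * R^o)%type -> R^o}) (fun q => q) p v _ _) _.
- by move=> q; exact: cvg_snd.
- exact: smooth_at_differentiable (smooth_at_id _).
- by rewrite derive_id.
Qed.

Definition affine_pt (k l : R) (p : R^o * R^o) : R^o * R^o := ((k * p.1 + l : R), p.2).

Lemma affine_pt_smooth k l p : smooth_at (affine_pt k l) p.
Proof.
apply: smooth_at_pair; last exact: smooth_snd.
apply: smooth_atD; last exact: smooth_at_cst.
by apply: smooth_atM; [exact: smooth_at_cst|exact: smooth_fst].
Qed.

Lemma derive_affine_pt k l p (v : R^o * R^o) : 'D_v (affine_pt k l) p = ((k * v.1 : R), v.2).
Proof.
have s1 : smooth_at (fun q : R^o * R^o => k * q.1 : R^o) p.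
  by apply: smooth_atM; [exact: smooth_at_cst|exact: smooth_fst].
rewrite derive_pair; last 2 first.
- apply: smooth_at_differentiable; apply: smooth_atD => //; exact: smooth_at_cst.
- exact: smooth_at_differentiable (smooth_snd _).
congr pair; last exact: derive_snd.
rewrite deriveD; [|exact: smooth_at_derivable|exact: derivable_cst].
rewrite derive_cst addr0.
have [_ ->] := diff_scale (differentiable_cst k p) (smooth_at_differentiable (smooth_fst p)).
by rewrite derive_cst derive_fst scale0r add0r.
Qed.

Lemma msmooth_affine F k l : (forall p, msmooth_at F p) ->
  forall p, msmooth_at (fun p => F (affine_pt k l p)) p.
Proof.
move=> sF p; apply: (@msmooth_at_comp _ _ _ _ _ (affine_pt k l) F).
- exact: fin_dim_R2.
- exact: affine_pt_smooth.
- exact: sF.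
Qed.

Lemma density_affine a F (k l : R) p : is_form a -> (forall p, msmooth_at F p) ->
  density a (fun p => F (affine_pt k l p)) p = k * density a F (affine_pt k l p).
Proof.
move=> fa sF; set q := affine_pt k l p; set c := chart_at (F q).
have ac : atlas c := chart_at_atlas (F q); have cq : chart_dom c (F q) := chart_at_dom (F q).
have cy := chart_funP cq.
have sc : smooth_at (fun q => c (F q)) q by exact: (sF q).2.
have dc := smooth_at_differentiable sc.
have D (v : R^o * R^o) : 'D_v (fun p => c (F (affine_pt k l p))) p =
    'D_((k * v.1 : R), v.2) (fun q => c (F q)) q.
  rewrite (@derive_comp _ _ _ _ (fun q => c (F q)) (affine_pt k l)) ?derive_affine_pt//.
  exact: smooth_at_differentiable (affine_pt_smooth _ _ _).
rewrite (density2E fa (msmooth_affine k l sF) ac)// (density2E fa sF ac)//.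
rewrite (D (1, 0)) (D (0, 1)) /= mulr0 mulr1.
have -> : ((k, 0) : R^o * R^o) = k *: ((1, 0) : R^o * R^o).
  by rewrite -[RHS]/(_, _) /= scaler0 -[k *: 1]/(k * 1) mulr1.
by rewrite derive_dirZ// (bilinear_Zl (form_multilinear fa ac cy)).
Qed.

Lemma slice_area_affine a F k l s : is_form a -> (forall p, msmooth_at F p) ->
  slice_area a (fun p => F (affine_pt k l p)) s = k * slice_area a F (k * s + l).
Proof.
move=> fa sF; rewrite /slice_area -pintZ; last first.
  move=> b _; apply: (@smooth_at_continuous _ R _ (fun b : R => density a F (k * s + l, b))).
  apply: (@smooth_at_comp _ _ _ _ (fun b : R => ((k * s + l : R), b) : R^o * R^o)).
  - exact: fin_dim_R2.
  - by apply: smooth_at_pair; [exact: smooth_at_cst|exact: smooth_at_id].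
  - exact: density_smooth.
by apply: eq_pint => b _; rewrite density_affine.
Qed.

Lemma near_fst (s b : R) (P : R -> Prop) : (\forall u \near s, P u) ->
  nbhs ((s, b) : R^o * R^o) [set q : R^o * R^o | P q.1].
Proof.
move=> H; have c1 : ((q.1 : R) @[q --> ((s, b) : R^o * R^o)]) --> s by exact: cvg_fst.
exact: (c1 [set u | P u] H).
Qed.

Lemma slice_area_near a F F' (s : R) : is_form a -> (forall p, msmooth_at F p) ->
  (forall p, msmooth_at F' p) ->
  (\forall u \near s, forall b : R, F (u, b) = F' (u, b)) -> slice_area a F s = slice_area a F' s.
Proof.
move=> fa sF sF' E; apply: eq_pint => b _; apply: density_near => //.
by have := near_fst b E; apply: filterS => -[u v] /= H; exact: H.
Qed.

(** Near s the map agrees with its composite with an affine map of slope 0, and slope k multiplies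
    slice areas by k. *)
Lemma slice_area_cst a F (L : R -> M) s : is_form a -> (forall p, msmooth_at F p) ->
  (\forall u \near s, forall b : R, F (u, b) = L b) -> slice_area a F s = 0.
Proof.
move=> fa sF E.
have E2 : \forall u \near s, forall b : R, F (u, b) = F (affine_pt 0 s (u, b)).
  by have Es := nbhs_singleton E; apply: filterS E => u Hu b; rewrite /affine_pt /= mul0r add0r Hu Es.
rewrite (slice_area_near fa sF (msmooth_affine 0 s sF) E2).
by rewrite slice_area_affine// mul0r.
Qed.

Lemma sweeps_rev L L' I : sweeps L L' I -> sweeps L' L (fun a => - I a).
Proof.
move=> [F [[sF pF F0 F1] HF]].
exists (fun p => F (affine_pt (-1) 1 p)); split.
  split.
  - exact: msmooth_affine.
  - by move=> s b; rewrite /affine_pt /= pF.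
  - by move=> s b sb; rewrite /affine_pt /= F1//; lra.
  - by move=> s b sb; rewrite /affine_pt /= F0//; lra.
move=> a fa; have [T [dT IT]] := HF a fa.
exists (fun s => T (-1 * s + 1)); split; last first.
  have -> : -1 * 1 + 1 = 0 :> R by ring.
  have -> : -1 * 0 + 1 = 1 :> R by ring.
  by rewrite IT opprB.
move=> s; rewrite slice_area_affine//.
have d1 : is_derive s 1 (fun s : R => -1 * s + 1) (-1).
  have := is_deriveD (is_deriveZ (-1) (is_derive_id s 1)) (is_derive_cst (1 : R) s 1).
  by rewrite addr0 /GRing.scale /= mulr1.
by have := is_derive1_comp (dT _) d1; rewrite mulrC.
Qed.

Lemma sweeps_cat L L' L'' I I' : sweeps L L' I -> sweeps L' L'' I' ->
  sweeps L L'' (fun a => I a + I' a).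
Proof.
move=> [F [[sF pF F0 F1] HF]] [F' [[sF' pF' F0' F1'] HF']].
(* With slope 4, both formulas give the loop L' for 7/16 < s < 9/16, so the pieces agree around the
   cut at 1/2; for s <= 1/4 and s >= 3/4 they have already reached L and L''. *)
pose F2 (p : R^o * R^o) := if (p.1 : R) <= 1 / 2 then F (affine_pt 4 (-1) p)
  else F' (affine_pt 4 (-2) p).
have lo (s : R) : s < 5 / 8 - 1 / 16 -> \forall u \near s, forall b : R, F2 (u, b) = F (affine_pt 4 (-1) (u, b)).
  move=> s0; near=> u => b; rewrite /F2 /=; case: ifPn => //; rewrite -ltNge => u2.
  have u3 : u < 5 / 8 - 1 / 16 by near: u; exact: lt_nbhsl.
  by rewrite /affine_pt /= F0' ?F1//; lra.
have hi (s : R) : 1 / 2 - 1 / 16 < s -> \forall u \near s, forall b : R, F2 (u, b) = F' (affine_pt 4 (-2) (u, b)).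
  move=> s0; near=> u => b; rewrite /F2 /=; case: ifPn => // u2.
  have u3 : 1 / 2 - 1 / 16 < u by near: u; exact: lt_nbhsr.
  by rewrite /affine_pt /= F0' ?F1//; lra.
have lift_near (s b : R) (P : R^o * R^o -> Prop) : (\forall u \near s, forall b : R, P (u, b)) ->
    \forall p \near ((s, b) : R^o * R^o), P p.
  by move=> H; have := near_fst b H; apply: filterS => -[u v] /= H'; exact: H'.
have cases (s : R) : s < 5 / 8 - 1 / 16 \/ 1 / 2 - 1 / 16 < s.
  by case: (ltP s (1 / 2)) => ?; [left|right]; lra.
have sF2 p : msmooth_at F2 p.
  case: p => s b; case: (cases s) => s0.
    have H := lift_near s b (fun q => F2 q = F (affine_pt 4 (-1) q)) (lo s s0).
    apply: msmooth_at_near (msmooth_affine 4 (-1) sF (s, b)).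
    by apply: filterS H => q ->.
  have H := lift_near s b (fun q => F2 q = F' (affine_pt 4 (-2) q)) (hi s s0).
  apply: msmooth_at_near (msmooth_affine 4 (-2) sF' (s, b)).
  by apply: filterS H => q ->.
exists F2; split.
  split=> //.
  - by move=> s b; rewrite /F2 /affine_pt /= pF pF'.
  - by move=> s b s4; rewrite /F2 /affine_pt /= ifT ?F0//; lra.
  - by move=> s b s4; rewrite /F2 /affine_pt /= ifF ?F1'//; lra.
move=> a fa; have [T [dT ->]] := HF a fa; have [T' [dT' ->]] := HF' a fa.
have cst_on (U : R -> R) (x y : R) : (forall z, Num.min x y <= z <= Num.max x y -> is_derive z 1 U 0) -> U x = U y.
  move=> H; have [xy|yx] := leP x y.
    by apply/esym; apply: is_derive_zero_cst => // z Hz; apply: H; rewrite min_l ?max_r.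
  apply: is_derive_zero_cst; first exact: ltW.
  by move=> z Hz; apply: H; rewrite (min_r (ltW yx)) (max_l (ltW yx)).
have Tc u : 3 / 4 < u -> T u = T 1.
  move=> u3; apply: cst_on => z; rewrite ge_min le_max => /andP[z1 _].
  have z3 : 3 / 4 < z by move: z1 => /orP[]; lra.
  rewrite -(@slice_area_cst a F L' z fa sF)//.
  by near=> v => b; apply: F1; apply/ltW; near: v; exact: lt_nbhsr.
have Tc' u : u < 1 / 4 -> T' u = T' 0.
  move=> u3; apply: cst_on => z; rewrite ge_min le_max => /andP[_ z1].
  have z3 : z < 1 / 4 by move: z1 => /orP[]; lra.
  rewrite -(@slice_area_cst a F' L' z fa sF')//.
  by near=> v => b; apply: F0'; apply/ltW; near: v; exact: lt_nbhsl.
(* The added constant matches the two primitives near 1/2, where both are locally constant. *)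
pose T2 (s : R) := if s <= 1 / 2 then T (4 * s + -1) else T' (4 * s + -2) + (T 1 - T' 0).
have aff (k l z : R) : is_derive z 1 (fun z : R => k * z + l) k.
  have := is_deriveD (is_deriveZ k (is_derive_id z 1)) (is_derive_cst (l : R) z 1).
  by rewrite addr0 /GRing.scale /= mulr1.
exists T2; split; last first.
  rewrite /T2 ifF; last by apply/negbTE; rewrite -ltNge; lra.
  rewrite ifT; last lra.
  have E1 : T (4 * 0 + -1) = T 0.
    apply: cst_on => z; rewrite ge_min le_max => /andP[_ z1].
    have z3 : z < 1 / 4 by move: z1 => /orP[]; lra.
    rewrite -(@slice_area_cst a F L z fa sF)//.
    by near=> v => b; apply: F0; apply/ltW; near: v; exact: lt_nbhsl.
  have E2 : T' (4 * 1 + -2) = T' 1.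
    apply: cst_on => z; rewrite ge_min le_max => /andP[z1 _].
    have z3 : 3 / 4 < z by move: z1 => /orP[]; lra.
    rewrite -(@slice_area_cst a F' L'' z fa sF')//.
    by near=> v => b; apply: F1'; apply/ltW; near: v; exact: lt_nbhsr.
  by rewrite E1 E2; ring.
move=> s; case: (cases s) => s0.
  rewrite (slice_area_near fa sF2 (msmooth_affine 4 (-1) sF) (lo s s0)) slice_area_affine// mulrC.
  have H := is_derive1_comp (dT _) (aff 4 (-1) s).
  apply: (near_eq_is_derive _ H).
  near=> u; rewrite /T2 /=; case: ifPn => //; rewrite -ltNge => u2.
  have u3 : u < 5 / 8 - 1 / 16 by near: u; exact: lt_nbhsl.
  by rewrite Tc' ?Tc; lra.
rewrite (slice_area_near fa sF2 (msmooth_affine 4 (-2) sF') (hi s s0)) slice_area_affine// mulrC.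
have H := is_deriveD (is_derive1_comp (dT' _) (aff 4 (-2) s)) (is_derive_cst (T 1 - T' 0) s 1).
rewrite addr0 in H; apply: (near_eq_is_derive _ H).
near=> u; rewrite /T2 /=; case: ifPn => // u2.
have u3 : 1 / 2 - 1 / 16 < u by near: u; exact: lt_nbhsr.
by rewrite !fctE /= Tc' ?[RHS]Tc; lra.
Unshelve. all: by end_near. Qed.

End Cylinders.

Section Cubes.
Context {R : realType} {m : nat} {M : manifold R m}.
Implicit Types (c : chart R m M) (y : 'rV[R]_m) (r : R).

(* [ball] refers to the sup norm of ['rV_m]. *)
Definition cube c y r : set M := [set x | chart_dom c x /\ ball y r (c x)].

Lemma ball_rVP y r z : 0 < r -> (ball y r z <-> forall j, `|y 0 j - z 0 j| < r).
Proof.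
move=> r0; rewrite -[ball y r z]/(0 < r /\ forall i j, ball (y i j) r (z i j)).
split=> [[_ H] j|H]; first exact: H.
by split=> // i j; rewrite (ord1 i); exact: H.
Qed.

Definition box y r : set 'rV[R]_m := [set z | forall j, `|y 0 j - z 0 j| <= r].

Lemma box_ball y r r' : 0 < r' -> r < r' -> box y r `<=` ball y r'.
Proof. by move=> r0 rr' z H; apply/ball_rVP => // j; exact: le_lt_trans (H j) rr'. Qed.

Lemma ball_box y r : ball y r `<=` box y r.
Proof. by move=> z [r0 H] j; rewrite ltW//; exact: H. Qed.

Lemma box_compact y r : compact (box y r).
Proof.
have seg (i : 'I_m) : compact [set` `[y 0 i - r, y 0 i + r]] by exact: segment_compact.
have := @rV_compact R m (fun i => [set` `[y 0 i - r, y 0 i + r]]) seg.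
congr (compact _); apply/seteqP; split=> v /= H i; have := H i;
  by rewrite in_itv /= ler_distlC.
Qed.

Lemma ball_convex (y p q : 'rV[R]_m) (r t : R) : ball y r p -> ball y r q -> 0 <= t <= 1 ->
  ball y r (p + t *: (q - p)).
Proof.
rewrite -!ball_normE /= => yp yq /andP[t0 t1].
have -> : y - (p + t *: (q - p)) = (1 - t) *: (y - p) + t *: (y - q).
  by apply/rowP => j; rewrite !mxE; ring.
apply: (le_lt_trans (ler_normD _ _)); rewrite !normrZ !ger0_norm ?subr_ge0//.
have [->|tn0] := eqVneq t 0; first by rewrite subr0 mul1r mul0r addr0.
have t0' : 0 < t by rewrite lt_neqAle eq_sym tn0.
have : t * `|y - q| < t * r by rewrite ltr_pM2l.
have : (1 - t) * `|y - p| <= (1 - t) * r by rewrite ler_wpM2l ?subr_ge0// ltW.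
lra.
Qed.

Lemma cube_open c y r : open (cube c y r).
Proof.
rewrite openE => x [cx bx]; apply: filterI.
  by apply: open_nbhs_nbhs; split=> //; exact: chart_dom_open.
have n : nbhs (c x) (ball y r) by apply: open_nbhs_nbhs; split=> //; exact: ball_open.
exact: (chart_fun_cont cx n).
Qed.

Lemma cube_inv c y r z : ball y r `<=` chart_img c -> ball y r z -> cube c y r (chart_inv c z).
Proof.
move=> yr bz; split; first by apply: chart_invP; exact: yr.
by rewrite chart_invK//; exact: yr.
Qed.

Lemma cube_le c y r r' : r <= r' -> cube c y r `<=` cube c y r'.
Proof. by move=> rr' x [cx bx]; split=> //; exact: le_ball bx. Qed.

Lemma small_cube c x (N : set M) : chart_dom c x -> nbhs x N ->
  exists2 r, 0 < r & ball (c x) r `<=` chart_img c /\ cube c (c x) r `<=` N.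
Proof.
move=> cx Nx.
have n1 : nbhs (c x) (chart_img c).
  by apply: open_nbhs_nbhs; split; [exact: chart_img_open|exact: chart_funP].
have n2 : nbhs (c x) [set z | N (chart_inv c z)].
  have := chart_inv_cont (chart_funP cx); rewrite /prop_for /continuous_at chart_funK//.
  by move=> /(_ _ Nx).
have /nbhs_ballP[r /= r0 Hr] : nbhs (c x) (chart_img c `&` [set z | N (chart_inv c z)]).
  exact: filterI.
exists r => //; split=> [z /Hr[]//|z [cz bz]].
by have [_ /=] := Hr _ bz; rewrite chart_funK.
Qed.

Definition closed_cube c y r : set M := [set x | chart_dom c x /\ box y r (c x)].

Lemma closed_cube_compact c y r : box y r `<=` chart_img c -> compact (closed_cube c y r).
Proof.
move=> yr.
have -> : closed_cube c y r = chart_inv c @` box y r.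
  apply/seteqP; split=> x /=.
    by move=> [cx bx]; exists (c x) => //; exact: chart_funK.
  move=> [z bz <-]; have cz := yr _ bz.
  by split; [exact: chart_invP|rewrite chart_invK].
apply: continuous_compact; last exact: box_compact.
apply: continuous_in_subspaceT => z; rewrite inE => /yr cz.
exact: chart_inv_cont.
Qed.

Lemma closed_cube_closed c y r : box y r `<=` chart_img c -> closed (closed_cube c y r).
Proof.
move=> yr; apply: compact_closed; first exact: manifold_hausdorff.
exact: closed_cube_compact.
Qed.

End Cubes.

Section FiniteCover.

(** Compactness in its near-covering form is applied to the filter of finite lists directed by
    inclusion. Membership is [List.In] because the index type I carries no decidable equality. *)
Lemma compact_finite_cover (T : topologicalType) (A : set T) (I : Type) (f : I -> set T) :
  compact A -> (forall x, A x -> exists i, nbhs x (f i)) ->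
  exists s : seq I, forall x, A x -> exists2 i, List.In i s & f i x.
Proof.
move=> /compact_near_coveringP cA Hf.
pose F : set_system (seq I) := [set P | exists s0, forall s, (forall i, List.In i s0 -> List.In i s) -> P s].
have FF : Filter F.
  split.
  - by exists [::].
  - move=> P Q [sP HP] [sQ HQ]; exists (sP ++ sQ) => s Hs; split.
      by apply: HP => i ip; apply: Hs; apply/List.in_or_app; left.
    by apply: HQ => i ip; apply: Hs; apply/List.in_or_app; right.
  - by move=> P Q PQ [s0 H]; exists s0 => s /H; exact: PQ.
have [x Ax|s0 H] := cA _ F (fun s x => exists2 i, List.In i s & f i x) FF.
  have [i fi] := Hf x Ax.
  exists (f i, [set s | List.In i s]).
    by split => //=; exists [:: i] => s; apply; left.
  by move=> [x' s] [/= fx' si]; exists i.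
by exists s0 => x Ax; apply: H.
Qed.

Lemma filter_In (T : Type) (F : set_system T) (I : Type) (s : seq I) (P : I -> set T) :
  Filter F -> (forall i, List.In i s -> F (P i)) -> F [set z | forall i, List.In i s -> P i z].
Proof.
move=> FF; elim: s => [|i s IH] H; first by apply: filterE => z i [].
apply: (@filterS _ F FF) (@filterI _ F FF _ _ (H i (or_introl erefl)) (IH (fun j js => H j (or_intror js)))).
by move=> z [Pi Ps] j [<-//|js]; exact: Ps.
Qed.

End FiniteCover.

(** * Smoothing of null-homotopies *)

Section Angles.
Context {R : realType}.

Lemma smooth_of_derive (f g : R -> R) : (forall x : R, is_derive x 1 f (g x)) ->
  (forall x : R, smooth_at g x) -> forall x : R, smooth_at f x.
Proof.
move=> df sg x; apply: (smooth_on_at (U := setT)) => //; first exact: openT.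
case=> [|k] /=.
  by move=> y _; apply: differentiable_continuous; apply/derivable1_diffP; apply: ex_derive.
split=> [y _|v]; first by apply/derivable1_diffP; apply: ex_derive.
have -> : 'D_v f = (fun y => v * g y).
  apply/funext => y; have -> : v = v *: (1 : R^o) by rewrite -[RHS]/(v * 1) mulr1.
  rewrite derive_dirZ; last by apply/derivable1_diffP; apply: ex_derive.
  by rewrite (@derive_val _ _ _ _ _ _ _ (df y)) -[v *: 1]/(v * 1) mulr1.
have sk : smooth_on setT (fun y : R => v * g y).
  apply/smooth_onP => [|y _]; first exact: openT.
  by apply: smooth_atM; [exact: smooth_at_cst|exact: sg].
exact: sk.
Qed.

Lemma sin_cos_Ck k : Ck_on k setT (@sin R) /\ Ck_on k setT (@cos R).
Proof.
elim: k => [|k [Hs Hc]] /=.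
  by split=> y _; [exact: continuous_sin|exact: continuous_cos].
have dirE (f : R -> R) v (y : R) : derivable f y 1 -> 'D_v f y = v * 'D_1 f y.
  move=> df; have {1}-> : v = v *: (1 : R^o) by rewrite -[RHS]/(v * 1) mulr1.
  by rewrite derive_dirZ//; apply/derivable1_diffP.
split; (split=> [y _|v]).
- by apply/derivable1_diffP; exact: derivable_sin.
- have -> : 'D_v (@sin R) = (fun y => v *: cos y).
    by apply/funext => y; rewrite dirE ?derive_val//; exact: derivable_sin.
  by apply: Ck_onZ => //; [exact: openT|exact: Ck_on_cst].
- by apply/derivable1_diffP; exact: derivable_cos.
- have -> : 'D_v (@cos R) = (fun y => (- v) *: sin y).
    by apply/funext => y; rewrite dirE ?derive_val ?mulrN ?scaleNr//; exact: derivable_cos.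
  by apply: Ck_onZ => //; [exact: openT|exact: Ck_on_cst].
Qed.

Lemma sin_smooth (x : R) : smooth_at (@sin R) x.
Proof. by apply: (smooth_on_at (U := setT)) => // [|k]; [exact: openT|exact: (sin_cos_Ck k).1]. Qed.

Lemma cos_smooth (x : R) : smooth_at (@cos R) x.
Proof. by apply: (smooth_on_at (U := setT)) => // [|k]; [exact: openT|exact: (sin_cos_Ck k).2]. Qed.

Lemma atan_smooth (x : R) : smooth_at (@atan R) x.
Proof.
apply: (@smooth_of_derive (@atan R) (fun x : R => (1 + x ^+ 2)^-1)) => y.
apply: smooth_at_inv; first by rewrite lt0r_neq0// ltr_pwDl// sqr_ge0.
apply: smooth_atD; first exact: smooth_at_cst.
by rewrite /=; apply: smooth_atM; exact: smooth_at_id.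
Qed.

Lemma period_int (T : Type) (f : R -> T) (p : R) : (forall b, f (b + p) = f b) ->
  forall (k : int) b, f (b + k%:~R * p) = f b.
Proof.
move=> fp; have N n b : f (b + n%:R * p) = f b.
  elim: n => [|n IH]; first by rewrite mul0r addr0.
  by rewrite -addn1 natrD mulrDl mul1r addrA fp.
case=> n b; first exact: N.
by rewrite NegzE mulrNz mulNr -(N n.+1) subrK.
Qed.

(** The difference is reduced modulo 2 pi to [-pi, pi], where a cosine equal to 1 forces it to be 0
    by injectivity of the cosine on [0, pi]. *)
Lemma angle_mod (a b : R) : cos a = cos b -> sin a = sin b ->
  exists k : int, a = b + k%:~R * (2 * pi).
Proof.
move=> ca sa; pose d := a - b.
have p0 : 0 < 2 * pi :> R by rewrite mulr_gt0// pi_gt0.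
have cd : cos d = 1 by rewrite /d cosB ca sa -!expr2 cos2Dsin2.
pose k := Num.floor ((d + pi) / (2 * pi)); exists k.
pose d' := d - k%:~R * (2 * pi).
have cd' : cos d' = 1.
  rewrite -cd /d' -mulNr -mulrNz; apply: period_int => x.
  by rewrite (_ : 2 * pi = pi *+ 2) ?cosD2pi// mulr_natl.
have /andP[k1 k2] : (k%:~R : R) <= (d + pi) / (2 * pi) < (k%:~R : R) + 1.
  by have := Num.Theory.floor_itv ((d + pi) / (2 * pi)); rewrite intrD.
rewrite ler_pdivlMr// in k1; rewrite ltr_pdivrMr// in k2.
have d'0 : `|d'| = 0.
  have pi0 := pi_ge0 R.
  apply: cos_inj; rewrite ?in_itv /= ?lexx ?pi_ge0 ?normr_ge0//= ?cos_norm ?cos0//.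
  by rewrite ler_norml /d'; apply/andP; split; lra.
by move/eqP: d'0; rewrite normr_eq0 subr_eq0 => /eqP; rewrite /d => E; rewrite -E addrC subrK.
Qed.

(** Away from the origin this determines t up to multiples of 2 pi, see [polar_mod]; a periodic
    function may thus be evaluated at any such angle. *)
Definition polar (x y t : R) :=
  x = Num.sqrt (x ^+ 2 + y ^+ 2) * cos t /\ y = Num.sqrt (x ^+ 2 + y ^+ 2) * sin t.

(** A global determination of the angle, discontinuous along the negative half axis. It is only fed
    to periodic functions, where [branch] can replace it locally. *)
Definition ang (x y : R) :=
  let c := acos (x / Num.sqrt (x ^+ 2 + y ^+ 2)) in if 0 <= y then c else - c.

Lemma polar_ang (x y : R) : 0 < x ^+ 2 + y ^+ 2 -> polar x y (ang x y).
Proof.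
move=> w0; set w := x ^+ 2 + y ^+ 2 in w0 *.
have r0 : 0 < Num.sqrt w by rewrite sqrtr_gt0.
have r2 : Num.sqrt w ^+ 2 = w by rewrite sqr_sqrtr// ltW.
have E : 1 - (x / Num.sqrt w) ^+ 2 = (y / Num.sqrt w) ^+ 2.
  rewrite !expr_div_n r2; apply: (@mulfI _ w); first by rewrite gt_eqF.
  by rewrite mulrBr mulr1 ![w * (_ / _)]mulrC !divfK ?gt_eqF//; rewrite /w; ring.
have c1 : -1 <= x / Num.sqrt w <= 1.
  rewrite -ler_norml -(@ler_sqr _ _ 1) ?nnegrE// expr1n real_normK ?num_real//.
  by rewrite -subr_ge0 E sqr_ge0.
have s1 : sin (acos (x / Num.sqrt w)) = `|y| / Num.sqrt w.
  by rewrite sin_acos// E sqrtr_sqr normf_div (gtr0_norm r0).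
have c2 : cos (acos (x / Num.sqrt w)) = x / Num.sqrt w by rewrite acosK// in_itv.
rewrite /polar /ang -/w; case: ifPn => [y0|]; last rewrite -ltNge => y0.
  by rewrite s1 c2 (ger0_norm y0) !mulrA ![Num.sqrt w * _]mulrC !mulfK// gt_eqF.
by rewrite cosN sinN s1 c2 (ltr0_norm y0) mulNr opprK !mulrA ![Num.sqrt w * _]mulrC !mulfK// gt_eqF.
Qed.

Lemma polar_mod (x y a b : R) : 0 < x ^+ 2 + y ^+ 2 -> polar x y a -> polar x y b ->
  exists k : int, a = b + k%:~R * (2 * pi).
Proof.
move=> w0 [xa ya] [xb yb].
have r0 : Num.sqrt (x ^+ 2 + y ^+ 2) != 0 by rewrite gt_eqF// sqrtr_gt0.
by apply: angle_mod; apply: (mulfI r0); rewrite -?xa -?ya.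
Qed.

Lemma polar_cos_sin (r t : R) : 0 <= r -> polar (r * cos t) (r * sin t) t.
Proof.
move=> r0; rewrite /polar !exprMn -mulrDr cos2Dsin2 mulr1 sqrtr_sqr ger0_norm//.
Qed.

(* A smooth determination of the angle near [(x0, y0)]. *)
Definition branch (x0 y0 x y : R) :=
  ang x0 y0 + atan ((x0 * y - y0 * x) / (x0 * x + y0 * y)).

(** The quotient of the cross product by the dot product is the tangent of the angle from (x0, y0)
    to (x, y); a positive dot product keeps that angle in the range of [atan]. *)
Lemma polar_branch (x0 y0 x y : R) : 0 < x0 ^+ 2 + y0 ^+ 2 -> 0 < x0 * x + y0 * y ->
  polar x y (branch x0 y0 x y).
Proof.
move=> w0 d0; have [c0 s0] := polar_ang w0.
set r0 : R := Num.sqrt (x0 ^+ 2 + y0 ^+ 2) in c0 s0.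
have r00 : 0 < r0 by rewrite sqrtr_gt0.
have r02 : r0 ^+ 2 = x0 ^+ 2 + y0 ^+ 2 by rewrite sqr_sqrtr// ltW.
set r : R := Num.sqrt (x ^+ 2 + y ^+ 2).
have w1 : 0 <= x ^+ 2 + y ^+ 2 by rewrite addr_ge0// sqr_ge0.
have r2 : r ^+ 2 = x ^+ 2 + y ^+ 2 by rewrite sqr_sqrtr.
have r1 : 0 < r.
  rewrite sqrtr_gt0 lt_neqAle w1 andbT; apply/eqP => /esym/eqP.
  rewrite paddr_eq0 ?sqr_ge0// !sqrf_eq0 => /andP[/eqP x0' /eqP y0'].
  by move: d0; rewrite x0' y0' !mulr0 addr0 ltxx.
rewrite /branch; set d := x0 * x + y0 * y in d0 *; set t := _ / d.
have ct : cos (atan t) = d / (r0 * r).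
  rewrite cos_atan; have -> : 1 + t ^+ 2 = ((r0 * r) / d) ^+ 2.
    have E : d ^+ 2 + (x0 * y - y0 * x) ^+ 2 = r0 ^+ 2 * r ^+ 2 by rewrite r02 r2 /d; ring.
    transitivity ((d ^+ 2 + (x0 * y - y0 * x) ^+ 2) / d ^+ 2).
      by rewrite /t; field; rewrite gt_eqF.
    by rewrite E; field; rewrite gt_eqF.
  by rewrite sqrtr_sqr ger0_norm ?invf_div// divr_ge0 ?mulr_ge0// ltW.
have st : sin (atan t) = t * cos (atan t).
  have H := atanK t; rewrite /tan in H; rewrite -{2}H divfK//.
  by rewrite ct mulf_neq0 ?invr_eq0 ?mulf_neq0 ?gt_eqF.
have c0' : cos (ang x0 y0) = x0 / r0 by rewrite {2}c0 mulrAC divff ?mul1r// gt_eqF.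
have s0' : sin (ang x0 y0) = y0 / r0 by rewrite {2}s0 mulrAC divff ?mul1r// gt_eqF.
rewrite /polar -/r cosD sinD st ct c0' s0' /t.
have dn : d != 0 by rewrite gt_eqF.
have rn : r != 0 by rewrite gt_eqF.
have r0n : r0 != 0 by rewrite gt_eqF.
split.
  apply: (@mulfI _ (r0 ^+ 2)); first by rewrite expf_neq0.
  rewrite [LHS](_ : _ = (x0 ^+ 2 + y0 ^+ 2) * x); last by rewrite r02.
  transitivity (x0 * d - y0 * (x0 * y - y0 * x)); first by rewrite /d; ring.
  by field; rewrite r0n rn.
apply: (@mulfI _ (r0 ^+ 2)); first by rewrite expf_neq0.
rewrite [LHS](_ : _ = (x0 ^+ 2 + y0 ^+ 2) * y); last by rewrite r02.
transitivity (y0 * d + x0 * (x0 * y - y0 * x)); first by rewrite /d; ring.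
by field; rewrite r0n rn.
Qed.

Lemma branch_smooth (V : normedModType R) (f g : V -> R) p x0 y0 :
  smooth_at f p -> smooth_at g p -> 0 < x0 * f p + y0 * g p ->
  smooth_at (fun q => branch x0 y0 (f q) (g q)) p.
Proof.
move=> sf sg d0; have sc (a : R) (h : V -> R) : smooth_at h p -> smooth_at (fun q => a * h q) p.
  by move=> sh; apply: smooth_atM => //; exact: smooth_at_cst.
apply: smooth_atD; first exact: smooth_at_cst.
apply: (@smooth_at_comp _ _ _ _ (fun q => (x0 * g q - y0 * f q) / (x0 * f q + y0 * g q))).
- exact: fin_dim_scalar.
- apply: smooth_atM; first by apply: smooth_atB; exact: sc.
  by apply: smooth_at_inv; [rewrite gt_eqF|apply: smooth_atD; exact: sc].
- exact: atan_smooth.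
Qed.

End Angles.

Section Plane.
Context {R : realType}.
Notation P2 := (R^o * R^o)%type.

Lemma norm_pair (p : P2) : `|p| = Num.max (`|p.1| : R) `|p.2|.
Proof. by []. Qed.

Lemma plane_compact (a b c d : R) : compact [set p : P2 | (a <= p.1 <= b) /\ (c <= p.2 <= d)].
Proof.
have := compact_setX (@segment_compact R a b) (@segment_compact R c d).
congr (compact _); apply/seteqP; split=> -[x y] /=; by rewrite !in_itv.
Qed.

Definition hat (x : R) : R := step (2 - x) * step (2 + x).

Lemma hat_smooth x : smooth_at hat x.
Proof.
have s2 (s : R) : smooth_at (fun x : R => step (2 + s * x)) x.
  apply: (@smooth_at_comp _ _ _ _ (fun x : R => 2 + s * x)).
  - exact: fin_dim_scalar.
  - apply: smooth_atD; first exact: smooth_at_cst.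
    by apply: smooth_atM; [exact: smooth_at_cst|exact: smooth_at_id].
  - exact: step_smooth.
have := smooth_atM (s2 (-1)) (s2 1); apply: smooth_at_near.
by apply: filterE => y; rewrite mulN1r mul1r.
Qed.

Lemma hat_ge0 x : 0 <= hat x.
Proof. by rewrite mulr_ge0// step_ge0. Qed.

Lemma hat_le1 x : hat x <= 1.
Proof. by rewrite mulr_ile1 ?step_ge0 ?step_le1. Qed.

Lemma hat_eq1 x : `|x| <= 1 -> hat x = 1.
Proof. by rewrite ler_norml => /andP[? ?]; rewrite /hat !step_eq1 ?mulr1//; lra. Qed.

Lemma hat_eq0 x : 7 / 4 <= `|x| -> hat x = 0.
Proof.
rewrite /hat ler_normr => /orP[] ?; first by rewrite step_eq0 ?mul0r//; lra.
by rewrite mulrC step_eq0 ?mul0r//; lra.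
Qed.

Definition hat2 (c : P2) (r : R) (q : P2) : R := hat ((q.1 - c.1) / r) * hat ((q.2 - c.2) / r).

Lemma hat2_smooth c r q : smooth_at (hat2 c r) q.
Proof.
have lin (l : {linear P2 -> R^o}) (a : R) : continuous l -> smooth_at (fun q : P2 => hat ((l q - a) / r)) q.
  move=> cl; apply: (@smooth_at_comp _ _ _ _ (fun q : P2 => (l q - a) / r)).
  - exact: fin_dim_scalar.
  - apply: smooth_atM; last exact: smooth_at_cst.
    by apply: smooth_atB; [apply: smooth_at_linear => //; exact: smooth_at_id|exact: smooth_at_cst].
  - exact: hat_smooth.
apply: smooth_atM.
  by apply: (lin (@fst R^o R^o : {linear P2 -> R^o})) => x; exact: cvg_fst.
by apply: (lin (@snd R^o R^o : {linear P2 -> R^o})) => x; exact: cvg_snd.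
Qed.

Lemma hat2_ge0 c r q : 0 <= hat2 c r q.
Proof. by rewrite mulr_ge0// hat_ge0. Qed.

Lemma hat2_le1 c r q : hat2 c r q <= 1.
Proof. by rewrite mulr_ile1 ?hat_ge0 ?hat_le1. Qed.

Lemma hat2_eq1 c (r : R) q : 0 < r -> `|q - c| <= r -> hat2 c r q = 1.
Proof.
move=> r0; rewrite norm_pair ge_max => /andP[h1 h2].
by rewrite /hat2 !hat_eq1 ?mulr1// normrM normfV (gtr0_norm r0) ler_pdivrMr// mul1r.
Qed.

Lemma hat2_eq0 c (r : R) q : 0 < r -> 7 / 4 * r <= `|q - c| -> hat2 c r q = 0.
Proof.
move=> r0; rewrite norm_pair le_max => /orP[] h; rewrite /hat2.
  by rewrite hat_eq0 ?mul0r// normrM normfV (gtr0_norm r0) ler_pdivlMr.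
by rewrite mulrC hat_eq0 ?mul0r// normrM normfV (gtr0_norm r0) ler_pdivlMr.
Qed.

(** An average of finitely many values of f with bump weights: a weight is nonzero at q only if q is
    close to its centre, so every value that counts is within e of f q. *)
Lemma smooth_approx (V : normedModType R) (K : set P2) (f : P2 -> V) (e : R) :
  0 < e -> compact K -> (forall q, K q -> {for q, continuous f}) ->
  exists A : P2 -> V, forall q, K q -> smooth_at A q /\ `|A q - f q| <= e.
Proof.
move=> e0 cK cf.
pose I := {i : P2 * R | 0 < i.2 /\ forall q, `|q - i.1| < 2 * i.2 -> `|f q - f i.1| <= e}.
have [|s Hs] := @compact_finite_cover _ K I (fun i => [set q : P2 | `|q - (sval i).1| < (sval i).2]) cK.
  move=> p Kp.
  have : nbhs (f p) (ball (f p) e) by exact: nbhsx_ballx.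
  move=> /(cf p Kp) /nbhs_ballP[d /= d0 Hd].
  have H q : `|q - p| < 2 * (d / 2) -> `|f q - f p| <= e.
    rewrite mulrC divfK// => qp.
    have /Hd : ball p d q by rewrite -ball_normE /= distrC.
    by rewrite -ball_normE /= distrC => /ltW.
  have d2 : 0 < d / 2 by rewrite divr_gt0.
  exists (exist _ (p, d / 2) (conj d2 H)) => /=.
  have : nbhs p (ball p (d / 2)) by exact: nbhsx_ballx.
  by apply: filterS => q; rewrite -ball_normE /= distrC.
pose w (i : I) q := hat2 (sval i).1 (sval i).2 q.
pose W q := \sum_(i <- s) w i q.
have W0 q : K q -> 0 < W q.
  move=> Kq; have [i si iq] := Hs q Kq; rewrite /W.
  have w1 : 1 <= w i q by rewrite /w hat2_eq1 ?(ltW iq)//; exact: (svalP i).1.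
  apply: lt_le_trans (_ : 0 < 1) (le_trans w1 _) => //.
  elim: s si {W Hs} => //= j s IH [->|/IH H]; rewrite big_cons.
    by rewrite lerDl sumr_ge0// => k _; exact: hat2_ge0.
  by rewrite (le_trans H)// lerDr hat2_ge0.
exists (fun q => (W q)^-1 *: \sum_(i <- s) w i q *: f (sval i).1) => q Kq; split.
  apply: smooth_atZ.
    apply: smooth_at_inv; first by rewrite gt_eqF// W0.
    by apply: smooth_at_sum => i _; exact: hat2_smooth.
  by apply: smooth_at_sum => i _; apply: smooth_atZ; [exact: hat2_smooth|exact: smooth_at_cst].
have Wq := W0 q Kq.
have -> : (W q)^-1 *: (\sum_(i <- s) w i q *: f (sval i).1) - f q =
    (W q)^-1 *: \sum_(i <- s) w i q *: (f (sval i).1 - f q).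
  under [in RHS]eq_bigr do rewrite scalerBr.
  by rewrite sumrB -scaler_suml scalerBr scalerA mulVf ?gt_eqF// scale1r.
rewrite normrZ normfV (gtr0_norm Wq) mulrC ler_pdivrMr//.
apply: (le_trans (ler_norm_sum _ _ _)); rewrite /W mulr_sumr; apply: ler_sum => i _.
rewrite normrZ ger0_norm ?hat2_ge0// mulrC.
have [h|h] := ltP `|q - (sval i).1| (2 * (sval i).2).
  by rewrite ler_wpM2r ?hat2_ge0// distrC; exact: (svalP i).2.
have i0 := (svalP i).1; rewrite /w hat2_eq0 ?mulr0//; apply: le_trans h; lra.
Qed.

End Plane.

(** * Smoothing a continuous map from the plane to M *)

Section Whitney.
Context {R : realType} {m : nat} {M : manifold R m}.
Notation P2 := (R^o * R^o)%type.

Record patch := Patch {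
  pc : P2; pr : R; pch : chart R m M;
  pr_gt0 : 0 < pr; pch_atlas : atlas pch }.

Variable js : seq patch.

(** Squares of radius 2 r are mapped into chart domains, while smoothness will be gained on those of
    radius r. The condition covers all patches at once, since it must survive the modification made
    in each of them. *)
Definition fits (D : P2 -> M) := continuous D /\
  forall j, List.In j js -> forall q, `|q - pc j| <= 2 * pr j -> chart_dom (pch j) (D q).

Lemma norm_compact (c : P2) (r : R) : compact [set q : P2 | `|q - c| <= r].
Proof.
have := @plane_compact R (c.1 - r) (c.1 + r) (c.2 - r) (c.2 + r).
congr (compact _); apply/seteqP; split=> q /=; rewrite norm_pair ge_max /= !ler_distl.
  by move=> [-> ->].
by move=> /andP[-> ->].
Qed.

Lemma far_near (q c : P2) (r : R) : r < `|q - c| -> \forall q' \near q, r < `|q' - c|.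
Proof.
move=> h; have cc : {for q, continuous (fun q' : P2 => `|q' - c|)}.
  by apply: cvg_norm; apply: cvgB; [exact: cvg_id|exact: cvg_cst].
exact: (cc [set x | r < x] (lt_nbhsr h)).
Qed.

Lemma close_near (q c : P2) (r : R) : `|q - c| < r -> \forall q' \near q, `|q' - c| < r.
Proof.
move=> h; have cc : {for q, continuous (fun q' : P2 => `|q' - c|)}.
  by apply: cvg_norm; apply: cvgB; [exact: cvg_id|exact: cvg_cst].
exact: (cc [set x | x < r] (lt_nbhsl h)).
Qed.

(** By compactness one e serves the whole square: a perturbation of size e in the chart of patch j
    stays in that chart and respects the constraints of all other patches. *)
Lemma whitney_room D j : List.In j js -> fits D ->
  exists2 e : R, 0 < e & forall q, `|q - pc j| <= 2 * pr j ->
    forall z, `|z - pch j (D q)| <= e -> chart_img (pch j) z /\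
      forall j', List.In j' js -> `|q - pc j'| <= 2 * pr j' ->
        chart_dom (pch j') (chart_inv (pch j) z).
Proof.
move=> jj [cD domD]; set c := pch j.
pose P (e : R) q := forall z, `|z - c (D q)| <= e -> chart_img c z /\
  forall j', List.In j' js -> `|q - pc j'| <= 2 * pr j' ->
    chart_dom (pch j') (chart_inv c z).
have /compact_near_coveringP cK := @norm_compact (pc j) (2 * pr j).
suff [e [e0 He]] : exists e : R, 0 < e /\ [set q : P2 | `|q - pc j| <= 2 * pr j] `<=` P e.
  by exists e.
have near_ok := cK R (0 : R)^'+ P _ _; last first.
  suff : \forall e \near (0 : R)^'+, 0 < e /\ [set q : P2 | `|q - pc j| <= 2 * pr j] `<=` P e.
    by move=> /(@filter_ex _ _ _)[e He]; exists e.
  apply: filterI; first exact: nbhs_right_gt.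
  apply: near_ok => q0 Kq0.
  have dq0 := domD j jj q0 Kq0.
  have n1 : nbhs (c (D q0)) [set z | chart_img c z /\ forall j', List.In j' js ->
      `|q0 - pc j'| <= 2 * pr j' -> chart_dom (pch j') (chart_inv c z)].
    apply: filterI; first exact: near_img (cvg_id) (chart_funP dq0).
    apply: filter_In => j' jj'.
    have [h|h] := pselect (`|q0 - pc j'| <= 2 * pr j'); last by apply: filterE => z /h.
    have : nbhs (c (D q0)) [set z | chart_dom (pch j') (chart_inv c z)].
      have ci : {for c (D q0), continuous (chart_inv c)} by exact: chart_inv_cont (chart_funP dq0).
      by apply: (near_dom ci); rewrite chart_funK//; exact: domD.
    by apply: filterS.
  have [d /= d0 Hd] := (nbhs_ballP _ _).1 n1.
  (* The squares are closed, so those that miss q0 impose nothing near q0. *)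
  have n2 : \forall q \near q0, forall j', List.In j' js ->
      `|q - pc j'| <= 2 * pr j' -> `|q0 - pc j'| <= 2 * pr j'.
    apply: filter_In => j' jj'.
    have [h|h] := leP `|q0 - pc j'| (2 * pr j'); first by apply: filterE.
    by apply: filterS (far_near h) => q; rewrite ltNge => /negP.
  have d2 : 0 < d / 2 by rewrite divr_gt0.
  have cc : {for q0, continuous (fun q => c (D q))}.
    by apply: continuous_comp; [exact: cD|exact: chart_fun_cont].
  have n3 : \forall q \near q0, ball (c (D q0)) (d / 2) (c (D q)) by exact: (cc _ (nbhsx_ballx _ _ d2)).
  exists ([set q | (forall j', List.In j' js ->
      `|q - pc j'| <= 2 * pr j' -> `|q0 - pc j'| <= 2 * pr j') /\ ball (c (D q0)) (d / 2) (c (D q))],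
      [set e : R | e < d / 2]).
    by split; [exact: filterI|exact: nbhs_right_lt].
  move=> [q e] [/= [A1 A2] ed] z ze.
  have /Hd[/= H1 H2] : ball (c (D q0)) d z.
    rewrite (splitr d); apply: ball_triangle A2 _.
    by rewrite -ball_normE /= distrC (le_lt_trans ze).
  by split=> // j' jj' qj'; apply: H2 => //; exact: A1.
Qed.

(** In the chart of patch j the map is moved towards a smooth approximation with weight [hat2].
    Weight 1 gives smoothness on the square of radius r; weight 0 beyond 7/4 r makes the change fit
    with D before the edge of the square of radius 2 r; in between, smoothness of D at a point is
    preserved. *)
Lemma whitney_step D j : List.In j js -> fits D -> exists D',
  [/\ fits D', forall q, msmooth_at D q -> msmooth_at D' q,
      forall q, `|q - pc j| < pr j -> msmooth_at D' q &
      forall q, 2 * pr j < `|q - pc j| -> D' q = D q].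
Proof.
move=> jj fD; have [cD domD] := fD; have [e e0 room] := whitney_room jj fD.
set c := pch j in room *; have ac : atlas c := pch_atlas j; have r0 := pr_gt0 j.
set r := pr j in room r0 *; set p := pc j in room *.
pose f q := c (D q).
have cf q : `|q - p| <= 2 * r -> {for q, continuous f}.
  move=> Kq; apply: continuous_comp; first exact: cD.
  by apply: chart_fun_cont; exact: domD.
have [A HA] := smooth_approx e0 (@norm_compact p (2 * r)) cf.
pose z q := f q + hat2 p r q *: (A q - f q).
have zf q : `|q - p| <= 2 * r -> `|z q - f q| <= e.
  move=> Kq; rewrite /z addrC addKr normrZ ger0_norm ?hat2_ge0//.
  apply: le_trans (HA q Kq).2; rewrite ler_piMl//; exact: hat2_le1.
pose D' q := if `|q - p| <= 2 * r then chart_inv c (z q) else D q.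
have D'far q : 7 / 4 * r <= `|q - p| -> D' q = D q.
  move=> qp; rewrite /D'; case: ifPn => // Kq.
  by rewrite /z hat2_eq0// scale0r addr0 chart_funK//; exact: domD.
have far q : 7 / 4 * r < `|q - p| -> \near q, D q = D' q.
  by move=> qp; apply: filterS (far_near qp) => q' h; rewrite D'far// ltW.
have near_in q : `|q - p| < 2 * r -> \near q, chart_inv c (z q) = D' q.
  by move=> qp; apply: filterS (close_near qp) => q' h; rewrite /D' ltW.
have cases q : 7 / 4 * r < `|q - p| \/ `|q - p| < 2 * r.
  by case: (ltP (7 / 4 * r) `|q - p|) => ?; [left|right; lra].
exists D'; split.
- split=> [q|j' jj' q qj']; last first.
    rewrite /D'; case: ifPn => [Kq|_]; last exact: domD.
    by have [_] := room q Kq (z q) (zf q Kq); apply.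
  case: (cases q) => qp.
    have E := far q qp; have E0 := nbhs_singleton E.
    rewrite /continuous_at -E0; apply: cvg_trans (cD q).
    by apply: near_eq_cvg.
  have E := near_in q qp; have E0 := nbhs_singleton E; have Kq := ltW qp.
  rewrite /continuous_at -E0.
  have cz : {for q, continuous z}.
    apply: cvgD; first exact: cf.
    apply: cvgZ; first exact: (smooth_at_continuous (hat2_smooth p r q)).
    apply: cvgB; last exact: cf.
    exact: (smooth_at_continuous (HA q Kq).1).
  have : {for q, continuous (fun q => chart_inv c (z q))}.
    by apply: continuous_comp => //; apply: chart_inv_cont; exact: (room q Kq (z q) (zf q Kq)).1.
  by apply: cvg_trans; apply: near_eq_cvg.
- move=> q sD; case: (cases q) => qp; first exact: msmooth_at_near (far q qp) sD.
  apply: msmooth_at_near (near_in q qp) _; have Kq := ltW qp.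
  apply: msmooth_at_inv => //; first exact: (room q Kq (z q) (zf q Kq)).1.
  have sf : smooth_at f q by apply: sD.2 => //; exact: domD.
  apply: smooth_atD => //; apply: smooth_atZ; first exact: hat2_smooth.
  by apply: smooth_atB => //; exact: (HA q Kq).1.
- move=> q qp; have Kq : `|q - p| <= 2 * r by rewrite (le_trans (ltW qp))//; lra.
  have qp2 : `|q - p| < 2 * r by rewrite (lt_trans qp)//; lra.
  apply: msmooth_at_near (near_in q qp2) _.
  apply: msmooth_at_inv => //; first exact: (room q Kq (z q) (zf q Kq)).1.
  apply: smooth_at_near (HA q Kq).1.
  apply: filterS (close_near qp) => q' h; rewrite /z hat2_eq1 ?(ltW h)//.
  by rewrite scale1r addrC subrK.
- by move=> q qp; rewrite /D' leNgt qp.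
Qed.

Lemma whitney_steps ts D : (forall j, List.In j ts -> List.In j js) -> fits D -> exists D',
  [/\ fits D', forall q, msmooth_at D q -> msmooth_at D' q,
      forall j, List.In j ts -> forall q, `|q - pc j| < pr j -> msmooth_at D' q &
      forall q, (forall j, List.In j ts -> 2 * pr j < `|q - pc j|) -> D' q = D q].
Proof.
elim: ts => [|j ts IH] sub fD; first by exists D; split.
have [D1 [f1 s1 t1 e1]] := IH (fun j' h => sub j' (or_intror h)) fD.
have [D2 [f2 s2 t2 e2]] := whitney_step (sub j (or_introl erefl)) f1.
exists D2; split=> //.
- by move=> q /s1/s2.
- by move=> j' [<-|h] q qj; [exact: t2|apply: s2; exact: t1 qj].
- move=> q h; rewrite e2 ?e1//; last by apply: h; left.
  by move=> j' h'; apply: h; right.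
Qed.

End Whitney.

Section Disc.
Context {R : realType} {m : nat} {M : manifold R m}.
Notation P2 := (R^o * R^o)%type.

Lemma smooth_disc (D : P2 -> M) : continuous D ->
  (forall q, 3 / 2 < `|q| -> msmooth_at D q) ->
  exists D' : P2 -> M, (forall q, msmooth_at D' q) /\ forall q, 2 < `|q| -> D' q = D q.
Proof.
move=> cD sD.
(* Centres of norm at most 3/2 and radii at most 1/4 confine all changes to norm at most 3/2 + 2 *
   1/4 = 2. *)
pose I := {j : @patch R m M | [/\ `|pc j| <= 3 / 2, pr j <= 1 / 4 &
  forall q, `|q - pc j| <= 2 * pr j -> chart_dom (pch j) (D q)]}.
have cK : compact [set q : P2 | `|q| <= 3 / 2].
  have := @norm_compact R 0 (3 / 2).
  by congr (compact _); apply/seteqP; split=> q /=; rewrite subr0.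
have [|s Hs] := @compact_finite_cover _ _ I (fun i => [set q : P2 | `|q - pc (sval i)| < pr (sval i)]) cK.
  move=> q0 Kq; have := near_dom (cD q0) (chart_at_dom (D q0)) => /nbhs_ballP[d /= d0 Hd].
  pose r := Num.min (1 / 4) (d / 4).
  have r0 : 0 < r by rewrite lt_min; apply/andP; split; lra.
  have rd : r <= d / 4 by rewrite ge_min lexx orbT.
  have H q : `|q - q0| <= 2 * r -> chart_dom (chart_at (D q0)) (D q).
    by move=> h; apply: Hd; rewrite -ball_normE /= distrC (le_lt_trans h)//; lra.
  have r4 : r <= 1 / 4 by rewrite ge_min lexx.
  exists (exist _ (Patch q0 r0 (chart_at_atlas (D q0))) (And3 Kq r4 H)) => /=.
  by have := close_near (q := q0) (c := q0) (r := r); apply; rewrite subrr normr0.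
pose js := map (fun i : I => sval i) s.
have jsP j : List.In j js -> exists i : I, j = sval i.
  by move=> /List.in_map_iff[i [<- _]]; exists i.
have fD : fits js D.
  by split=> // j /jsP[i ->] q; have [_ _] := svalP i; apply.
have [D' [_ s1 t1 e1]] := whitney_steps (fun j h => h) fD.
exists D'; split=> q.
  have [h|h] := ltP (3 / 2) `|q|; first by apply: s1; exact: sD.
  have [i si qi] := Hs q h; apply: t1 qi.
  by apply/List.in_map_iff; exists i.
move=> q2; apply: e1 => j /jsP[i ->]; have [h1 h2 _] := svalP i.
have := ler_normD (q - pc (sval i)) (pc (sval i)); rewrite subrK => h3; lra.
Qed.

End Disc.

Section NearInequalities.
Context {R : realType} {V : normedModType R} {f : V -> R} {x : V}.
Hypothesis sf : smooth_at f x.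

Lemma smooth_near_gt (c : R) : c < f x -> \forall y \near x, c < f y.
Proof. by move=> h; exact: (smooth_at_continuous sf (lt_nbhsr h)). Qed.

Lemma smooth_near_lt (c : R) : f x < c -> \forall y \near x, f y < c.
Proof. by move=> h; exact: (smooth_at_continuous sf (lt_nbhsl h)). Qed.

End NearInequalities.

Lemma cont_pair (T U V : topologicalType) (f : T -> U) (g : T -> V) (x : T) :
  {for x, continuous f} -> {for x, continuous g} -> {for x, continuous (fun q => (f q, g q))}.
Proof. by move=> cf cg; apply: cvg_pair; [exact: cf|exact: cg]. Qed.

Lemma smooth_is_derive (R : realType) (V W : normedModType R) (f : V -> W) x v :
  smooth_at f x -> is_derive x v f ('D_v f x).
Proof. by move=> sf; apply: DeriveDef => //; exact: smooth_at_derivable. Qed.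

Lemma derive_path (R : realType) (W : normedModType R) (g : R^o * R^o -> W) (f h : R -> R) (t : R) :
  differentiable g (f t, h t) -> smooth_at f t -> smooth_at h t ->
  'D_1 (fun t : R => g (f t, h t)) t = 'D_('D_1 f t, 'D_1 h t) g (f t, h t).
Proof.
move=> dg sf sh.
have dp : differentiable (fun t : R => ((f t, h t) : R^o * R^o)) t.
  by apply: smooth_at_differentiable; exact: smooth_at_pair.
rewrite (@derive_comp _ _ _ _ g (fun t : R => ((f t, h t) : R^o * R^o)))//.
by rewrite derive_pair//; exact: smooth_at_differentiable.
Qed.

Section Contraction.
Context {R : realType} {m : nat} {M : manifold R m}.
Notation P2 := (R^o * R^o)%type.

Definition clamp (t : R) : R := Num.max 0 (Num.min 1 t).

Lemma clamp_itv t : 0 <= clamp t <= 1.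
Proof. by rewrite /clamp le_max lexx /= ge_max ler01 ge_min lexx. Qed.

Lemma clamp_ge1 t : 1 <= t -> clamp t = 1.
Proof. by move=> t1; rewrite /clamp min_l// max_r. Qed.

Lemma clamp_le0 t : t <= 0 -> clamp t = 0.
Proof. by move=> t1; rewrite /clamp min_r ?max_l// (le_trans t1). Qed.

Lemma clamp_cont : continuous clamp.
Proof.
move=> t; rewrite /clamp; apply: (@continuous_max _ R (fun=> 0) (fun t => Num.min 1 t)).
  exact: cvg_cst.
by apply: (@continuous_min _ R (fun=> 1) id); [exact: cvg_cst|exact: cvg_id].
Qed.

(** A null-homotopy is continuous only relative to the strip; with its first argument clamped it
    becomes continuous on the whole plane. *)
Lemma within_comp (A : set (R * R)) (H : R * R -> M) (V : topologicalType) (g : V -> R * R) (q : V) :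
  {within A, continuous H} -> {for q, continuous g} -> (forall v, A (g v)) ->
  {for q, continuous (fun v => H (g v))}.
Proof.
move=> /subspace_continuousP cH cg Ag N /(cH _ (Ag q)); rewrite /within /= => HN.
have := cg _ HN; rewrite /nbhs /=; apply: filterS => v /= h; exact: h (Ag v).
Qed.

(** The norm of the product type is the sup norm, which is not smooth; the square of the Euclidean
    one is. *)
Definition sqn (q : P2) : R := q.1 ^+ 2 + q.2 ^+ 2.

Lemma sqn_smooth q : smooth_at sqn q.
Proof. by apply: smooth_atD; apply: smooth_atM; (exact: smooth_fst || exact: smooth_snd). Qed.

Lemma sqn_ge q : `|q| ^+ 2 <= sqn q.
Proof.
rewrite norm_pair /sqn; have [_|_] := leP `|q.1| `|q.2|; rewrite real_normK ?num_real//.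
  by rewrite lerDr sqr_ge0.
by rewrite lerDl sqr_ge0.
Qed.

Lemma dot_near (q0 : P2) : 0 < sqn q0 -> \forall q \near q0, 0 < q0.1 * q.1 + q0.2 * q.2.
Proof.
move=> w0; have sd : smooth_at (fun q : P2 => q0.1 * q.1 + q0.2 * q.2 : R) q0.
  by apply: smooth_atD; apply: smooth_atM; [exact: smooth_at_cst|exact: smooth_fst|exact: smooth_at_cst|exact: smooth_snd].
have := smooth_at_continuous sd; rewrite /prop_for /continuous_at -!expr2 => H.
exact: (H [set x | 0 < x] (lt_nbhsr w0)).
Qed.

Lemma sqn_gt_near (q0 : P2) (c : R) : c < sqn q0 -> \forall q \near q0, c < sqn q.
Proof. by move=> h; apply: (@smooth_near_gt _ _ sqn _ (sqn_smooth q0)). Qed.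

Lemma sqn_lt_near (q0 : P2) (c : R) : sqn q0 < c -> \forall q \near q0, sqn q < c.
Proof. by move=> h; apply: (@smooth_near_lt _ _ sqn _ (sqn_smooth q0)). Qed.

Lemma periodic_polar (T : Type) (f : R -> T) (x y a b : R) : (forall b, f (b + 2 * pi) = f b) ->
  0 < x ^+ 2 + y ^+ 2 -> polar x y a -> polar x y b -> f a = f b.
Proof.
move=> fp w0 pa pb; have [k ->] := polar_mod w0 pa pb.
exact: period_int.
Qed.

Lemma null_homotopic_sweeps (L : R -> M) : (forall b : R, msmooth_at L b) ->
  (forall b, L (b + 2 * pi) = L b) -> null_homotopic (fun t => L (2 * pi * t)) ->
  exists p I, sweeps L (fun=> p) I.
Proof.
move=> sL pL [H [p [cH pH H0 H1]]].
have pi0 : 2 * pi != 0 :> R by rewrite mulf_neq0// gt_eqF// pi_gt0.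
pose G (s b : R) := H (clamp s, b / (2 * pi)).
have pG s b : G s (b + 2 * pi) = G s b by rewrite /G mulrDl divff// pH// clamp_itv.
have G0 s b : s <= 0 -> G s b = L b by move=> s0; rewrite /G clamp_le0// H0 mulrC divfK.
have G1 s b : 1 <= s -> G s b = p by move=> s1; rewrite /G clamp_ge1// H1.
(* The homotopy parameter is 2 minus the squared radius. D is the point p for squared radius at most
   1, which hides the singular angle at the origin, and the loop L from squared radius 2 on; beyond
   2 it is smooth. *)
pose D (q : P2) := G (2 - sqn q) (ang q.1 q.2).
have Dbranch (q0 : P2) : 0 < sqn q0 ->
    \forall q \near q0, G (2 - sqn q) (branch q0.1 q0.2 q.1 q.2) = D q.
  move=> w0; apply: filterS (filterI (dot_near w0) (sqn_gt_near w0)) => q [d0 wq].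
  apply: (periodic_polar (pG _) wq); last exact: polar_ang.
  exact: polar_branch.
have sb (q0 : P2) : 0 < sqn q0 -> smooth_at (fun q : P2 => branch q0.1 q0.2 q.1 q.2) q0.
  move=> w0; apply: branch_smooth; [exact: smooth_fst|exact: smooth_snd|].
  by rewrite -!expr2.
have cD : continuous D.
  move=> q0; have [w0|w0] := ltP 0 (sqn q0); last first.
    have w1 : sqn q0 < 1 by rewrite (le_lt_trans w0).
    have E : \forall q \near q0, p = D q.
      by apply: filterS (sqn_lt_near w1) => q h; rewrite /D G1//; lra.
    rewrite /continuous_at -(nbhs_singleton E); apply: cvg_trans (near_eq_cvg E) _; exact: cvg_cst.
  have E := Dbranch q0 w0.
  rewrite /continuous_at -(nbhs_singleton E); apply: cvg_trans (near_eq_cvg E) _.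
  apply: (@within_comp _ H _ (fun q : P2 => (clamp (2 - sqn q), branch q0.1 q0.2 q.1 q.2 / (2 * pi)) : R * R) q0 cH).
    apply: (@cont_pair _ R R (fun q : P2 => clamp (2 - sqn q))); last first.
      by apply: (smooth_at_continuous (f := fun q : P2 => branch q0.1 q0.2 q.1 q.2 / (2 * pi) : R)); apply: smooth_atM (sb _ w0) (smooth_at_cst _ _).
    apply: (@continuous_comp _ _ _ (fun q : P2 => 2 - sqn q : R) clamp); last exact: clamp_cont.
    apply: smooth_at_continuous; apply: smooth_atB; [exact: smooth_at_cst|exact: sqn_smooth].
  by move=> q /=; exact: clamp_itv.
have Dout q : 2 <= sqn q -> D q = L (ang q.1 q.2) by move=> h; rewrite /D G0//; lra.
have sD (q0 : P2) : 3 / 2 < `|q0| -> msmooth_at D q0.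
  move=> h; have w2 : 2 < sqn q0.
    apply: lt_le_trans (sqn_ge q0); apply: lt_trans (_ : 2 < (3 / 2) ^+ 2) _; first by lra.
    by rewrite ltr_pXn2r// ?nnegrE//; lra.
  have w0 : 0 < sqn q0 by rewrite (lt_trans _ w2).
  apply: (@msmooth_at_near _ _ _ _ (fun q : P2 => L (branch q0.1 q0.2 q.1 q.2))); last first.
    by apply: msmooth_at_comp; [exact: fin_dim_scalar|exact: sb|exact: sL].
  apply: filterS (filterI (sqn_gt_near w2) (Dbranch q0 w0)) => q [h2 <-].
  by rewrite G0//; lra.
have [D' [sD' DD']] := smooth_disc cD sD.
exists (D' 0).
(* The radius falls from 3 to 0. The circle of radius 3 lies outside the sup-norm square of radius
   2, since 3 / sqrt 2 > 2, so the smoothing has left D unchanged on it. *)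
pose rho (s : R) : R := 3 * (1 - step s).
pose F (q : P2) := D' ((rho q.1 * cos q.2 : R), (rho q.1 * sin q.2 : R)).
apply: (@cylinder_sweeps _ _ _ F); split.
- move=> q; apply: (@msmooth_at_comp _ _ _ _ _ (fun q : P2 => ((rho q.1 * cos q.2 : R), (rho q.1 * sin q.2 : R)) : P2)).
  + exact: fin_dim_R2.
  + have sr : smooth_at (fun q : P2 => rho q.1) q.
      apply: smooth_atM; first exact: smooth_at_cst.
      apply: smooth_atB; first exact: smooth_at_cst.
      by apply: smooth_at_comp; [exact: fin_dim_scalar|exact: smooth_fst|exact: step_smooth].
    apply: smooth_at_pair; apply: smooth_atM => //.
      by apply: smooth_at_comp; [exact: fin_dim_scalar|exact: smooth_snd|exact: cos_smooth].
    by apply: smooth_at_comp; [exact: fin_dim_scalar|exact: smooth_snd|exact: sin_smooth].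
  + exact: sD'.
- by move=> s b; rewrite /F /= mulr_natl cosD2pi sinD2pi.
- move=> s b s4; rewrite /F /= /rho step_eq0// subr0 mulr1.
  have wE : sqn ((3 * cos b : R), (3 * sin b : R)) = 9.
    by rewrite /sqn /= !exprMn -mulrDr cos2Dsin2; lra.
  rewrite DD'.
    rewrite Dout ?wE//=; last by lra.
    apply: (periodic_polar pL (x := 3 * cos b) (y := 3 * sin b)).
    + by move: wE; rewrite /sqn /= => ->.
    + by apply: polar_ang; move: wE; rewrite /sqn /= => ->.
    + exact: polar_cos_sin.
  rewrite norm_pair /=; have [//|h] := ltP 2 (Num.max `|3 * cos b| `|3 * sin b|).
  move: h; rewrite ge_max => /andP[]; rewrite -!(@ler_sqr _ _ 2) ?nnegrE// !real_normK ?num_real//.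
  by move: wE; rewrite /sqn /=; lra.
- by move=> s b s4; rewrite /F /= /rho step_eq1// subrr mulr0 !mul0r.
Qed.

End Contraction.

(** * Spheres from discs *)

Section Sphere.
Context {R : realType} {m : nat} {M : manifold R m}.
Notation P2 := (R^o * R^o)%type.

Let i0 : 'I_3 := @Ordinal 3 0 isT.
Let i1 : 'I_3 := @Ordinal 3 1 isT.
Let i2 : 'I_3 := @Ordinal 3 2 isT.

Let den (w z : R) := w * (1 + z ^+ 2) + z ^+ 2.

(* A smooth function of [x != 0] which is at most [-3/2] on the upper half of the
   polar axis and at least [5/2] on the lower half. *)
Definition height (w z : R) := 1 / 2 - z * (1 + z ^+ 2) / den w z.

Let wx (x : 'rV[R]_3) := x 0 i0 ^+ 2 + x 0 i1 ^+ 2.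

Let wx_ge0 x : 0 <= wx x.
Proof. by rewrite addr_ge0// sqr_ge0. Qed.

Let den_gt0 x : x != 0 -> 0 < den (wx x) (x 0 i2).
Proof.
move=> x0; have h1 : 0 < 1 + x 0 i2 ^+ 2 by rewrite ltr_pwDl// sqr_ge0.
have [w0|w0] := ltP 0 (wx x); first by rewrite ltr_pwDl ?sqr_ge0// mulr_gt0.
have w0' : wx x = 0 by apply/eqP; rewrite eq_le w0 wx_ge0.
rewrite /den w0' mul0r add0r exprn_even_gt0//=; apply: contra x0 => /eqP z0.
move/eqP: w0'; rewrite paddr_eq0 ?sqr_ge0// !sqrf_eq0 => /andP[/eqP x00 /eqP x01].
apply/eqP/rowP => -[[|[|[|//]]] k]; rewrite mxE.
- by rewrite -x00; congr (x _ _); apply: val_inj.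
- by rewrite -x01; congr (x _ _); apply: val_inj.
- by rewrite -z0; congr (x _ _); apply: val_inj.
Qed.

Let coord_smooth (x : 'rV[R]_3) i : smooth_at (fun x : 'rV[R]_3 => x 0 i : R) x.
Proof. by apply: smooth_at_coord; exact: smooth_at_id. Qed.

Let wx_smooth x : smooth_at wx x.
Proof. by apply: smooth_atD; apply: smooth_atM; exact: coord_smooth. Qed.

Let height_smooth_comp (V : normedModType R) (f g : V -> R) (x : V) : smooth_at f x -> smooth_at g x ->
  den (f x) (g x) != 0 -> smooth_at (fun x => height (f x) (g x)) x.
Proof.
move=> sf sg d0.
have sq : smooth_at (fun x => g x ^+ 2) x by apply: smooth_atM.
have s1 : smooth_at (fun x => 1 + g x ^+ 2) x by apply: smooth_atD => //; exact: smooth_at_cst.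
apply: smooth_atB; first exact: smooth_at_cst.
apply: smooth_atM; first exact: smooth_atM.
apply: smooth_at_inv => //; apply: smooth_atD => //; exact: smooth_atM.
Qed.

Variables (F : P2 -> M) (p p' : M).
Hypothesis cF : cylinder F (fun=> p) (fun=> p').

Let u (x : 'rV[R]_3) := F (height (wx x) (x 0 i2), ang (x 0 i0) (x 0 i1)).

Let sF q : msmooth_at F q. Proof. by have [] := cF. Qed.

Let axis_height z : z != 0 -> height 0 z = 1 / 2 - (1 + z ^+ 2) / z.
Proof. by move=> z0; rewrite /height /den mul0r add0r; field. Qed.

(** On the axis (1 + z^2) / z has absolute value at least 2, so the height falls where F is constant
    and the angle does not matter. *)
Let axis_near x : x != 0 -> ~ 0 < wx x ->
  (\forall y \near x, u y = p) \/ (\forall y \near x, u y = p').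
Proof.
move=> x0 w0; have w0' : wx x = 0.
  by apply/eqP; rewrite eq_le wx_ge0 andbT leNgt; apply/negP.
have z0 : x 0 i2 != 0.
  by have := den_gt0 x0; rewrite /den w0' mul0r add0r; apply: contraTneq => ->; rewrite expr0n ltxx.
have sh : smooth_at (fun x => height (wx x) (x 0 i2)) x.
  by apply: height_smooth_comp; [exact: wx_smooth|exact: coord_smooth|rewrite gt_eqF// den_gt0].
have sq0 := sqr_ge0 (x 0 i2 - 1); have sq1 := sqr_ge0 (x 0 i2 + 1).
move: z0; rewrite neq_lt => /orP[] z0.
  right; have h : 3 / 4 < height (wx x) (x 0 i2).
    rewrite w0' axis_height ?lt_eqF//.
    have : 1 / 4 < - ((1 + x 0 i2 ^+ 2) / x 0 i2); last by lra.
    by rewrite -mulrN -invrN ltr_pdivlMr ?oppr_gt0//; nra.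
  have := smooth_near_gt sh h.
  by apply: filterS => y /= hy; rewrite /u; have [_ _ _ ->//] := cF; exact: ltW.
left; have h : height (wx x) (x 0 i2) < 1 / 4.
  rewrite w0' axis_height ?gt_eqF//.
  have : 1 / 4 < ((1 + x 0 i2 ^+ 2) / x 0 i2); last by lra.
  by rewrite ltr_pdivlMr//; nra.
have := smooth_near_lt sh h.
by apply: filterS => y /= hy; rewrite /u; have [_ _ -> //] := cF; exact: ltW.
Qed.

Lemma sphere_smooth : smooth_sphere u.
Proof.
have op : open [set x : 'rV[R]_3 | x != 0].
  have -> : [set x : 'rV[R]_3 | x != 0] = ~` [set 0].
    by apply/seteqP; split=> x /= /eqP.
  by apply: closed_openC; apply: accessible_closed_set1; apply: hausdorff_accessible; exact: norm_hausdorff.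
apply/(smooth_mapP _ op) => x /= x0.
have [w0|w0] := pselect (0 < wx x); last first.
  by case: (axis_near x0 w0) => E; [apply: (@msmooth_at_near _ _ _ _ (fun=> p))|apply: (@msmooth_at_near _ _ _ _ (fun=> p'))];
    rewrite ?(fun V => @msmooth_at_cst _ _ _ V)//; try (by apply: filterS E => y ->); exact: msmooth_at_cst.
have sb : smooth_at (fun y : 'rV[R]_3 => branch (x 0 i0) (x 0 i1) (y 0 i0) (y 0 i1)) x.
  by apply: branch_smooth; [exact: coord_smooth|exact: coord_smooth|rewrite -!expr2].
apply: (@msmooth_at_near _ _ _ _ (fun y => F (height (wx y) (y 0 i2), branch (x 0 i0) (x 0 i1) (y 0 i0) (y 0 i1)))); last first.
  apply: (@msmooth_at_comp _ _ _ _ _ (fun y => (height (wx y) (y 0 i2), branch (x 0 i0) (x 0 i1) (y 0 i0) (y 0 i1)) : P2)).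
  - exact: fin_dim_R2.
  - apply: smooth_at_pair => //.
    by apply: height_smooth_comp; [exact: wx_smooth|exact: coord_smooth|rewrite gt_eqF// den_gt0].
  - exact: sF.
have sd : smooth_at (fun y : 'rV[R]_3 => x 0 i0 * y 0 i0 + x 0 i1 * y 0 i1) x.
  by apply: smooth_atD; apply: smooth_atM; (exact: smooth_at_cst || exact: coord_smooth).
have n1' := smooth_near_gt (c := 0) sd; rewrite -!expr2 in n1'; have {}n1' := n1' w0.
have n2 := smooth_near_gt (wx_smooth x) w0.
apply: filterS (filterI n1' n2) => y [/= d0 wy].
have [_ pF _ _] := cF.
apply: (periodic_polar (pF _) wy); last exact: polar_ang.
exact: polar_branch.
Qed.

Let hs (a : R) := height (sin a ^+ 2) (cos a).

Let sin2_den (a : R) : 0 < den (sin a ^+ 2) (cos a).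
Proof.
rewrite /den; have := cos2Dsin2 a; have := sqr_ge0 (sin a); have := sqr_ge0 (cos a).
move: (cos a ^+ 2) (sin a ^+ 2) => x y; nra.
Qed.

Let hs_smooth (a : R) : smooth_at hs a.
Proof.
apply: height_smooth_comp; last by rewrite gt_eqF// sin2_den.
  by apply: smooth_atM; exact: sin_smooth.
exact: cos_smooth.
Qed.

Let wx_spherical (a b : R) : wx (spherical a b) = sin a ^+ 2.
Proof. by rewrite /wx !mxE /= !exprMn -mulrDr cos2Dsin2 mulr1. Qed.

(** Near the poles F is constant; elsewhere the sine is positive, and [ang] differs from the
    longitude by a multiple of the period. *)
Let u_near (a b : R) : 0 <= a <= pi -> \forall c \near a, forall b : R, u (spherical c b) = F (hs c, b).
Proof.
move=> /andP[a0 api]; have [_ pF F0 F1] := cF.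
have uE c b' : u (spherical c b') = F (hs c, ang (sin c * cos b') (sin c * sin b')).
  by rewrite /u wx_spherical !mxE.
have [->|an0] := eqVneq a 0.
  have h : hs 0 < 1 / 4.
    by rewrite /hs sin0 cos0 expr0n /= axis_height ?oner_eq0// expr1n; lra.
  have := smooth_near_lt (hs_smooth 0) h.
  by apply: filterS => c /= hc b'; rewrite uE !F0// ltW.
have [->|anpi] := eqVneq a pi.
  have h : 3 / 4 < hs pi.
    by rewrite /hs sinpi cospi expr0n /= axis_height ?oppr_eq0 ?oner_eq0// sqrrN expr1n invrN1; lra.
  have := smooth_near_gt (hs_smooth pi) h.
  by apply: filterS => c /= hc b'; rewrite uE !F1// ltW.
have sa : 0 < sin a by apply: sin_gt0_pi; rewrite !lt_neqAle a0 api eq_sym an0 anpi.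
have := smooth_near_gt (sin_smooth a) sa.
apply: filterS => c /= hc b'; rewrite uE.
have w0 : 0 < (sin c * cos b') ^+ 2 + (sin c * sin b') ^+ 2.
  by rewrite !exprMn -mulrDr cos2Dsin2 mulr1 exprn_gt0.
apply: (periodic_polar (pF _) w0); first exact: polar_ang.
by apply: polar_cos_sin; exact: ltW.
Qed.

(** The substitution s = hs(a) is carried out on the primitive [T \o hs]. The height goes from -3/2
    at the upper pole to 5/2 at the lower one, and T is constant on either side of [1/4, 3/4]. *)
Lemma sphere_area (a : preform M 2) (T : R -> R) : is_form a ->
  (forall s : R, is_derive s 1 T (slice_area a F s)) ->
  sphere_integral a u = T 1 - T 0.
Proof.
move=> fa dT; have [_ pF F0 F1] := cF.
have pi0 : 0 <= pi :> R := pi_ge0 R.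
have E (x b : R) : 0 <= x <= pi ->
   (let c := chart_at (u (spherical x b)) in
       a c (c (u (spherical x b)))
         (col_mx (derive1 (fun a' : R => c (u (spherical a' b))) x)
                 (derive1 (fun b' : R => c (u (spherical x b'))) b))) =
   derive1 hs x * density a F (hs x, b).
  move=> xpi; have un := u_near b xpi; have u0 := nbhs_singleton un.
  rewrite /= u0; set c := chart_at _.
  have ac : atlas c := chart_at_atlas _; have cq : chart_dom c (F (hs x, b)) := chart_at_dom _.
  have dc := smooth_at_differentiable ((sF (hs x, b)).2 c ac cq).
  rewrite (density2E fa sF ac cq).
  have -> : derive1 (fun a' : R => c (u (spherical a' b))) x =
      derive1 hs x *: 'D_((1, 0) : P2) (fun q => c (F q)) (hs x, b).
    rewrite derive1E; transitivity ('D_1 (fun t : R => c (F (hs t, b))) x).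
      by apply: near_eq_derive; apply: filterS un => t ->.
    apply: etrans (derive_path (g := fun q => c (F q)) dc (hs_smooth x) (smooth_at_cst b x)) _.
    rewrite derive_cst; apply: etrans _ (derive_dirZ (f := fun q => c (F q)) _ _ dc).
    by congr ('D_ _ _ _); congr pair; rewrite ?scaler0 ?derive1E -?[RHS]/(_ * 1) ?mulr1.
  have -> : derive1 (fun b' : R => c (u (spherical x b'))) b =
      'D_((0, 1) : P2) (fun q => c (F q)) (hs x, b).
    rewrite derive1E; transitivity ('D_1 (fun t : R => c (F (hs x, t))) b).
      by congr ('D_1 _ b); apply/funext => t; rewrite u0.
    apply: etrans (derive_path (g := fun q => c (F q)) (f := fun=> hs x) (h := fun t => t) dc (smooth_at_cst (hs x) b) (smooth_at_id b)) _.
    by rewrite derive_cst derive_id.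
  by rewrite (bilinear_Zl (form_multilinear fa ac (chart_funP cq))).
have cd (s : R) : cont_on 0 (2 * pi) (fun b => density a F (s, b)).
  move=> b _; apply: (@smooth_at_continuous _ R _ (fun b : R => density a F (s, b))).
  apply: (@smooth_at_comp _ _ _ _ (fun b : R => (s, b) : P2)).
  - exact: fin_dim_R2.
  - by apply: smooth_at_pair; [exact: smooth_at_cst|exact: smooth_at_id].
  - exact: density_smooth.
have d1 (x : R) : is_derive x 1 hs (derive1 hs x).
  by rewrite derive1E; exact: smooth_is_derive (hs_smooth x).
rewrite /sphere_integral -/(pint 0 pi _).
rewrite (@eq_pint _ _ _ _ (fun x => slice_area a F (hs x) * derive1 hs x)); last first.
  move=> x xpi; rewrite [RHS]mulrC /slice_area -pintZ//; rewrite -/(pint 0 (2 * pi) _).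
  by apply: eq_pint => b _; exact: E.
have cI : cont_on 0 pi (fun x => slice_area a F (hs x) * derive1 hs x).
  move=> x _; apply: cvgM.
    apply: continuous_comp; first exact: smooth_at_continuous (hs_smooth x).
    exact: slice_area_cont.
  have -> : derive1 hs = 'D_1 hs by apply/funext => y; rewrite derive1E.
  exact: smooth_at_continuous (smooth_at_derive _ (hs_smooth x)).
rewrite (@pint_FTC _ _ _ _ (T \o hs) pi0 cI).
have TE (x y : R) : x <= y -> (forall z, x <= z <= y -> slice_area a F z = 0) -> T y = T x.
  by move=> xy H; apply: is_derive_zero_cst => // z zxy; rewrite -(H z zxy).
have z0 z : z < 1 / 4 -> slice_area a F z = 0.
  move=> z4; apply: (slice_area_cst (L := fun=> p)) => //.
  by near=> t => b; apply: F0; apply/ltW; near: t; exact: lt_nbhsl.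
have z1 z : 3 / 4 < z -> slice_area a F z = 0.
  move=> z4; apply: (slice_area_cst (L := fun=> p')) => //.
  by near=> t => b; apply: F1; apply/ltW; near: t; exact: lt_nbhsr.
have h0 : hs 0 = - (3 / 2).
  by rewrite /hs sin0 cos0 expr0n /= axis_height ?oner_eq0// expr1n; lra.
have hpi : hs pi = 5 / 2.
  by rewrite /hs sinpi cospi expr0n /= axis_height ?oppr_eq0 ?oner_eq0// sqrrN expr1n invrN1; lra.
rewrite /= h0 hpi (TE 1 (5 / 2)); last 2 first.
- by lra.
- by move=> z /andP[h _]; apply: z1; lra.
have -> // : T 0 = T (- (3 / 2)).
apply: TE; first by lra.
by move=> z /andP[_ h]; apply: z0; lra.
Unshelve. all: by end_near. Qed.

End Sphere.

Lemma sweeps_sphere (R : realType) (m : nat) (M : manifold R m) (p p' : M) I :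
  sweeps (fun=> p) (fun=> p') I -> exists2 u, smooth_sphere u &
  forall a : preform M 2, is_form a -> sphere_integral a u = I a.
Proof.
move=> [F [cF HF]]; eexists; first exact: sphere_smooth cF.
by move=> a fa; have [T [dT ->]] := HF a fa; exact: (sphere_area cF fa dT).
Qed.

(** * Fibre integration along the action *)

Section Rows.
Context {R : realType} {m : nat}.

Lemma multilinear_of_set_row k (f : 'M[R]_(k, m) -> R) :
  (forall (i : 'I_k) (a b : R) (x y : 'rV[R]_m) v,
    f (set_row i (a *: x + b *: y) v) = a * f (set_row i x v) + b * f (set_row i y v)) ->
  multilinear f.
Proof.
move=> H i a b u v w Hi Hu Hv.
have rr (A : 'M[R]_(k, m)) (j : 'I_k.-1) : row j (row' i A) = row (lift i j) A.
  by apply/rowP => l; rewrite !mxE.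
have E z : row' i z = row' i w -> z = set_row i (row i z) w.
  move=> Hz; apply/row_matrixP => l; rewrite row_set_row.
  case: (unliftP i l) => [j ->|->]; last by rewrite eqxx.
  by rewrite eq_sym (negbTE (neq_lift i j)) -!rr Hz.
by rewrite (E u Hu) (E v Hv) -{1}(set_row_id i w) Hi H.
Qed.

(** Contraction puts a vector in front of the others. The definition by cases on [unlift ord0] fits
    the [lift] calculus of the alternating sums in [ext_d]. *)
Definition cons_row k (x : 'rV[R]_m) (v : 'M[R]_(k, m)) : 'M[R]_(k.+1, m) :=
  \matrix_(i, j) if unlift ord0 i is Some l then v l j else x 0 j.

Lemma row_cons_row0 k x (v : 'M[R]_(k, m)) : row ord0 (cons_row x v) = x.
Proof. by apply/rowP => j; rewrite !mxE unlift_none. Qed.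

Lemma row_cons_rowS k x (v : 'M[R]_(k, m)) l : row (lift ord0 l) (cons_row x v) = row l v.
Proof. by apply/rowP => j; rewrite !mxE liftK. Qed.

Lemma cons_row_set_row k x y (v : 'M[R]_(k, m)) l :
  cons_row x (set_row l y v) = set_row (lift ord0 l) y (cons_row x v).
Proof.
apply/row_matrixP => i; case: (unliftP ord0 i) => [j ->|->].
  by rewrite row_cons_rowS !row_set_row row_cons_rowS (inj_eq lift_inj).
by rewrite row_set_row !row_cons_row0 (negbTE (neq_lift _ _)).
Qed.

Lemma set_row_cons_row0 k x y (v : 'M[R]_(k, m)) :
  set_row ord0 y (cons_row x v) = cons_row y v.
Proof.
apply/row_matrixP => i; rewrite row_set_row; case: (unliftP ord0 i) => [j ->|->].
  by rewrite eq_sym (negbTE (neq_lift _ _)) !row_cons_rowS.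
by rewrite eqxx row_cons_row0.
Qed.

Lemma row'0_cons_row k x (v : 'M[R]_(k, m)) : row' ord0 (cons_row x v) = v.
Proof. by apply/row_matrixP => i; rewrite row_row' row_cons_rowS. Qed.

Lemma row'S_cons_row k x (v : 'M[R]_(k.+1, m)) l :
  row' (lift ord0 l) (cons_row x v) = cons_row x (row' l v).
Proof.
apply/row_matrixP => i; rewrite row_row'; case: (unliftP ord0 i) => [j ->|->].
  rewrite row_cons_rowS row_row'.
  have -> : lift (lift ord0 l) (lift ord0 j) = lift ord0 (lift l j).
    by apply: val_inj; rewrite /= /bump /= !add1n ltnS !addnS.
  by rewrite row_cons_rowS.
have -> : lift (lift ord0 l) ord0 = ord0 by apply: val_inj.
by rewrite !row_cons_row0.
Qed.

Lemma cons_row1 (x v : 'rV[R]_m) : cons_row x v = (col_mx x v : 'M[R]_(2, m)).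
Proof.
apply/row_matrixP => i; case: (unliftP ord0 i) => [j ->|->].
  rewrite row_cons_rowS; have -> : lift ord0 j = 1 by apply: val_inj; rewrite (ord1 j).
  by rewrite row1_col_mx (ord1 j); apply/rowP => l; rewrite !mxE.
by rewrite row_cons_row0 -[ord0]/(0 : 'I_2) row0_col_mx.
Qed.

Lemma cons_row_mul k x (v : 'M[R]_(k, m)) (N : 'M[R]_m) :
  cons_row x v *m N = cons_row (x *m N) (v *m N).
Proof.
apply/row_matrixP => i; rewrite row_mul; case: (unliftP ord0 i) => [j ->|->].
  by rewrite !row_cons_rowS row_mul.
by rewrite !row_cons_row0.
Qed.

Lemma set_row_mul k l x (v : 'M[R]_(k, m)) (N : 'M[R]_m) :
  set_row l x v *m N = set_row l (x *m N) (v *m N).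
Proof.
by apply/row_matrixP => i; rewrite row_mul !row_set_row; case: eqP => // _; rewrite row_mul.
Qed.

Lemma multilinear_mul k (f : 'M[R]_(k, m) -> R) (N : 'M[R]_m) :
  multilinear f -> multilinear (fun v => f (v *m N)).
Proof.
move=> mf; apply: multilinear_of_set_row => i a b x y v.
by rewrite !set_row_mul mulmxDl -!scalemxAl multilinear_set_row.
Qed.

Lemma alternating_mul k (f : 'M[R]_(k, m) -> R) (N : 'M[R]_m) :
  alternating f -> alternating (fun v => f (v *m N)).
Proof. by move=> af v i j ij E; apply: (af _ i j ij); rewrite !row_mul E. Qed.

Lemma multilinear_cons k (f : 'M[R]_(k.+1, m) -> R) (x : 'rV[R]_m) :
  multilinear f -> multilinear (fun v : 'M[R]_(k, m) => f (cons_row x v)).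
Proof.
move=> mf; apply: multilinear_of_set_row => i a b y z v.
by rewrite !cons_row_set_row multilinear_set_row.
Qed.

Lemma alternating_cons k (f : 'M[R]_(k.+1, m) -> R) (x : 'rV[R]_m) :
  alternating f -> alternating (fun v : 'M[R]_(k, m) => f (cons_row x v)).
Proof.
move=> af v i j ij E; apply: (af _ (lift ord0 i) (lift ord0 j)).
  by rewrite (inj_eq lift_inj).
by rewrite !row_cons_rowS.
Qed.

Lemma multilinear_pint k (f : R -> 'M[R]_(k, m) -> R) (s t : R) :
  (forall v, cont_on s t (f ^~ v)) -> (forall u, s <= u <= t -> multilinear (f u)) ->
  multilinear (fun v => pint s t (f ^~ v)).
Proof.
move=> cf mf; apply: multilinear_of_set_row => i a b x y v.
rewrite -!pintZ// -pintD; last 2 first.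
- by apply: cont_onM => //; exact: cont_on_cst.
- by apply: cont_onM => //; exact: cont_on_cst.
by apply: eq_pint => u /mf mu; rewrite multilinear_set_row.
Qed.

Lemma pint0 (s t : R) : pint s t (fun=> 0) = 0.
Proof.
have E : (fun=> 0) = (fun t : R => 0 * (0 : R)) by apply/funext => u; rewrite mul0r.
by rewrite E pintZ ?mul0r//; exact: cont_on_cst.
Qed.

Lemma alternating_pint k (f : R -> 'M[R]_(k, m) -> R) (s t : R) :
  (forall u, s <= u <= t -> alternating (f u)) ->
  alternating (fun v => pint s t (f ^~ v)).
Proof.
move=> af v i j ij E; rewrite -[RHS](pint0 s t); apply: eq_pint => u /af au.
exact: au ij E.
Qed.

End Rows.

Section Flow.
Context {R : realType} {m : nat} {M : manifold R m}.
Variable act : R -> M -> M.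
Hypothesis sact : smooth_circle_action act.
Notation V := (R^o * 'rV[R]_m)%type.
Notation X := (action_field act).

Definition flow (c : chart R m M) : V -> M := fun p => act p.1 (chart_inv c p.2).

Lemma flow_smooth c (p : V) : atlas c -> chart_img c p.2 -> msmooth_at (flow c) p.
Proof. by move=> ac cp; exact: (act_param_smooth sact ac cp). Qed.

Lemma snd_near (p : V) (P : 'rV[R]_m -> Prop) : (\forall y \near p.2, P y) -> \forall q \near p, P q.2.
Proof.
move=> H; have c2 : ((q.2 : 'rV[R]_m) @[q --> p]) --> p.2 by exact: cvg_snd.
exact: (c2 [set y | P y] H).
Qed.

Lemma img_near (c : chart R m M) (y : 'rV[R]_m) : chart_img c y -> \forall z \near y, chart_img c z.
Proof. by move=> cy; apply: open_nbhs_nbhs; split=> //; exact: chart_img_open. Qed.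

Lemma flow_near_smooth c (p : V) : atlas c -> chart_img c p.2 -> \forall q \near p, msmooth_at (flow c) q.
Proof.
by move=> ac cp; apply: filterS (snd_near (img_near cp)) => q; exact: flow_smooth.
Qed.

Lemma fin_dim_V : fin_dim (V : normedModType R).
Proof. by apply: fin_dim_prod; [exact: fin_dim_scalar|exact: fin_dim_mx]. Qed.

Lemma smooth_fstV (p : V) : smooth_at (fun q : V => q.1) p.
Proof.
apply: (@smooth_at_linear _ _ _ _ (@fst R^o 'rV[R]_m : {linear V -> R^o})) => //.
  by move=> q; exact: cvg_fst.
exact: smooth_at_id.
Qed.

Lemma smooth_sndV (p : V) : smooth_at (fun q : V => q.2) p.
Proof.
apply: (@smooth_at_linear _ _ _ _ (@snd R^o 'rV[R]_m : {linear V -> 'rV[R]_m})) => //.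
  by move=> q; exact: cvg_snd.
exact: smooth_at_id.
Qed.

Lemma derive_fstV (p v : V) : 'D_v (fun q : V => q.1) p = v.1.
Proof.
apply: etrans (@derive_linear _ _ _ _ (@fst R^o 'rV[R]_m : {linear V -> R^o}) (fun q => q) p v _ _) _.
- by move=> q; exact: cvg_fst.
- exact: smooth_at_differentiable (smooth_at_id _).
- by rewrite derive_id.
Qed.

Lemma derive_sndV (p v : V) : 'D_v (fun q : V => q.2) p = v.2.
Proof.
apply: etrans (@derive_linear _ _ _ _ (@snd R^o 'rV[R]_m : {linear V -> 'rV[R]_m}) (fun q => q) p v _ _) _.
- by move=> q; exact: cvg_snd.
- exact: smooth_at_differentiable (smooth_at_id _).
- by rewrite derive_id.
Qed.

Lemma derive_snd_comp (W : normedModType R) (g : 'rV[R]_m -> W) (q v : V) : differentiable g q.2 ->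
  'D_v (fun q : V => g q.2) q = 'D_(v.2) g q.2.
Proof.
move=> dg; have ds := smooth_at_differentiable (smooth_sndV q).
have := derive_comp v ds dg; rewrite derive_sndV; exact.
Qed.

Lemma derive_dir_mx (g : V -> 'rV[R]_m) p : differentiable g p ->
  exists N : 'M[R]_m, forall u, 'D_(0, u) g p = u *m N.
Proof.
move=> dg; pose f (u : 'rV[R]_m) := 'd g p ((0, u) : V).
have lf : linear f.
  move=> a u v; rewrite /f -linearZ -linearD; congr ('d g p _).
  by rewrite -[RHS]/(_, _) /= scaler0 addr0.
pose fL : {linear 'rV[R]_m -> 'rV[R]_m} := HB.pack f (GRing.isLinear.Build _ _ _ _ f lf).
by exists (lin1_mx fL) => u; rewrite mul_rV_lin1 deriveE.
Qed.

(* [act] carries the vector field [X] to itself. *)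
Lemma flow_derive_time c (W : normedModType R) (g : M -> W) (t : R) y : atlas c -> chart_img c y ->
  differentiable (fun q => g (flow c q)) ((t, y) : V) ->
  'D_((1, 0) : V) (fun q => g (flow c q)) (t, y) = 'D_((0, X c y) : V) (fun q => g (flow c q)) (t, y).
Proof.
move=> ac cy dG; pose x := chart_inv c y; have cx : chart_dom c x := chart_invP cy.
have so : smooth_at (fun s : R => c (act s x)) 0.
  by apply: (orbit_smooth sact x 0).2 => //; rewrite act0.
pose f1 (s : R) : V := (t + s, y); pose f2 (s : R) : V := (t, c (act s x)).
have f10 : f1 0 = (t, y) by rewrite /f1 addr0.
have f20 : f2 0 = (t, y) by rewrite /f2 act0// chart_invK.
have d1 : differentiable f1 0.
  apply: smooth_at_differentiable; apply: smooth_at_pair; last exact: smooth_at_cst.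
  by apply: smooth_atD; [exact: smooth_at_cst|exact: smooth_at_id].
have d2 : differentiable f2 0.
  by apply: smooth_at_differentiable; apply: smooth_at_pair => //; exact: smooth_at_cst.
have e1 : 'D_1 f1 0 = (1, 0).
  rewrite derive_pair; last 2 first.
  - by apply: smooth_at_differentiable; apply: smooth_atD; [exact: smooth_at_cst|exact: smooth_at_id].
  - exact: differentiable_cst.
  by rewrite derive_cst deriveD// derive_cst derive_id add0r.
have e2 : 'D_1 f2 0 = (0, X c y).
  rewrite derive_pair; last 2 first.
  - exact: differentiable_cst.
  - exact: smooth_at_differentiable.
  by rewrite derive_cst /action_field derive1E.
have E1 := @derive_comp _ _ _ _ (fun q => g (flow c q)) f1 0 1 d1.
have E2 := @derive_comp _ _ _ _ (fun q => g (flow c q)) f2 0 1 d2.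
rewrite e1 f10 in E1; rewrite e2 f20 in E2; rewrite -(E1 dG) -(E2 dG).
apply: near_eq_derive.
have nd : \forall s \near (0 : R), chart_dom c (act s x).
  apply: (near_dom (f := fun s : R => act s x)); first exact: (orbit_smooth sact x 0).1.
  by rewrite act0.
apply: filterS nd => s cs; rewrite /flow /f1 /f2 /= chart_funK// -(actD sact).
by rewrite -/x addrC (addrC s).
Qed.

Lemma flow_chart_change c c' (W : normedModType R) (g : M -> W) (t a : R) y u :
  atlas c -> atlas c' -> overlap c c' y ->
  differentiable (fun q => g (flow c' q)) ((t, transition c c' y) : V) ->
  'D_((a, u) : V) (fun q => g (flow c q)) (t, y) =
  'D_((a, u *m 'J (transition c c') y) : V) (fun q => g (flow c' q)) (t, transition c c' y).
Proof.
move=> ac ac' oy dG; have st := transition_smooth_at ac ac' oy.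
pose f (q : V) : V := (q.1, transition c c' q.2).
have s2 : smooth_at (fun q : V => transition c c' q.2) ((t, y) : V).
  by apply: smooth_at_comp; [exact: fin_dim_mx|exact: smooth_sndV|].
have df : differentiable f ((t, y) : V).
  by apply: smooth_at_differentiable; apply: smooth_at_pair => //; exact: smooth_fstV.
have e : 'D_((a, u) : V) f ((t, y) : V) = (a, u *m 'J (transition c c') y).
  rewrite derive_pair; last 2 first.
  - exact: smooth_at_differentiable (smooth_fstV _).
  - exact: smooth_at_differentiable.
  rewrite derive_fstV jacobianE//; congr pair.
have E := @derive_comp _ _ _ _ (fun q => g (flow c' q)) f ((t, y) : V) (a, u) df dG.
rewrite e in E; rewrite -E; apply: near_eq_derive.
have := snd_near (p := (t, y)) (overlap_nbhs oy).
by apply: filterS => q [cq c'q]; rewrite /flow /f /= /transition chart_funK.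
Qed.

Lemma mpull_eq (V1 V2 : normedModType R) k (a : preform M k) (F : V1 -> M) (F' : V2 -> M)
    (w : 'I_k -> V1) (w' : 'I_k -> V2) p p' : F p = F' p' ->
  (forall l, 'D_(w l) (fun q => chart_at (F p) (F q)) p =
     'D_(w' l) (fun q => chart_at (F p) (F' q)) p') ->
  mpull a F w p = mpull a F' w' p'.
Proof.
move=> E H; rewrite /mpull -E; congr (a _ _ _).
by apply/matrixP => i j; rewrite !mxE H.
Qed.

Definition sdir k (v : 'M[R]_(k, m)) (i : 'I_k) : V := (0, row i v).

(** Time comes first: the flow pushes these directions to X followed by the images of the rows of
    v. *)
Definition wdir k (v : 'M[R]_(k, m)) (i : 'I_k.+1) : V :=
  if unlift ord0 i is Some j then (0, row j v) else (1, 0).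

(* [shift t a] is the pullback of [a] by [act t]; [fib s t a] is the integral over
   [s, t] of the contraction of its pullbacks with [X]. *)
Definition shift (t : R) k (a : preform M k) : preform M k :=
  fun c y v => mpull a (flow c) (sdir v) (t, y).

Definition fib (s t : R) k (a : preform M k.+1) : preform M k :=
  fun c y v => pint s t (fun r => mpull a (flow c) (wdir v) (r, y)).

(** N is the derivative of [act t] read in the two charts. The time derivative is the image of
    [X c y] under it because the flow preserves X, so that contraction may precede the pullback. *)
Lemma flow_jac c c' (t : R) y : atlas c -> chart_img c y -> atlas c' -> chart_dom c' (flow c (t, y)) ->
  exists N : 'M[R]_m, forall k (v : 'M[R]_(k, m)),
    mjac c' (flow c) (sdir v) (t, y) = v *m N /\
    mjac c' (flow c) (wdir v) (t, y) = cons_row (X c y) v *m N.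
Proof.
move=> ac cy ac' c'y.
have sG : smooth_at (fun q => c' (flow c q)) ((t, y) : V) by apply: (flow_smooth (p := (t, y)) ac cy).2.
have dG := smooth_at_differentiable sG.
have [N HN] := derive_dir_mx dG; exists N => k v; split.
  by apply/row_matrixP => i; rewrite row_mul -HN; apply/rowP => j; rewrite !mxE.
apply/row_matrixP => i; rewrite row_mul -HN; apply/rowP => j; rewrite !mxE /wdir.
case: (unliftP ord0 i) => [l ->|->]; first by rewrite row_cons_rowS.
by rewrite row_cons_row0 -(flow_derive_time ac cy dG).
Qed.

Lemma mpull_wdir k (a : preform M k.+1) c (v : 'M[R]_(k, m)) (t : R) y : atlas c -> chart_img c y ->
  mpull a (flow c) (wdir v) (t, y) = shift t a c y (cons_row (X c y) v).
Proof.
move=> ac cy; have [N HN] := flow_jac ac cy (chart_at_atlas _) (chart_at_dom (flow c (t, y))).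
by rewrite /shift /mpull (HN _ _).2 (HN _ _).1.
Qed.

Lemma mpull_wdir_smooth k (a : preform M k.+1) c (v : 'M[R]_(k, m)) (p : V) : is_form a ->
  atlas c -> chart_img c p.2 -> smooth_at (mpull a (flow c) (wdir v)) p.
Proof. by move=> fa ac cp; apply: mpull_smooth_at => //; exact: flow_near_smooth. Qed.

Lemma mpull_sdir_smooth k (a : preform M k) c (v : 'M[R]_(k, m)) (p : V) : is_form a ->
  atlas c -> chart_img c p.2 -> smooth_at (mpull a (flow c) (sdir v)) p.
Proof. by move=> fa ac cp; apply: mpull_smooth_at => //; exact: flow_near_smooth. Qed.

Lemma slice_time (W : normedModType R) (G : V -> W) (t : R) y : smooth_at G (t, y) ->
  smooth_at (fun r : R => G (r, y)) t /\
  'D_1 (fun r : R => G (r, y)) t = 'D_((1, 0) : V) G (t, y).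
Proof.
move=> sG; have sp : smooth_at (fun r : R => ((r, y) : V)) t.
  by apply: smooth_at_pair; [exact: smooth_at_id|exact: smooth_at_cst].
split; first by apply: (@smooth_at_comp _ _ _ _ (fun r : R => ((r, y) : V))) => //; exact: fin_dim_V.
rewrite (@derive_comp _ _ _ _ G (fun r : R => ((r, y) : V))).
- rewrite derive_pair; last 2 first.
  + exact: smooth_at_differentiable (smooth_at_id _).
  + exact: differentiable_cst.
  by rewrite derive_cst derive_id.
- exact: smooth_at_differentiable.
- exact: smooth_at_differentiable.
Qed.

Lemma slice_space (W : normedModType R) (G : V -> W) (t : R) y u : smooth_at G (t, y) ->
  smooth_at (fun z => G (t, z)) y /\
  'D_u (fun z => G (t, z)) y = 'D_((0, u) : V) G (t, y).
Proof.
move=> sG; have sp : smooth_at (fun z : 'rV[R]_m => ((t, z) : V)) y.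
  by apply: smooth_at_pair; [exact: smooth_at_cst|exact: smooth_at_id].
split; first by apply: (@smooth_at_comp _ _ _ _ (fun z : 'rV[R]_m => ((t, z) : V))) => //; exact: fin_dim_V.
rewrite (@derive_comp _ _ _ _ G (fun z : 'rV[R]_m => ((t, z) : V))).
- rewrite derive_pair; last 2 first.
  + exact: differentiable_cst.
  + exact: smooth_at_differentiable (smooth_at_id _).
  by rewrite derive_cst derive_id.
- exact: smooth_at_differentiable.
- exact: smooth_at_differentiable.
Qed.

Lemma shift_form t k (a : preform M k) : is_form a -> is_form (shift t a).
Proof.
move=> fa c ac; split.
- move=> y cy; have [N HN] := flow_jac ac cy (chart_at_atlas _) (chart_at_dom (flow c (t, y))).
  have -> : shift t a c y = (fun v => a (chart_at (flow c (t, y))) (chart_at (flow c (t, y)) (flow c (t, y))) (v *m N)).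
    by apply/funext => v; rewrite /shift /mpull (HN _ _).1.
  have cy' := chart_funP (chart_at_dom (flow c (t, y))).
  split; [apply: multilinear_mul|apply: alternating_mul].
    exact: form_multilinear fa (chart_at_atlas _) cy'.
  exact: form_alternating fa (chart_at_atlas _) cy'.
- move=> v; apply/smooth_onP => [|y cy]; first exact: chart_img_open.
  exact: (slice_space 0 (mpull_sdir_smooth v (p := (t, y)) fa ac cy)).1.
- move=> c' ac' y oy v; have [cy c'y] := oy; have c'y' := overlap_img oy.
  have E : flow c (t, y) = flow c' (t, transition c c' y).
    by rewrite /flow /= /transition chart_funK.
  apply: mpull_eq => // l.
  have -> : sdir (v *m 'J (transition c c') y) l = (0, row l v *m 'J (transition c c') y).
    by rewrite /sdir row_mul.
  apply: (flow_chart_change (g := chart_at (flow c (t, y)))) => //.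
  apply: smooth_at_differentiable; apply: (flow_smooth (p := (t, transition c c' y)) ac' c'y').2.
    exact: chart_at_atlas.
  by rewrite -E; exact: chart_at_dom.
Qed.

Lemma fibE s t k (a : preform M k.+1) c y v : atlas c -> chart_img c y ->
  fib s t a c y v = pint s t (fun r => shift r a c y (cons_row (X c y) v)).
Proof. by move=> ac cy; apply: eq_pint => r _; rewrite mpull_wdir. Qed.

Lemma fib_cont s t k (a : preform M k.+1) c y v : is_form a -> atlas c -> chart_img c y ->
  cont_on s t (fun r => mpull a (flow c) (wdir v) (r, y)).
Proof.
move=> fa ac cy r _; apply: smooth_at_continuous.
exact: (slice_time (mpull_wdir_smooth v (p := (r, y)) fa ac cy)).1.
Qed.

Lemma shift_cont s t k (a : preform M k) c y v : is_form a -> atlas c -> chart_img c y ->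
  cont_on s t (fun r => shift r a c y v).
Proof.
move=> fa ac cy r _; apply: smooth_at_continuous.
exact: (slice_time (mpull_sdir_smooth v (p := (r, y)) fa ac cy)).1.
Qed.

Lemma fib_form s t k (a : preform M k.+1) : s <= t -> is_form a -> is_form (fib s t a).
Proof.
move=> st fa c ac; split.
- move=> y cy; have sf r := shift_form r fa; split.
    have -> : fib s t a c y = (fun v => pint s t (fun r => shift r a c y (cons_row (X c y) v))).
      by apply/funext => v; rewrite fibE.
    apply: (@multilinear_pint _ _ _ (fun r v => shift r a c y (cons_row (X c y) v))) => [v r rst|r _].
      by move: (@shift_cont s t _ a c y (cons_row (X c y) v) fa ac cy r rst).
    by apply: multilinear_cons; exact: form_multilinear (sf r) ac cy.
  have -> : fib s t a c y = (fun v => pint s t (fun r => shift r a c y (cons_row (X c y) v))).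
    by apply/funext => v; rewrite fibE.
  apply: (@alternating_pint _ _ _ (fun r v => shift r a c y (cons_row (X c y) v))) => r _.
  by apply: alternating_cons; exact: form_alternating (sf r) ac cy.
- move=> v; apply: (pint_smooth (@fin_dim_mx R 1 m) st (@chart_img_open _ _ _ c) _).1 => r y _ cy.
  exact: (mpull_wdir_smooth v (p := (r, y)) fa ac cy).
- move=> c' ac' y oy v; have [cy c'y] := oy; have c'y' := overlap_img oy.
  have E1 := @fibE s t k a c y v ac cy.
  have E2 := @fibE s t k a c' _ (v *m 'J (transition c c') y) ac' c'y'.
  rewrite E1 E2; apply: eq_pint => r _.
  rewrite (form_transition _ (shift_form r fa) ac ac' oy) cons_row_mul.
  have -> // : X c y *m 'J (transition c c') y = X c' (transition c c' y).
  have := action_field_change sact ac ac' (chart_invP cy) c'y.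
  by rewrite chart_invK// => <-.
Qed.

Lemma wdir_lift0 k (v : 'M[R]_(k, m)) : (fun l => wdir v (lift ord0 l)) = sdir v.
Proof. by apply/funext => l; rewrite /wdir liftK. Qed.

Lemma wdir_liftS k (v : 'M[R]_(k.+1, m)) j :
  (fun l => wdir v (lift (lift ord0 j) l)) = wdir (row' j v).
Proof.
apply/funext => l; case: (unliftP ord0 l) => [i ->|->].
  have -> : lift (lift ord0 j) (lift ord0 i) = lift ord0 (lift j i).
    by apply: val_inj; rewrite /= /bump /= !add1n ltnS !addnS.
  by rewrite /wdir !liftK row_row'.
have -> : lift (lift ord0 j) ord0 = ord0 by apply: val_inj.
by rewrite /wdir !unlift_none.
Qed.

(* The infinitesimal form of Cartan's formula. *)
Lemma flow_cartan k (a : preform M k.+1) c (p : V) (v : 'M[R]_(k.+1, m)) : is_form a ->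
  atlas c -> chart_img c p.2 ->
  'D_((1, 0) : V) (mpull a (flow c) (sdir v)) p -
  \sum_(j < k.+1) (-1) ^+ j * 'D_(sdir v j) (mpull a (flow c) (wdir (row' j v))) p =
  mpull (ext_d a) (flow c) (wdir v) p.
Proof.
move=> fa ac cp; rewrite -(mpull_ext_d _ fa (flow_near_smooth ac cp)) [RHS]big_ord_recl.
have e0 : wdir v ord0 = (1, 0) by rewrite /wdir unlift_none.
have eS j : wdir v (lift ord0 j) = sdir v j by rewrite /wdir liftK.
rewrite expr0 mul1r wdir_lift0 e0 -sumrN; apply: (f_equal (fun z => _ + z)).
by apply: eq_bigr => j _; rewrite wdir_liftS eS lift0 exprS mulN1r mulNr.
Qed.

(** Cartan's formula integrated over [s, t]: the time derivative of the pullbacks integrates to the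
    difference of the two end pullbacks. *)
Lemma fib_ext_d s t k (a : preform M k.+1) c y (v : 'M[R]_(k.+1, m)) : s <= t -> is_form a ->
  atlas c -> chart_img c y ->
  ext_d (fib s t a) c y v = shift t a c y v - shift s a c y v - fib s t (ext_d a) c y v.
Proof.
move=> st fa ac cy.
have sw j r : smooth_at (mpull a (flow c) (wdir (row' j v))) (r, y).
  exact: mpull_wdir_smooth.
have ss r : smooth_at (mpull a (flow c) (sdir v)) (r, y) by exact: mpull_sdir_smooth.
pose f j r := 'D_(sdir v j) (mpull a (flow c) (wdir (row' j v))) (r, y).
have cf j : cont_on s t (f j).
  move=> r _; apply: smooth_at_continuous.
  exact: (slice_time (smooth_at_derive (sdir v j) (sw j r))).1.
have -> : ext_d (fib s t a) c y v = \sum_(j < k.+1) (-1) ^+ j * pint s t (f j).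
  apply: eq_bigr => j _; congr (_ * _).
  have := (pint_smooth (@fin_dim_mx R 1 m) st (@chart_img_open _ _ _ c) (f := mpull a (flow c) (wdir (row' j v)))
    (fun r z _ cz => mpull_wdir_smooth (row' j v) (p := (r, z)) fa ac cz)).2 y (row j v) cy.
  exact.
have E : fib s t (ext_d a) c y v = pint s t (fun r => 'D_((1, 0) : V) (mpull a (flow c) (sdir v)) (r, y) -
    \sum_(j < k.+1) (-1) ^+ j * f j r).
  by apply: eq_pint => r _; rewrite -flow_cartan.
have c1 : cont_on s t (fun r => 'D_((1, 0) : V) (mpull a (flow c) (sdir v)) (r, y)).
  move=> r _; apply: smooth_at_continuous.
  exact: (slice_time (smooth_at_derive _ (ss r))).1.
have c2 (j : 'I_k.+1) : cont_on s t (fun r => (-1) ^+ j * f j r).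
  by apply: cont_onM; [exact: cont_on_cst|exact: cf].
rewrite E pintB//; last first.
  by move=> r rst; apply: cont_sum => j; exact: c2.
have S1 (g : 'I_k.+1 -> R -> R) : (forall j, cont_on s t (g j)) ->
    pint s t (fun r => \sum_(j < k.+1) (-1) ^+ j * g j r) = \sum_(j < k.+1) (-1) ^+ j * pint s t (g j).
  move=> cg; rewrite (@pint_sum _ s t _ (fun j r => (-1) ^+ (j : 'I_k.+1) * g j r)).
    by apply: eq_bigr => j _; rewrite (pintZ _ (cg j)).
  by move=> j; apply: cont_onM; [exact: cont_on_cst|exact: cg].
rewrite (S1 f cf).
have dG (r : R) : is_derive r 1 (fun r : R => mpull a (flow c) (sdir v) (r, y))
    ('D_((1, 0) : V) (mpull a (flow c) (sdir v)) (r, y)).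
  by have [s1 <-] := slice_time (ss r); exact: smooth_is_derive.
have F1 := pint_FTC st c1 (fun r _ => dG r).
have fin (A B D Q : R) : Q = A - B -> D = A - B - (Q - D) by move=> ->; ring.
exact: (fin _ _ _ _ F1).
Qed.

Lemma shift0 k (a : preform M k) c y v : is_form a -> atlas c -> chart_img c y -> shift 0 a c y v = a c y v.
Proof.
move=> fa ac cy; have F0 z : flow c (0, z) = chart_inv c z by rewrite /flow /= act0.
have c0 : chart_dom c (flow c (0, y)) by rewrite F0; exact: chart_invP.
have sF := flow_smooth (p := (0, y)) ac cy.
rewrite /shift (mpullE _ fa ac c0 sF) F0 chart_invK//; congr (a c y _).
apply/row_matrixP => i; apply/rowP => j; rewrite !mxE.
rewrite -(slice_space _ (sF.2 c ac c0)).2.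
transitivity ('D_(row i v) id y 0 j); last by rewrite derive_id mxE.
congr (fun_of_matrix _ 0 j); apply: near_eq_derive.
by apply: filterS (img_near cy) => z cz; rewrite F0 chart_invK.
Qed.

Lemma shift1 k (a : preform M k) c y v : is_form a -> atlas c -> chart_img c y -> shift 1 a c y v = a c y v.
Proof.
move=> fa ac cy; rewrite -[RHS](shift0 v fa ac cy) /shift.
have F1 z : flow c (1, z) = flow c (0, z) by rewrite /flow /= act1// act0.
apply: mpull_eq => // l.
have s1 (t : R) : chart_dom (chart_at (flow c (1, y))) (flow c (t, y)) ->
    smooth_at (fun q => chart_at (flow c (1, y)) (flow c q)) ((t, y) : V).
  by apply: (flow_smooth (p := (t, y)) ac cy).2; exact: chart_at_atlas.
rewrite -(slice_space _ (s1 1 (chart_at_dom _))).2 -(slice_space _ (s1 0 _)).2; last first.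
  by rewrite -F1; exact: chart_at_dom.
by apply: near_eq_derive; apply: filterE => z; rewrite (F1 z).
Qed.

Lemma mpull_closed k (a : preform M k) (V1 : normedModType R) (F : V1 -> M) (w : 'I_k.+1 -> V1) p :
  closed_form a -> mpull (ext_d a) F w p = 0.
Proof. by move=> da; rewrite /mpull da//; [exact: chart_at_atlas|exact/chart_funP/chart_at_dom]. Qed.

(** By Cartan's formula the time derivative of the pullback is the pullback of d(i_X w) plus that of
    a contraction of dw; both forms vanish. *)
Lemma shift_invariant (w : preform M 2) t c y (v : 'M[R]_(2, m)) : is_form w -> closed_form w ->
  symplectic_action w act -> atlas c -> chart_img c y -> shift t w c y v = w c y v.
Proof.
move=> fw dw dal ac cy; rewrite -[RHS](shift0 v fw ac cy).
have fal := contraction_form sact fw.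
(* Contraction with X commutes with pullback by the flow. *)
have wal (u : 'rV[R]_m) (q : V) : chart_img c q.2 ->
    mpull (contraction X w) (flow c) (sdir u) q = mpull w (flow c) (wdir u) q.
  case: q => r z /= cz; have [N HN] := flow_jac ac cz (chart_at_atlas _) (chart_at_dom (flow c (r, z))).
  rewrite /mpull (HN _ _).1 (HN _ _).2 cons_row_mul cons_row1 /contraction; congr (w _ _ _).
  apply: (f_equal (fun x : 'rV[R]_m => col_mx x (u *m N))).
  set c' := chart_at _; have ac' : atlas c' := chart_at_atlas _.
  have c'z : chart_dom c' (flow c (r, z)) := chart_at_dom _.
  rewrite -(orbit_derive sact ac')// (slice_time ((flow_smooth (p := (r, z)) ac cz).2 c' ac' c'z)).2.
  have sG := (flow_smooth (p := (r, z)) ac cz).2 c' ac' c'z.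
  have dG := smooth_at_differentiable sG.
  rewrite (flow_derive_time ac cz dG).
  rewrite -(HN 1%N (X c z)).1.
  by apply/rowP => j; rewrite mxE /sdir row_id.
have D0 (r : R) : is_derive r 1 (fun r => mpull w (flow c) (sdir v) (r, y)) 0.
  have ss := mpull_sdir_smooth v (p := (r, y)) fw ac cy.
  have [s1 e1] := slice_time ss.
  have H := @smooth_is_derive R R^o R^o _ r 1 s1.
  have C := etrans (@flow_cartan _ w c (r, y) v fw ac cy) (mpull_closed (flow c) (wdir v) (r, y) dw).
  move/eqP: C; rewrite subr_eq0 => /eqP C.
  apply: (is_derive_eq H); apply: etrans e1 _; apply: etrans C _.
  change ( \sum_(j < 2) (-1) ^+ j * 'D_(sdir v j) (mpull w (flow c) (wdir (row' j v))) (r, y) = 0).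
  transitivity (mpull (ext_d (contraction X w)) (flow c) (sdir v) (r, y)); last exact: mpull_closed.
  rewrite -(mpull_ext_d _ fal (flow_near_smooth ac (p := (r, y)) cy)); apply: eq_bigr => j _; congr (_ * _).
  have -> : (fun l => sdir v (lift j l)) = sdir (row' j v).
    by apply/funext => l; rewrite /sdir row_row'.
  by apply: near_eq_derive; apply: filterS (snd_near (p := (r, y)) (img_near cy)) => q cq; rewrite wal.
have [t0|t0] := leP 0 t.
  by apply: (is_derive_zero_cst (F := fun r => mpull w (flow c) (sdir v) (r, y))) => // r _; exact: D0.
by apply/esym; apply: (is_derive_zero_cst (F := fun r => mpull w (flow c) (sdir v) (r, y))); exact: ltW.
Qed.

Lemma fib_symplectic (w : preform M 2) : is_form w -> closed_form w ->
  symplectic_action w act -> form_eq (fib 0 1 w) (contraction X w).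
Proof.
move=> fw dw sw c ac y cy v; rewrite fibE//.
rewrite (@eq_pint _ _ _ _ (fun=> contraction X w c y v)); last first.
  by move=> r _; rewrite shift_invariant// cons_row1.
set K := contraction X w c y v.
have cK : cont_on 0 1 (fun=> K : R) by move=> r _; exact: cvg_cst.
have dK (t : R) : is_derive t 1 (fun r : R => r * K) K.
  have := is_deriveM (is_derive_id t 1) (is_derive_cst K t 1).
  by rewrite /GRing.scale /= mulr0 add0r mulr1.
by rewrite (pint_FTC ler01 cK (fun t _ => dK t)) mul1r mul0r subr0.
Qed.

End Flow.

Lemma primitive_unique (R : realType) (f F G : R -> R) (a b : R) : a <= b ->
  (forall t : R, a <= t <= b -> is_derive t 1 F (f t)) ->
  (forall t : R, a <= t <= b -> is_derive t 1 G (f t)) -> F b - F a = G b - G a.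
Proof.
move=> ab dF dG.
have H t : a <= t <= b -> is_derive t 1 (fun t => F t - G t) 0.
  by move=> h; have := is_deriveB (dF t h) (dG t h); rewrite subrr.
have := is_derive_zero_cst ab H; lra.
Qed.

Lemma pint_scale (R : realType) (f : R -> R) (k : R) : 0 < k -> continuous f ->
  pint 0 k (fun b => f (b / k)) = k * pint 0 1 f.
Proof.
move=> k0 cf; have [T dT] := exists_primitive cf.
rewrite (pint_FTC (F := T) ler01); last first.
  by move=> t _; exact: cf.
have aff (z : R) : is_derive z 1 (fun z : R => z / k) k^-1.
  have := is_deriveM (is_derive_id z 1) (is_derive_cst k^-1 z 1).
  by rewrite /GRing.scale /= mulr0 add0r mulr1.
have H (z : R) : is_derive z 1 (fun z => k * T (z / k)) (f (z / k)).
  have H1 := is_derive1_comp (dT _) (aff z).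
  by apply: is_derive_eq; rewrite /GRing.scale /= mulrCA mulfV ?mulr1// gt_eqF.
rewrite (pint_FTC (F := fun z => k * T (z / k)) (ltW k0)).
- by rewrite divff ?gt_eqF// mul0r mulrBr.
- by move=> z _; apply: (@continuous_comp _ _ _ (fun z : R => z / k) f); [exact: mulrr_continuous|exact: cf].
Qed.

(** * The cylinder swept by the orbits of the points of a segment *)

Section Segment.
Context {R : realType} {m : nat} {M : manifold R m}.
Variable act : R -> M -> M.
Hypothesis sact : smooth_circle_action act.
Notation V := (R^o * 'rV[R]_m)%type.
Notation P2 := (R^o * R^o)%type.
Notation X := (action_field act).

(** All primitives of the slice area have the same increment from 0 to 1, so the area can be
    computed with whichever is at hand. *)
Lemma sweeps_value (F : P2 -> M) (L L' : R -> M) : cylinder F L L' -> exists I, sweeps L L' I /\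
  forall a, is_form a -> forall T : R -> R, (forall s : R, is_derive s 1 T (slice_area a F s)) ->
    I a = T 1 - T 0.
Proof.
move=> cF; have [sF _ _ _] := cF.
have H a : {T : R -> R | is_form a -> forall s : R, is_derive s 1 T (slice_area a F s)}.
  apply: cid; have [fa|nfa] := pselect (is_form a); last by exists (fun=> 0).
  by have [T HT] := exists_primitive (slice_area_cont fa sF); exists T.
exists (fun a => sval (H a) 1 - sval (H a) 0); split.
  by exists F; split=> // a fa; exists (sval (H a)); split=> //; exact: (svalP (H a)).
move=> a fa T dT.
exact: (primitive_unique ler01 (fun t _ => svalP (H a) fa t) (fun t _ => dT t)).
Qed.

Definition orbit (x : M) (b : R) : M := act (b / (2 * pi)) x.

Lemma orbit_msmooth x (b : R) : msmooth_at (orbit x) b.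
Proof.
apply: (@msmooth_act _ _ _ _ sact _ (fun b : R => b / (2 * pi)) (fun=> x)); last exact: msmooth_at_cst.
by apply: smooth_atM; [exact: smooth_at_id|exact: smooth_at_cst].
Qed.

Lemma pi2_neq0 : 2 * pi != 0 :> R.
Proof. by rewrite mulf_neq0// gt_eqF// pi_gt0. Qed.

Lemma orbit_periodic x (b : R) : orbit x (b + 2 * pi) = orbit x b.
Proof. by rewrite /orbit mulrDl divff ?pi2_neq0// (actDn sact _ 1). Qed.

Lemma contractible_sweeps x : contractible_orbit act x -> exists p I, sweeps (orbit x) (fun=> p) I.
Proof.
move=> cx; apply: null_homotopic_sweeps; [exact: orbit_msmooth|exact: orbit_periodic|].
have -> // : (fun t => orbit x (2 * pi * t)) = (fun t => act t x).
by apply/funext => t; rewrite /orbit mulrC mulKf ?pi2_neq0.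
Qed.

Variables (c : chart R m M) (p v : 'rV[R]_m).
Hypotheses (ac : atlas c) (pv : forall t : R, 0 <= t <= 1 -> chart_img c (p + t *: v)).

(** [step] makes the segment rest at its ends, as a cylinder requires. *)
Let g (s : R) := p + step s *: v.

Let g_img s : chart_img c (g s).
Proof. by apply: pv; rewrite step_ge0 step_le1. Qed.

Let F (q : P2) : M := flow act c (q.2 / (2 * pi), g q.1).

Let in_smooth (q : P2) : smooth_at (fun q : P2 => ((q.2 / (2 * pi), g q.1) : V)) q.
Proof.
apply: smooth_at_pair.
  by apply: smooth_atM; [exact: smooth_snd|exact: smooth_at_cst].
apply: smooth_atD; first exact: smooth_at_cst.
apply: smooth_atZ; last exact: smooth_at_cst.
by apply: smooth_at_comp; [exact: fin_dim_scalar|exact: smooth_fst|exact: step_smooth].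
Qed.

Let F_smooth q : msmooth_at F q.
Proof.
apply: (@msmooth_at_comp _ _ _ _ _ (fun q : P2 => ((q.2 / (2 * pi), g q.1) : V)) (flow act c)).
- exact: fin_dim_V.
- exact: in_smooth.
- by apply: flow_smooth => //=.
Qed.

Let F_cylinder : cylinder F (orbit (chart_inv c p)) (orbit (chart_inv c (p + v))).
Proof.
split.
- exact: F_smooth.
- by move=> s b; have := orbit_periodic (chart_inv c (g s)) b.
- by move=> s b s4; rewrite /F /flow /= /g step_eq0// scale0r addr0.
- by move=> s b s4; rewrite /F /flow /= /g step_eq1// scale1r.
Qed.

Let F_derive (W : normedModType R) (f : M -> W) (s b : R) :
  differentiable (fun q => f (flow act c q)) ((b / (2 * pi), g s) : V) ->
  'D_((1, 0) : P2) (fun q => f (F q)) (s, b) =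
    'D_1 step s *: 'D_((0, v) : V) (fun q => f (flow act c q)) (b / (2 * pi), g s) /\
  'D_((0, 1) : P2) (fun q => f (F q)) (s, b) =
    (2 * pi)^-1 *: 'D_((1, 0) : V) (fun q => f (flow act c q)) (b / (2 * pi), g s).
Proof.
move=> df.
have din := smooth_at_differentiable (in_smooth (s, b)).
have sfst : smooth_at (fun q : P2 => step q.1) (s, b).
  by apply: smooth_at_comp; [exact: fin_dim_scalar|exact: smooth_fst|exact: step_smooth].
have dg (w : P2) : 'D_w (fun q : P2 => g q.1) (s, b) = (w.1 * 'D_1 step s) *: v.
  rewrite deriveD; last 2 first.
  - exact: derivable_cst.
  - by apply: smooth_at_derivable; apply: smooth_atZ => //; exact: smooth_at_cst.
  rewrite derive_cst add0r.
  have [_ ->] := diff_scale (smooth_at_differentiable sfst) (differentiable_cst v (s, b)).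
  rewrite derive_cst scaler0 addr0; congr (_ *: _).
  rewrite (@derive_comp _ P2 R^o _ step (fun q : P2 => q.1)).
  - rewrite derive_fst -[RHS]/(w.1 *: 'D_1 step s) -derive_dirZ; last exact: smooth_at_differentiable (step_smooth _).
    by congr ('D_ _ _ _); rewrite -[RHS]/(_ * 1) mulr1.
  - exact: smooth_at_differentiable (smooth_fst _).
  - exact: smooth_at_differentiable (step_smooth _).
have db (w : P2) : 'D_w (fun q : P2 => (q.2 / (2 * pi) : R)) (s, b) = w.2 / (2 * pi).
  have [_ ->] := diff_scale (smooth_at_differentiable (smooth_snd (s, b))) (differentiable_cst (2 * pi)^-1 (s, b)).
  by rewrite derive_cst scaler0 addr0 derive_snd.
have D (w : P2) : 'D_w (fun q => f (F q)) (s, b) =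
    'D_((w.2 / (2 * pi) : R), (w.1 * 'D_1 step s) *: v) (fun q => f (flow act c q)) (b / (2 * pi), g s).
  have := @derive_comp _ P2 V W (fun q => f (flow act c q)) (fun q : P2 => ((q.2 / (2 * pi), g q.1) : V)) (s, b) w din df.
  move=> ->; rewrite derive_pair; [rewrite dg db //| |].
  - apply: smooth_at_differentiable; apply: smooth_atM; [exact: smooth_snd|exact: smooth_at_cst].
  - apply: smooth_at_differentiable; apply: smooth_atD; first exact: smooth_at_cst.
    by apply: smooth_atZ => //; exact: smooth_at_cst.
split.
  apply: etrans (D _) _; rewrite /= mul0r mul1r; apply: etrans _ (derive_dirZ _ _ df).
  by congr ('D_ _ _ _); rewrite -[RHS]/(_, _) /= scaler0.
apply: etrans (D _) _; rewrite /= mul0r scale0r mul1r; apply: etrans _ (derive_dirZ _ _ df).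
by congr ('D_ _ _ _); rewrite -[RHS]/(_, _) /= scaler0 -[X in _ = (X, _)]/(_ * 1) mulr1.
Qed.

(** The sign arises because the cylinder lists the segment direction before the orbit direction, and
    the fibre integral does the opposite; 2 pi comes from the rescaled period of [orbit]. *)
Let F_density a (s b : R) : is_form a -> density a F (s, b) =
  - ('D_1 step s / (2 * pi)) * mpull a (flow act c) (wdir v) (b / (2 * pi), g s).
Proof.
move=> fa; set c' := chart_at (F (s, b)).
have ac' : atlas c' := chart_at_atlas _; have c's : chart_dom c' (F (s, b)) := chart_at_dom _.
have sP := flow_smooth sact (p := (b / (2 * pi), g s)) ac (g_img s).
have c's2 : chart_dom c' (flow act c (b / (2 * pi), g s)) := c's.
have dP := smooth_at_differentiable (sP.2 c' ac' c's2).
rewrite (density2E fa F_smooth ac' c's) (mpullE _ fa ac' c's2 sP).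
have [D1 D2] := F_derive (f := c') dP.
have E1 := congr2 (fun x y : 'rV[R]_m => a c' (c' (F (s, b))) (col_mx x y)) D1 D2.
apply: etrans E1 _ => /=.
have mf := form_multilinear fa ac' (chart_funP c's).
have af := form_alternating fa ac' (chart_funP c's).
rewrite (bilinear_Zl mf) (bilinear_Zr mf) (alternating2C mf af) mulrA mulrN mulNr.
congr (- (_ * a c' _ _)); rewrite -cons_row1; apply/row_matrixP => i; apply/rowP => j.
case: (unliftP ord0 i) => [l ->|->].
  by rewrite row_cons_rowS !mxE /wdir liftK (ord1 l) row_id.
by rewrite row_cons_row0 !mxE /wdir unlift_none.
Qed.

Lemma sweeps_segment : exists I, sweeps (orbit (chart_inv c p)) (orbit (chart_inv c (p + v))) I /\
  forall a, is_form a -> I a = - pint 0 1 (fun t => fib act 0 1 a c (p + t *: v) v).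
Proof.
have [I [sI HI]] := sweeps_value F_cylinder; exists I; split=> // a fa.
have ff := fib_form sact ler01 fa.
(* [clamp] extends the integrand continuously to the line, so that it has a primitive there;
   composed with [step], that primitive is one of the slice area up to sign. *)
have ca : forall t : R, {for t, continuous (fun t : R => fib act 0 1 a c (p + clamp t *: v) v)}.
  move=> t; apply: (@continuous_comp _ _ _ (fun t : R => p + clamp t *: v) (fun y => fib act 0 1 a c y v)).
    apply: cvgD; first exact: cvg_cst.
    by apply: cvgZ; [exact: clamp_cont|exact: cvg_cst].
  by apply: smooth_at_continuous; apply: form_smooth ff ac _; apply: pv; exact: clamp_itv.
have [A dA] := exists_primitive ca.
have clE t : 0 <= t <= 1 -> clamp t = t.
  by move=> /andP[t0 t1]; rewrite /clamp min_r// max_r.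
have -> : pint 0 1 (fun t => fib act 0 1 a c (p + t *: v) v) = A 1 - A 0.
  rewrite -(pint_FTC (f := fun t : R => fib act 0 1 a c (p + clamp t *: v) v) ler01).
  - by apply: eq_pint => t t01; rewrite clE.
  - by move=> t _; exact: ca.
have dstep (s : R) : is_derive s 1 step ('D_1 step s) by exact: smooth_is_derive (step_smooth s).
suff dT (s : R) : is_derive s 1 (fun s => - A (step s)) (slice_area a F s).
  have E := HI a fa _ dT; rewrite E step_eq1 ?step_eq0; [ring|lra|lra].
have H := is_deriveN (is_derive1_comp (dA (step s)) (dstep s)).
apply: (is_derive_eq H); rewrite clE ?step_ge0 ?step_le1//= -/(g s) /slice_area.
have cf : continuous (fun r : R => mpull a (flow act c) (wdir v) (r, g s)).
  move=> r; apply: smooth_at_continuous.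
  exact: (slice_time (mpull_wdir_smooth sact v (p := (r, g s)) fa ac (g_img s))).1.
have p0 : 0 < 2 * pi :> R by rewrite mulr_gt0// pi_gt0.
rewrite (@eq_pint _ _ _ _ (fun b => - ('D_1 step s / (2 * pi)) * mpull a (flow act c) (wdir v) (b / (2 * pi), g s))).
  rewrite pintZ; last first.
    move=> b _; apply: (@continuous_comp _ _ _ (fun z : R => z / (2 * pi)) (fun r : R => mpull a (flow act c) (wdir v) (r, g s))).
      exact: mulrr_continuous.
    exact: cf.
  rewrite (pint_scale (f := fun r : R => mpull a (flow act c) (wdir v) (r, g s)) p0 cf).
  by rewrite -/(fib act 0 1 a c (g s) v) mulNr mulrA divfK ?pi2_neq0// mulrC.
by move=> b _; exact: F_density.
Qed.

End Segment.

(** * A primitive of alpha from the areas of discs *)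

Section Obstruction.
Context {R : realType} {m : nat} {M : manifold R m}.
Variable act : R -> M -> M.
Hypothesis sact : smooth_circle_action act.
Notation X := (action_field act).
Variables (w s : preform M 2) (l : R) (k : M -> R).
Hypotheses (M0 : [set: M] !=set0) (cM : compact [set: M]) (sw : symplectic_form w).
Hypotheses (aw : symplectic_action w act) (fr : free_circle_action act).
Hypotheses (fs : is_form s)
  (areas : forall u : 'rV[R]_3 -> M, smooth_sphere u -> sphere_integral w u = l * sphere_integral s u)
  (dk : forall c, atlas c -> forall y, chart_img c y -> smooth_at (fun z => k (chart_inv c z)) y /\
     forall v, 'D_v (fun z => k (chart_inv c z)) y = l * fib act 0 1 s c y v).
Hypothesis contr : forall x, contractible_orbit act x.

Let fw : is_form w. Proof. by have [] := sw. Qed.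

Let al : preform M 1 := contraction X w.

Let fal : is_form al. Proof. exact: contraction_form. Qed.

Let disc x : {I : preform M 2 -> R | exists p, sweeps (orbit act x) (fun=> p) I}.
Proof. by apply: cid; have [p [I H]] := contractible_sweeps sact (contr x); exists I, p. Qed.

(** As k is a primitive of the fibre integral of l s, the summand [k x] removes the contribution of
    sigma, and h varies as a primitive of alpha. *)
Let h x := sval (disc x) w - l * sval (disc x) s + k x.

Let seg_cont (a : preform M 1) c (p v : 'rV[R]_m) : is_form a -> atlas c ->
  (forall t : R, 0 <= t <= 1 -> chart_img c (p + t *: v)) ->
  cont_on 0 1 (fun t : R => a c (p + t *: v) v).
Proof.
move=> fa ac pv t t01.
apply: (@continuous_comp _ _ _ (fun t : R => p + t *: v) (fun y => a c y v)).
  by apply: cvgD; [exact: cvg_cst|apply: cvgZ; [exact: cvg_id|exact: cvg_cst]].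
by apply: smooth_at_continuous; apply: form_smooth fa ac _; exact: pv.
Qed.

(* The sphere made of the discs at the two ends of the segment and of the torus
   swept by the orbits in between. *)
Let h_segment c p v : atlas c -> (forall t : R, 0 <= t <= 1 -> chart_img c (p + t *: v)) ->
  h (chart_inv c (p + v)) = h (chart_inv c p) + pint 0 1 (fun t => al c (p + t *: v) v).
Proof.
move=> ac pv; have [I [sI HI]] := sweeps_segment sact ac pv.
set x := chart_inv c p in sI *; set y := chart_inv c (p + v) in sI *.
have [px sx] := svalP (disc x); have [py sy] := svalP (disc y).
have [u su Hu] := sweeps_sphere (sweeps_cat (sweeps_cat (sweeps_rev sx) sI) sy).
have := areas su; rewrite !Hu// !HI//.
have -> : pint 0 1 (fun t => fib act 0 1 w c (p + t *: v) v) = pint 0 1 (fun t => al c (p + t *: v) v).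
  apply: eq_pint => t t01; apply: (fib_symplectic sact fw _ aw ac (pv t t01)).
  by have [] := sw.
have ky : k y - k x = l * pint 0 1 (fun t => fib act 0 1 s c (p + t *: v) v).
  have cs := seg_cont (fib_form sact ler01 fs) ac pv.
  rewrite -pintZ//.
  have dK (t : R) : 0 <= t <= 1 -> is_derive t 1 (fun t : R => k (chart_inv c (p + t *: v)))
      (l * fib act 0 1 s c (p + t *: v) v).
    move=> t01; have [s1 <-] := dk ac (pv t t01).
    exact: (line_is_derive (smooth_at_differentiable s1)).
  rewrite (pint_FTC (F := fun t : R => k (chart_inv c (p + t *: v))) ler01 _ dK).
    by rewrite scale1r scale0r addr0.
  by apply: cont_onM => //; exact: cont_on_cst.
by rewrite /h => E; lra.
Qed.

(** [h_segment] along the segment from y to z expresses h near y as an integral that depends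
    smoothly on z, and it can be differentiated under the integral sign. *)
Let h_smooth c y : atlas c -> chart_img c y -> smooth_at (fun z => h (chart_inv c z)) y /\
  forall v, 'D_v (fun z => h (chart_inv c z)) y = al c y v.
Proof.
move=> ac cy.
have /nbhs_ballP[r /= r0 Hr] := img_near cy.
have inb z t : ball y r z -> 0 <= t <= 1 -> chart_img c (y + t *: (z - y)).
  move=> bz t01; apply: Hr; apply: ball_convex => //; exact: ballxx.
pose f (q : R^o * 'rV[R]_m) := al c (y + q.1 *: (q.2 - y)) (q.2 - y).
have sphi q : smooth_at (fun q : R^o * 'rV[R]_m => y + q.1 *: (q.2 - y)) q.
  apply: smooth_atD; first exact: smooth_at_cst.
  by apply: smooth_atZ; [exact: smooth_fstV|apply: smooth_atB; [exact: smooth_sndV|exact: smooth_at_cst]].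
have sU q : smooth_at (fun q : R^o * 'rV[R]_m => q.2 - y) q.
  by apply: smooth_atB; [exact: smooth_sndV|exact: smooth_at_cst].
have sf t z : 0 <= t <= 1 -> ball y r z -> smooth_at f (t, z).
  move=> t01 bz; have cz := inb z t bz t01.
  apply: (@smooth_at_pull _ _ _ 1 (al c) (fun q : R^o * 'rV[R]_m => y + q.1 *: (q.2 - y)) (t, z) _ _ _ (fun q => q.2 - y)) => //.
  - by move=> v; exact: form_smooth.
  - exact: form_near_multilinear.
have ob : open (ball y r : set 'rV[R]_m) by exact: ball_open.
have [S D] := pint_smooth (@fin_dim_mx R 1 m) ler01 ob sf.
have E : \forall z \near y, h (chart_inv c y) + pint 0 1 (fun t => f (t, z)) = h (chart_inv c z).
  have : nbhs y (ball y r) by exact: nbhsx_ballx.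
  apply: filterS => z bz; have pv t : 0 <= t <= 1 -> chart_img c (y + t *: (z - y)) by exact: inb.
  by have := h_segment ac pv; rewrite addrC subrK => ->.
have sP : smooth_at (fun z => pint 0 1 (fun t => f (t, z))) y.
  by apply: (smooth_on_at ob _ S); exact: ballxx.
split.
  by apply: smooth_at_near E _; apply: smooth_atD => //; exact: smooth_at_cst.
move=> v; rewrite -(near_eq_derive v E) deriveD; last 2 first.
- exact: derivable_cst.
- exact: smooth_at_derivable.
rewrite derive_cst add0r D; last exact: ballxx.
(* At z = y the vector argument vanishes, so moving the base point contributes nothing; only the
   derivative of the argument remains, for every t. *)
have Df t : 'D_((0, v) : R^o * 'rV[R]_m) f (t, y) = al c y v.
  have cyt : chart_img c (y + t *: (y - y)) by rewrite subrr scaler0 addr0.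
  have ml := form_near_multilinear fal ac cyt.
  rewrite (@derive_pull _ _ _ 1 (al c) (fun q : R^o * 'rV[R]_m => y + q.1 *: (q.2 - y)) (t, y) _ _ _ (fun q => q.2 - y) (0, v))//; last first.
    by move=> u; exact: form_smooth.
  rewrite /= big_ord1 subrr scaler0 addr0.
  have -> : row 0 ('D_((0, v) : R^o * 'rV[R]_m) (fun q : R^o * 'rV[R]_m => q.2 - y) (t, y)) = v.
    rewrite deriveB; last 2 first.
    - exact: smooth_at_derivable (smooth_sndV _).
    - exact: derivable_cst.
    by rewrite derive_cst subr0 derive_sndV row_id.
  have -> : set_row 0 v (0 : 'rV[R]_m) = v by apply/row_matrixP => i; rewrite row_set_row (ord1 i) eqxx row_id.
  rewrite -[RHS]add0r; congr (_ + _).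
  have zn : \forall z \near y, (fun=> 0) z = al c z 0.
    have := ml; rewrite /= subrr scaler0 addr0; apply: filterS => z mz.
    have := multilinear_set_row0 mz 0 0.
    by have -> : set_row 0 0 (0 : 'rV[R]_m) = 0 by apply/row_matrixP => i; rewrite row_set_row (ord1 i) eqxx row_id.
  by rewrite -(near_eq_derive _ zn) derive_cst.
rewrite (@eq_pint _ _ _ _ (fun=> al c y v)); last by move=> t _; exact: Df.
have dK (t : R) : is_derive t 1 (fun r : R => r * al c y v) (al c y v).
  have := is_deriveM (is_derive_id t 1) (is_derive_cst (al c y v) t 1).
  by rewrite /GRing.scale /= mulr0 add0r mulr1.
rewrite (pint_FTC ler01 _ (fun t _ => dK t)); last by move=> t _; exact: cvg_cst.
by rewrite mul1r mul0r subr0.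
Qed.

Lemma contractible_absurd : False.
Proof.
pose g : preform M 0 := fun c y _ => h (chart_inv c y).
apply: (exact_alpha_absurd (g := g) sact M0 cM sw fr).
- move=> c ac; split.
  + by move=> y cy; split=> [[]//|v []].
  + move=> v; apply/smooth_onP => [|y cy]; first exact: chart_img_open.
    exact: (h_smooth ac cy).1.
  + by move=> c' ac' y [cy c'y] v; rewrite /g /transition chart_funK.
- by move=> c ac y cy v; rewrite /ext_d big_ord1 expr0 mul1r (h_smooth ac cy).2 row_id.
Qed.

End Obstruction.

(** * The Chern form *)

Section MatrixCalculus.
Context {R : realType} {V : normedModType R}.

Lemma derive_mulmx m n r (f : V -> 'M[R]_(m, n)) (g : V -> 'M[R]_(n, r)) x w :
  smooth_at f x -> smooth_at g x ->
  'D_w (fun q => f q *m g q) x = 'D_w f x *m g x + f x *m 'D_w g x.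
Proof.
move=> sf sg; apply/matrixP => i j.
rewrite -derive_coord; last exact: smooth_at_derivable (smooth_at_mulmx sf sg).
under eq_fun do rewrite mxE.
rewrite derive_sum_mul; last 2 first.
- by move=> k; apply: smooth_at_differentiable; exact: smooth_at_coord.
- by move=> k; apply: smooth_at_differentiable; exact: smooth_at_coord.
rewrite !mxE -big_split; apply: eq_bigr => k _ /=.
by rewrite !derive_coord//; exact: smooth_at_derivable.
Qed.

Lemma smooth_at_tr n (f : V -> 'M[R]_n) x : smooth_at f x -> smooth_at (fun q => \tr (f q)) x.
Proof. by move=> sf; apply: smooth_at_sum => i _; exact: smooth_at_coord. Qed.

Lemma derive_tr n (f : V -> 'M[R]_n) x w : smooth_at f x ->
  'D_w (fun q => \tr (f q)) x = \tr ('D_w f x).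
Proof.
move=> sf.
have -> : (fun q => \tr (f q)) = (fun q => \sum_(i < n) f q i i * 1).
  by apply/funext => q; apply: eq_bigr => i _; rewrite mulr1.
rewrite derive_sum_mul; last 2 first.
- by move=> k; apply: smooth_at_differentiable; exact: smooth_at_coord.
- by move=> k; exact: differentiable_cst.
apply: eq_bigr => i _; rewrite derive_cst mulr1 mulr0 addr0 derive_coord//.
exact: smooth_at_derivable.
Qed.

(** Curvature of a matrix-valued connection on constant directions; the order of the products
    reflects the action of matrices on rows from the right. *)
Definition curvF m (B : V -> V -> 'M[R]_m) (u v : V) (p : V) : 'M[R]_m :=
  'D_u (B v) p - 'D_v (B u) p + B v p *m B u p - B u p *m B v p.

(** The relation A S = dS + S B is differentiated once more and antisymmetrised: the second
    derivatives of S cancel by symmetry. *)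
Lemma gauge m (S : V -> 'M[R]_m) (A B : V -> V -> 'M[R]_m) (p u v : V) :
  smooth_at S p -> (forall w, smooth_at (A w) p) -> (forall w, smooth_at (B w) p) ->
  (forall w, \forall q \near p, A w q *m S q = 'D_w S q + S q *m B w q) ->
  curvF A u v p *m S p = S p *m curvF B u v p.
Proof.
move=> sS sA sB E.
have D w w' : 'D_w (A w') p *m S p + A w' p *m (A w p *m S p - S p *m B w p) =
    'D_w ('D_w' S) p + (A w p *m S p - S p *m B w p) *m B w' p + S p *m 'D_w (B w') p.
  have Ew : 'D_w S p = A w p *m S p - S p *m B w p by rewrite (nbhs_singleton (E w)) addrK.
  rewrite -Ew -derive_mulmx// (near_eq_derive w (E w')) deriveD; last 2 first.
  - exact: smooth_at_derivable (smooth_at_derive _ sS).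
  - exact: smooth_at_derivable (smooth_at_mulmx sS (sB w')).
  by rewrite derive_mulmx// addrA.
have := D u v; have := D v u.
rewrite (Schwarz v u sS) /curvF ?(mulmxBl, mulmxBr, mulmxDl, mulmxDr, mulNmx, mulmxN) !mulmxA.
move: ('D_u (A v) p *m S p) ('D_v (A u) p *m S p) (S p *m 'D_u (B v) p) (S p *m 'D_v (B u) p)
  ('D_u ('D_v S) p) (A v p *m A u p *m S p) (A u p *m A v p *m S p) (A v p *m S p *m B u p)
  (A u p *m S p *m B v p) (S p *m B u p *m B v p) (S p *m B v p *m B u p).
move=> x1 x2 x3 x4 x5 x6 x7 x8 x9 x10 x11 /matrixP e1 /matrixP e2.
by apply/matrixP => i j; have := e1 i j; have := e2 i j; rewrite !mxE; lra.
Qed.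

End MatrixCalculus.

Section PullCurvature.
Context {R : realType} {V : normedModType R}.

Lemma linear_comb (U W : lmodType R) (f : U -> W) (a b : R) u v : linear f ->
  f (a *: u + b *: v) = a *: f u + b *: f v.
Proof.
move=> lf; have f0 : f 0 = 0.
  have := lf 1 0 0; rewrite scaler0 addr0 scale1r => /eqP.
  by rewrite -subr_eq0 opprD addNKr oppr_eq0 => /eqP.
by rewrite lf -[b *: v]addr0 lf f0 addr0.
Qed.

(** Differentiating the pulled back connection produces an extra term in the second derivative of
    [phi], which is symmetric in u and v and drops out. *)
Lemma pull_curvature m (G : 'rV[R]_m -> 'rV[R]_m -> 'M[R]_m) (phi : V -> 'rV[R]_m) (p u v : V) :
  smooth_at phi p -> (\forall y \near phi p, linear (G y)) ->
  (forall w, smooth_at (G ^~ w) (phi p)) ->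
  (forall w, smooth_at (fun q => G (phi q) ('D_w phi q)) p) /\
  curvF (fun w q => G (phi q) ('D_w phi q)) u v p =
  curvF (fun w y => G y w) ('D_u phi p) ('D_v phi p) (phi p).
Proof.
move=> sphi lG sG.
have mG i j : \forall y \near phi p, multilinear (fun w : 'rV[R]_m => G y w i j).
  apply: filterS lG => y ly; apply: multilinear_of_set_row => k a b x z w.
  have sr (t : 'rV[R]_m) : set_row k t w = t.
    by apply/row_matrixP => l; rewrite row_set_row (ord1 l) (ord1 k) eqxx row_id.
  by rewrite !sr linear_comb// !mxE.
have sc i j w : smooth_at (fun y => G y w i j : R) (phi p) by exact: smooth_at_coord.
have sB w : smooth_at (fun q => G (phi q) ('D_w phi q)) p.
  apply: smooth_at_mx => i j.
  by apply: (smooth_at_pull (k := 1) (sc i j) (mG i j) sphi (U := 'D_w phi)); exact: smooth_at_derive.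
split; first exact: sB.
have D w w' : 'D_w (fun q => G (phi q) ('D_w' phi q)) p =
    'D_('D_w phi p) (G ^~ ('D_w' phi p)) (phi p) + G (phi p) ('D_w ('D_w' phi) p).
  apply/matrixP => i j; rewrite -derive_coord; last exact: smooth_at_derivable (sB w').
  have := derive_pull (k := 1) (sc i j) (mG i j) sphi (U := 'D_w' phi) w (smooth_at_derive _ sphi).
  move=> ->; rewrite big_ord1 row_id mxE -derive_coord; last exact: smooth_at_derivable (sG _).
  congr (_ + G _ _ _ _); apply/row_matrixP => l.
  by rewrite row_set_row (ord1 l) eqxx row_id.
have alg (X Y x y g g' P Q : 'M[R]_m) : X = x + g -> Y = y + g' -> g = g' ->
    X - Y + P - Q = x - y + P - Q.
  by move=> -> -> ->; rewrite opprD addrACA subrr addr0.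
exact: (alg _ _ _ _ _ _ _ _ (D u v) (D v u) (f_equal (G (phi p)) (Schwarz u v sphi))).
Qed.

End PullCurvature.

Section ChernForm.
Context {R : realType} {m : nat} {M : manifold R m}.
Variables (J : chart R m M -> 'rV[R]_m -> 'M[R]_m) (G : chart R m M -> 'rV[R]_m -> 'rV[R]_m -> 'M[R]_m).
Variable w : preform M 2.
Hypotheses (cJ : compatible_acs w J) (cG : complex_connection J G).

Lemma conn_linear c y : atlas c -> chart_img c y -> linear (G c y).
Proof. by move=> ac cy; have [H _ _ _] := cG ac; exact: H. Qed.

Lemma conn_near_linear c y : atlas c -> chart_img c y -> \forall z \near y, linear (G c z).
Proof. by move=> ac cy; apply: filterS (img_near cy) => z; exact: conn_linear. Qed.

Lemma conn_smooth c y u : atlas c -> chart_img c y -> smooth_at (fun y => G c y u) y.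
Proof. by move=> ac cy; have [_ H _ _] := cG ac; apply: smooth_on_at (H u) => //; exact: chart_img_open. Qed.

Lemma conn_change c c' y u : atlas c -> atlas c' -> overlap c c' y ->
  G c y u *m 'J (transition c c') y = 'D_u (fun z => 'J (transition c c') z) y +
  'J (transition c c') y *m G c' (transition c c' y) (u *m 'J (transition c c') y).
Proof. by move=> ac ac' oy; have [_ _ H _] := cG ac; exact: H. Qed.

Lemma conn_parallel c y u : atlas c -> chart_img c y ->
  'D_u (J c) y + J c y *m G c y u - G c y u *m J c y = 0.
Proof. by move=> ac cy; have [_ _ _ H] := cG ac; exact: H. Qed.

Lemma acs_smooth c y : atlas c -> chart_img c y -> smooth_at (J c) y.
Proof. by move=> ac cy; have [H _ _] := cJ ac; apply: smooth_on_at H => //; exact: chart_img_open. Qed.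

Lemma acs_change c c' y : atlas c -> atlas c' -> overlap c c' y ->
  J c y *m 'J (transition c c') y = 'J (transition c c') y *m J c' (transition c c' y).
Proof. by move=> ac ac' oy; have [_ H _] := cJ ac; exact: H. Qed.

Lemma acs_sqr c y : atlas c -> chart_img c y -> J c y *m J c y = - 1%:M.
Proof. by move=> ac cy; have [_ _ H] := cJ ac; have [] := H y cy. Qed.

Lemma acs_pos c y (v : 'rV[R]_m) : atlas c -> chart_img c y -> v != 0 -> 0 < w c y (col_mx v (v *m J c y)).
Proof. by move=> ac cy v0; have [_ _ H] := cJ ac; have [_ _] := H y cy; apply. Qed.

Lemma jac_smooth (c c' : chart R m M) y : atlas c -> atlas c' -> overlap c c' y ->
  smooth_at (fun z => 'J (transition c c') z) y.
Proof.
move=> ac ac' oy; apply: smooth_at_mx => i j.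
have st := transition_smooth_at ac ac' oy.
have := smooth_at_coord 0 j (smooth_at_derive 'e_i st).
apply: smooth_at_near; apply: filterS (overlap_nbhs oy) => z oz.
by rewrite -(jacobianE _ ac ac' oz) -rowE mxE.
Qed.

Lemma jac_mul (c c' : chart R m M) y : atlas c -> atlas c' -> overlap c c' y ->
  'J (transition c c') y *m 'J (transition c' c) (transition c c' y) = 1%:M.
Proof.
move=> ac ac' oy; have oy' := overlap_sym oy; apply/row_matrixP => i.
rewrite !rowE mulmx1 mulmxA.
have E1 := jacobianE 'e_i ac ac' oy; have E2 := jacobianE ('e_i *m 'J (transition c c') y) ac' ac oy'.
apply: etrans E2 _; apply: etrans (f_equal (fun v => 'D_v (transition c' c) _) E1) _.
apply: etrans (esym (@derive_comp _ _ _ _ (transition c' c) (transition c c') y 'e_i _ _)) _.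
- exact: smooth_at_differentiable (transition_smooth_at ac ac' oy).
- exact: smooth_at_differentiable (transition_smooth_at ac' ac oy').
- transitivity ('D_('e_i) id y); last by rewrite derive_id.
  by apply: near_eq_derive; apply: filterS (overlap_nbhs oy) => z /transitionK.
Qed.

Lemma jac_unit (c c' : chart R m M) y : atlas c -> atlas c' -> overlap c c' y ->
  'J (transition c c') y \in unitmx.
Proof. move=> ac ac' oy; exact: (mulmx1_unit (jac_mul ac ac' oy)).1. Qed.

Lemma curvatureE c y u v : curvature G c y u v = curvF (fun w z => G c z w) u v y.
Proof. by []. Qed.

(** The Jacobian of the transition map is a change of frame between G in c and the pullback of G in
    c', so [gauge] applies. *)
Lemma curvature_change c c' y u v : atlas c -> atlas c' -> overlap c c' y ->
  curvature G c y u v *m 'J (transition c c') y = 'J (transition c c') y *m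
    curvature G c' (transition c c' y) (u *m 'J (transition c c') y) (v *m 'J (transition c c') y).
Proof.
move=> ac ac' oy; have [cy _] := oy; have c'y := overlap_img oy.
have st := transition_smooth_at ac ac' oy.
have [sB E] := pull_curvature u v st (conn_near_linear ac' c'y) (fun w => conn_smooth w ac' c'y).
have H := @gauge _ _ m (fun z => 'J (transition c c') z) (fun w z => G c z w) _ y u v
  (jac_smooth ac ac' oy) (fun z => conn_smooth z ac cy) sB.
rewrite E in H; rewrite (jacobianE u ac ac' oy) (jacobianE v ac ac' oy); apply: H => z.
apply: filterS (overlap_nbhs oy) => q oq.
have C := conn_change z ac ac' oq; rewrite (jacobianE z ac ac' oq) in C; exact: C.
Qed.

Lemma curvature_bilinear c y (a b : R) u u' v : atlas c -> chart_img c y ->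
  curvature G c y (a *: u + b *: u') v = a *: curvature G c y u v + b *: curvature G c y u' v /\
  curvature G c y v (a *: u + b *: u') = a *: curvature G c y v u + b *: curvature G c y v u'.
Proof.
move=> ac cy; have ly := conn_linear ac cy.
have dG x : differentiable (fun z => G c z x) y by apply: smooth_at_differentiable; exact: conn_smooth.
have D1 x : 'D_(a *: u + b *: u') (fun z => G c z x) y =
    a *: 'D_u (fun z => G c z x) y + b *: 'D_u' (fun z => G c z x) y.
  by rewrite !deriveE// linearD !linearZ.
have lG : G c y (a *: u + b *: u') = a *: G c y u + b *: G c y u'.
  exact: linear_comb.
have D2 x : 'D_x (fun z => G c z (a *: u + b *: u')) y =
    a *: 'D_x (fun z => G c z u) y + b *: 'D_x (fun z => G c z u') y.
  have E : \forall z \near y, a *: G c z u + b *: G c z u' = G c z (a *: u + b *: u').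
    by apply: filterS (conn_near_linear ac cy) => z lz; rewrite linear_comb.
  rewrite -(near_eq_derive x E) deriveD; last 2 first.
  - by apply: derivableZ; exact: diff_derivable.
  - by apply: derivableZ; exact: diff_derivable.
  by rewrite !deriveZ//; exact: diff_derivable.
rewrite /curvature D1 D2 lG !mulmxDl !mulmxDr -!scalemxAl -!scalemxAr.
have alg (x1 x2 x3 x4 x5 x6 x7 x8 : 'M[R]_m) :
    a *: x1 + b *: x2 - (a *: x3 + b *: x4) + (a *: x5 + b *: x6) - (a *: x7 + b *: x8) =
    a *: (x1 - x3 + x5 - x7) + b *: (x2 - x4 + x6 - x8).
  by apply/matrixP => i j; rewrite !mxE; ring.
by split; exact: alg.
Qed.

Lemma curvature_refl c y u : curvature G c y u u = 0.
Proof. by rewrite /curvature subrr add0r subrr. Qed.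

Lemma chern_is_form : is_form (chern_form J G).
Proof.
move=> c ac; split.
- move=> y cy; split.
    apply: multilinear_of_set_row => i a b x z v; rewrite /chern_form.
    have tl (A B : 'M[R]_m) : \tr ((a *: A + b *: B) *m J c y) = a * \tr (A *m J c y) + b * \tr (B *m J c y).
      by rewrite mulmxDl -!scalemxAl mxtraceD !mxtraceZ.
    case: (unliftP ord0 i) => [k ->|->].
      have -> : lift ord0 k = 1 by apply: val_inj; rewrite (ord1 k).
      by rewrite !row_set_row /= (curvature_bilinear a b x z _ ac cy).2 tl; ring.
    by rewrite !row_set_row /= (curvature_bilinear a b x z _ ac cy).1 tl; ring.
  move=> v i j ij E; rewrite /chern_form.
  have -> : row 0 v = row 1 v.
    move: ij E; case: (unliftP ord0 i) => [k ->|->]; case: (unliftP ord0 j) => [l ->|->].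
    - by rewrite (ord1 k) (ord1 l) eqxx.
    - have -> : lift ord0 k = 1 by apply: val_inj; rewrite (ord1 k).
      by move=> _ ->.
    - have -> : lift ord0 l = 1 by apply: val_inj; rewrite (ord1 l).
      by move=> _ ->.
    - by rewrite eqxx.
  by rewrite curvature_refl mul0mx mxtrace0 mulr0.
- move=> v; apply/smooth_onP => [|y cy]; first exact: chart_img_open.
  have sG u : smooth_at (fun z => G c z u) y by exact: conn_smooth.
  apply: smooth_atM; first exact: smooth_at_cst.
  apply: smooth_at_tr; apply: smooth_at_mulmx; last exact: acs_smooth.
  apply: smooth_atB; last exact: smooth_at_mulmx.
  apply: smooth_atD; last exact: smooth_at_mulmx.
  by apply: smooth_atB; exact: smooth_at_derive.
- move=> c' ac' y oy v; rewrite /chern_form !row_mul; congr (_ * _).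
  have T1 := jac_unit ac ac' oy.
  set T := 'J (transition c c') y in T1 *.
  have E := curvature_change (row 0 v) (row 1 v) ac ac' oy; rewrite -/T in E.
  have EJ := acs_change ac ac' oy; rewrite -/T in EJ.
  rewrite -[curvature G c y _ _](mulmxK T1) E -mulmxA mxtrace_mulC !mulmxA.
  by rewrite -(mulmxA _ (J c y)) EJ mulmxA mulVmx// mul1mx mxtrace_mulC.
Qed.

End ChernForm.

(** * Pointwise matrix identities for a connection in a moving frame *)

Section MatrixIdentities.
Context {R : comUnitRingType} {m : nat}.
Implicit Types A B C F N J D : 'M[R]_m.

Lemma trace_conj F C C' J J' : F \in unitmx -> C *m F = F *m C' -> F *m J' = J *m F ->
  \tr (C' *m J') = \tr (C *m J).
Proof.
move=> UF CF FJ; rewrite -[C'](mulKmx UF) -CF -mulmxA -(mulmxA C) FJ mxtrace_mulC.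
by rewrite -!mulmxA mulmxV// mulmx1.
Qed.

(** Here F is the frame, N its derivative, A the connection matrix in that frame, and D, D' are the
    derivatives of J, J'. The relation F J' = J F is differentiated, J' being parallel for B. *)
Lemma conn_commutator A F N B J J' D D' : F \in unitmx -> A *m F = N + F *m B ->
  F *m J' = J *m F -> D' = B *m J' - J' *m B ->
  N *m J' + F *m D' = D *m F + J *m N -> A *m J = D + J *m A.
Proof.
move=> UF AF FJ -> DE; apply: (can_inj (mulmxK UF)).
rewrite mulmxDl -!mulmxA -FJ (mulmxA A) AF mulmxDl mulmxDr addrA -DE mulmxBr !mulmxA -FJ.
by rewrite addrA subrK.
Qed.

(** As B commutes with J, the products of A, B and J in any order have the same trace, so both the
    commutator term and the trace of D B vanish. The latter is displayed because it completes the
    derivative of the trace of J B. *)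
Lemma trace_commute J A B C C' D : A *m J = D + J *m A -> B *m J = J *m B ->
  \tr ((C - C' + B *m A - A *m B) *m J) = (\tr (D *m B) + \tr (J *m C)) - \tr (J *m C').
Proof.
move=> AJ BJ; have -> : D = A *m J - J *m A by rewrite AJ addrK.
rewrite !(mulmxBl, mulmxDl, mulNmx) !(raddfB, raddfD, raddfN) /=.
rewrite (mxtrace_mulC C) (mxtrace_mulC C').
have -> : \tr (A *m J *m B) = \tr (A *m B *m J) by rewrite -!mulmxA BJ.
have -> : \tr (J *m A *m B) = \tr (B *m A *m J).
  by rewrite [LHS]mxtrace_mulC [RHS]mxtrace_mulC !mulmxA BJ.
have -> : \tr (B *m A *m J) = \tr (A *m B *m J).
  by rewrite -mulmxA mxtrace_mulC -!mulmxA -BJ.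
ring.
Qed.

(** Change of the chart in the target by T: frame and connection change together, and the connection
    matrix on the source side stays the same. *)
Lemma gauge_unique A A' F F' T N N' B B' DT : F \in unitmx -> T \in unitmx ->
  A *m F = N + F *m B -> A' *m F' = N' + F' *m B' -> F' = F *m T ->
  N' = N *m T + F *m DT -> B *m T = DT + T *m B' -> A = A'.
Proof.
move=> UF UT AF AF' EF' EN' BT; rewrite EF' EN' in AF'.
apply: (can_inj (mulmxK UF)); apply: (can_inj (mulmxK UT)).
by rewrite AF mulmxDl -[F *m B *m T]mulmxA BT -mulmxA AF' mulmxDr addrA !mulmxA.
Qed.

(** Change of the chart in the source by a K that is constant in the direction of differentiation: A
    is conjugated, and so is J. *)
Lemma trace_base A A' F F' K N N' B B' J J' : K \in unitmx -> F' \in unitmx ->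
  A *m F = N + F *m B -> A' *m F' = N' + F' *m B' -> F = K *m F' ->
  N = K *m N' -> B = B' -> J *m K = K *m J' -> \tr (J *m A) = \tr (J' *m A').
Proof.
move=> UK UF AF AF' EF EN EB EJ.
have AK : A *m K = K *m A'.
  apply: (can_inj (mulmxK UF)); rewrite -mulmxA -EF AF EF EN EB -!mulmxA -mulmxDr -AF'.
  by [].
by rewrite -[A](mulmxK UK) AK !mulmxA EJ mxtrace_mulC !mulmxA mulVmx// mul1mx.
Qed.

End MatrixIdentities.

Lemma combine (R : fieldType) (k a b x y T q q' : R) : k != 0 -> a = x -> b = y -> T = a - b ->
  q' = k^-1 * T -> q' = - q -> x = - k * q + y.
Proof. by move=> k0 <- <- -> -> /eqP; rewrite -eqr_oppLR => /eqP <-; field. Qed.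

Lemma mpull_swap (R : realType) (m : nat) (M : manifold R m) (a : preform M 2)
    (F : R^o * 'rV[R]_m -> M) (v : 'rV[R]_m) p : is_form a ->
  mpull a F (fun i : 'I_2 => if i == 0 then ((0, v) : R^o * 'rV[R]_m) else (1, 0)) p =
  - mpull a F (wdir v) p.
Proof.
move=> fa; set c := chart_at (F p).
have cp : chart_dom c (F p) := chart_at_dom _; have ac : atlas c := chart_at_atlas _.
have mf := form_multilinear fa ac (chart_funP cp); have af := form_alternating fa ac (chart_funP cp).
have r (d : 'I_2 -> R^o * 'rV[R]_m) :
    mjac c F d p = col_mx ('D_(d 0) (fun q => c (F q)) p) ('D_(d 1) (fun q => c (F q)) p).
  rewrite -cons_row1; apply/row_matrixP => i; apply/rowP => j.
  case: (unliftP ord0 i) => [l ->|->]; last by rewrite row_cons_row0 !mxE.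
  rewrite row_cons_rowS !mxE; have -> : lift ord0 l = 1 by apply: val_inj; rewrite (ord1 l).
  by rewrite (ord1 l).
have w0 : wdir v 0 = (1, 0) by rewrite /wdir -[0]/(ord0 : 'I_2) unlift_none.
have w1 : wdir v 1 = (0, v).
  have -> : (1 : 'I_2) = lift ord0 (0 : 'I_1) by apply: val_inj.
  by rewrite /wdir liftK row_id.
have E1 := r (fun i : 'I_2 => if i == 0 then ((0, v) : R^o * 'rV[R]_m) else (1, 0)).
have E2 := etrans (r (wdir v)) (congr2 (fun x y : R^o * 'rV[R]_m =>
  col_mx ('D_x (fun q => c (F q)) p) ('D_y (fun q => c (F q)) p)) w0 w1).
apply: etrans (f_equal (a c (c (F p))) E1) _.
apply: etrans (alternating2C mf af _ _) _.
exact: (f_equal (fun x => - a c (c (F p)) x) (esym E2)).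
Qed.

(** * The fibre integral of the Chern form *)

Section ChernFiber.
Context {R : realType} {m : nat} {M : manifold R m}.
Variable act : R -> M -> M.
Hypothesis sact : smooth_circle_action act.
Variables (J : chart R m M -> 'rV[R]_m -> 'M[R]_m) (G : chart R m M -> 'rV[R]_m -> 'rV[R]_m -> 'M[R]_m).
Variable w : preform M 2.
Hypotheses (fw : is_form w) (dw : closed_form w) (aw : symplectic_action w act).
Hypotheses (cJ : compatible_acs w J) (cG : complex_connection J G).
Notation V := (R^o * 'rV[R]_m)%type.
Notation X := (action_field act).
Notation fl := (flow act).

Definition chphi (c c' : chart R m M) (q : V) : 'rV[R]_m := c' (fl c q).

Definition dact c c' (q : V) : 'M[R]_m := \matrix_i 'D_((0, 'e_i) : V) (chphi c c') q.

(* Twice the complex linear part of the derivative of [act]. *)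
Definition frame c c' (q : V) : 'M[R]_m := dact c c' q - J c q.2 *m dact c c' q *m J c' (chphi c c' q).

Definition pconn c c' (v q : V) : 'M[R]_m := G c' (chphi c c' q) ('D_v (chphi c c') q).

Definition nabla c c' (v q : V) : 'M[R]_m := 'D_v (frame c c') q + frame c c' q *m pconn c c' v q.

(** The matrix A with A F = dF + F B: the connection pulled back by the flow, seen through the
    isomorphism F on the tangent space at the source point, where J does not depend on time. *)
Definition fconn c c' (v q : V) : 'M[R]_m := nabla c c' v q *m invmx (frame c c' q).

(** In the time direction this is the potential: modulo a time derivative, its spatial derivative is
    a multiple of the Chern form contracted with the flow. *)
Definition theta c c' (v q : V) : R := \tr (J c q.2 *m fconn c c' v q).

Definition good c c' (p : V) := [/\ atlas c, chart_img c p.2, atlas c' & chart_dom c' (fl c p)].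

Lemma good_near c c' p : good c c' p -> \forall q \near p, good c c' q.
Proof.
move=> [ac cp ac' c'p].
have sF := flow_smooth sact ac cp.
by apply: filterS (filterI (snd_near (img_near cp)) (near_dom sF.1 c'p)) => q [].
Qed.

Section AtGoodPoint.
Variables (c c' : chart R m M) (p : V).
Hypothesis gp : good c c' p.

Lemma chphi_smooth : smooth_at (chphi c c') p.
Proof. by have [ac cp ac' c'p] := gp; apply: (flow_smooth sact ac cp).2. Qed.

Lemma chphi_img : chart_img c' (chphi c c' p).
Proof. by have [ac cp ac' c'p] := gp; exact: chart_funP. Qed.

Lemma dact_smooth : smooth_at (dact c c') p.
Proof.
apply: smooth_at_mx => i j; have := smooth_at_coord 0 j (smooth_at_derive ((0, 'e_i) : V) chphi_smooth).
by apply: smooth_at_near; apply: filterE => q; rewrite mxE.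
Qed.

Lemma dactE (u : 'rV[R]_m) : 'D_((0, u) : V) (chphi c c') p = u *m dact c c' p.
Proof.
have [N HN] := derive_dir_mx (smooth_at_differentiable chphi_smooth).
rewrite HN; congr (_ *m _); apply/row_matrixP => i.
by rewrite rowE -HN; apply/rowP => j; rewrite !mxE.
Qed.

Lemma acs_snd_smooth : smooth_at (fun q : V => J c q.2) p.
Proof.
have [ac cp ac' c'p] := gp.
by apply: smooth_at_comp; [exact: fin_dim_mx|exact: smooth_sndV|exact: (acs_smooth cJ ac cp)].
Qed.

Lemma acs_phi_smooth : smooth_at (fun q : V => J c' (chphi c c' q)) p.
Proof.
have [ac cp ac' c'p] := gp.
by apply: smooth_at_comp; [exact: fin_dim_mx|exact: chphi_smooth|exact: (acs_smooth cJ ac' chphi_img)].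
Qed.

Lemma frame_smooth : smooth_at (frame c c') p.
Proof.
apply: smooth_atB; first exact: dact_smooth.
apply: smooth_at_mulmx; last exact: acs_phi_smooth.
by apply: smooth_at_mulmx; [exact: acs_snd_smooth|exact: dact_smooth].
Qed.

Lemma pconn_smooth v : smooth_at (pconn c c' v) p.
Proof.
have [ac cp ac' c'p] := gp.
exact: (pull_curvature v v chphi_smooth (conn_near_linear cG ac' chphi_img) (fun u => conn_smooth cG u ac' chphi_img)).1.
Qed.

Lemma dact_symplectic (a b : 'rV[R]_m) :
  w c' (chphi c c' p) (col_mx (a *m dact c c' p) (b *m dact c c' p)) = w c p.2 (col_mx a b).
Proof.
have [ac cp ac' c'p] := gp; rewrite -(shift_invariant sact p.1 (col_mx a b) fw dw aw ac cp).
have sF := flow_smooth sact ac cp.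
have -> : shift act p.1 w c p.2 (col_mx a b) = mpull w (fl c) (sdir (col_mx a b)) p.
  by rewrite /shift -surjective_pairing.
rewrite (mpullE _ fw ac' c'p sF); congr (w c' _ _).
rewrite -cons_row1 -cons_row1 -cons_row_mul.
by apply/row_matrixP => i; rewrite row_mul -dactE; apply/rowP => j; rewrite !mxE.
Qed.

Lemma frame_acs : frame c c' p *m J c' (chphi c c' p) = J c p.2 *m frame c c' p.
Proof.
have [ac cp ac' c'p] := gp.
have alg (E J0 J' : 'M[R]_m) : J0 *m J0 = - 1%:M -> J' *m J' = - 1%:M ->
    (E - J0 *m E *m J') *m J' = J0 *m (E - J0 *m E *m J').
  move=> h0 h'; rewrite mulmxBl mulmxBr -(mulmxA (J0 *m E) J' J') h' mulmxN mulmx1 opprK.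
  by rewrite !mulmxA h0 mulNmx mul1mx mulNmx opprK addrC.
exact: alg (acs_sqr cJ ac cp) (acs_sqr cJ ac' chphi_img).
Qed.

(* A vector killed by the complex linear part would be [w]-null with its image
   under [J]. *)
Lemma frame_unit : frame c c' p \in unitmx.
Proof.
have [ac cp ac' c'p] := gp.
suff inj (v : 'rV[R]_m) : v *m frame c c' p = 0 -> v = 0.
  rewrite -row_free_unit -kermx_eq0; apply/eqP/row_matrixP => i; rewrite row0.
  by apply: inj; rewrite -row_mul mulmx_ker row0.
rewrite /frame mulmxBr => /eqP; rewrite subr_eq0 => /eqP E.
apply/eqP; apply: contraT => v0.
have pv := acs_pos cJ ac cp v0.
have mw := form_multilinear fw ac cp; have aw' := form_alternating fw ac cp.
(* Let x be the image of v J. As v is killed, v itself is mapped to x J', and w(x, x J') = w(v J, v)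
   is negative, against compatibility; if x = 0, then w(v J, v) would be 0. *)
have E2 := dact_symplectic (v *m J c p.2) v; rewrite (alternating2C mw aw') E !mulmxA in E2.
set x := v *m J c p.2 *m dact c c' p in E2.
have [x0|x0] := eqVneq x 0.
  have mw2 := form_multilinear fw ac' chphi_img.
  move: E2; rewrite x0 mul0mx.
  have := bilinear_Zl mw2 0 0 0; rewrite scaler0 mul0r => -> /eqP.
  by rewrite eq_sym oppr_eq0 gt_eqF.
have := acs_pos cJ ac' chphi_img x0; rewrite E2 oppr_gt0 => h.
by have := lt_trans h pv; rewrite ltxx.
Qed.

Lemma fconn_frame v : fconn c c' v p *m frame c c' p = nabla c c' v p.
Proof. by rewrite /fconn mulmxKV// frame_unit. Qed.

Lemma fconn_smooth v : smooth_at (fconn c c' v) p.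
Proof.
apply: smooth_at_mulmx; last by apply: smooth_at_invmx; [exact: frame_unit|exact: frame_smooth].
apply: smooth_atD; first exact: smooth_at_derive frame_smooth.
by apply: smooth_at_mulmx; [exact: frame_smooth|exact: pconn_smooth].
Qed.

Lemma theta_smooth v : smooth_at (theta c c' v) p.
Proof. by apply: smooth_at_tr; apply: smooth_at_mulmx; [exact: acs_snd_smooth|exact: fconn_smooth]. Qed.

End AtGoodPoint.

(** This is the derivative of [frame_acs], with J parallel on the target. In the time direction J of
    the source is constant, and the connection matrix commutes with J. *)
Lemma fconn_acs c c' p v : good c c' p ->
  fconn c c' v p *m J c p.2 = 'D_v (fun q : V => J c q.2) p + J c p.2 *m fconn c c' v p.
Proof.
move=> gp; have [ac cp ac' c'p] := gp.
have U := frame_unit gp; have c'i := chphi_img gp.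
have E : \forall q \near p, frame c c' q *m J c' (chphi c c' q) = J c q.2 *m frame c c' q.
  by apply: filterS (good_near gp) => q; exact: frame_acs.
have sf := frame_smooth gp; have sJ' := acs_phi_smooth gp; have sJ := acs_snd_smooth gp.
have D1 := derive_mulmx v sf sJ'; have D2 := derive_mulmx v sJ sf.
have D3 := near_eq_derive v E.
have par := conn_parallel cG ('D_v (chphi c c') p) ac' c'i.
have dJ := @derive_comp _ _ _ _ (J c') (chphi c c') p v (smooth_at_differentiable (chphi_smooth gp))
  (smooth_at_differentiable (acs_smooth cJ ac' c'i)).
have fE := fconn_frame gp v; rewrite /nabla in fE.
have fr := frame_acs gp.
have D4 : 'D_v (frame c c') p *m J c' (chphi c c' p) + frame c c' p *m 'D_('D_v (chphi c c') p) (J c') (chphi c c' p) =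
   'D_v (fun q : V => J c q.2) p *m frame c c' p + J c p.2 *m 'D_v (frame c c') p.
  by rewrite -dJ -D1 -D2.
have par' : 'D_('D_v (chphi c c') p) (J c') (chphi c c' p) =
   pconn c c' v p *m J c' (chphi c c' p) - J c' (chphi c c' p) *m pconn c c' v p.
  have alg (x y z : 'M[R]_m) : x + y - z = 0 -> x = z - y.
    by move=> /eqP; rewrite subr_eq0 => /eqP <-; rewrite addrK.
  exact: alg par.
exact: conn_commutator U fE fr par' D4.
Qed.

Lemma snd_time c p : atlas c -> chart_img c p.2 -> 'D_((1, 0) : V) (fun q : V => J c q.2) p = 0.
Proof.
move=> ac cp; rewrite derive_snd_comp; last exact: smooth_at_differentiable (acs_smooth cJ ac cp).
by have := derive_dirZ 0 0 (smooth_at_differentiable (acs_smooth cJ ac cp)); rewrite !scale0r.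
Qed.

Lemma mpull_chern c c' p (u v : V) : good c c' p ->
  mpull (chern_form J G) (fl c) (fun i : 'I_2 => if i == 0 then u else v) p =
  (4 * pi)^-1 * \tr (curvF (fconn c c') u v p *m J c p.2).
Proof.
move=> gp; have [ac cp ac' c'p] := gp; have c'i := chphi_img gp.
rewrite (mpullE _ (chern_is_form cJ cG) ac' c'p (flow_smooth sact ac cp)) /chern_form; congr (_ * _).
have r0 : row 0 (mjac c' (fl c) (fun i : 'I_2 => if i == 0 then u else v) p) = 'D_u (chphi c c') p.
  by apply/rowP => j; rewrite !mxE.
have r1 : row 1 (mjac c' (fl c) (fun i : 'I_2 => if i == 0 then u else v) p) = 'D_v (chphi c c') p.
  by apply/rowP => j; rewrite !mxE.
rewrite r0 r1 curvatureE.
have [_ E] := pull_curvature u v (chphi_smooth gp) (conn_near_linear cG ac' c'i) (fun z => conn_smooth cG z ac' c'i).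
have U := frame_unit gp.
have H := @gauge _ _ m (frame c c') (fconn c c') (pconn c c') p u v (frame_smooth gp)
  (fconn_smooth gp) (pconn_smooth gp).
have {}H : curvF (fconn c c') u v p *m frame c c' p = frame c c' p *m curvF (pconn c c') u v p.
  by apply: H => z; apply: filterS (good_near gp) => q gq; exact: fconn_frame.
have E' : curvF (fun w : 'rV[R]_m => (G c')^~ w) ('D_u (chphi c c') p) ('D_v (chphi c c') p) (chphi c c' p) =
   curvF (pconn c c') u v p := esym E.
apply: etrans (f_equal (fun C => \tr (C *m _)) E') _.
exact: trace_conj U H (frame_acs gp).
Qed.

(* The curvature term drops out because [fconn (1, 0)] is complex linear. *)
Lemma chern_exact c c' p (u : V) : good c c' p ->
  \tr (curvF (fconn c c') u (1, 0) p *m J c p.2) =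
  'D_u (theta c c' (1, 0)) p - 'D_((1, 0) : V) (theta c c' u) p.
Proof.
move=> gp; have [ac cp ac' c'p] := gp.
have sJ := acs_snd_smooth gp; have sA := fconn_smooth gp.
have D (x y : V) : 'D_x (theta c c' y) p =
   \tr ('D_x (fun q : V => J c q.2) p *m fconn c c' y p) + \tr (J c p.2 *m 'D_x (fconn c c' y) p).
  have sM : smooth_at (fun q : V => J c q.2 *m fconn c c' y q) p := smooth_at_mulmx sJ (sA y).
  by apply: etrans (derive_tr x sM) _; rewrite (derive_mulmx x sJ (sA y)) mxtraceD.
have Au := fconn_acs u gp; have At := fconn_acs (1, 0) gp.
have dt := snd_time ac cp; rewrite dt add0r in At.
have Du := D u (1, 0); have Dt := D (1, 0) u; rewrite dt mul0mx mxtrace0 add0r in Dt.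
apply: etrans _ (esym (congr2 (fun x y : R => x - y) Du Dt)).
exact: trace_commute.
Qed.

(** The Jacobian T between the target charts multiplies the frame on the right and is absorbed by
    the transformation rule of G. The target chart may therefore change along an orbit. *)
Lemma fconn_chart c c' c'' p v : good c c' p -> good c c'' p -> fconn c c' v p = fconn c c'' v p.
Proof.
move=> gp gp''; have [ac cp ac' c'p] := gp; have [_ _ ac'' c''p] := gp''.
have op : overlap c' c'' (chphi c c' p) := overlap_dom c'p c''p.
pose T (q : V) := 'J (transition c' c'') (chphi c c' q).
have sT : smooth_at T p.
  by apply: smooth_at_comp; [exact: fin_dim_mx|exact: chphi_smooth gp|exact: jac_smooth].
have dphi q z : good c c' q -> good c c'' q -> 'D_z (chphi c c'') q = 'D_z (chphi c c') q *m T q.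
  move=> [_ cq _ c'q] [_ _ _ c''q].
  exact: (derive_chart_change z ac' ac'' c'q c''q (flow_smooth sact ac cq)).
have fT q : good c c' q -> good c c'' q -> frame c c'' q = frame c c' q *m T q.
  move=> gq gq''; have [_ cq _ c'q] := gq; have [_ _ _ c''q] := gq''.
  have oq : overlap c' c'' (chphi c c' q) := overlap_dom c'q c''q.
  have EJ := acs_change cJ ac' ac'' oq; rewrite -/(T q) (transition_fun c'' c'q) in EJ.
  have dE : dact c c'' q = dact c c' q *m T q.
    apply/row_matrixP => i; rewrite row_mul.
    have := dphi q ((0, 'e_i) : V) gq gq''; rewrite (dactE gq'') (dactE gq) -!rowE; exact.
  by rewrite /frame dE mulmxBl -!mulmxA -EJ.
have near2 : \forall q \near p, frame c c' q *m T q = frame c c'' q.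
  by apply: filterS (filterI (good_near gp) (good_near gp'')) => q [g1 g2]; rewrite (fT q g1 g2).
have D1 := near_eq_derive v near2; have D2 := derive_mulmx v (frame_smooth gp) sT.
have dT : 'D_v T p = 'D_('D_v (chphi c c') p) (fun z => 'J (transition c' c'') z) (chphi c c' p).
  apply: (@derive_comp _ _ _ _ (fun z => 'J (transition c' c'') z)).
    exact: smooth_at_differentiable (chphi_smooth gp).
  exact: smooth_at_differentiable (jac_smooth ac' ac'' op).
have C := conn_change cG ('D_v (chphi c c') p) ac' ac'' op.
have B'' : pconn c c'' v p = G c'' (transition c' c'' (chphi c c' p)) ('D_v (chphi c c') p *m 'J (transition c' c'') (chphi c c' p)).
  by rewrite (transition_fun c'' c'p) /pconn (dphi p v gp gp'').
have UT : T p \in unitmx := jac_unit ac' ac'' op.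
have C' : pconn c c' v p *m T p = 'D_v T p + T p *m pconn c c'' v p.
  by rewrite B'' dT; exact: C.
exact: (gauge_unique (frame_unit gp) UT (fconn_frame gp v) (fconn_frame gp'' v)
  (fT p gp gp'') (etrans (esym D1) D2) C').
Qed.

(** In the time direction the Jacobian between the source charts is constant, so the connection
    matrix is merely conjugated, and the trace makes [kappa] independent of the chart. *)
Lemma theta_base c b c' t y : overlap c b y -> atlas b -> good c c' (t, y) ->
  theta c c' (1, 0) (t, y) = theta b c' (1, 0) (t, transition c b y).
Proof.
move=> oy ab gp; have [ac cp ac' c'p] := gp.
have flE (s : R) z : overlap c b z -> fl c (s, z) = fl b (s, transition c b z).
  by move=> [cz bz]; rewrite /flow /= /transition chart_funK.
have gq z : overlap c b z -> good c c' (t, z) -> good b c' (t, transition c b z).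
  move=> oz [_ _ _ c'z]; split=> //; first exact: overlap_img.
  by rewrite -flE.
have gb := gq y oy gp.
set K := 'J (transition c b) y; have UK : K \in unitmx := jac_unit ac ab oy.
have phE (s : R) z : overlap c b z -> chphi c c' (s, z) = chphi b c' (s, transition c b z).
  by move=> oz; rewrite /chphi flE.
have EJ := acs_change cJ ac ab oy; rewrite -/K in EJ.
have fK (s : R) : good c c' (s, y) -> frame c c' (s, y) = K *m frame b c' (s, transition c b y).
  move=> gs; have gbs : good b c' (s, transition c b y).
    by have [_ _ _ h] := gs; split=> //; [exact: overlap_img|rewrite -flE].
  have dE : dact c c' (s, y) = K *m dact b c' (s, transition c b y).
    apply/row_matrixP => i; rewrite row_mul.
    have := flow_chart_change (g := c') 0 'e_i ac ab oy (smooth_at_differentiable (chphi_smooth gbs)).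
    by rewrite (dactE gs) (dactE gbs) -rowE -mulmxA -rowE row_mul.
  by rewrite /frame dE phE// mulmxBr !mulmxA EJ.
have sbf := frame_smooth gb; have scf := frame_smooth gp.
have [s1 e1] := slice_time scf; have [s2 e2] := slice_time sbf.
have Dt : 'D_((1, 0) : V) (frame c c') (t, y) = K *m 'D_((1, 0) : V) (frame b c') (t, transition c b y).
  rewrite -e1 -e2; transitivity ('D_1 (fun r : R => K *m frame b c' (r, transition c b y)) t).
    have ng := good_near gp.
    have sp : {for t, continuous (fun r : R => ((r, y) : V))}.
      by apply: smooth_at_continuous; apply: smooth_at_pair; [exact: smooth_at_id|exact: smooth_at_cst].
    have ng' : \forall r \near t, good c c' (r, y) by exact: (sp _ ng).
    by apply: near_eq_derive; apply: filterS ng' => r gr; rewrite fK.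
  apply: etrans (@derive_mulmx R R^o m m m (fun=> K) _ t 1 (smooth_at_cst K t) s2) _.
  by rewrite derive_cst mul0mx add0r.
have Bt : pconn c c' (1, 0) (t, y) = pconn b c' (1, 0) (t, transition c b y).
  apply: etrans (f_equal (fun z => G c' z _) (phE t y oy)) _; apply: (f_equal (G c' _)).
  rewrite -(slice_time (chphi_smooth gp)).2 -(slice_time (chphi_smooth gb)).2.
  by apply: near_eq_derive; apply: filterE => r; rewrite phE.
exact: (trace_base UK (frame_unit gb) (fconn_frame gp _) (fconn_frame gb _) (fK t gp) Dt Bt EJ).
Qed.

Definition ctheta c (v q : V) : R := theta c (chart_at (fl c q)) v q.

Lemma good_at c q : atlas c -> chart_img c q.2 -> good c (chart_at (fl c q)) q.
Proof. by move=> ac cq; split=> //; [exact: chart_at_atlas|exact: chart_at_dom]. Qed.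

Lemma ctheta_near c (v p : V) : atlas c -> chart_img c p.2 ->
  \forall q \near p, theta c (chart_at (fl c p)) v q = ctheta c v q.
Proof.
move=> ac cp; apply: filterS (good_near (good_at ac cp)) => q gq; have [_ cq _ _] := gq.
by rewrite /ctheta /theta (fconn_chart v gq (good_at ac cq)).
Qed.

Lemma ctheta_smooth c (v p : V) : atlas c -> chart_img c p.2 -> smooth_at (ctheta c v) p.
Proof.
by move=> ac cp; apply: smooth_at_near (ctheta_near v ac cp) _; exact: theta_smooth (good_at ac cp) v.
Qed.

Lemma derive_period (W : normedModType R) (f : V -> W) (h p v : V) : (forall q, f (q + h) = f q) ->
  'D_v f (p + h) = 'D_v f p.
Proof.
move=> fp; rewrite /derive; apply: (f_equal (fun g : R -> W => lim (g @ 0^'))).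
by apply/funext => s /=; rewrite addrA !fp.
Qed.

(** As [act 1] is the identity, all ingredients are 1-periodic in time; this is what makes the time
    derivative integrate to 0 over an orbit. *)
Lemma ctheta_period c (v q : V) : ctheta c v (q + (1, 0)) = ctheta c v q.
Proof.
have fp z : fl c (z + (1, 0)) = fl c z.
  by rewrite /flow /= addr0 (actDn sact _ 1).
have pp c' z : chphi c c' (z + (1, 0)) = chphi c c' z by rewrite /chphi fp.
have dp c' u z : 'D_u (chphi c c') (z + (1, 0)) = 'D_u (chphi c c') z by exact: derive_period.
have q2 z : (z + (1, 0) : V).2 = z.2 by rewrite /= addr0.
have ep c' z : dact c c' (z + (1, 0)) = dact c c' z by apply/row_matrixP => i; rewrite !rowK dp.
have frp c' z : frame c c' (z + (1, 0)) = frame c c' z by rewrite /frame ep pp q2.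
have dfp c' u z : 'D_u (frame c c') (z + (1, 0)) = 'D_u (frame c c') z by exact: derive_period.
by rewrite /ctheta fp /theta /fconn /nabla /pconn q2 frp dfp pp dp.
Qed.

Definition kappa c (y : 'rV[R]_m) : R := pint 0 1 (fun t => ctheta c (1, 0) (t, y)).

Lemma kappa_derive c y v : atlas c -> chart_img c y -> smooth_at (kappa c) y /\
  'D_v (kappa c) y = - (4 * pi) * fib act 0 1 (chern_form J G) c y v.
Proof.
move=> ac cy; pose u : V := (0, v); pose e : V := (1, 0).
have [S D] := pint_smooth (@fin_dim_mx R 1 m) ler01 (@chart_img_open _ _ _ c)
  (fun t z _ cz => ctheta_smooth (1, 0) (p := (t, z)) ac cz).
split; first by apply: (smooth_on_at (@chart_img_open _ _ _ c) _ S).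
have fs := chern_is_form cJ cG.
have p40 : 4 * pi != 0 :> R by rewrite mulf_neq0// gt_eqF// pi_gt0.
(* [chern_exact] for v and the time direction, solved for the spatial derivative. The minus sign is
   that of [mpull_swap], as the fibre integral puts time first. *)
have E t : 'D_u (ctheta c e) (t, y) = - (4 * pi) * mpull (chern_form J G) (fl c) (wdir v) (t, y) +
    'D_e (ctheta c u) (t, y).
  have gp := good_at ac (q := (t, y)) cy.
  have N1 := near_eq_derive u (ctheta_near e ac (p := (t, y)) cy).
  have N2 := near_eq_derive e (ctheta_near u ac (p := (t, y)) cy).
  have H1 := chern_exact u gp; have H2 := mpull_chern u e gp.
  have H3 : mpull (chern_form J G) (fl c) (fun i : 'I_2 => if i == 0 then u else e) (t, y) =
      - mpull (chern_form J G) (fl c) (wdir v) (t, y).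
    have cf := chart_funP (chart_at_dom (fl c (t, y))); have af := chart_at_atlas (fl c (t, y)).
    exact: (mpull_swap (fl c) v (t, y) fs).
  exact: (combine p40 N1 N2 H1 H2 H3).
have cf : cont_on 0 1 (fun t : R => mpull (chern_form J G) (fl c) (wdir v) (t, y)) by exact: fib_cont.
apply: etrans (D y v cy) _.
have su (t : R) := slice_time (ctheta_smooth u (p := (t, y)) ac cy).
have cu : cont_on 0 1 (fun t : R => 'D_e (ctheta c u) (t, y)).
  move=> t _; apply: smooth_at_continuous.
  exact: (slice_time (smooth_at_derive e (ctheta_smooth u (p := (t, y)) ac cy))).1.
have du (t : R) : is_derive t 1 (fun t : R => ctheta c u (t, y)) ('D_e (ctheta c u) (t, y)).
  by have [s1 <-] := su t; exact: smooth_is_derive.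
have F1 := pint_FTC ler01 cu (fun t _ => du t).
have per : ctheta c u (1, y) = ctheta c u (0, y).
  rewrite -(ctheta_period c u (0, y)); congr (ctheta c u _).
  by rewrite -[RHS]/(_, _) /= add0r addr0.
rewrite per subrr in F1.
apply: etrans (eq_pint (fun t _ => E t)) _.
have ck : cont_on 0 1 (fun t : R => - (4 * pi) * mpull (chern_form J G) (fl c) (wdir v) (t, y)).
  by apply: cont_onM => //; exact: cont_on_cst.
apply: etrans (pintD ck cu) _; rewrite F1 addr0; exact: pintZ.
Qed.

Lemma kappa_base c b y : atlas c -> atlas b -> overlap c b y ->
  kappa c y = kappa b (transition c b y).
Proof.
move=> ac ab oy; have [cy _] := oy; apply: eq_pint => t _.
have gp := good_at ac (q := (t, y)) cy.
have E : fl c (t, y) = fl b (t, transition c b y).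
  by have [cy' by'] := oy; rewrite /flow /= /transition chart_funK.
apply: etrans (theta_base oy ab gp) _.
exact: (f_equal (fun x => theta b (chart_at x) (1, 0) (t, transition c b y)) E).
Qed.

Lemma chern_potential : exists k : M -> R, forall c, atlas c -> forall y, chart_img c y ->
  smooth_at (fun z => k (chart_inv c z)) y /\
  forall v, 'D_v (fun z => k (chart_inv c z)) y = fib act 0 1 (chern_form J G) c y v.
Proof.
have p40 : 4 * pi != 0 :> R by rewrite mulf_neq0// gt_eqF// pi_gt0.
exists (fun x => - (4 * pi)^-1 * kappa (chart_at x) (chart_at x x)) => c ac y cy.
have E : \forall z \near y, - (4 * pi)^-1 * kappa c z =
    - (4 * pi)^-1 * kappa (chart_at (chart_inv c z)) (chart_at (chart_inv c z) (chart_inv c z)).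
  apply: filterS (img_near cy) => z cz; apply: (f_equal (fun x => - (4 * pi)^-1 * x)).
  by apply: kappa_base => //; [exact: chart_at_atlas|split=> //; exact: chart_at_dom].
have [sk _] := kappa_derive 0 ac cy.
split.
  by apply: smooth_at_near E _; apply: smooth_atM => //; exact: smooth_at_cst.
move=> v; apply: etrans (esym (near_eq_derive v E)) _.
have [_ Dk] := kappa_derive v ac cy.
have [_ ->] := diff_scale (differentiable_cst (- (4 * pi)^-1) y) (smooth_at_differentiable sk).
by rewrite derive_cst scale0r add0r Dk /GRing.scale /= mulrA mulrNN mulVf// mul1r.
Qed.

End ChernFiber.

(** * Compactly supported cohomology of a cube *)

Section Determinants.
Context {R : realType} {m : nat}.

Lemma row_expand (x : 'rV[R]_m) : x = \sum_j x 0 j *: 'e_j.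
Proof.
apply/rowP => j; rewrite summxE (bigD1 j)//= big1 => [|k kj].
  by rewrite !mxE !eqxx mulr1 addr0.
by rewrite !mxE eqxx eq_sym (negbTE kj) mulr0.
Qed.

Lemma cons_row_entry0 k (x : 'rV[R]_m) (A : 'M[R]_(k, m)) j : cons_row x A ord0 j = x 0 j.
Proof. by rewrite mxE unlift_none. Qed.

Lemma cons_row_entryS k (x : 'rV[R]_m) (A : 'M[R]_(k, m)) i j : cons_row x A (lift ord0 i) j = A i j.
Proof. by rewrite mxE liftK. Qed.

Lemma cons_row_split k (A : 'M[R]_(k.+1, m)) : A = cons_row (row ord0 A) (row' ord0 A).
Proof.
apply/row_matrixP => i; case: (unliftP ord0 i) => [j ->|->].
  by rewrite row_cons_rowS row_row'.
by rewrite row_cons_row0.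
Qed.

Lemma multilinear_cons_sum k (f : 'M[R]_(k.+1, m) -> R) (A : 'M[R]_(k, m)) x : multilinear f ->
  f (cons_row x A) = \sum_j x 0 j * f (cons_row 'e_j A).
Proof.
move=> mf; rewrite -(set_row_cons_row0 x) {1}(row_expand x) (multilinear_set_row_sum mf).
by apply: eq_bigr => j _; rewrite (multilinear_set_rowZ mf) set_row_cons_row0.
Qed.

Lemma multilinear_basis k (f : 'M[R]_(k, m) -> R) : multilinear f ->
  (forall s : 'I_k -> 'I_m, f (\matrix_i 'e_(s i)) = 0) -> forall A, f A = 0.
Proof.
elim: k f => [|k IH] f mf H A.
  have s0 : 'I_0 -> 'I_m by case.
  by rewrite -(H s0); congr f; apply/matrixP => -[].
rewrite [A]cons_row_split multilinear_cons_sum// big1// => j _.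
rewrite (IH (fun B => f (cons_row 'e_j B))) ?mulr0//; first exact: multilinear_cons.
move=> s; rewrite -(H (fun i => if unlift ord0 i is Some l then s l else j)); congr f.
apply/row_matrixP => i; rewrite rowK; case: (unliftP ord0 i) => [l ->|->].
  by rewrite row_cons_rowS rowK.
by rewrite row_cons_row0.
Qed.

Lemma multilinearB k (f g : 'M[R]_(k, m) -> R) (a : R) : multilinear f -> multilinear g ->
  multilinear (fun A => f A - a * g A).
Proof.
move=> mf mg; apply: multilinear_of_set_row => i b d x y v.
by rewrite !multilinear_set_row//; ring.
Qed.

Lemma row_xrow_tperm k (B : 'M[R]_(k, m)) i j l : row l (xrow i j B) = row (tperm i j l) B.
Proof. by apply/rowP => a; rewrite !mxE. Qed.

Lemma det_multilinear : multilinear (fun A : 'M[R]_m => \det A).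
Proof. by move=> i a b u v w H Hu Hv; exact: (determinant_multilinear H Hu Hv). Qed.

Lemma det_alternating : alternating (fun A : 'M[R]_m => \det A).
Proof.
move=> A i j ij E; apply: determinant_alternate ij _ => l.
by move/rowP: E => /(_ l); rewrite !mxE.
Qed.

(** The difference of the two sides is alternating and vanishes at the identity. On a tuple of basis
    vectors it vanishes by alternation if there is a repetition, and otherwise by writing the
    permutation as a product of transpositions. *)
Lemma top_form_det (f : 'M[R]_m -> R) : multilinear f -> alternating f ->
  forall A, f A = f 1%:M * \det A.
Proof.
move=> mf af A; apply/eqP; rewrite -subr_eq0; apply/eqP.
pose g A := f A - f 1%:M * \det A.
have mg : multilinear g := multilinearB (f 1%:M) mf det_multilinear.
have ag : alternating g.
  by move=> B i j ij E; rewrite /g (af B i j ij E) (det_alternating ij E) mulr0 subr0.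
have g1 : g 1%:M = 0 by rewrite /g det1 mulr1 subrr.
have gt i j B : i != j -> g (tperm_mx i j *m B) = - g B.
  move=> ij; have E : tperm_mx i j *m B = set_row i (row j B) (set_row j (row i B) B).
    apply/row_matrixP => l; rewrite !row_set_row -xrowE.
    rewrite row_xrow_tperm; case: tpermP => [->|->|/eqP/negbTE -> /eqP/negbTE ->//].
    - by rewrite eqxx.
    - by rewrite eqxx; case: eqP => // ->.
  have E2 : B = set_row i (row i B) (set_row j (row j B) B) by rewrite !set_row_id.
  by rewrite E (alternating_swap mg ag)// -E2.
apply: (multilinear_basis mg) => s.
have [/injectiveP injs|/injectivePn[i [j ij sij]]] := boolP (injectiveb s); last first.
  by apply: (ag _ i j ij); rewrite !rowK sij.
pose t := perm injs.
have -> : \matrix_i 'e_(s i) = perm_mx t :> 'M[R]_m.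
  by apply/row_matrixP => i; rewrite rowK; apply/rowP => j; rewrite !mxE permE eqxx eq_sym.
have [ts -> Hts] := prod_tpermP t.
elim: ts Hts => [|[i j] ts IH] /=; first by rewrite big_nil perm_mx1.
by move=> /andP[ij /IH H]; rewrite big_cons perm_mxM gt//= H oppr0.
Qed.

(** Prefixing the column [W *m l] to W gives a square matrix of rank at most m, whose zero
    determinant is expanded along that column. In terms of forms, the product of a covector with the
    determinant has degree m + 1 and vanishes. *)
Lemma det_cofactor_identity (l : 'cV[R]_m) (W : 'M[R]_(m.+1, m)) :
  \sum_(i < m.+1) (-1) ^+ i * ((row i W *m l) 0 0 * \det (row' i W)) = 0.
Proof.
pose N : 'M[R]_m.+1 := row_mx (W *m l) W.
have N0 : \det N = 0.
  apply/eqP; rewrite -[_ == 0]negbK -unitfE -unitmxE -row_free_unit /row_free.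
  have -> : N = W *m row_mx l 1%:M by rewrite mul_mx_row mulmx1.
  by rewrite neq_ltn (leq_ltn_trans (mulmx_max_rank _ _)).
rewrite -[RHS]N0 (expand_det_col N (ord0 : 'I_m.+1)); apply: eq_bigr => i _.
have -> : N i ord0 = (row i W *m l) 0 0.
  have -> : (ord0 : 'I_m.+1) = lshift m (ord0 : 'I_1) by apply: val_inj.
  by apply: etrans (row_mxEl (W *m l) W i 0) _; rewrite -row_mul [RHS]mxE.
rewrite /cofactor addn0 mulrCA; congr (_ * (_ * \det _)).
apply/matrixP => a b; rewrite [LHS]mxE [RHS]mxE [RHS]mxE.
have -> : lift ord0 b = rshift 1 b :> 'I_(1 + m) by apply: val_inj.
by apply/esym; exact: (row_mxEr (W *m l) W _ b).
Qed.

End Determinants.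

Section Codimension1.
Context {R : realType} {m : nat}.

(** The exterior product of l with i_x det is l(x) det; it follows from [det_cofactor_identity] with
    x as an additional row. *)
Lemma det_cons_identity (l : 'cV[R]_m.+2) x (V : 'M[R]_m.+2) :
  (x *m l) 0 0 * \det V =
  \sum_(i < m.+2) (-1) ^+ i * ((row i V *m l) 0 0 * \det (cons_row x (row' i V) : 'M[R]_m.+2)).
Proof.
have := det_cofactor_identity l (cons_row x V); rewrite big_ord_recl expr0 mul1r.
rewrite row_cons_row0 row'0_cons_row => /eqP; rewrite addr_eq0 => /eqP ->.
rewrite -sumrN; apply: eq_bigr => i _.
by rewrite lift0 exprS mulN1r mulNr opprK row_cons_rowS row'S_cons_row.
Qed.

(** The product [h j] of the j-th coordinate covector with f is a top form, hence a multiple of the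
    determinant. Contracting it with ['e_j] and summing over j gives (m + 2) f - (m + 1) f. *)
Lemma codim1_form (f : 'M[R]_(m.+1, m.+2) -> R) : multilinear f -> alternating f ->
  forall V, f V = \sum_(j < m.+2) (-1) ^+ j * f (row' j 1%:M) * \det (cons_row 'e_j V : 'M[R]_m.+2).
Proof.
move=> mf af V.
pose h j (W : 'M[R]_m.+2) := \sum_(i < m.+2) (-1) ^+ i * (W i j * f (row' i W)).
have mh j : multilinear (h j).
  apply: multilinear_of_set_row => i a b x y W.
  rewrite /h !mulr_sumr -big_split; apply: eq_bigr => k _ /=.
  have [->|ki] := eqVneq k i; first by rewrite !row'_set_row !mxE eqxx; ring.
  have [l ->] : exists l, i = lift k l by case: (unliftP k i) ki => [l -> _|->]; [exists l|rewrite eqxx].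
  rewrite !row'_set_row_lift (multilinear_set_row mf) !mxE (negbTE (neq_lift _ _)); ring.
have ah j : alternating (h j).
  move=> W i i' ii E; rewrite /h.
  wlog lt : i i' ii E / (i < i')%N.
    by move=> H; case: (ltngtP i i') => [/H->//|/H->//|/val_inj e]; rewrite 1?eq_sym// e eqxx in ii.
  rewrite (bigD1 i)//= (bigD1 i')/=; last by rewrite eq_sym.
  rewrite big1 => [|k /andP[ki ki']].
    have := row'_equal_rows mf af lt E; move/rowP: E => /(_ j); rewrite !mxE => -> e.
    by rewrite addr0 !(mulrCA _ (W i' j)) e mulrN addNr.
  have [l el] : exists l, i = lift k l by case: (unliftP k i) ki => [l -> _|->]; [exists l|rewrite eqxx].
  have [l' el'] : exists l, i' = lift k l by case: (unliftP k i') ki' => [l' -> _|->]; [exists l'|rewrite eqxx].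
  rewrite (af _ l l'); rewrite ?mulr0//; last by rewrite !row_row' -el -el'.
  by apply: contra ii => /eqP e; rewrite el el' e.
have h1 j : h j 1%:M = (-1) ^+ j * f (row' j 1%:M).
  rewrite /h (bigD1 j)//= big1 ?addr0 => [|k kj]; first by rewrite mxE eqxx mul1r.
  by rewrite mxE (negbTE kj) mul0r mulr0.
under [RHS]eq_bigr do rewrite -h1 -(top_form_det (mh _) (ah _)).
have he j : h j (cons_row 'e_j V) =
    f V - \sum_(i < m.+1) (-1) ^+ i * (V i j * f (cons_row 'e_j (row' i V))).
  rewrite /h big_ord_recl expr0 mul1r row'0_cons_row; congr (_ + _).
    by rewrite cons_row_entry0 mxE !eqxx mul1r.
  rewrite -sumrN; apply: eq_bigr => i _.
  by rewrite lift0 exprS mulN1r mulNr row'S_cons_row cons_row_entryS.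
rewrite (eq_bigr _ (fun j _ => he j)) sumrB sumr_const card_ord exchange_big /=.
rewrite (eq_bigr (fun=> f V)); first by rewrite sumr_const card_ord mulrS addrK.
move=> i _.
rewrite -mulr_sumr.
have -> : \sum_(j < m.+2) V i j * f (cons_row 'e_j (row' i V)) = f (cons_row (row i V) (row' i V)).
  by rewrite (multilinear_cons_sum _ _ mf); apply: eq_bigr => j _; rewrite mxE.
have := row'_equal_rows mf af (v := cons_row (row i V) V) (i := ord0) (j := lift ord0 i) isT.
rewrite row_cons_row0 row_cons_rowS => /(_ erefl).
by rewrite row'0_cons_row row'S_cons_row lift0 exprS mulN1r mulNr opprK expr0 mul1r => ->.
Qed.

(** The product of l with i_y i_x det, again from [det_cofactor_identity], now with two additional
    rows. *)
Lemma det_cons2_identity (l : 'cV[R]_m.+2) x y (V : 'M[R]_(m.+1, m.+2)) :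
  \sum_(i < m.+1) (-1) ^+ i * ((row i V *m l) 0 0 *
      \det (cons_row x (cons_row y (row' i V)) : 'M[R]_m.+2)) =
  (y *m l) 0 0 * \det (cons_row x V : 'M[R]_m.+2) - (x *m l) 0 0 * \det (cons_row y V : 'M[R]_m.+2).
Proof.
have := det_cofactor_identity l (cons_row x (cons_row y V)).
rewrite big_ord_recl expr0 mul1r row_cons_row0 row'0_cons_row.
rewrite big_ord_recl lift0 expr1 row_cons_rowS row_cons_row0 row'S_cons_row row'0_cons_row.
under eq_bigr do rewrite row_cons_rowS row_cons_rowS row'S_cons_row row'S_cons_row lift0 lift0 exprS exprS mulN1r mulN1r opprK.
by set S := \sum_(i < _) _; lra.
Qed.

End Codimension1.

(** * Homotopy operators on functions supported in a cube *)

Section Cube_operators.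
Context {R : realType} {m : nat}.
Notation E := ('rV[R]_m.+1 : normedModType R).
Variables (y0 : 'rV[R]_m.+1) (r : R) (h : 'I_m.+1 -> R -> R).
Hypothesis r_gt0 : 0 < r.
Hypothesis h_smooth : forall i (s : R), smooth_at (h i) s.
Hypothesis h_supp : forall i s, r < `|y0 0 i - s| -> h i s = 0.
(** The margin of one unit places the end points outside the support. *)
Notation lo i := (y0 0 i - r - 1).
Notation hi i := (y0 0 i + r + 1).
Hypothesis h_int : forall i, pint (lo i) (hi i) (h i) = 1.
Implicit Types (f g u : E -> R) (i j : 'I_m.+1) (x v : E).

Definition cs f := (forall x, smooth_at f x) /\ (forall x, ~ box y0 r x -> f x = 0).

Definition setc i (s : R) (x : E) : E := x + (s - x 0 i) *: 'e_i.

Lemma setcE i s x j : setc i s x 0 j = if j == i then s else x 0 j.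
Proof.
rewrite !mxE eqxx /=; case: eqP => [->|_]; last by rewrite mulr0 addr0.
by rewrite mulr1 addrC subrK.
Qed.

Lemma setc_id i x : setc i (x 0 i) x = x.
Proof. by rewrite /setc subrr scale0r addr0. Qed.

Lemma setcK i s t x : setc i s (setc i t x) = setc i s x.
Proof. by apply/rowP => j; rewrite !setcE; case: eqP. Qed.

Lemma setcC i j s t x : i != j -> setc i s (setc j t x) = setc j t (setc i s x).
Proof.
move=> ij; apply/rowP => k; rewrite !setcE.
by case: eqP => // ->; rewrite (negbTE ij).
Qed.

Lemma not_box x j : r < `|y0 0 j - x 0 j| -> ~ box y0 r x.
Proof. by move=> lt /(_ j); rewrite leNgt lt. Qed.

Lemma not_boxP x : ~ box y0 r x -> exists j, r < `|y0 0 j - x 0 j|.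
Proof.
move=> nb; apply: contrapT => H; apply: nb => j; rewrite leNgt; apply/negP => lt.
by apply: H; exists j.
Qed.

Lemma smooth_entry i x : smooth_at (fun x : E => x 0 i) x.
Proof. by apply: smooth_at_coord; exact: smooth_at_id. Qed.

Lemma smooth_setc (V : normedModType R) i (s : V -> R) (F : V -> E) p :
  smooth_at s p -> smooth_at F p -> smooth_at (fun p => setc i (s p) (F p)) p.
Proof.
move=> ss sF; apply: smooth_atD => //; apply: smooth_atZ; last exact: smooth_at_cst.
by apply: smooth_atB => //; exact: smooth_at_coord.
Qed.

Lemma cs_derive f v : cs f -> cs ('D_v f).
Proof.
move=> [sf zf]; split=> x; first exact: smooth_at_derive.
move=> nb; have e : {near x, f =1 cst 0}.
  have o : open (~` box y0 r).
    by apply: closed_openC; apply: compact_closed; [exact: norm_hausdorff|exact: box_compact].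
  by apply: filterS (open_nbhs_nbhs (conj o nb)) => z; exact: zf.
have e' : {near x, cst 0 =1 f} by apply: filterS e => z.
by rewrite deriveE ?(near_eq_diff e' _).2 ?diff_cst//; exact: smooth_at_differentiable.
Qed.

Lemma csB f g : cs f -> cs g -> cs (fun x => f x - g x).
Proof.
move=> [sf zf] [sg zg]; split=> x; first exact: smooth_atB.
by move=> nb; rewrite zf// zg// subr0.
Qed.

Lemma derive_setc (V : normedModType R) i (s : V -> R) (F : V -> E) (p w : V) :
  smooth_at s p -> smooth_at F p ->
  'D_w (fun p => setc i (s p) (F p)) p = setc i ('D_w s p) ('D_w F p).
Proof.
move=> ss sF; apply/rowP => j.
have D := smooth_at_derivable (v := w) (smooth_setc i ss sF).
rewrite -(derive_coord 0 j D) setcE.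
have E1 : (fun y => setc i (s y) (F y) 0 j) = (if j == i then s else fun y => F y 0 j).
  by apply/funext => y; rewrite setcE; case: eqP.
rewrite E1; case: eqP => _; first by [].
exact: derive_coord (smooth_at_derivable sF).
Qed.

Lemma pint_smoothT a b (f : R^o * E -> R) : a <= b -> (forall p, smooth_at f p) ->
  (forall x, smooth_at (fun x => pint a b (fun t => f (t, x))) x) /\
  forall x v, 'D_v (fun x => pint a b (fun t => f (t, x))) x = pint a b (fun t => 'D_(0, v) f (t, x)).
Proof.
move=> ab sf.
have [s d] := pint_smooth (@fin_dim_mx R 1 m.+1) ab (@openT E) (fun t x _ _ => sf (t, x)).
by split=> x; [exact: (smooth_on_at openT I s)|move=> v; exact: d].
Qed.

Lemma smooth_cont_on a b (f : R -> R) : (forall s : R, smooth_at f s) -> cont_on a b f.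
Proof. by move=> sf t _; exact: smooth_at_continuous. Qed.

Definition line_int i f x := pint (lo i) (hi i) (fun t => f (setc i t x)).

Definition proj_op i f x := h i (x 0 i) * line_int i f x.

(** The primitive in the i-th variable that starts at [lo i]. Rescaling to [0, 1] makes the bounds
    independent of x, as differentiation under the integral requires. *)
Definition prim_op i u x :=
  pint 0 1 (fun t => (x 0 i - lo i) * u (setc i (lo i + t * (x 0 i - lo i)) x)).

Lemma lo_le_hi i : lo i <= hi i.
Proof. by have := r_gt0; lra. Qed.

Lemma smooth_line i f x (t : R) : (forall x, smooth_at f x) -> smooth_at (fun t : R => f (setc i t x)) t.
Proof.
move=> sf; apply: smooth_at_comp (sf _); first exact: fin_dim_mx.
by apply: smooth_setc; [exact: smooth_at_id|exact: smooth_at_cst].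
Qed.

Lemma smooth_lineV i f p : (forall x, smooth_at f x) ->
  smooth_at (fun p : R^o * E => f (setc i p.1 p.2)) p.
Proof.
move=> sf; apply: smooth_at_comp (sf _); first exact: fin_dim_mx.
by apply: smooth_setc; [exact: smooth_fstV|exact: smooth_sndV].
Qed.

Lemma line_int_smooth i f : (forall x, smooth_at f x) ->
  (forall x, smooth_at (line_int i f) x) /\
  forall x v, 'D_v (line_int i f) x = line_int i ('D_(setc i 0 v) f) x.
Proof.
move=> sf; have [s d] := pint_smoothT (lo_le_hi i) (fun p => smooth_lineV i p sf).
split; first exact: s.
move=> x v; apply: etrans (d x v) _; apply: eq_pint => t _.
have sG : smooth_at (fun p : R^o * E => setc i p.1 p.2) ((t : R^o), x).
  by apply: smooth_setc; [exact: smooth_fstV|exact: smooth_sndV].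
apply: etrans (derive_comp (g := f) (f := fun p : R^o * E => setc i p.1 p.2) _ _ _) _.
- exact: smooth_at_differentiable.
- exact: smooth_at_differentiable.
rewrite (@derive_setc _ i (fun p : R^o * E => p.1) (fun p : R^o * E => p.2)); [|exact: smooth_fstV|exact: smooth_sndV].
by rewrite derive_fstV derive_sndV.
Qed.

Lemma line_int_setc i s f x : line_int i f (setc i s x) = line_int i f x.
Proof. by apply: eq_pint => t _; rewrite setcK. Qed.

Lemma out_lo i s x : s < y0 0 i - r -> ~ box y0 r (setc i s x).
Proof. by move=> lt; apply: (@not_box _ i); rewrite setcE eqxx lter_normr; lra. Qed.

Lemma out_hi i s x : y0 0 i + r < s -> ~ box y0 r (setc i s x).
Proof. by move=> lt; apply: (@not_box _ i); rewrite setcE eqxx lter_normr; lra. Qed.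

Lemma line_is_deriveE i f x (t : R) : (forall x, smooth_at f x) ->
  is_derive t 1 (fun t : R => f (setc i t x)) ('D_('e_i) f (setc i t x)).
Proof.
move=> sf.
have e (s : R) : setc i s x = setc i 0 x + s *: 'e_i.
  by rewrite /setc -addrA -scalerDl sub0r (addrC (- _)).
have -> : (fun t : R => f (setc i t x)) = (fun s : R => f (setc i 0 x + s *: 'e_i)).
  by apply/funext => s; rewrite e.
by rewrite (e t); exact: (@line_is_derive R E R f (setc i 0 x) 'e_i t (smooth_at_differentiable (sf _))).
Qed.

Lemma line_int_derive i f x : cs f -> line_int i ('D_('e_i) f) x = 0.
Proof.
move=> [sf zf]; have lh := lo_le_hi i.
rewrite /line_int (pint_FTC lh _ (fun t _ => line_is_deriveE i x t sf)).
  by rewrite !zf ?subrr//; [apply: out_lo|apply: out_hi]; lra.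
apply: smooth_cont_on => t; apply: (@smooth_line i ('D_('e_i) f)) => y; exact: smooth_at_derive.
Qed.

Lemma cs_proj i f : cs f -> cs (proj_op i f).
Proof.
move=> [sf zf]; split=> x.
  apply: smooth_atM; last exact: (line_int_smooth i sf).1.
  apply: (smooth_at_comp (f := fun x : E => x 0 i)); last exact: h_smooth; first exact: fin_dim_scalar.
  exact: smooth_entry.
move=> /not_boxP[j lt]; rewrite /proj_op; have [e|ji] := eqVneq j i.
  by rewrite h_supp ?mul0r// -e.
rewrite [line_int _ _ _](_ : _ = 0) ?mulr0// /line_int.
rewrite (eq_pint (g := fun=> 0)) ?pint0// => t _; apply/zf/(@not_box _ j).
by rewrite setcE (negbTE ji).
Qed.

Lemma proj_derive_self i f : cs f -> proj_op i ('D_('e_i) f) = fun=> 0.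
Proof. by move=> cf; apply/funext => x; rewrite /proj_op line_int_derive// mulr0. Qed.

Lemma setc_e i j : j != i -> setc i 0 'e_j = 'e_j.
Proof.
move=> ji; apply/rowP => k; rewrite setcE !mxE eqxx /=.
by case: eqP => // ->; rewrite eq_sym (negbTE ji).
Qed.

Lemma proj_derive i j f : j != i -> cs f -> 'D_('e_j) (proj_op i f) = proj_op i ('D_('e_j) f).
Proof.
move=> ji [sf zf]; apply/funext => x; have [sl dl] := line_int_smooth i sf.
have sh : smooth_at (fun x : E => h i (x 0 i)) x.
  apply: (smooth_at_comp (f := fun x : E => x 0 i)); last exact: h_smooth; first exact: fin_dim_scalar.
  exact: smooth_entry.
rewrite /proj_op (deriveM (smooth_at_derivable sh) (smooth_at_derivable (sl x))) dl setc_e//.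
rewrite (_ : 'D_('e_j) (fun x : E => h i (x 0 i)) x = 0) ?scaler0 ?addr0//.
apply: etrans (derive_comp (g := h i) (f := fun x : E => x 0 i) _ _ _) _.
- exact: smooth_at_differentiable (smooth_entry _ _).
- exact: smooth_at_differentiable (h_smooth _ _).
rewrite (derive_coord (f := fun x : E => x) 0 i (smooth_at_derivable (smooth_at_id x))) derive_id mxE eqxx eq_sym (negbTE ji).
exact: derive0.
Qed.

Lemma line_int_proj i f x : cs f -> line_int i (proj_op i f) x = line_int i f x.
Proof.
move=> cf; rewrite {1}/line_int.
rewrite (eq_pint (g := fun t => line_int i f x * h i t)).
  by rewrite pintZ ?h_int ?mulr1//; exact: smooth_cont_on.
by move=> t _; rewrite /proj_op line_int_setc setcE eqxx mulrC.
Qed.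

Lemma line_intB i f g x : cs f -> cs g ->
  line_int i (fun x => f x - g x) x = line_int i f x - line_int i g x.
Proof.
by move=> [sf _] [sg _]; apply: pintB; apply: smooth_cont_on => t; exact: smooth_line.
Qed.

(* The Poincare lemma with compact supports, one variable at a time:
   d_i hom_op_i = 1 - proj_op_i and proj_op_i d_i = 0. *)
Definition hom_op i f := prim_op i (fun x => f x - proj_op i f x).

Definition seg i (p : R^o * E) : E := setc i (lo i + p.1 * (p.2 0 i - lo i)) p.2.

Lemma smooth_seg_coord i (p : R^o * E) : smooth_at (fun p : R^o * E => lo i + p.1 * (p.2 0 i - lo i)) p.
Proof.
apply: smooth_atD; first exact: smooth_at_cst.
apply: smooth_atM; first exact: smooth_fstV.
by apply: smooth_atB; [apply: smooth_at_coord; exact: smooth_sndV|exact: smooth_at_cst].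
Qed.

Lemma smooth_seg i p : smooth_at (seg i) p.
Proof. by apply: smooth_setc; [exact: smooth_seg_coord|exact: smooth_sndV]. Qed.

Lemma smooth_seg_comp i u p : (forall x, smooth_at u x) -> smooth_at (fun p => u (seg i p)) p.
Proof. by move=> su; apply: smooth_at_comp (su _); [exact: fin_dim_mx|exact: smooth_seg]. Qed.

Lemma smooth_seg_width i (p : R^o * E) : smooth_at (fun p : R^o * E => p.2 0 i - lo i) p.
Proof. by apply: smooth_atB; [apply: smooth_at_coord; exact: smooth_sndV|exact: smooth_at_cst]. Qed.

Lemma derive_seg i (t : R) x v :
  'D_(0, v) (seg i) ((t : R^o), x) = setc i (t * v 0 i) v.
Proof.
rewrite /seg derive_setc; [|exact: smooth_seg_coord|exact: smooth_sndV].
rewrite derive_sndV; congr (setc i _ v).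
have s1 : smooth_at (fun p : R^o * E => p.2 0 i) ((t : R^o), x).
  by apply: smooth_at_coord; exact: smooth_sndV.
have s0 := smooth_at_cst (lo i : R) ((t : R^o), x).
rewrite (deriveD (smooth_at_derivable s0)); last first.
  by apply: smooth_at_derivable; apply: smooth_atM; [exact: smooth_fstV|exact: smooth_seg_width].
rewrite derive_cst add0r (deriveM (smooth_at_derivable (smooth_fstV _)) (smooth_at_derivable (smooth_seg_width i _))).
rewrite derive_fstV scaler0 addr0 (deriveB (smooth_at_derivable s1) (smooth_at_derivable s0)).
rewrite derive_cst subr0 (derive_coord (f := fun p : R^o * E => p.2) 0 i (smooth_at_derivable (smooth_sndV _))) derive_sndV.
by [].
Qed.

Lemma prim_op_smooth i u : (forall x, smooth_at u x) ->
  (forall x, smooth_at (prim_op i u) x) /\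
  forall x v, 'D_v (prim_op i u) x =
    pint 0 1 (fun t => v 0 i * u (seg i ((t : R^o), x)) +
      (x 0 i - lo i) * 'D_(setc i (t * v 0 i) v) u (seg i ((t : R^o), x))).
Proof.
move=> su.
have sF p : smooth_at (fun p : R^o * E => (p.2 0 i - lo i) * u (seg i p)) p.
  by apply: smooth_atM; [exact: smooth_seg_width|exact: smooth_seg_comp].
have [s d] := pint_smoothT (@ler01 R) sF.
split=> // x v; rewrite d; apply: eq_pint => t _.
rewrite (deriveM (smooth_at_derivable (smooth_seg_width i _)) (smooth_at_derivable (smooth_seg_comp i _ su))).
have s1 : smooth_at (fun p : R^o * E => p.2 0 i) ((t : R^o), x).
  by apply: smooth_at_coord; exact: smooth_sndV.
have s0 := smooth_at_cst (lo i : R) ((t : R^o), x).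
rewrite (deriveB (smooth_at_derivable s1) (smooth_at_derivable s0)).
rewrite derive_cst subr0 (derive_coord (f := fun p : R^o * E => p.2) 0 i (smooth_at_derivable (smooth_sndV _))) derive_sndV.
rewrite (derive_comp (g := u) (f := seg i)).
- by rewrite derive_seg addrC; congr (_ + _); exact: mulrC.
- exact: smooth_at_differentiable (smooth_seg _ _).
- exact: smooth_at_differentiable (su _).
Qed.

Lemma seg_is_derive i u x (t : R) : (forall x, smooth_at u x) ->
  is_derive t 1 (fun t : R => u (seg i ((t : R^o), x)))
    ((x 0 i - lo i) * 'D_('e_i) u (seg i ((t : R^o), x))).
Proof.
move=> su; pose w : E := (x 0 i - lo i) *: 'e_i.
have e (s : R) : seg i ((s : R^o), x) = setc i (lo i) x + s *: w.
  by rewrite /seg /setc /w /=; apply/rowP => j; rewrite !mxE; ring.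
have -> : (fun t : R => u (seg i ((t : R^o), x))) = (fun s : R => u (setc i (lo i) x + s *: w)).
  by apply/funext => s; rewrite e.
have d := @line_is_derive R E R u (setc i (lo i) x) w t (smooth_at_differentiable (su _)).
suff -> : (x 0 i - lo i) * 'D_('e_i) u (seg i ((t : R^o), x)) = 'D_w u (setc i (lo i) x + t *: w) by exact: d.
by rewrite -e /w derive_dirZ//; exact: smooth_at_differentiable.
Qed.

Lemma smooth_seg_line i u x (t : R) : (forall x, smooth_at u x) ->
  smooth_at (fun t : R => u (seg i ((t : R^o), x))) t.
Proof.
move=> su; apply: (@smooth_at_comp _ _ _ _ (fun t : R => seg i ((t : R^o), x))); last exact: su.
  exact: fin_dim_mx.
apply: smooth_setc; last exact: smooth_at_cst.
apply: smooth_atD; first exact: smooth_at_cst.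
apply: (smooth_atM (f := fun t : R => t) (g := fun=> x 0 i - lo i)); first exact: smooth_at_id.
exact: smooth_at_cst.
Qed.

Lemma prim_op_derive_self i u x : (forall x, smooth_at u x) -> 'D_('e_i) (prim_op i u) x = u x.
Proof.
move=> su; rewrite (prim_op_smooth i su).2 mxE !eqxx /=.
pose F (t : R) := t * u (seg i ((t : R^o), x)).
have sF (t : R) : smooth_at F t.
  by apply: smooth_atM; [exact: smooth_at_id|exact: smooth_seg_line].
have e : setc i 1 ('e_i) = 'e_i :> E.
  by apply/rowP => j; rewrite setcE !mxE eqxx /=; case: eqP.
have et (t : R) : setc i t ('e_i) = t *: 'e_i :> E.
  by apply/rowP => j; rewrite setcE !mxE eqxx /=; case: eqP; rewrite ?mulr1 ?mulr0.
rewrite (eq_pint (g := 'D_1 F)).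
  rewrite (pint_FTC ler01 _ (fun (t : R) _ => @smooth_is_derive R R^o R^o F t 1 (sF t))).
    by rewrite /F mul1r mul0r subr0 /seg /= mul1r addrC subrK setc_id.
  by move=> t _; apply: smooth_at_continuous; exact: smooth_at_derive.
move=> t _; rewrite mulr1 mul1r et derive_dirZ; last exact: smooth_at_differentiable.
rewrite /F (deriveM (smooth_at_derivable (smooth_at_id t)) (smooth_at_derivable (smooth_seg_line i _ _ su))).
have := seg_is_derive i x t su => /(@derive_val _ _ _ _ _ _ _) ->; rewrite derive_id.
have alg (a b c : R) : a + b * (t * c) = t * (b * c) + a * 1 by ring.
exact: alg.
Qed.

Lemma prim_op_derive i j u x : j != i -> (forall x, smooth_at u x) ->
  'D_('e_j) (prim_op i u) x = prim_op i ('D_('e_j) u) x.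
Proof.
move=> ji su; rewrite (prim_op_smooth i su).2; apply: eq_pint => t _.
rewrite mxE eqxx eq_sym (negbTE ji) /= mulr0 mul0r add0r.
by rewrite setc_e.
Qed.

Lemma prim_op_of_derive i f : cs f -> prim_op i ('D_('e_i) f) = f.
Proof.
move=> [sf zf]; apply/funext => x; rewrite /prim_op.
rewrite (pint_FTC ler01 _ (fun t _ => seg_is_derive i x t sf)).
  rewrite /seg /= mul1r mul0r addr0 (addrC (lo i)) subrK setc_id (zf (setc _ _ _)) ?subr0//.
  by apply: out_lo; lra.
apply: smooth_cont_on => t; apply: smooth_atM; first exact: smooth_at_cst.
by apply: (@smooth_seg_line i ('D_('e_i) f)) => y; exact: smooth_at_derive.
Qed.

Lemma prim_op_setc i u x (s : R) : (forall x, smooth_at u x) ->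
  is_derive s 1 (fun s : R => prim_op i u (setc i s x)) (u (setc i s x)).
Proof.
move=> su; have [sp _] := prim_op_smooth i su.
by have := line_is_deriveE i x s sp; rewrite prim_op_derive_self.
Qed.

(** Below the box in direction i there is nothing to integrate; above it the primitive is constant,
    equal to the total integral, which vanishes. *)
Lemma cs_prim i u : cs u -> (forall x, line_int i u x = 0) -> cs (prim_op i u).
Proof.
move=> [su zu] iu; split; first exact: (prim_op_smooth i su).1.
move=> x /not_boxP[j lt]; have [ji|ji] := eqVneq j i; last first.
  rewrite /prim_op (eq_pint (g := fun=> 0)) ?pint0// => t _.
  by rewrite (zu (setc _ _ _)) ?mulr0//; apply: (@not_box _ j); rewrite setcE (negbTE ji).
rewrite {j}ji in lt *; have r0 := r_gt0.
have [xlo|xlo] := ltP (x 0 i) (y0 0 i - r).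
  rewrite /prim_op (eq_pint (g := fun=> 0)) ?pint0// => t /andP[t0 t1].
  rewrite (zu (setc _ _ _)) ?mulr0//; apply: out_lo.
  have [->|t1'] := eqVneq t 1; first by lra.
  have t1'' : t < 1 by rewrite lt_neqAle t1'.
  have : t * (x 0 i - (y0 0 i - r)) <= 0 by rewrite mulr_ge0_le0//; lra.
  lra.
have xhi : y0 0 i + r < x 0 i by move: lt; rewrite lter_normr; lra.
have F (a b : R) (ab : a <= b) := pint_FTC ab
  (fun (t : R) _ => smooth_at_continuous (smooth_line i x t su)) (fun t _ => prim_op_setc i x t su).
have Elo : prim_op i u (setc i (lo i) x) = 0.
  rewrite /prim_op (eq_pint (g := fun=> 0)) ?pint0// => t _.
  by rewrite setcE eqxx subrr mul0r.
have Ehi : prim_op i u (setc i (hi i) x) = 0.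
  have := F _ _ (lo_le_hi i); rewrite Elo subr0 => <-.
  exact: iu.
have Z (a b : R) : a <= b -> y0 0 i + r < a -> prim_op i u (setc i b x) = prim_op i u (setc i a x).
  move=> ab ra; apply/eqP; rewrite -subr_eq0 -F//; apply/eqP.
  rewrite (eq_pint (g := fun=> 0)) ?pint0// => t /andP[at_ _].
  by apply/zu/out_hi; lra.
have [xb|bx] := leP (x 0 i) (hi i); first by rewrite -(setc_id i x) -(Z _ _ xb xhi) Ehi.
by rewrite -(setc_id i x) (Z (hi i))// ?ltW//; lra.
Qed.

Lemma cs_hom i f : cs f -> cs (hom_op i f).
Proof.
move=> cf; apply: cs_prim; first by apply: csB => //; exact: cs_proj.
by move=> x; rewrite line_intB ?line_int_proj ?subrr//; exact: cs_proj.
Qed.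

Lemma hom_derive_self i f x : cs f -> 'D_('e_i) (hom_op i f) x = f x - proj_op i f x.
Proof.
move=> cf; apply: prim_op_derive_self => y.
by apply: (csB cf (cs_proj i cf)).1.
Qed.

Lemma deriveB_fun f g v : (forall x, smooth_at f x) -> (forall x, smooth_at g x) ->
  'D_v (fun x => f x - g x) = fun x => 'D_v f x - 'D_v g x.
Proof.
move=> sf sg; apply/funext => x.
exact: (deriveB (smooth_at_derivable (sf x)) (smooth_at_derivable (sg x))).
Qed.

Lemma hom_derive i j f x : j != i -> cs f ->
  'D_('e_j) (hom_op i f) x = hom_op i ('D_('e_j) f) x.
Proof.
move=> ji cf; have cp := cs_proj i cf.
rewrite /hom_op prim_op_derive//; last by move=> y; exact: (csB cf cp).1.
by rewrite -(proj_derive ji cf) -(@deriveB_fun f (proj_op i f) 'e_j cf.1 cp.1).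
Qed.

Lemma hom_of_derive i f : cs f -> hom_op i ('D_('e_i) f) = f.
Proof.
move=> cf; rewrite /hom_op proj_derive_self//.
rewrite (_ : (fun x => _) = 'D_('e_i) f) ?prim_op_of_derive//.
by apply/funext => x; rewrite subr0.
Qed.

Lemma proj0 i : proj_op i (fun=> 0) = fun=> 0.
Proof. by apply/funext => x; rewrite /proj_op /line_int pint0 mulr0. Qed.

Lemma hom0 i : hom_op i (fun=> 0) = fun=> 0.
Proof.
apply/funext => x; rewrite /hom_op proj0 /prim_op (eq_pint (g := fun=> 0)) ?pint0// => t _.
by rewrite subr0 mulr0.
Qed.

Lemma proj_sum i n (F : 'I_n -> E -> R) : (forall k, cs (F k)) ->
  proj_op i (fun x => \sum_k F k x) = fun x => \sum_k proj_op i (F k) x.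
Proof.
move=> cF; apply/funext => x; rewrite /proj_op /line_int pint_sum ?mulr_sumr// => k.
by apply: smooth_cont_on => t; apply: smooth_line; exact: (cF k).1.
Qed.

Lemma hom_sum i n (F : 'I_n -> E -> R) : (forall k, cs (F k)) ->
  hom_op i (fun x => \sum_k F k x) = fun x => \sum_k hom_op i (F k) x.
Proof.
move=> cF; apply/funext => x; rewrite /hom_op /prim_op proj_sum// -pint_sum.
  by apply: eq_pint => t _; rewrite -sumrB mulr_sumr.
move=> k; apply: smooth_cont_on => t; apply: smooth_atM; first exact: smooth_at_cst.
apply: (@smooth_seg_line i (fun x => F k x - proj_op i (F k) x)).
by apply: (csB (cF k) (cs_proj i (cF k))).1.
Qed.

Fixpoint projs k f := if k is k'.+1 then proj_op (inord k') (projs k' f) else f.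

Lemma cs_projs k f : cs f -> cs (projs k f).
Proof. by move=> cf; elim: k => //= k; exact: cs_proj. Qed.

Lemma projs0 k : projs k (fun=> 0) = fun=> 0.
Proof. by elim: k => //= k ->; exact: proj0. Qed.

Lemma projs_derive k j f : (k <= j)%N -> cs f -> 'D_('e_j) (projs k f) = projs k ('D_('e_j) f).
Proof.
move=> kj cf; elim: k kj => //= k IH kj; have kj' := kj.
rewrite proj_derive ?IH 1?ltnW//; last exact: cs_projs.
apply/eqP => jk; move: kj; rewrite jk inordK ?ltnn//.
by rewrite (ltn_trans kj').
Qed.

Lemma projs_derive0 k j f : (j < k)%N -> cs f -> projs k ('D_('e_j) f) = fun=> 0.
Proof.
move=> jk cf; elim: k jk => //= k IH; rewrite ltnS leq_eqVlt => /predU1P[e|/IH ->].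
  rewrite -projs_derive -?e// inord_val proj_derive_self//; exact: cs_projs.
exact: proj0.
Qed.

Lemma projs_sum k n (F : 'I_n -> E -> R) : (forall k, cs (F k)) ->
  projs k (fun x => \sum_l F l x) = fun x => \sum_l projs k (F l) x.
Proof.
by move=> cF; elim: k => //= k ->; rewrite proj_sum// => l; exact: cs_projs.
Qed.

Lemma ltnS_neq k (i : 'I_m.+1) : (k < m.+1)%N -> (i < k.+1)%N && (i != inord k) = (i < k)%N.
Proof.
move=> km; rewrite ltnS leq_eqVlt; have [->|ik] := eqVneq i (inord k).
  by rewrite inordK// ltnn andbF.
by rewrite andbT; case: eqP => // e; case/eqP: ik; apply: val_inj; rewrite /= inordK.
Qed.

(** Each projection integrates out one more variable and replaces it by a factor h, so that after
    all of them only a constant is left besides the h. *)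
Lemma projs_product k f : (k <= m.+1)%N -> cs f ->
  exists g : E -> R, [/\ forall x, smooth_at g x,
    forall (i : 'I_m.+1) (s : R) x, (i < k)%N -> g (setc i s x) = g x &
    forall x, projs k f x = (\prod_(i < m.+1 | (i < k)%N) h i (x 0 i)) * g x].
Proof.
move=> km cf; elim: k km => [|k IH] km.
  by exists f; split=> [x|//|x]; [exact: cf.1|rewrite big_pred0// mul1r].
have [g [sg ig eg]] := IH (ltnW km); pose i : 'I_m.+1 := inord k.
have ik : i = k :> nat by rewrite inordK.
exists (line_int i g); split.
- exact: (line_int_smooth i sg).1.
- move=> j s x; rewrite ltnS leq_eqVlt => /predU1P[jk|jk].
    have -> : j = i by apply: val_inj; rewrite /= jk.
    exact: line_int_setc.
  have ij : i != j by apply/eqP => e; move: jk; rewrite -e ik ltnn.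
  by apply: eq_pint => t _; rewrite (setcC t s x ij) (ig j s _ jk).
- move=> x /=; rewrite -/i /proj_op (bigD1 i) ?ik//= -mulrA; congr (_ * _).
  rewrite -pintZ; last by apply: smooth_cont_on => t; exact: smooth_line.
  apply: eq_pint => t _; rewrite eg; congr (_ * _).
  apply: eq_big => [j|j jk]; first by rewrite ltnS_neq.
  by rewrite setcE; case: eqP => // e; rewrite e ik ltnn in jk.
Qed.

(** Telescoping over [projs]: the difference of two successive projections is a derivative of
    [hom_op], and the last projection is a constant times the product of the h. *)
Lemma top_decomposition f : cs f -> exists (Z : 'I_m.+1 -> E -> R) (c : R),
  (forall j, cs (Z j)) /\
  forall x, f x = \sum_j 'D_('e_j) (Z j) x + c * \prod_j h j (x 0 j).
Proof.
move=> cf; have [g [sg ig eg]] := projs_product (leqnn _) cf.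
exists (fun j => hom_op j (projs j f)), (g 0); split; first by move=> j; apply: cs_hom; exact: cs_projs.
move=> x.
have gc : g x = g 0.
  have H k : (k <= m.+1)%N -> exists2 y : E, g y = g x & forall j : 'I_m.+1, (j < k)%N -> y 0 j = 0.
    elim: k => [|k IH] km; first by exists x.
    have [y ey yj] := IH (ltnW km); exists (setc (inord k) 0 y); first by rewrite ig.
    move=> j; rewrite setcE; case: eqP => // jk; rewrite ltnS leq_eqVlt => /predU1P[e|/yj//].
    by case: jk; apply: val_inj; rewrite /= inordK.
  have [y <- yj] := H _ (leqnn _); congr g; apply/rowP => j; rewrite yj// mxE.
  by [].
rewrite (eq_bigr (fun j : 'I_m.+1 => projs j f x - proj_op j (projs j f) x)); last first.
  by move=> j _; rewrite hom_derive_self//; exact: cs_projs.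
have tel k : (k <= m.+1)%N ->
    f x = \sum_(j < m.+1 | (j < k)%N) (projs j f x - proj_op j (projs j f) x) + projs k f x.
  elim: k => [|k IH] km; first by rewrite big_pred0// add0r.
  rewrite (IH (ltnW km)) [in RHS](bigD1 (inord k : 'I_m.+1)) ?inordK//=.
  rewrite [RHS]addrAC subrK addrC; congr (_ + _).
  by apply: eq_bigl => j; rewrite ltnS_neq.
rewrite {1}(tel _ (leqnn _)) eg gc mulrC; congr (_ + _ * _).
  by apply: eq_bigl => j; rewrite ltn_ord.
by apply: eq_bigl => j; rewrite ltn_ord.
Qed.

(** The same telescoping, stopped at j, expresses Y j by the B i j with i < j and the remainder
    [projs j (Y j)]. Applying [hom_op j] after [projs j] to the divergence recovers this remainder:
    the terms i < j are killed by a projection, and those with i > j are derivatives of B j i. *)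
Lemma codim1_decomposition (Y : 'I_m.+1 -> E -> R) : (forall j, cs (Y j)) ->
  (forall x, \sum_j 'D_('e_j) (Y j) x = 0) ->
  exists B : 'I_m.+1 -> 'I_m.+1 -> E -> R, (forall i j, cs (B i j)) /\
  forall j x, Y j x = \sum_(i < m.+1 | (i < j)%N) 'D_('e_i) (B i j) x -
    \sum_(i < m.+1 | (j < i)%N) 'D_('e_i) (B j i) x.
Proof.
move=> cY dY; exists (fun i j => hom_op i (projs i (Y j))); split.
  by move=> i j; apply: cs_hom; exact: cs_projs.
move=> j x.
have tel k : (k <= m.+1)%N -> Y j x =
    \sum_(i < m.+1 | (i < k)%N) 'D_('e_i) (hom_op i (projs i (Y j))) x + projs k (Y j) x.
  elim: k => [|k IH] km; first by rewrite big_pred0// add0r.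
  rewrite (IH (ltnW km)) [in RHS](bigD1 (inord k : 'I_m.+1)) ?inordK//= hom_derive_self; last exact: cs_projs.
  rewrite [RHS]addrAC subrK addrC; congr (_ + _).
  by apply: eq_bigl => i; rewrite ltnS_neq.
rewrite {1}(tel j (ltnW (ltn_ord j))); congr (_ + _).
have cD i : cs ('D_('e_i) (Y i)) by exact: cs_derive.
have H : \sum_i hom_op j (projs j ('D_('e_i) (Y i))) x = 0.
  rewrite -[LHS]/((fun x => \sum_i hom_op j (projs j ('D_('e_i) (Y i))) x) x).
  rewrite -hom_sum; last by move=> i; exact: cs_projs.
  rewrite -projs_sum// (_ : (fun x => _) = fun=> 0) ?projs0 ?hom0//.
  by apply/funext => y; exact: dY.
have T i : hom_op j (projs j ('D_('e_i) (Y i))) x = if i == j then projs j (Y j) x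
    else if (j < i)%N then 'D_('e_i) (hom_op j (projs j (Y i))) x else 0.
  case: eqP => [->|/eqP ij].
    by rewrite -projs_derive// hom_of_derive//; exact: cs_projs.
  case: ltnP => [ji|]; first by rewrite hom_derive ?projs_derive// 1?ltnW//; exact: cs_projs.
  rewrite leq_eqVlt => /predU1P[e|lt]; first by case/eqP: ij; exact: val_inj.
  by rewrite projs_derive0// hom0.
move: H; rewrite (eq_bigr _ (fun i _ => T i)) (bigD1 j)//= eqxx => /eqP.
rewrite addr_eq0 => /eqP ->; congr (- _).
rewrite [RHS]big_mkcond [LHS]big_mkcond; apply: eq_bigr => i _.
by have [->|//] := eqVneq i j; rewrite ltnn.
Qed.

End Cube_operators.

Section Form_algebra.
Context {R : realType} {m : nat} {M : manifold R m}.

Lemma multilinear_sum (I : finType) (P : pred I) k (f : I -> 'M[R]_(k, m) -> R) (a : I -> R) :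
  (forall i, multilinear (f i)) -> multilinear (fun v => \sum_(i | P i) a i * f i v).
Proof.
move=> mf; apply: multilinear_of_set_row => l s t x y v.
rewrite !mulr_sumr -big_split; apply: eq_bigr => i _ /=.
by rewrite (multilinear_set_row (mf i)); ring.
Qed.

Lemma alternating_sum (I : finType) (P : pred I) k (f : I -> 'M[R]_(k, m) -> R) (a : I -> R) :
  (forall i, alternating (f i)) -> alternating (fun v => \sum_(i | P i) a i * f i v).
Proof. by move=> af v i j ij e; apply: big1 => l _; rewrite (af l v i j ij e) mulr0. Qed.

Definition form_scale k (u : M -> R) (a : preform M k) : preform M k :=
  fun c y v => u (chart_inv c y) * a c y v.

Definition form_add k (a b : preform M k) : preform M k := fun c y v => a c y v + b c y v.

Definition smooth_fun (u : M -> R) := forall c, atlas c -> forall y, chart_img c y ->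
  smooth_at (fun y => u (chart_inv c y)) y.

Lemma smooth_fun_cst (s : R) : smooth_fun (fun=> s).
Proof. by move=> c _ y _; exact: smooth_at_cst. Qed.

Lemma smooth_funB u w : smooth_fun u -> smooth_fun w -> smooth_fun (fun x => u x - w x).
Proof. by move=> su sw c ac y cy; apply: smooth_atB; [exact: su|exact: sw]. Qed.

Lemma smooth_funM u w : smooth_fun u -> smooth_fun w -> smooth_fun (fun x => u x * w x).
Proof. by move=> su sw c ac y cy; apply: smooth_atM; [exact: su|exact: sw]. Qed.

Lemma smooth_fun_sum (I : Type) (r : seq I) (P : pred I) (u : I -> M -> R) :
  (forall i, smooth_fun (u i)) -> smooth_fun (fun x => \sum_(i <- r | P i) u i x).
Proof. by move=> su c ac y cy; apply: smooth_at_sum => i _; exact: su. Qed.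

Lemma is_form_add k (a b : preform M k) : is_form a -> is_form b -> is_form (form_add a b).
Proof.
move=> fa fb c ac; have [H1 H2 H3] := fa c ac; have [G1 G2 G3] := fb c ac; split.
- move=> y cy; have [ma aa] := H1 y cy; have [mb ab] := G1 y cy; split.
    apply: multilinear_of_set_row => i s t x z v.
    by rewrite /form_add (multilinear_set_row ma) (multilinear_set_row mb); ring.
  by move=> v i j ij e; rewrite /form_add (aa v i j ij e) (ab v i j ij e) addr0.
- move=> v; apply/smooth_onP; first exact: chart_img_open.
  by move=> y cy; apply: smooth_atD; [exact: form_smooth|exact: form_smooth].
- by move=> c' ac' y H v; rewrite /form_add (H3 c' ac' y H) (G3 c' ac' y H).
Qed.

Lemma is_form_scale k (u : M -> R) (a : preform M k) : smooth_fun u -> is_form a -> is_form (form_scale u a).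
Proof.
move=> su fa c ac; have [H1 H2 H3] := fa c ac; split.
- move=> y cy; have [ma aa] := H1 y cy; split.
    apply: multilinear_of_set_row => i s t x z v.
    by rewrite /form_scale (multilinear_set_row ma); ring.
  by move=> v i j ij e; rewrite /form_scale (aa v i j ij e) mulr0.
- move=> v; apply/smooth_onP; first exact: chart_img_open.
  by move=> y cy; apply: smooth_atM; [exact: su|exact: form_smooth].
- move=> c' ac' y H v; rewrite /form_scale (H3 c' ac' y H); congr (u _ * _).
  by rewrite /transition chart_funK//; case: H.
Qed.

Lemma is_form_ext k (a b : preform M k) : (forall c y v, a c y v = b c y v) -> is_form a -> is_form b.
Proof. by move=> e; have -> : a = b by apply/funext => c; apply/funext => y; apply/funext => v. Qed.

Lemma ext_d_add k (a b : preform M k) c y v : is_form a -> is_form b -> atlas c -> chart_img c y ->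
  ext_d (form_add a b) c y v = ext_d a c y v + ext_d b c y v.
Proof.
move=> fa fb ac cy; rewrite /ext_d -big_split; apply: eq_bigr => i _ /=; rewrite -mulrDr; congr (_ * _).
exact: (deriveD (smooth_at_derivable (form_smooth (row' i v) fa ac cy))
  (smooth_at_derivable (form_smooth (row' i v) fb ac cy))).
Qed.

Lemma ext_d_scale k (u : M -> R) (a : preform M k) c y v : smooth_fun u -> is_form a ->
  atlas c -> chart_img c y ->
  ext_d (form_scale u a) c y v = u (chart_inv c y) * ext_d a c y v +
   \sum_(i < k.+1) (-1) ^+ i * ('D_(row i v) (fun y => u (chart_inv c y)) y * a c y (row' i v)).
Proof.
move=> su fa ac cy; rewrite /ext_d mulr_sumr -big_split; apply: eq_bigr => i _ /=.
rewrite mulrCA -mulrDr; congr (_ * _).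
rewrite (deriveM (smooth_at_derivable (su c ac y cy)) (smooth_at_derivable (form_smooth (row' i v) fa ac cy))).
by congr (_ + _); exact: mulrC.
Qed.

Lemma ext_d_eq k (a b : preform M k) : form_eq a b -> form_eq (ext_d a) (ext_d b).
Proof.
move=> e c ac y cy v; apply: eq_bigr => i _; congr (_ * _); apply: near_eq_derive.
have n : nbhs y (chart_img c) by apply: open_nbhs_nbhs; split=> //; exact: chart_img_open.
by apply: filterS n => z cz; exact: e.
Qed.

Definition exact_form k (a : preform M k.+1) := exists2 b : preform M k, is_form b & form_eq a (ext_d b).

Lemma exact_add k (a b : preform M k.+1) : exact_form a -> exact_form b -> exact_form (form_add a b).
Proof.
move=> [p fp ep] [q fq eq]; exists (form_add p q); first exact: is_form_add.
by move=> c ac y cy v; rewrite ext_d_add// /form_add (ep c ac y cy) (eq c ac y cy).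
Qed.

Lemma exact_scale k (s : R) (a : preform M k.+1) : exact_form a -> exact_form (form_scale (fun=> s) a).
Proof.
move=> [p fp ep]; exists (form_scale (fun=> s) p); first by apply: is_form_scale => //; exact: smooth_fun_cst.
move=> c ac y cy v; rewrite ext_d_scale//; last exact: smooth_fun_cst.
rewrite big1 ?addr0 => [|i _]; first by rewrite /form_scale (ep c ac y cy).
by rewrite derive_cst mul0r mulr0.
Qed.

Lemma exact_eq k (a b : preform M k.+1) : form_eq a b -> exact_form b -> exact_form a.
Proof.
move=> e [p fp ep]; exists p => // c ac y cy v.
by rewrite (e c ac y cy) (ep c ac y cy).
Qed.

Lemma exact_ext_d k (a : preform M k) : is_form a -> exact_form (ext_d a).
Proof. by exists a. Qed.

Lemma is_form_zero k : is_form (@form_zero R m M k).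
Proof.
move=> c ac; split => //.
- by move=> y cy; split=> // i a b *; rewrite /form_zero !mulr0 addr0.
- by move=> v k'; exact: Ck_on_cst.
Qed.

Lemma exact_zero k : exact_form (@form_zero R m M k.+1).
Proof.
exists (@form_zero R m M k); first exact: is_form_zero.
move=> c ac y cy v; apply/esym/big1 => i _.
by rewrite [X in 'D__ X _](_ : _ = cst 0) ?derive_cst ?mulr0//; exact/funext.
Qed.

Lemma exact_sum (I : Type) (r : seq I) k (a : I -> preform M k.+1) : (forall i, exact_form (a i)) ->
  exact_form (fun c y v => \sum_(i <- r) a i c y v).
Proof.
move=> ea; elim: r => [|i r IH].
  by apply: exact_eq (exact_zero k) => c ac y cy v; rewrite big_nil.
by apply: exact_eq (exact_add (ea i) IH) => c ac y cy v; rewrite big_cons.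
Qed.

Lemma is_form_sum (I : Type) (r : seq I) k (a : I -> preform M k) : (forall i, is_form (a i)) ->
  is_form (fun c y v => \sum_(i <- r) a i c y v).
Proof.
move=> ea; elim: r => [|i r IH].
  by apply: is_form_ext (is_form_zero k) => c y v; rewrite big_nil.
by apply: is_form_ext (is_form_add (ea i) IH) => c y v; rewrite big_cons.
Qed.

End Form_algebra.

Lemma mx_eq_of_mul (R : realType) (m : nat) (A B C : 'M[R]_m) :
  (forall u : 'rV[R]_m, u *m A = u *m B *m C) -> A = B *m C.
Proof. by move=> H; apply/row_matrixP => i; rewrite !rowE H mulmxA. Qed.

Lemma mulmx_chain (R : realType) (k m : nat) (v : 'M[R]_(k, m)) (A B C : 'M[R]_m) :
  A = B *m C -> v *m B *m C = v *m A.
Proof. by move=> ->; rewrite mulmxA. Qed.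

(** * Forms supported in a chart and extension by zero *)

Section Support.
Context {R : realType} {m : nat} {M : manifold R m}.

Definition supp_in k (K : set M) (a : preform M k) := forall c, atlas c -> forall y, chart_img c y ->
  ~ K (chart_inv c y) -> forall v, a c y v = 0.

Lemma near_not_closed (K : set M) (c : chart R m M) y : closed K -> chart_img c y -> ~ K (chart_inv c y) ->
  \forall z \near y, chart_img c z /\ ~ K (chart_inv c z).
Proof.
move=> cK cy nK.
have n : nbhs y (chart_img c) by apply: open_nbhs_nbhs; split=> //; exact: chart_img_open.
have oK : nbhs (chart_inv c y) (~` K) by apply: open_nbhs_nbhs; split=> //; exact: closed_openC.
exact: (filterI n (chart_inv_cont cy oK)).
Qed.

Lemma supp_in_ext_d k (K : set M) (a : preform M k) : closed K -> supp_in K a -> supp_in K (ext_d a).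
Proof.
move=> cK sa c ac y cy nK v; apply: big1 => i _.
have e : \forall z \near y, a c z (row' i v) = cst 0 z.
  by apply: filterS (near_not_closed cK cy nK) => z [cz nz]; exact: sa.
by rewrite (near_eq_derive _ e) derive_cst mulr0.
Qed.

Lemma supp_in_sub k (K L : set M) (a : preform M k) : K `<=` L -> supp_in K a -> supp_in L a.
Proof. by move=> KL sa c ac y cy nL; apply: sa => // /KL. Qed.

Lemma form_eq_chart k (a b : preform M k) c (K : set M) : atlas c ->
  (forall c' y v, atlas c' -> overlap c' c y ->
     a c' y v = a c (transition c' c y) (v *m 'J (transition c' c) y)) ->
  (forall c' y v, atlas c' -> overlap c' c y ->
     b c' y v = b c (transition c' c y) (v *m 'J (transition c' c) y)) ->
  K `<=` chart_dom c -> supp_in K a -> supp_in K b ->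
  (forall y v, chart_img c y -> a c y v = b c y v) -> form_eq a b.
Proof.
move=> ac ta tb Kc sa sb e c' ac' y c'y v.
have [cx|ncx] := pselect (chart_dom c (chart_inv c' y)).
  have H : overlap c' c y by [].
  by rewrite ta// tb// e//; exact: overlap_img.
by rewrite sa ?sb// => /Kc.
Qed.

Lemma jac_chain (c c' c'' : chart R m M) y : atlas c -> atlas c' -> atlas c'' ->
  overlap c c' y -> overlap c c'' y ->
  'J (transition c c'') y = 'J (transition c c') y *m 'J (transition c' c'') (transition c c' y).
Proof.
move=> ac ac' ac'' H H'.
have H2 : overlap c' c'' (transition c c' y).
  split; first exact: overlap_img.
  by rewrite /transition chart_funK; [case: H'|case: H].
apply: mx_eq_of_mul => u; apply: etrans (jacobianE u ac ac'' H') _; apply/esym.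
apply: etrans (f_equal (fun w => w *m _) (jacobianE u ac ac' H)) _.
apply: etrans (jacobianE _ ac' ac'' H2) _.
have n : \forall z \near y, transition c' c'' (transition c c' z) = transition c c'' z.
  by apply: filterS (overlap_nbhs H) => z [cz c'z]; rewrite /transition chart_funK.
apply: etrans _ (near_eq_derive _ n); apply/esym.
apply: (derive_comp (g := transition c' c'') (f := transition c c')).
  by apply: smooth_at_differentiable; exact: transition_smooth_at.
by apply: smooth_at_differentiable; exact: transition_smooth_at.
Qed.

Lemma jac_self (c : chart R m M) y : atlas c -> chart_img c y -> 'J (transition c c) y = 1%:M.
Proof.
move=> ac cy; have H := overlap_self cy; apply/row_matrixP => i; rewrite rowE jacobianE//.
have n : \forall z \near y, id z = transition c c z.
  by apply: filterS (overlap_nbhs H) => z [cz _]; rewrite /transition chart_invK.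
by rewrite -(near_eq_derive _ n) derive_id rowE mulmx1.
Qed.

Variables (c : chart R m M) (y0 : 'rV[R]_m) (r : R).
Hypothesis ac : atlas c.
Hypothesis box_img : box y0 r `<=` chart_img c.
Notation K := (closed_cube c y0 r).

(** At points outside the domain of c smoothness will rely on the support being in a compact cube,
    which is closed in the Hausdorff space M. *)
Definition ext_zero k (phi : 'rV[R]_m -> 'M[R]_(k, m) -> R) : preform M k := fun c' y v =>
  if pselect (chart_dom c (chart_inv c' y)) is left _
  then phi (transition c' c y) (v *m 'J (transition c' c) y) else 0.

Definition local_form k (phi : 'rV[R]_m -> 'M[R]_(k, m) -> R) :=
  [/\ forall y, multilinear (phi y) /\ alternating (phi y),
      forall v y, smooth_at (phi ^~ v) y & forall y v, ~ box y0 r y -> phi y v = 0].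

Lemma ext_zeroE k (phi : 'rV[R]_m -> 'M[R]_(k, m) -> R) c' y v : overlap c' c y ->
  ext_zero phi c' y v = phi (transition c' c y) (v *m 'J (transition c' c) y).
Proof. by move=> [_ H]; rewrite /ext_zero; case: pselect. Qed.

Lemma supp_ext_zero k (phi : 'rV[R]_m -> 'M[R]_(k, m) -> R) : local_form phi ->
  supp_in K (ext_zero phi).
Proof.
move=> [_ _ z] c' ac' y c'y nK v; rewrite /ext_zero; case: pselect => // cx.
by apply: z => bx; apply: nK; split.
Qed.

Lemma ext_zero_form k (phi : 'rV[R]_m -> 'M[R]_(k, m) -> R) : local_form phi ->
  is_form (ext_zero phi).
Proof.
move=> lp; have [ma sp z] := lp; move=> c' ac'; split.
- move=> y c'y; rewrite /ext_zero; case: pselect => cx.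
    by split; [apply: multilinear_mul; exact: (ma _).1|apply: alternating_mul; exact: (ma _).2].
  by split=> // i a b *; rewrite !mulr0 addr0.
- move=> v; apply/smooth_onP; first exact: chart_img_open.
  move=> y c'y; have [cx|ncx] := pselect (chart_dom c (chart_inv c' y)); last first.
    have nK : ~ K (chart_inv c' y) by case.
    have e : \forall z \near y, 0 = ext_zero phi c' z v.
      apply: filterS (near_not_closed (closed_cube_closed box_img) c'y nK) => x [cx nx].
      by rewrite (supp_ext_zero lp).
    by apply: smooth_at_near e _; exact: smooth_at_cst.
  have H : overlap c' c y by [].
  have e : \forall z \near y, phi (transition c' c z) (v *m 'J (transition c' c) z) = ext_zero phi c' z v.
    by apply: filterS (overlap_nbhs H) => z' H'; rewrite ext_zeroE.
  apply: smooth_at_near e _; apply: smooth_at_pull => //.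
  - by apply: filterE => x; exact: (ma x).1.
  - exact: transition_smooth_at.
  - by apply: smooth_at_mulmx; [exact: smooth_at_cst|exact: jac_smooth].
- move=> c'' ac'' y H v; have [c'y c''x] := H.
  have e : chart_inv c'' (transition c' c'' y) = chart_inv c' y by rewrite /transition chart_funK.
  have [cx|ncx] := pselect (chart_dom c (chart_inv c' y)); last first.
    by rewrite /ext_zero; case: pselect => //; case: pselect => //; rewrite e.
  have H1 : overlap c' c y by [].
  have H2 : overlap c'' c (transition c' c'' y) by split; [exact: overlap_img|rewrite e].
  apply: etrans (ext_zeroE _ _ H1) _; apply/esym; apply: etrans (ext_zeroE _ _ H2) _.
  have -> : transition c'' c (transition c' c'' y) = transition c' c y by rewrite /transition chart_funK.
  exact: (f_equal (fun w => phi (transition c' c y) w) (mulmx_chain v (jac_chain ac' ac'' ac H H1))).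
Qed.

Definition local_d k (phi : 'rV[R]_m -> 'M[R]_(k, m) -> R) y (v : 'M[R]_(k.+1, m)) :=
  \sum_(i < k.+1) (-1) ^+ i * 'D_(row i v) (phi ^~ (row' i v)) y.

Lemma ext_zero_chart k (phi : 'rV[R]_m -> 'M[R]_(k, m) -> R) y v : chart_img c y ->
  ext_zero phi c y v = phi y v.
Proof.
move=> cy; rewrite ext_zeroE; last exact: overlap_self.
by rewrite jac_self// mulmx1 /transition chart_invK.
Qed.

Lemma ext_d_ext_zero k (phi : 'rV[R]_m -> 'M[R]_(k, m) -> R) y v : chart_img c y ->
  ext_d (ext_zero phi) c y v = local_d phi y v.
Proof.
move=> cy; apply: eq_bigr => i _; congr (_ * _); apply: near_eq_derive.
have n : nbhs y (chart_img c) by apply: open_nbhs_nbhs; split=> //; exact: chart_img_open.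
by apply: filterS n => z cz; rewrite ext_zero_chart.
Qed.

Lemma near_not_box z : ~ box y0 r z -> \forall x \near z, ~ box y0 r x.
Proof.
move=> nb; have o : open (~` box y0 r).
  by apply: closed_openC; apply: compact_closed; [exact: norm_hausdorff|exact: box_compact].
exact: (open_nbhs_nbhs (conj o nb)).
Qed.

(** Coefficients are arbitrary outside the image of the chart; cut off at the box, where the support
    ends, they become smooth on the whole coordinate space. *)
Definition local_part k (a : preform M k) (v : 'M[R]_(k, m)) (y : 'rV[R]_m) : R :=
  if pselect (box y0 r y) is left _ then a c y v else 0.

Lemma local_partE k (a : preform M k) v y : supp_in K a -> chart_img c y -> local_part a v y = a c y v.
Proof.
move=> sa cy; rewrite /local_part; case: pselect => // nb.
by rewrite sa// => -[_]; rewrite chart_invK.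
Qed.

Lemma local_part_smooth k (a : preform M k) v y : is_form a -> supp_in K a ->
  smooth_at (local_part a v) y.
Proof.
move=> fa sa; have [cy|ncy] := pselect (chart_img c y).
  have n : nbhs y (chart_img c) by apply: open_nbhs_nbhs; split=> //; exact: chart_img_open.
  have e : \forall z \near y, a c z v = local_part a v z by apply: filterS n => z cz; rewrite local_partE.
  by apply: smooth_at_near e _; exact: form_smooth.
have nb : ~ box y0 r y by move=> /box_img.
have e : \forall z \near y, 0 = local_part a v z.
  by apply: filterS (near_not_box nb) => z nz; rewrite /local_part; case: pselect.
by apply: smooth_at_near e _; exact: smooth_at_cst.
Qed.

Lemma local_part0 k (a : preform M k) v y : ~ box y0 r y -> local_part a v y = 0.
Proof. by rewrite /local_part; case: pselect. Qed.

Lemma form_eq_ext_zero k (a b : preform M k) : is_form a -> supp_in K a ->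
  (forall c' y v, atlas c' -> overlap c' c y ->
     b c' y v = b c (transition c' c y) (v *m 'J (transition c' c) y)) -> supp_in K b ->
  (forall y v, chart_img c y -> a c y v = b c y v) -> form_eq a b.
Proof.
move=> fa sa tb sb e; apply: (form_eq_chart ac _ tb _ sa sb e) => [c' y v ac' H|x []//].
exact: form_transition.
Qed.

End Support.

Section Bumps.
Context {R : realType} {m : nat}.
Implicit Types (z y : 'rV[R]_m) (d s : R).

(** [hat] vanishes from 7/4 on, so this scale makes the bump vanish at distance d; it is 1 up to 4 d
    / 7, in particular up to d / 2. *)
Definition bump z d i s := hat ((s - z 0 i) * (7 / (4 * d))).

Lemma bump_smooth z d i (s : R) : smooth_at (bump z d i) s.
Proof.
apply: (smooth_at_comp (f := fun s : R => (s - z 0 i) * (7 / (4 * d)))); last exact: hat_smooth.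
  exact: fin_dim_scalar.
apply: smooth_atM; last exact: smooth_at_cst.
by apply: smooth_atB; [exact: smooth_at_id|exact: smooth_at_cst].
Qed.

Lemma bump_eq0 z d i s : 0 < d -> d <= `|z 0 i - s| -> bump z d i s = 0.
Proof.
move=> d0 ds; apply: hat_eq0; rewrite normrM (@ger0_norm _ (7 / _)); last by rewrite divr_ge0// mulr_ge0// ltW.
rewrite -normrN opprB; have -> : 7 / 4 = d * (7 / (4 * d)) by field; lra.
by rewrite ler_wpM2r// divr_ge0// mulr_ge0// ltW.
Qed.

Lemma bump_eq1 z d i s : 0 < d -> `|z 0 i - s| <= d / 2 -> bump z d i s = 1.
Proof.
move=> d0 ds; apply: hat_eq1; rewrite normrM (@ger0_norm _ (7 / _)); last by rewrite divr_ge0// mulr_ge0// ltW.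
rewrite -normrN opprB; have : 1 = d / 2 * (8 / (4 * d)) by field; lra.
move=> e; rewrite [leRHS]e ler_pM// ?divr_ge0// ?mulr_ge0// ?ltW//.
by rewrite ltr_pM2r ?invr_gt0 ?mulr_gt0//; lra.
Qed.

Lemma pint_ge0 (a b : R) f : (forall s, 0 <= f s) -> 0 <= pint a b f.
Proof. by move=> f0; apply: Rintegral_ge0. Qed.

Lemma bump_int z d i (a b : R) : 0 < d -> a <= z 0 i - d / 2 -> z 0 i + d / 2 <= b ->
  0 < pint a b (bump z d i).
Proof.
move=> d0 az zb; have c a' b' : cont_on a' b' (bump z d i).
  by move=> t _; apply: smooth_at_continuous; exact: bump_smooth.
rewrite (pint_split az)//; last by lra.
rewrite (@pint_split _ (z 0 i - d / 2) (z 0 i + d / 2) b)//; last by lra.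
have p a' b' : 0 <= pint a' b' (bump z d i) by apply: pint_ge0 => s; exact: hat_ge0.
suff -> : pint (z 0 i - d / 2) (z 0 i + d / 2) (bump z d i) = d by have := p a (z 0 i - d / 2); have := p (z 0 i + d / 2) b; lra.
rewrite (eq_pint (g := fun=> 1)) => [|t /andP[t1 t2]]; last first.
  by rewrite bump_eq1// ler_distlC; lra.
have dd : forall t : R, z 0 i - d / 2 <= t <= z 0 i + d / 2 -> is_derive t 1 (fun t : R => t) 1.
  by move=> t _; exact: is_derive_id.
rewrite (pint_FTC _ _ dd); [by lra|by lra|exact: cont_on_cst].
Qed.

End Bumps.

Section Local_forms.
Context {R : realType} {m : nat}.
Variables (y0 : 'rV[R]_m) (r : R).

Lemma derive_coords (f : 'rV[R]_m -> R) (y v : 'rV[R]_m) : smooth_at f y ->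
  'D_v f y = (v *m \col_j 'D_('e_j) f y) 0 0.
Proof.
move=> sf; have df := smooth_at_differentiable sf.
rewrite deriveE// {1}(row_expand v) linear_sum mxE; apply: eq_bigr => j _.
by rewrite linearZ mxE -deriveE.
Qed.

Lemma local_form_sum (I : finType) (P : pred I) k (g : I -> 'rV[R]_m -> R) (F : I -> 'M[R]_(k, m) -> R) :
  (forall p, (forall y, smooth_at (g p) y) /\ (forall y, ~ box y0 r y -> g p y = 0)) ->
  (forall p, multilinear (F p) /\ alternating (F p)) ->
  local_form y0 r (fun y v => \sum_(p | P p) g p y * F p v) /\
  forall y v, local_d (fun y v => \sum_(p | P p) g p y * F p v) y v =
    \sum_(p | P p) \sum_(i < k.+1) (-1) ^+ i * ('D_(row i v) (g p) y * F p (row' i v)).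
Proof.
move=> hg hF; have sF p (s : R) y : smooth_at (fun y => g p y * s) y.
  by apply: smooth_atM; [exact: (hg p).1|exact: smooth_at_cst].
split; first split.
- move=> y; split; [apply: multilinear_sum|apply: alternating_sum] => p; [exact: (hF p).1|exact: (hF p).2].
- by move=> v y; apply: smooth_at_sum => p _; exact: sF.
- by move=> y v nb; apply: big1 => p _; rewrite (hg p).2// mul0r.
move=> y v; rewrite exchange_big; apply: eq_bigr => i _; rewrite /= -mulr_sumr; congr (_ * _).
have -> : (fun x => \sum_(p | P p) g p x * F p (row' i v)) =
    fun x => \sum_(p <- [seq p <- index_enum I | P p]) g p x * F p (row' i v).
  by apply/funext => x; rewrite big_filter.
rewrite -[RHS]big_filter (@derive_sum_mul R _ I _ g (fun p _ => F p (row' i v)) y (row i v)).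
- by apply: eq_bigr => p _; rewrite derive_cst mulr0 addr0.
- by move=> p; apply: smooth_at_differentiable; exact: (hg p).1.
- by move=> p; exact: differentiable_cst.
Qed.

End Local_forms.

Section Cube_cohomology.
Context {R : realType} {m : nat} {M : manifold R m.+2}.
Variables (c : chart R m.+2 M) (y0 : 'rV[R]_m.+2) (r : R).
Hypothesis ac : atlas c.
Hypothesis r_gt0 : 0 < r.
Hypothesis box_img : box y0 r `<=` chart_img c.
Notation K := (closed_cube c y0 r).

Definition bump_density (z : 'rV[R]_m.+2) (d : R) (y : 'rV[R]_m.+2) := \prod_i bump z d i (y 0 i).

Definition bump_form (z : 'rV[R]_m.+2) (d : R) : preform M m.+2 :=
  ext_zero c (fun y v => bump_density z d y * \det v).

Lemma bump_density_smooth z d (y : 'rV[R]_m.+2) : smooth_at (bump_density z d) y.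
Proof.
apply: smooth_at_prod => i _.
apply: (smooth_at_comp (f := fun y : 'rV[R]_m.+2 => y 0 i)); last exact: bump_smooth.
  exact: fin_dim_scalar.
by apply: smooth_at_coord; exact: smooth_at_id.
Qed.

Lemma bump_density0 z d y : 0 < d -> ~ box z d y -> bump_density z d y = 0.
Proof.
move=> d0 /not_boxP[j lt]; rewrite /bump_density (bigD1 j)//= bump_eq0 ?mul0r//.
exact: ltW.
Qed.

Lemma bump_local_form z d : 0 < d -> local_form z d (fun y (v : 'M[R]_m.+2) => bump_density z d y * \det v).
Proof.
move=> d0; split.
- move=> y; split.
    apply: multilinear_of_set_row => i a b x x' v.
    by rewrite (multilinear_set_row det_multilinear) mulrDr !(mulrCA _ (bump_density z d y)).
  by move=> v i j ij e; rewrite (det_alternating ij e) mulr0.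
- by move=> v y; apply: smooth_atM; [exact: bump_density_smooth|exact: smooth_at_cst].
- by move=> y v nb; rewrite bump_density0// mul0r.
Qed.

Lemma bump_form_form z d : 0 < d -> box z d `<=` chart_img c -> is_form (bump_form z d).
Proof. by move=> d0 zi; apply: (ext_zero_form ac zi); exact: bump_local_form. Qed.

Lemma supp_bump_form z d : 0 < d -> supp_in (closed_cube c z d) (bump_form z d).
Proof. by move=> d0; apply: supp_ext_zero; exact: bump_local_form. Qed.

(** [top_decomposition] is used with the normalised bumps of the smaller box as h; its divergence
    term becomes an exterior derivative by [det_cons_identity]. The freedom in the smaller box will
    allow different cubes to be compared. *)
Lemma top_exact_in (z : 'rV[R]_m.+2) (d : R) (a : preform M m.+2) : 0 < d -> box z d `<=` box y0 r ->
  is_form a -> supp_in K a ->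
  exists (s : R) (t : preform M m.+1), [/\ is_form t, supp_in K t &
    form_eq a (form_add (form_scale (fun=> s) (bump_form z d)) (ext_d t))].
Proof.
move=> d0 zb fa sa.
pose N i := pint (y0 0 i - r - 1) (y0 0 i + r + 1) (bump z d i).
have cz i : y0 0 i - r <= z 0 i - d /\ z 0 i + d <= y0 0 i + r.
  have H s : `|z 0 i - s| <= d -> `|y0 0 i - s| <= r.
    move=> zs; have : box z d (setc i s z).
      by move=> j; rewrite setcE; case: eqP => [->//|_]; rewrite subrr normr0 ltW.
    by move/zb => /(_ i); rewrite setcE eqxx.
  have h1 : `|z 0 i - (z 0 i - d)| <= d by rewrite opprB addrC subrK ger0_norm// ltW.
  have h2 : `|z 0 i - (z 0 i + d)| <= d by rewrite opprD addrA subrr sub0r normrN ger0_norm// ltW.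
  by have := H _ h1; have := H _ h2; rewrite !ler_distlC; lra.
have N0 i : 0 < N i by have [z1 z2] := cz i; apply: bump_int => //; lra.
pose h i (s : R) := (N i)^-1 * bump z d i s.
have hs i (s : R) : smooth_at (h i) s.
  by apply: smooth_atM; [exact: smooth_at_cst|exact: bump_smooth].
have h0 i s : r < `|y0 0 i - s| -> h i s = 0.
  move=> lt; rewrite /h bump_eq0 ?mulr0//; have [z1 z2] := cz i.
  by move: lt; rewrite lter_normr => /orP[|] lt; rewrite ler_normr; apply/orP; [left|right]; lra.
have hi i : pint (y0 0 i - r - 1) (y0 0 i + r + 1) (h i) = 1.
  rewrite pintZ ?mulVf ?gt_eqF ?N0// => t _.
  by apply: smooth_at_continuous; exact: bump_smooth.
have cf : cs y0 r (local_part c y0 r a 1%:M).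
  by split=> y; [exact: local_part_smooth|exact: local_part0].
have [Z [s [cZ eZ]]] := top_decomposition r_gt0 hs h0 hi cf.
have [lf ld] := local_form_sum xpredT (I := 'I_m.+2) (F := fun j v => \det (cons_row 'e_j v : 'M[R]_m.+2)) cZ
  (fun j => conj (multilinear_cons _ det_multilinear) (alternating_cons _ det_alternating)).
pose phi y (v : 'M[R]_(m.+1, m.+2)) := \sum_j Z j y * \det (cons_row 'e_j v : 'M[R]_m.+2).
have ft : is_form (ext_zero c phi) := ext_zero_form ac box_img lf.
have st : supp_in K (ext_zero c phi) by exact: supp_ext_zero.
pose s' := s * \prod_i (N i)^-1.
have fb : is_form (bump_form z d) by apply: bump_form_form => // y /zb/box_img.
have sb : supp_in K (bump_form z d).
  apply: supp_in_sub (supp_bump_form d0) => x [cx bx]; split=> //; exact: zb.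
exists s', (ext_zero c phi); split=> //.
have fs : is_form (form_scale (fun=> s') (bump_form z d)).
  by apply: is_form_scale => //; exact: smooth_fun_cst.
apply: (form_eq_ext_zero ac fa sa).
- move=> c' y v ac' H; rewrite /form_add (form_transition _ fs ac' ac H).
  by congr (_ + _); exact: ext_d_transition.
- move=> c' ac' y cy nK v; rewrite /form_add /form_scale sb// mulr0 add0r.
  by apply: (supp_in_ext_d _ st) => //; exact: closed_cube_closed.
move=> y v cy; have [ma aa] : multilinear (a c y) /\ alternating (a c y) by have [H _ _] := fa c ac; exact: H.
rewrite (top_form_det ma aa) -(local_partE ac 1%:M sa cy) eZ /form_add /form_scale /bump_form ext_zero_chart//.
rewrite ext_d_ext_zero// ld mulrDl addrC; congr (_ + _).
  rewrite /bump_density /h big_split /= /s' -!mulrA; congr (_ * _); ring.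
rewrite mulr_suml; apply: eq_bigr => j _.
have := det_cons_identity (\col_i 'D_('e_i) (Z j) y) 'e_j v.
rewrite -derive_coords => [->|]; last exact: (cZ j).1.
by apply: eq_bigr => i _; rewrite -derive_coords//; exact: (cZ j).1.
Qed.

(** By [codim1_form] a closed form of codimension one amounts to a vector field Y of divergence
    zero, and the potentials of [codim1_decomposition] are, up to sign, the coefficients of a
    primitive. *)
Lemma codim1_exact_in (a : preform M m.+1) : is_form a -> supp_in K a -> closed_form a -> exact_form a.
Proof.
move=> fa sa da.
pose N i := pint (y0 0 i - r - 1) (y0 0 i + r + 1) (bump y0 r i).
have N0 i : 0 < N i by apply: bump_int => //; have := r_gt0; lra.
pose h i (s : R) := (N i)^-1 * bump y0 r i s.
have hs i (s : R) : smooth_at (h i) s.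
  by apply: smooth_atM; [exact: smooth_at_cst|exact: bump_smooth].
have h0 i s : r < `|y0 0 i - s| -> h i s = 0 by move=> lt; rewrite /h bump_eq0 ?mulr0// ltW.
have hi i : pint (y0 0 i - r - 1) (y0 0 i + r + 1) (h i) = 1.
  rewrite pintZ ?mulVf ?gt_eqF ?N0// => t _.
  by apply: smooth_at_continuous; exact: bump_smooth.
pose Y (j : 'I_m.+2) y := (-1) ^+ j * local_part c y0 r a (row' j 1%:M) y.
have cY j : cs y0 r (Y j).
  split=> y; last by move=> nb; rewrite /Y local_part0// mulr0.
  by apply: smooth_atM; [exact: smooth_at_cst|exact: local_part_smooth].
(* This is closedness evaluated on the standard basis. *)
have dY y : \sum_j 'D_('e_j) (Y j) y = 0.
  have [by_|nb] := pselect (box y0 r y); last by apply: big1 => j _; exact: (cs_derive 'e_j (cY j)).2.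
  have cy := box_img by_.
  apply: etrans _ (da c ac y cy 1%:M); apply: eq_bigr => j _.
  rewrite row1 /Y.
  rewrite (deriveM (smooth_at_derivable (smooth_at_cst _ _)) (smooth_at_derivable (local_part_smooth ac box_img _ _ fa sa))).
  rewrite derive_cst scaler0 addr0; congr (_ * _); apply: near_eq_derive.
  have n : nbhs y (chart_img c) by apply: open_nbhs_nbhs; split=> //; exact: chart_img_open.
  by apply: filterS n => z cz; rewrite local_partE.
have [B [cB eB]] := codim1_decomposition r_gt0 hs h0 hi cY dY.
have cB' (p : 'I_m.+2 * 'I_m.+2) : cs y0 r (fun y => - B p.1 p.2 y).
  split=> y; first by apply: smooth_atN; exact: (cB p.1 p.2).1.
  by move=> nb; rewrite (cB p.1 p.2).2// oppr0.
have [lf ld] := local_form_sum (fun p : 'I_m.+2 * 'I_m.+2 => (p.1 < p.2)%N)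
  (F := fun p v => \det (cons_row 'e_p.1 (cons_row 'e_p.2 v) : 'M[R]_m.+2)) cB'
  (fun p => conj (multilinear_cons _ (multilinear_cons _ det_multilinear))
     (alternating_cons _ (alternating_cons _ det_alternating))).
set phi := fun y v => _ in lf ld.
have ft : is_form (ext_zero c phi) := ext_zero_form ac box_img lf.
have st : supp_in K (ext_zero c phi) by exact: supp_ext_zero.
exists (ext_zero c phi) => //.
apply: (form_eq_ext_zero ac fa sa).
- by move=> c' y v ac' H; exact: ext_d_transition.
- by apply: supp_in_ext_d => //; exact: closed_cube_closed.
move=> y v cy; have [ma aa] : multilinear (a c y) /\ alternating (a c y) by have [H _ _] := fa c ac; exact: H.
rewrite ext_d_ext_zero// ld (codim1_form ma aa).
transitivity (\sum_j Y j y * \det (cons_row 'e_j v : 'M[R]_m.+2)).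
  by apply: eq_bigr => j _; rewrite /Y (local_partE ac _ sa cy).
under eq_bigr => j _ do rewrite eB mulrBl !mulr_suml.
have T (p : 'I_m.+2 * 'I_m.+2) : \sum_(i < m.+1) (-1) ^+ i * ('D_(row i v) (fun y => - B p.1 p.2 y) y *
     \det (cons_row 'e_p.1 (cons_row 'e_p.2 (row' i v)) : 'M[R]_m.+2)) =
   'D_('e_p.1) (B p.1 p.2) y * \det (cons_row 'e_p.2 v : 'M[R]_m.+2) -
   'D_('e_p.2) (B p.1 p.2) y * \det (cons_row 'e_p.1 v : 'M[R]_m.+2).
  have := det_cons2_identity (\col_i 'D_('e_i) (B p.1 p.2) y) 'e_p.1 'e_p.2 v.
  have sB := (cB p.1 p.2).1 y.
  rewrite -!derive_coords// => e; rewrite -[RHS]opprB -e -sumrN; apply: eq_bigr => i _.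
  by rewrite -derive_coords// deriveN ?mulNr ?mulrN//; exact: smooth_at_derivable.
rewrite (eq_bigr _ (fun p _ => T p)) !sumrB; congr (_ - _).
  by rewrite (exchange_big_dep xpredT)//= pair_big_dep.
by rewrite pair_big_dep.
Qed.

End Cube_cohomology.

(** * Top forms on a compact connected manifold *)

Section Cohomology_relation.
Context {R : realType} {m : nat} {M : manifold R m} {k : nat}.
Implicit Types a b : preform M k.+1.

Definition cohom a b := exact_form (form_sub a b).

Lemma cohom_refl a : cohom a a.
Proof. by apply: exact_eq (exact_zero k) => c ac y cy v; rewrite /form_sub subrr. Qed.

Lemma cohom_trans b a d : cohom a b -> cohom b d -> cohom a d.
Proof.
move=> ab bd; apply: exact_eq (exact_add ab bd) => c ac y cy v.
by rewrite /form_add /form_sub addrA subrK.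
Qed.

Lemma cohom_sym a b : cohom a b -> cohom b a.
Proof.
move=> ab; apply: exact_eq (exact_scale (-1) ab) => c ac y cy v.
by rewrite /form_scale /form_sub mulN1r opprB.
Qed.

Lemma cohom_scale (s : R) a b : cohom a b -> cohom (form_scale (fun=> s) a) (form_scale (fun=> s) b).
Proof.
move=> ab; apply: exact_eq (exact_scale s ab) => c ac y cy v.
by rewrite /form_scale /form_sub mulrBr.
Qed.

Lemma cohom_exact a b : cohom a b -> exact_form b -> exact_form a.
Proof.
move=> ab eb; apply: exact_eq (exact_add ab eb) => c ac y cy v.
by rewrite /form_add /form_sub subrK.
Qed.

Lemma cohom_eq a b d : form_eq a b -> cohom b d -> cohom a d.
Proof. by move=> e bd; apply: exact_eq bd => c ac y cy v; rewrite /form_sub e. Qed.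

End Cohomology_relation.

Record ccube (R : realType) (m : nat) (M : manifold R m) := CCube {
  cc : chart R m M;
  cy : 'rV[R]_m;
  cr : R;
  cc_atlas : atlas cc;
  cr_gt0 : 0 < cr;
  cc_img : box cy cr `<=` chart_img cc
}.

Lemma not_in_box (R : realType) (m : nat) (y x : 'rV[R]_m) r : ~ box y r x ->
  exists j, r < `|y 0 j - x 0 j|.
Proof.
move=> nb; apply: contrapT => H; apply: nb => j; rewrite leNgt; apply/negP => lt.
by apply: H; exists j.
Qed.

Lemma sum_stick (R : realType) (f : nat -> R) n :
  \sum_(i < n) f i * \prod_(j < i) (1 - f j) = 1 - \prod_(j < n) (1 - f j).
Proof.
elim: n => [|n IH]; first by rewrite !big_ord0 subrr.
by rewrite big_ord_recr /= IH [in RHS]big_ord_recr /=; ring.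
Qed.

Section Chart_cubes.
Context {R : realType} {m : nat} {M : manifold R m}.
Implicit Types C D : ccube M.

(** Three fractions of the side occur: cubes with t = 1/4 cover M, cutoffs are supported in t = 1/2,
    and forms are treated in t = 1. *)
Definition cin (t : R) C := cube (cc C) (cy C) (t * cr C).
Definition ccl (t : R) C := closed_cube (cc C) (cy C) (t * cr C).

Lemma cin_open t C : open (cin t C).
Proof. exact: cube_open. Qed.

Lemma cin_ccl t C : cin t C `<=` ccl t C.
Proof. by move=> x [cx bx]; split=> //; exact: ball_box. Qed.

Lemma ccl_cin s t C : 0 < t -> s < t -> ccl s C `<=` cin t C.
Proof.
move=> t0 st x [cx bx]; split=> //; apply: box_ball bx; first by rewrite mulr_gt0 ?cr_gt0.
by rewrite ltr_pM2r ?cr_gt0.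
Qed.

Lemma box_mono (y : 'rV[R]_m) s t : s <= t -> box y s `<=` box y t.
Proof. by move=> st z bz j; exact: le_trans (bz j) st. Qed.

Lemma ccl_img t C : t <= 1 -> box (cy C) (t * cr C) `<=` chart_img (cc C).
Proof.
move=> t1 y b; apply/cc_img/(box_mono _ b); rewrite -[leRHS]mul1r ler_wpM2r// ltW// cr_gt0//.
Qed.

Lemma ccl_closed t C : t <= 1 -> closed (ccl t C).
Proof. by move=> t1; apply: closed_cube_closed; exact: ccl_img. Qed.

Lemma ccl_mono s t C : s <= t -> ccl s C `<=` ccl t C.
Proof.
by move=> st x [cx bx]; split=> //; apply: box_mono bx; rewrite ler_wpM2r// ltW// cr_gt0.
Qed.

Lemma cin_mono s t C : s <= t -> cin s C `<=` cin t C.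
Proof. by move=> st; apply: cube_le; rewrite ler_wpM2r// ltW// cr_gt0. Qed.

Lemma subcube C x (N : set M) : cin 1 C x -> nbhs x N ->
  exists D, [/\ cc D = cc C, cin (1/4) D x, box (cy D) (cr D) `<=` box (cy C) (cr C) & ccl 1 D `<=` N].
Proof.
move=> cx nN; have n : nbhs x (cin 1 C `&` N).
  by apply: filterI => //; apply: open_nbhs_nbhs; split=> //; exact: cin_open.
have [r r0 [ri rN]] := small_cube cx.1 n.
have r2 : 0 < r / 2 by rewrite divr_gt0.
have bi : box (cc C x) (r / 2) `<=` ball (cc C x) r by apply: box_ball => //; lra.
have bi' : box (cc C x) (r / 2) `<=` chart_img (cc C) by move=> z /bi/ri.
exists (CCube (cc_atlas C) r2 bi'); split=> //=.
- split; first exact: cx.1.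
  by apply/ball_rVP => /=; [rewrite mulr_gt0//; lra|move=> j; rewrite subrr normr0 mulr_gt0//; lra].
- move=> z /bi bz; have H := cube_inv ri bz; have [[_]] := rN _ H.
  rewrite chart_invK; last exact: ri.
  by rewrite mul1r => /ball_box.
- move=> z [cz]; rewrite /= mul1r => /bi bz.
  by have [] := rN z (conj cz bz).
Qed.

Lemma exists_cube x (N : set M) : nbhs x N -> exists D, cin (1/4) D x /\ ccl 1 D `<=` N.
Proof.
move=> nN; have [r r0 [ri rN]] := small_cube (chart_at_dom x) nN.
have r2 : 0 < r / 2 by rewrite divr_gt0.
have bi : box (chart_at x x) (r / 2) `<=` ball (chart_at x x) r by apply: box_ball => //; lra.
have bi' : box (chart_at x x) (r / 2) `<=` chart_img (chart_at x) by move=> z /bi/ri.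
exists (CCube (chart_at_atlas x) r2 bi'); split.
  split; first exact: chart_at_dom.
  by apply/ball_rVP => /=; [rewrite mulr_gt0//; lra|move=> j; rewrite subrr normr0 mulr_gt0//; lra].
by move=> z [cz]; rewrite /= mul1r => /bi bz; apply: rN.
Qed.

Lemma finite_cubes (W : M -> ccube M) : [set: M] !=set0 -> compact [set: M] ->
  (forall x, cin (1/4) (W x) x) ->
  exists (n : nat) (p : 'I_n.+1 -> M), forall x, exists i, cin (1/4) (W (p i)) x.
Proof.
move=> [x0 _] cM Wx.
have [x _|s Hs] := compact_finite_cover (f := fun x => cin (1/4) (W x)) cM.
  by exists x; apply: open_nbhs_nbhs; split; [exact: cin_open|].
have [i0 i0s _] := Hs x0 I.
have s0 : (0 < size s)%N by case: s i0s {Hs}.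
exists (size s).-1, (fun i => nth x0 s i) => x; have [i /(List.In_nth _ _ x0)[n [/ssrnat.ltP ns <-]] ix] := Hs x I.
have n' : (n < (size s).-1.+1)%N by rewrite prednK.
exists (Ordinal n') => /=; suff -> : nth x0 s n = List.nth n s x0 by [].
by elim: s n {Hs i0s s0 ns ix n'} => [|a s IH] [|n] //=.
Qed.

Definition cutoff C (x : M) : R :=
  if pselect (chart_dom (cc C) x) is left _
  then \prod_i bump (cy C) (1/2 * cr C) i (cc C x 0 i) else 0.

Lemma half_gt0 C : 0 < 1/2 * cr C.
Proof. by rewrite mulr_gt0 ?cr_gt0//; lra. Qed.

Lemma cutoff_supp C x : ~ ccl (1/2) C x -> cutoff C x = 0.
Proof.
move=> nK; rewrite /cutoff; case: pselect => // cx.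
have /not_in_box[j lt] : ~ box (cy C) (1/2 * cr C) (cc C x) by move=> b; apply: nK; split.
by rewrite (bigD1 j)//= bump_eq0 ?mul0r ?half_gt0// ltW.
Qed.

Lemma cutoff_eq1 C x : cin (1/4) C x -> cutoff C x = 1.
Proof.
move=> [cx /ball_box bx]; rewrite /cutoff; case: pselect => // _; apply: big1 => i _.
apply: bump_eq1 (half_gt0 C) _; apply: le_trans (bx i) _.
by have := cr_gt0 C; lra.
Qed.

Lemma cutoff_smooth C : smooth_fun (cutoff C).
Proof.
move=> c ac y cy'.
have lf : local_form (cy C) (1/2 * cr C)
    (fun y (_ : 'M[R]_(0, m)) => \prod_i bump (cy C) (1/2 * cr C) i (y 0 i)).
  split.
  - by move=> z; split; [case|move=> v []].
  - move=> _ z; apply: smooth_at_prod => i _.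
    apply: (smooth_at_comp (f := fun y : 'rV[R]_m => y 0 i)); last exact: bump_smooth.
      exact: fin_dim_scalar.
    by apply: smooth_at_coord; exact: smooth_at_id.
  - by move=> z _ /not_in_box[j lt]; rewrite (bigD1 j)//= bump_eq0 ?mul0r ?half_gt0// ltW.
have ci : box (cy C) (1/2 * cr C) `<=` chart_img (cc C) by apply: ccl_img; lra.
exact: (form_smooth 0 (ext_zero_form (cc_atlas C) ci lf) ac cy').
Qed.

End Chart_cubes.

Section Partition_of_unity.
Context {R : realType} {m : nat} {M : manifold R m} {n : nat}.
Variable C : 'I_n.+1 -> ccube M.
Hypothesis cover : forall x, exists i, cin (1/4) (C i) x.

(** Chosen so that the sum telescopes to 1 minus the product of all [1 - cutoff], a product that
    vanishes since at every point some cutoff is 1. *)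
Definition punity (i : 'I_n.+1) x : R := cutoff (C i) x * \prod_(j < i) (1 - cutoff (C (inord j)) x).

Lemma punity_sum x : \sum_i punity i x = 1.
Proof.
have := sum_stick (fun j => cutoff (C (inord j)) x) n.+1.
have [i /cutoff_eq1 e] := cover x.
rewrite (bigD1 i (F := fun j : 'I_n.+1 => 1 - _))//= inord_val e subrr mul0r subr0 => {1}<-.
by apply: eq_bigr => j _; rewrite inord_val.
Qed.

Lemma punity_smooth i : smooth_fun (punity i).
Proof.
move=> c ac y cy'; apply: smooth_atM; first exact: cutoff_smooth.
apply: smooth_at_prod => j _; apply: smooth_atB; first exact: smooth_at_cst.
exact: cutoff_smooth.
Qed.

Lemma punity_supp i x : ~ ccl (1/2) (C i) x -> punity i x = 0.
Proof. by move=> nK; rewrite /punity cutoff_supp// mul0r. Qed.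

End Partition_of_unity.

Section Top_forms.
Context {R : realType} {m : nat} {M : manifold R m.+2}.
Hypothesis M0 : [set: M] !=set0.
Hypothesis cM : compact [set: M].
Hypothesis coM : connected [set: M].
Implicit Types C D : ccube M.

Definition cube_form C : preform M m.+2 := bump_form (cc C) (cy C) (cr C).

Lemma cube_form_form C : is_form (cube_form C).
Proof. by apply: bump_form_form; [exact: cc_atlas|exact: cr_gt0|exact: cc_img]. Qed.

Lemma cube_form_supp C : supp_in (ccl 1 C) (cube_form C).
Proof. by rewrite /ccl mul1r; apply: supp_bump_form; exact: cr_gt0. Qed.

Lemma top_cohom_in C D (a : preform M m.+2) : cc D = cc C -> box (cy D) (cr D) `<=` box (cy C) (cr C) ->
  is_form a -> supp_in (ccl 1 C) a ->
  exists (s : R) (t : preform M m.+1), [/\ is_form t, supp_in (ccl 1 C) t &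
    form_eq a (form_add (form_scale (fun=> s) (cube_form D)) (ext_d t))].
Proof.
rewrite /ccl mul1r => e b fa sa.
have [s [t [ft st eq]]] := top_exact_in (cc_atlas C) (cr_gt0 C) (@cc_img _ _ _ C) (cr_gt0 D) b fa sa.
by exists s, t; split=> //; rewrite /cube_form e.
Qed.

Lemma top_cohom C D (a : preform M m.+2) : cc D = cc C -> box (cy D) (cr D) `<=` box (cy C) (cr C) ->
  is_form a -> supp_in (ccl 1 C) a ->
  exists s : R, cohom a (form_scale (fun=> s) (cube_form D)).
Proof.
move=> e b fa sa; have [s [t [ft st eq]]] := top_cohom_in e b fa sa.
exists s; exists t => // c ac y cy' v.
by rewrite /form_sub eq// /form_add addrC addKr.
Qed.

Let good C0 C := forall a : preform M m.+2, is_form a -> supp_in (ccl 1 C) a ->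
  exists s : R, cohom a (form_scale (fun=> s) (cube_form C0)).

(** If C meets a good cube D, a small cube in both has a bump form that spans the forms supported in
    C up to exact ones and is itself supported in D, so C is good. The points in good cubes thus
    form an open and closed set, and M is connected. *)
Lemma good_all C0 x : exists C, cin 1 C x /\ good C0 C.
Proof.
pose G : set M := [set x | exists C, cin 1 C x /\ good C0 C].
have oG : open G.
  rewrite openE => y [C [Cy gC]]; have n : nbhs y (cin 1 C).
    by apply: open_nbhs_nbhs; split=> //; exact: cin_open.
  by apply: filterS n => z Cz; exists C.
have cG : closed G.
  rewrite -(setCK G); apply: open_closedC; rewrite openE => y nGy.
  have [C [Cy _]] := exists_cube (@filterT _ (nbhs y) _).
  have Cy1 : cin 1 C y by apply: cin_mono Cy; lra.
  have n : nbhs y (cin 1 C) by apply: open_nbhs_nbhs; split=> //; exact: cin_open.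
  apply: filterS n => z Cz [D [Dz gD]]; apply: nGy; exists C; split=> // a fa sa.
  have nD : nbhs z (cin 1 D) by apply: open_nbhs_nbhs; split=> //; exact: cin_open.
  have [B [eB _ bB BD]] := subcube Cz nD.
  have [s hs] := top_cohom eB bB fa sa.
  have [s' hs'] := gD (cube_form B) (cube_form_form B)
    (supp_in_sub (fun z Bz => cin_ccl (BD z Bz)) (cube_form_supp (C := B))).
  exists (s * s'); apply: cohom_trans hs _; apply: cohom_trans (cohom_scale s hs') _.
  by apply: cohom_eq (cohom_refl _) => c ac u cu v; rewrite /form_scale mulrA.
suff GT : G = setT by have : G x by rewrite GT.
have := coM; apply.
- exists (chart_inv (cc C0) (cy C0)); exists C0; split.
    apply: cube_inv; first by move=> z /ball_box; exact: ccl_img.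
    by apply/ball_rVP; rewrite ?mul1r ?cr_gt0// => j; rewrite subrr normr0 cr_gt0.
  by move=> a fa sa; exact: top_cohom.
- by exists G => //; rewrite setTI.
- by exists G => //; rewrite setTI.
Qed.

(** The form is split by a partition of unity subordinate to finitely many good cubes. *)
Lemma top_span C0 (a : preform M m.+2) : is_form a ->
  exists s : R, cohom a (form_scale (fun=> s) (cube_form C0)).
Proof.
move=> fa.
have H x : exists D, cin (1/4) D x /\ good C0 D.
  have [C [Cx gC]] := good_all C0 x.
  have [D [eD Dx bD _]] := subcube Cx (@filterT _ (nbhs x) _).
  exists D; split=> // b fb sb; apply: gC => //; apply: supp_in_sub sb => z [].
  by rewrite eD => dz bz; split=> //; move: bz; rewrite !mul1r; exact: bD.
have [W HW] := choice H.
have [n [p cov]] := finite_cubes M0 cM (fun x => (HW x).1).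
pose rho := punity (fun i => W (p i)).
have fr i : is_form (form_scale (rho i) a) by apply: is_form_scale => //; exact: punity_smooth.
have sr i : supp_in (ccl 1 (W (p i))) (form_scale (rho i) a).
  move=> c ac y cy' nK v; rewrite /form_scale /rho punity_supp ?mul0r// => K; apply: nK.
  by apply: ccl_mono K; lra.
have [s hs] := choice (fun i => (HW (p i)).2 _ (fr i) (sr i)).
exists (\sum_i s i); apply: exact_eq (exact_sum (index_enum _) hs) => c ac y cy' v.
rewrite /form_sub /form_scale sumrB -!mulr_suml; congr (_ - _).
by rewrite /rho (punity_sum cov) mul1r.
Qed.

Lemma top_exact C0 (a : preform M m.+2) : exact_form (cube_form C0) -> is_form a -> exact_form a.
Proof.
move=> e fa; have [s hs] := top_span C0 fa.
by apply: cohom_exact hs _; exact: exact_scale.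
Qed.

End Top_forms.

(** * Exactness in codimension one *)

Section Boundaries.
Context {R : realType} {I : finType}.
Implicit Types (x y z i j : I) (p : I * I) (t : I * I * I).

Definition edge x y p : R := (p == (x, y))%:R.

(** The antisymmetrised boundary of a triangle: 1-chains are antisymmetric functions of pairs, and
    degenerate triples have boundary 0. *)
Definition bdry t p : R := let: (x, y, z) := t in
  edge x y p + edge y z p + edge z x p - edge y x p - edge z y p - edge x z p.

Lemma sum_edge x y (c : I * I -> R) : \sum_p c p * edge x y p = c (x, y).
Proof.
rewrite (bigD1 (x, y))//= big1 ?addr0 => [|p /negbTE ne]; first by rewrite /edge eqxx mulr1.
by rewrite /edge ne mulr0.
Qed.

Lemma sum_bdry t (c : I * I -> R) : \sum_p c p * bdry t p = let: (x, y, z) := t in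
  c (x, y) + c (y, z) + c (z, x) - c (y, x) - c (z, y) - c (x, z).
Proof.
case: t => [[x y] z]; rewrite /bdry.
under eq_bigr do rewrite !mulrBr !mulrDr.
by rewrite !sumrB !big_split /= !sum_edge.
Qed.

Lemma edge_sum_r x y i : \sum_j edge x y (i, j) = (i == x)%:R.
Proof.
rewrite (bigD1 y)//= big1 ?addr0 => [|j /negbTE jy]; rewrite /edge xpair_eqE ?eqxx ?andbT//.
by rewrite jy andbF.
Qed.

Lemma bdry_sum_r t i : \sum_j bdry t (i, j) = 0.
Proof.
case: t => [[x y] z]; rewrite /bdry !sumrB !big_split /= !edge_sum_r; ring.
Qed.

Lemma edgeC x y i j : edge x y (j, i) = edge y x (i, j).
Proof. by rewrite /edge !xpair_eqE andbC. Qed.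

Lemma bdryC t i j : bdry t (j, i) = - bdry t (i, j).
Proof. by case: t => [[x y] z]; rewrite /bdry !(edgeC _ _ i j); ring. Qed.

Lemma bdry_eq0 t i j : (let: (x, y, z) := t in [&& i != x, i != y & i != z]) -> bdry t (i, j) = 0.
Proof.
case: t => [[x y] z] /and3P[/negbTE ix /negbTE iy /negbTE iz].
by rewrite /bdry /edge !xpair_eqE ix iy iz !andFb !subr0 !addr0.
Qed.

(* A 1-chain of the nerve [N] that is orthogonal to the cocycles is a boundary. *)
Lemma boundary_span (N : I * I * I -> Prop) (a : I * I -> R) :
  (forall i j, a (j, i) = - a (i, j)) ->
  (forall c : I * I -> R, (forall i j, c (j, i) = - c (i, j)) ->
     (forall x y z, N (x, y, z) -> c (x, y) + c (y, z) + c (z, x) = 0) ->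
     \sum_p c p * a p = 0) ->
  exists b : I * I * I -> R, (forall t, ~ N t -> b t = 0) /\ forall p, a p = \sum_t b t * bdry t p.
Proof.
move=> aa H.
pose B : 'M[R]_(#|{: I * I * I}|, #|{: I * I}|) :=
  \matrix_(s, p) if `[< N (enum_val s) >] then bdry (enum_val s) (enum_val p) else 0.
pose ar : 'rV[R]_#|{: I * I}| := \row_p a (enum_val p).
(* Linear duality: a row lies in the row space of B once the columns of the cokernel of B annihilate
   it. Such a column, after antisymmetrisation, is a cocycle. *)
have : (ar <= B)%MS.
  rewrite submxE; apply/eqP/rowP => l; rewrite [RHS]mxE.
  pose c0 p := cokermx B (enum_rank p) l.
  pose c p := c0 p - c0 (p.2, p.1).
  have c0B t : N t -> \sum_p c0 p * bdry t p = 0.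
    move=> Nt; have : (B *m cokermx B) (enum_rank t) l = 0 by rewrite mulmx_coker mxE.
    rewrite mxE (reindex enum_rank)/=; last by apply: onW_bij; exact: enum_rank_bij.
    move=> e; rewrite -[RHS]e; apply: eq_bigr => p _; rewrite mxE !enum_rankK.
    by case: asboolP => // _; rewrite mulrC.
  have Hc : \sum_p c p * a p = 0.
    apply: H => [i j|x y z Nt]; first by rewrite /c /= opprB.
    by have := c0B _ Nt; rewrite sum_bdry /c /= => e; rewrite -[RHS]e; ring.
  have E : \sum_p c0 (p.2, p.1) * a p = - \sum_p c0 p * a p.
    rewrite (reindex_inj (h := fun p : I * I => (p.2, p.1)))/=; last first.
      by move=> [i j] [i' j'] [-> ->].
    by rewrite -sumrN; apply: eq_bigr => -[i j] _ /=; rewrite (aa i j) mulrN.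
  move: Hc; rewrite /c; under eq_bigr do rewrite mulrBl.
  rewrite sumrB E opprK => H2; have {}H2 : \sum_p c0 p * a p = 0 by lra.
  rewrite mxE (reindex enum_rank)/=; last by apply: onW_bij; exact: enum_rank_bij.
  by rewrite -[RHS]H2; apply: eq_bigr => p _; rewrite mxE enum_rankK mulrC.
move=> /submxP[D eD].
exists (fun t => if `[< N t >] then D 0 (enum_rank t) else 0); split.
  by move=> t nN; case: asboolP.
move=> p; have : ar 0 (enum_rank p) = a p by rewrite mxE enum_rankK.
rewrite eD mxE (reindex enum_rank)/= => [<-|]; last by apply: onW_bij; exact: enum_rank_bij.
apply: eq_bigr => t _; rewrite mxE !enum_rankK; case: asboolP => _ //.
by rewrite mulr0 mul0r.
Qed.

End Boundaries.

Lemma derive_fsum (R : realType) (V : normedModType R) (I : Type) (r : seq I) (f : I -> V -> R) p w :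
  (forall i, differentiable (f i) p) ->
  'D_w (fun q => \sum_(i <- r) f i q) p = \sum_(i <- r) 'D_w (f i) p.
Proof.
move=> df; have := derive_sum_mul r w df (fun i => differentiable_cst (1 : R) p).
rewrite (_ : (fun q => \sum_(i <- r) f i q * _) = fun q => \sum_(i <- r) f i q); last first.
  by apply/funext => q; apply: eq_bigr => i _; rewrite mulr1.
by move=> ->; apply: eq_bigr => i _; rewrite derive_cst mulr0 addr0 mulr1.
Qed.

Section Star_cover.
Context {R : realType} {m : nat} {M : manifold R m}.

(** Let A be a cube of a first cover whose quarter contains the centre of U i. Fine cubes are so
    small that membership of the centre in the half cubes, in the complements of the closed half
    cubes and in the full cubes passes to all their points. A common point of U i and U j then
    places U j in A. *)
Lemma star_cover : [set: M] !=set0 -> compact [set: M] ->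
  exists (n : nat) (U V : 'I_n.+1 -> ccube M),
    (forall x, exists i, cin (1/4) (U i) x) /\
    forall i j, cin 1 (U i) `&` cin 1 (U j) !=set0 -> ccl 1 (U j) `<=` ccl 1 (V i).
Proof.
move=> M0 cM.
have [W HW] := choice (fun x : M => exists_cube (@filterT _ (nbhs x) _)).
have [n [p cov]] := finite_cubes M0 cM (fun x => (HW x).1).
pose A a := W (p a).
have near_x x : nbhs x [set z | forall a, [/\ cin (1/2) (A a) x -> cin (1/2) (A a) z,
    ~ ccl (1/2) (A a) x -> ~ ccl (1/2) (A a) z & cin 1 (A a) x -> cin 1 (A a) z]].
  apply: filter_forall => a.
  have o t : nbhs x [set z | cin t (A a) x -> cin t (A a) z].
    have [xi|nx] := pselect (cin t (A a) x); last by apply: filterE => z /nx.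
    have n' : nbhs x (cin t (A a)) by apply: open_nbhs_nbhs; split=> //; exact: cin_open.
    by apply: filterS n' => z zi _.
  have cl : nbhs x [set z | ~ ccl (1/2) (A a) x -> ~ ccl (1/2) (A a) z].
    have [xi|nx] := pselect (ccl (1/2) (A a) x); first by apply: filterE => z /(_ xi).
    have n' : nbhs x (~` ccl (1/2) (A a)).
      by apply: open_nbhs_nbhs; split=> //; apply: closed_openC; apply: ccl_closed; lra.
    by apply: filterS n' => z zi _.
  by apply: filterS (filterI (o (1/2)) (filterI cl (o 1))) => z [? [? ?]]; split.
have [S HS] := choice (fun x => exists_cube (near_x x)).
have [n' [p' cov']] := finite_cubes M0 cM (fun x => (HS x).1).
have [v Hv] := choice cov.
exists n', (fun i => S (p' i)), (fun i => A (v (p' i))); split=> // i j [z [zi zj]].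
set x := p' i in zi *; set x' := p' j in zj *.
have xv : cin (1/2) (A (v x)) x by apply: cin_mono (Hv x); lra.
have z1 : cin (1/2) (A (v x)) z.
  by have [H _ _] := (HS x).2 z (cin_ccl zi) (v x); exact: H.
have x'c : ccl (1/2) (A (v x)) x'.
  apply: contrapT => nx'; have [_ H _] := (HS x').2 z (cin_ccl zj) (v x).
  by apply: (H nx'); exact: cin_ccl.
have x'1 : cin 1 (A (v x)) x' by apply: ccl_cin x'c; lra.
move=> u /((HS x').2) /(_ (v x))[_ _ H].
by apply: cin_ccl; exact: H.
Qed.

End Star_cover.

(** * Duality between cocycles of a cover and codimension-one forms, for a derivation L *)

Section Duality.
Context {R : realType} {m : nat} {M : manifold R m.+2}.
Hypothesis M0 : [set: M] !=set0.
Hypothesis cM : compact [set: M].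
Hypothesis coM : connected [set: M].
Variables (L : (M -> R) -> M -> R) (vol : preform M m.+2) (eta : preform M m.+1).
Hypothesis L_smooth : forall u, smooth_fun u -> smooth_fun (L u).
Hypothesis L_sum : forall n (u : 'I_n -> M -> R) (s : 'I_n -> R) x, (forall i, smooth_fun (u i)) ->
  L (fun x => \sum_i s i * u i x) x = \sum_i s i * L (u i) x.
Hypothesis L_near : forall u w x, (\forall z \near x, u z = w z) -> L u x = L w x.
Hypothesis L_cst : forall (s : R) x, L (fun=> s) x = 0.
Hypothesis vol_form : is_form vol.
Hypothesis eta_form : is_form eta.
Hypothesis dL : forall u, smooth_fun u ->
  form_eq (ext_d (form_scale u eta)) (form_scale (L u) vol).
Hypothesis vol_exact : exact_form vol -> exact_form eta.
(** The f i are local primitives of a closed 1-form beta with cocycle s, and g is beta(X). In the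
    application g is a derivative along X because the orbits are contractible. *)
Hypothesis L_int : forall n (C : 'I_n -> ccube M) (f : 'I_n -> M -> R) (s : 'I_n -> 'I_n -> R) (g : M -> R),
  (forall x, exists i, cin 1 (C i) x) -> (forall i, smooth_fun (f i)) -> smooth_fun g ->
  (forall i j x, cin 1 (C i) x -> cin 1 (C j) x -> f i x - f j x = s i j) ->
  (forall i x, cin 1 (C i) x -> L (f i) x = g x) ->
  exists2 phi, smooth_fun phi & forall x, L phi x = g x.

Section Nontrivial.
Variable C0 : ccube M.
Hypothesis nontrivial : ~ exact_form (cube_form C0).
Notation H0 := (cube_form C0).

Lemma scaled_exact0 (s : R) : exact_form (form_scale (fun=> s) H0) -> s = 0.
Proof.
move=> e; apply: contrapT => /eqP s0; apply: nontrivial.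
apply: exact_eq (exact_scale s^-1 e) => c ac y cy v.
by rewrite /form_scale mulrA mulVf// mul1r.
Qed.

(* [q a] plays the role of the integral of [a] over [M], in units of [H0]. *)
Lemma period_exists : exists q : preform M m.+2 -> R, forall a, is_form a ->
  cohom a (form_scale (fun=> q a) H0).
Proof.
have H (a : preform M m.+2) : exists s : R, is_form a -> cohom a (form_scale (fun=> s) H0).
  have [fa|nfa] := pselect (is_form a); last by exists 0.
  by have [s hs] := top_span M0 cM coM C0 fa; exists s.
by have [q hq] := choice H; exists q.
Qed.

Section Period.
Variable q : preform M m.+2 -> R.
Hypothesis qP : forall a, is_form a -> cohom a (form_scale (fun=> q a) H0).

Lemma period_uniq a (s : R) : is_form a -> cohom a (form_scale (fun=> s) H0) -> q a = s.
Proof.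
move=> fa hs; apply/eqP; rewrite -subr_eq0; apply/eqP/scaled_exact0.
apply: exact_eq (exact_add hs (cohom_sym (qP fa))) => c ac y cy v.
by rewrite /form_scale /form_add /form_sub; ring.
Qed.

Lemma period_exact a : is_form a -> exact_form a -> q a = 0.
Proof.
move=> fa ea; apply: period_uniq => //; apply: exact_eq ea => c ac y cy v.
by rewrite /form_sub /form_scale mul0r subr0.
Qed.

Lemma period0_exact a : is_form a -> q a = 0 -> exact_form a.
Proof.
move=> fa q0; have := qP fa; rewrite q0 => e; apply: exact_eq e => c ac y cy v.
by rewrite /form_sub /form_scale mul0r subr0.
Qed.

Lemma period_lin (I : finType) (a : I -> preform M m.+2) (s : I -> R) (b : preform M m.+2) :
  (forall i, is_form (a i)) -> is_form b ->
  (form_eq b (fun c y v => \sum_i s i * a i c y v)) -> q b = \sum_i s i * q (a i).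
Proof.
move=> fa fb e; apply: period_uniq => //; apply: cohom_eq e _.
apply: exact_eq (exact_sum (index_enum I) (fun i => exact_scale (s i) (qP (fa i)))) => c ac y cy v.
rewrite /form_sub /form_scale mulr_suml -sumrB; apply: eq_bigr => i _.
by rewrite mulrBr mulrA.
Qed.

Lemma cube_form_period D : q (cube_form D) != 0.
Proof.
apply/eqP => q0; apply: nontrivial.
have e := period0_exact (cube_form_form D) q0.
exact: (top_exact M0 cM coM e (cube_form_form C0)).
Qed.

Lemma unit_form (x : M) (N : set M) : nbhs x N ->
  exists w : preform M m.+2, [/\ is_form w, supp_in N w & q w = 1].
Proof.
move=> nN; have [D [Dx DN]] := exists_cube nN.
have fw : is_form (form_scale (fun=> (q (cube_form D))^-1) (cube_form D)).
  by apply: is_form_scale (cube_form_form D); exact: smooth_fun_cst.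
exists (form_scale (fun=> (q (cube_form D))^-1) (cube_form D)); split=> //.
  move=> c ac y cy nK v; rewrite /form_scale (cube_form_supp (C := D)) ?mulr0// => /DN.
  exact: nK.
rewrite (@period_lin unit (fun=> cube_form D) (fun=> (q (cube_form D))^-1))//.
- by rewrite big_const card_unit /= addr0 mulVf// cube_form_period.
- by move=> _; exact: cube_form_form.
- by move=> c ac y cy v; rewrite big_const card_unit /= addr0.
Qed.

(** Inside the cube the form is a multiple of the bump form plus d t. The multiple must be 0, since
    the bump form has nonzero period; this keeps the primitive supported in the cube. *)
Lemma period0_primitive D a : is_form a -> supp_in (ccl 1 D) a -> q a = 0 ->
  exists t : preform M m.+1, [/\ is_form t, supp_in (ccl 1 D) t & form_eq a (ext_d t)].
Proof.
move=> fa sa q0; have [s [t [ft st e]]] := top_cohom_in (erefl (cc D)) (fun z H => H) fa sa.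
exists t; split=> //.
have fD := cube_form_form D.
have fs : is_form (form_scale (fun=> s) (cube_form D)).
  by apply: is_form_scale => //; exact: smooth_fun_cst.
have es : exact_form (form_scale (fun=> s) (cube_form D)).
  apply: exact_eq (exact_add (period0_exact fa q0) (exact_scale (-1) (exact_ext_d ft))) => c ac y cy v.
  by rewrite /form_add e// /form_add /form_scale; ring.
have s0 : s = 0.
  have := period_exact fs es.
  rewrite (@period_lin unit (fun=> cube_form D) (fun=> s))//; last first.
    by move=> c ac y cy v; rewrite big_const card_unit /= addr0.
  rewrite big_const card_unit /= addr0 => /eqP; rewrite mulf_eq0 (negbTE (cube_form_period D)) orbF.
  by move/eqP.
by move=> c ac y cy v; rewrite e// /form_add /form_scale s0 mul0r add0r.
Qed.

(* Cech-de Rham argument. For a partition of unity [rho], the top forms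
   [th (i, j) = (rho j * L (rho i) - rho i * L (rho j)) vol] are antisymmetric,
   supported in the intersections, and sum over [j] to [d (rho i eta)]. Their
   periods form a 1-cycle of the nerve, which is a boundary: it pairs to zero with
   a cocycle [c] because [sum c th = 2 g vol] is exact by [L_int]. Hence [th] can
   be corrected, without changing the sums over [j], into [th' = d tau], and
   [rho i eta - sum_j tau i j] is closed with support in a cube, so exact. *)
Lemma eta_exact : exact_form eta.
Proof.
have [n [U [V [cov star]]]] := star_cover M0 cM.
pose rho := punity U; pose sg i := L (rho i).
have sr i : smooth_fun (rho i) by exact: punity_smooth.
have ss i : smooth_fun (sg i) by exact: L_smooth.
have r1 x : \sum_i rho i x = 1 by exact: punity_sum.
have r0 i x : ~ ccl (1/2) (U i) x -> rho i x = 0 by exact: punity_supp.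
have ccl2 i : closed (ccl (1/2) (U i)) by apply: ccl_closed; lra.
have s0 i x : ~ ccl (1/2) (U i) x -> sg i x = 0.
  move=> nK; rewrite /sg (L_near (w := fun=> 0)) ?L_cst//.
  have n' : nbhs x (~` ccl (1/2) (U i)) by apply: open_nbhs_nbhs; split=> //; exact: closed_openC.
  by apply: filterS n' => z; exact: r0.
have cin1 i x : ccl (1/2) (U i) x -> cin 1 (U i) x by apply: ccl_cin; lra.
have r0' i x : ~ cin 1 (U i) x -> rho i x = 0 by move=> nK; apply: r0 => /cin1.
have s0' i x : ~ cin 1 (U i) x -> sg i x = 0 by move=> nK; apply: s0 => /cin1.
have sg0 x : \sum_i sg i x = 0.
  rewrite -[RHS](L_cst 1 x) (L_near (u := fun=> 1) (w := fun x => \sum_i 1 * rho i x)).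
    by rewrite L_sum//; apply: eq_bigr => i _; rewrite mul1r.
  by apply: filterE => z; rewrite -[LHS](r1 z); apply: eq_bigr => i _; rewrite mul1r.
pose u p x := rho p.2 x * sg p.1 x - rho p.1 x * sg p.2 x.
have su p : smooth_fun (u p) by apply: smooth_funB; apply: smooth_funM.
pose th p := form_scale (u p) vol.
have fth p : is_form (th p) by exact: is_form_scale.
pose N (t : 'I_n.+1 * 'I_n.+1 * 'I_n.+1) :=
  exists x, [/\ cin 1 (U t.1.1) x, cin 1 (U t.1.2) x & cin 1 (U t.2) x].
have aa i j : q (th (j, i)) = - q (th (i, j)).
  rewrite (@period_lin unit (fun=> th (i, j)) (fun=> -1))//.
    by rewrite big_const card_unit /= addr0 mulN1r.
  move=> c ac y cy v; rewrite big_const card_unit /= addr0 /th /form_scale /u /=; ring.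
have Hc (c : 'I_n.+1 * 'I_n.+1 -> R) : (forall i j, c (j, i) = - c (i, j)) ->
    (forall x y z, N (x, y, z) -> c (x, y) + c (y, z) + c (z, x) = 0) ->
    \sum_p c p * q (th p) = 0.
  move=> ca cN.
  (* On the cube U k, f k is a primitive of a closed 1-form with cocycle c, averaged by the
     partition of unity; g is the value of that form on X and is global. *)
  pose f k x := \sum_i c (i, k) * rho i x.
  pose g x := \sum_p c p * (rho p.2 x * sg p.1 x).
  have sf k : smooth_fun (f k).
    by apply: smooth_fun_sum => i; apply: smooth_funM => //; exact: smooth_fun_cst.
  have sgg : smooth_fun g.
    by apply: smooth_fun_sum => p; do !apply: smooth_funM => //; exact: smooth_fun_cst.
  have cU x : exists i, cin 1 (U i) x by have [i ix] := cov x; exists i; apply: cin_mono ix; lra.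
  have cf i j x : cin 1 (U i) x -> cin 1 (U j) x -> f i x - f j x = c (j, i).
    move=> ix jx; rewrite /f -sumrB -[RHS]mulr1 -(r1 x) mulr_sumr; apply: eq_bigr => l _.
    rewrite -mulrBl; have [lx|nx] := pselect (cin 1 (U l) x); last by rewrite r0'// !mulr0.
    have := cN l i j; rewrite (ca i j) (ca l j) => H; congr (_ * _).
    by have := H (ex_intro _ x (And3 lx ix jx)); lra.
  have Lf k x : cin 1 (U k) x -> L (f k) x = g x.
    move=> kx; rewrite /f L_sum// /g.
    (* The added terms c (k, j) contribute nothing, as the sg i sum to 0; the cocycle condition then
       turns c (i, k) + c (k, j) into c (i, j). *)
    transitivity (\sum_p (c (p.1, k) + c (k, p.2)) * (rho p.2 x * sg p.1 x)).
      rewrite -(pair_big xpredT xpredT (fun i j => (c (i, k) + c (k, j)) * (rho j x * sg i x))) /=.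
      under [RHS]eq_bigr => i _ do under eq_bigr => j _ do rewrite mulrDl.
      under [RHS]eq_bigr do rewrite big_split /=.
      rewrite big_split /= [X in _ + X]exchange_big /= [X in _ + X]big1 ?addr0 => [|j _].
        by apply: eq_bigr => i _; rewrite -mulr_sumr -mulr_suml r1 mul1r.
      by rewrite -!mulr_sumr sg0 !mulr0.
    apply: eq_bigr => -[i j] _ /=.
    have [ix|nx] := pselect (cin 1 (U i) x); last by rewrite s0'// !mulr0.
    have [jx|nx] := pselect (cin 1 (U j) x); last by rewrite r0'// mul0r !mulr0.
    have := cN i j k (ex_intro _ x (And3 ix jx kx)); rewrite (ca k j) (ca i k) => H.
    by congr (_ * _); lra.
  have [phi sphi Lphi] := @L_int n.+1 U f (fun i j => c (j, i)) g cU sf sgg cf Lf.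
  (* By antisymmetry of c, both halves of u contribute g, hence the factor 2. *)
  have sp : smooth_fun (fun x => 2 * phi x) by apply: smooth_funM => //; exact: smooth_fun_cst.
  have fb : is_form (form_scale (fun x => 2 * g x) vol).
    by apply: is_form_scale => //; apply: smooth_funM => //; exact: smooth_fun_cst.
  rewrite -(@period_lin _ th c (form_scale (fun x => 2 * g x) vol))//.
    apply: period_exact => //.
    apply: exact_eq (exact_scale 2 (exact_ext_d (is_form_scale sphi eta_form))) => d ad y cy v.
    by rewrite /form_scale dL// /form_scale Lphi mulrA.
  move=> d ad y cy v; rewrite /th /form_scale.
  under eq_bigr do rewrite mulrA; rewrite -mulr_suml; congr (_ * _).
  rewrite /u /g; under [RHS]eq_bigr do rewrite mulrBr.
  rewrite sumrB mulr_natl mulr2n; congr (_ + _); rewrite -sumrN.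
  rewrite (reindex_inj (h := fun p : 'I_n.+1 * 'I_n.+1 => (p.2, p.1)))/=; last first.
    by move=> [i j] [i' j'] [-> ->].
  by apply: eq_bigr => -[i j] _ /=; rewrite (ca i j) mulNr.
have [b [b0 eb]] := boundary_span aa Hc.
have Hw (t : 'I_n.+1 * 'I_n.+1 * 'I_n.+1) : exists w : preform M m.+2, is_form w /\
    (N t -> [/\ supp_in (ccl 1 (U t.1.1)) w, supp_in (ccl 1 (U t.1.2)) w,
      supp_in (ccl 1 (U t.2)) w & q w = 1]).
  have [[x [x1 x2 x3]]|nN] := pselect (N t); last by exists (@form_zero R _ M _); split=> //; exact: is_form_zero.
  have nb : nbhs x (cin 1 (U t.1.1) `&` (cin 1 (U t.1.2) `&` cin 1 (U t.2))).
    have nU i : cin 1 (U i) x -> nbhs x (cin 1 (U i)).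
      by move=> xi; apply: open_nbhs_nbhs; split=> //; exact: cin_open.
    by apply: filterI; [exact: nU|apply: filterI; exact: nU].
  have [w [fw sw qw]] := unit_form nb; exists w; split=> // _; split=> //;
    by apply: supp_in_sub sw => z [z1 [z2 z3]]; exact: cin_ccl.
have [w Hw'] := choice Hw.
(* Forms of period 1 in the triple intersections are subtracted along boundaries. This cancels the
   periods of the th p and, a boundary having zero row sums, preserves the sums over j. *)
pose th' p : preform M m.+2 := fun c y v => th p c y v - \sum_t b t * bdry t p * w t c y v.
have fth' p : is_form (th' p).
  have f1 := is_form_sum (index_enum _) (fun t => is_form_scale (smooth_fun_cst (- (b t * bdry t p))) (Hw' t).1).
  apply: is_form_ext (is_form_add (fth p) f1) => c y v.
  by rewrite /form_add /th' -sumrN; congr (_ + _); apply: eq_bigr => t _; rewrite /form_scale mulNr.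
have qth' p : q (th' p) = 0.
  have /(_ (fun o => if o is Some t then w t else th p)
      (fun o => if o is Some t then - (b t * bdry t p) else 1) (th' p)) := @period_lin (option ('I_n.+1 * 'I_n.+1 * 'I_n.+1)).
  have opt (F : option ('I_n.+1 * 'I_n.+1 * 'I_n.+1) -> R) : \sum_o F o = F None + \sum_t F (Some t).
    rewrite (bigD1 None)//=; congr (_ + _).
    rewrite (reindex_omap Some id) => [|[t|]//].
    by apply: eq_bigl => t; rewrite /= eqxx.
  rewrite opt => ->.
  - rewrite mul1r eb -big_split big1//= => t _.
    have [Nt|nN] := pselect (N t); last by rewrite b0// mul0r oppr0 mul0r addr0.
    by have [_ _ _ ->] := (Hw' t).2 Nt; rewrite mulr1 subrr.
  - by move=> [t|]; [exact: (Hw' t).1|exact: fth].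
  - exact: fth'.
  - move=> c ac y cy v; rewrite opt mul1r /th' -sumrN; congr (_ + _).
    by apply: eq_bigr => t _; rewrite mulNr.
have supp' i j K : (forall x, cin 1 (U i) x -> cin 1 (U j) x -> K x) ->
    (forall t, N t -> (bdry t (i, j) != 0 :> R) -> supp_in K (w t)) -> supp_in K (th' (i, j)).
  move=> HK Ht c ac y cy nK v; rewrite /th' /th /form_scale big1 ?subr0 => [|t _].
    rewrite (_ : u _ _ = 0) ?mul0r// /u /=.
    have [ix|nx] := pselect (cin 1 (U i) (chart_inv c y)); last by rewrite (s0' i _ nx) (r0' i _ nx) mulr0 mul0r subrr.
    have [jx|nx] := pselect (cin 1 (U j) (chart_inv c y)); last by rewrite (s0' j _ nx) (r0' j _ nx) mul0r mulr0 subrr.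
    by case: nK; exact: HK.
  have [Nt|nN] := pselect (N t); last by rewrite b0// !mul0r.
  have [->|e0] := eqVneq (bdry t (i, j) : R) 0; first by rewrite mulr0 mul0r.
  by rewrite (Ht t Nt e0)// mulr0.
have bdry_in i j t : bdry t (i, j) != 0 :> R ->
    (i = t.1.1 \/ i = t.1.2 \/ i = t.2) /\ (j = t.1.1 \/ j = t.1.2 \/ j = t.2).
  have H i' j' : bdry t (i', j') != 0 :> R -> i' = t.1.1 \/ i' = t.1.2 \/ i' = t.2.
    case: t => [[x y] z]; have [->|ix] := eqVneq i' x; first by left.
    have [->|iy] := eqVneq i' y; first by right; left.
    have [->|iz] := eqVneq i' z; first by right; right.
    by rewrite (_ : bdry _ _ = 0) ?eqxx//; apply: bdry_eq0; rewrite ix iy iz.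
  by move=> nz; split; [exact: H nz|apply: (H j i); rewrite bdryC oppr_eq0].
have Ui i : cin 1 (U i) (chart_inv (cc (U i)) (cy (U i))).
  apply: cube_inv; first by move=> z /ball_box; exact: ccl_img.
  by apply/ball_rVP; rewrite ?mul1r ?cr_gt0// => j; rewrite subrr normr0 cr_gt0.
have UV i : ccl 1 (U i) `<=` ccl 1 (V i).
  by apply: star; exists (chart_inv (cc (U i)) (cy (U i))).
have Htau i j : exists t : preform M m.+1, [/\ is_form t, supp_in (ccl 1 (V i)) t,
    supp_in (ccl 1 (V j)) t & form_eq (th' (i, j)) (ext_d t)].
  have wi t l : N t -> l = t.1.1 \/ l = t.1.2 \/ l = t.2 -> supp_in (ccl 1 (U l)) (w t).
    by move=> Nt; have [? ? ? _] := (Hw' t).2 Nt; move=> [->|[->|->]].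
  have [ne|em] := pselect (cin 1 (U i) `&` cin 1 (U j) !=set0).
    have ne' : cin 1 (U j) `&` cin 1 (U i) !=set0 by rewrite setIC.
    have sU : supp_in (ccl 1 (U i)) (th' (i, j)).
      apply: supp' => [x ix _|t Nt /bdry_in[it _]]; [exact: cin_ccl|exact: wi].
    have [t [ft st et]] := period0_primitive (fth' _) sU (qth' _).
    exists t; split=> //; first exact: supp_in_sub (UV i) st.
    exact: supp_in_sub (star _ _ ne') st.
  exists (@form_zero R _ M _); split=> //; first exact: is_form_zero.
  have sU : supp_in set0 (th' (i, j)).
    apply: supp' => [x ix jx|t Nt /bdry_in[it jt]]; first by apply: em; exists x.
    case: Nt => x [x1 x2 x3]; case: em; exists x.
    by split; [move: it|move: jt] => -[->|[->|->]].
  move=> c ac y cy v; rewrite sU//; apply/esym/big1 => l _.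
  by rewrite [X in 'D__ X _](_ : _ = cst 0) ?derive_cst ?mulr0//; exact/funext.
have [tau0 Ht0] := choice (fun p : 'I_n.+1 * 'I_n.+1 => Htau p.1 p.2).
(* Primitives are chosen for i < j and extended antisymmetrically, so that the double sum of tau
   vanishes at the end. *)
pose tau (i j : 'I_n.+1) : preform M m.+1 := if (i < j)%N then tau0 (i, j)
  else if (j < i)%N then form_scale (fun=> -1) (tau0 (j, i)) else @form_zero R _ M _.
have ftau i j : is_form (tau i j).
  rewrite /tau; case: ltnP => _; first by have [] := Ht0 (i, j).
  case: ltnP => _; last exact: is_form_zero.
  by apply: is_form_scale; [exact: smooth_fun_cst|have [] := Ht0 (j, i)].
have stau i j : supp_in (ccl 1 (V i)) (tau i j).
  rewrite /tau; case: ltnP => _; first by have [] := Ht0 (i, j).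
  case: ltnP => _; last by move=> c ac y cy _ v.
  by move=> c ac y cy nK v; have [_ _ s _] := Ht0 (j, i); rewrite /form_scale s// mulr0.
have tauC i j c y v : tau i j c y v = - tau j i c y v.
  rewrite /tau; case: (ltngtP i j) => [ij|ji|_].
  - by rewrite /form_scale mulN1r opprK.
  - by rewrite /form_scale mulN1r.
  - by rewrite /form_zero oppr0.
have th'C i j c y v : th' (j, i) c y v = - th' (i, j) c y v.
  rewrite /th' opprB -[RHS]addrC; congr (_ + _).
    by rewrite /th /form_scale /u /=; ring.
  by rewrite -sumrN; apply: eq_bigr => t _; rewrite bdryC; ring.
have dtau i j : form_eq (ext_d (tau i j)) (th' (i, j)).
  move=> c ac y cy v; rewrite /tau; case: (ltngtP i j) => [ij|ji|/val_inj ->].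
  - by have [_ _ _ ->] := Ht0 (i, j).
  - have [f _ _ e] := Ht0 (j, i); rewrite ext_d_scale//; last exact: smooth_fun_cst.
    rewrite big1 ?addr0 => [|l _]; last by rewrite derive_cst mul0r mulr0.
    by rewrite -e//= mulN1r th'C opprK.
  - have := th'C j j c y v => H; have -> : th' (j, j) c y v = 0 by lra.
    apply: big1 => l _.
    by rewrite [X in 'D__ X _](_ : _ = cst 0) ?derive_cst ?mulr0//; exact/funext.
(* Closed, because d(rho i eta) = sg i vol is also the sum over j of the th' (i, j); supported in
   the chart cube V i, hence exact. *)
pose kap i : preform M m.+1 := form_add (form_scale (rho i) eta)
  (form_scale (fun=> -1) (fun c y v => \sum_j tau i j c y v)).
have fst i : is_form (fun c y v => \sum_j tau i j c y v).
  exact: is_form_sum.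
have fk i : is_form (kap i).
  by apply: is_form_add; apply: is_form_scale => //; exact: smooth_fun_cst.
have ek i : exact_form (kap i).
  apply: (codim1_exact_in (cc_atlas (V i)) (cr_gt0 (V i)) (@cc_img _ _ _ (V i)) (fk i)).
    have sk : supp_in (ccl 1 (V i)) (kap i).
      move=> c ac y cy nK v; rewrite /kap /form_add /form_scale r0 => [|K].
        by rewrite mul0r add0r big1 ?mulr0// => j _; rewrite stau.
      by apply: nK; apply: UV; apply: ccl_mono K; lra.
    by move: sk; rewrite /ccl mul1r.
  move=> c ac y cy v; have f1 := is_form_scale (sr i) eta_form.
  have f2 := is_form_scale (smooth_fun_cst (-1)) (fst i).
  rewrite ext_d_add// dL//.
  rewrite ext_d_scale//; last exact: smooth_fun_cst.
  rewrite [X in _ * _ + X]big1 ?addr0 => [|l _]; last by rewrite derive_cst mul0r mulr0.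
  have -> : ext_d (fun c y v => \sum_j tau i j c y v) c y v = \sum_j th' (i, j) c y v.
    transitivity (\sum_j ext_d (tau i j) c y v); last by apply: eq_bigr => j _; exact: dtau.
    rewrite /ext_d exchange_big; apply: eq_bigr => l _; rewrite -mulr_sumr; congr (_ * _).
    by apply: derive_fsum => j; apply: smooth_at_differentiable; exact: form_smooth.
  rewrite /th' sumrB exchange_big /= [X in _ - X]big1 => [|t _].
    rewrite subr0 /th /form_scale -mulr_suml /u /= sumrB -mulr_suml -mulr_sumr r1 sg0.
    by rewrite mul1r mulr0 subr0 /form_zero -/(sg i); ring.
  by rewrite -mulr_suml -mulr_sumr bdry_sum_r mulr0 mul0r.
apply: exact_eq (exact_sum (index_enum _) ek) => c ac y cy v.
rewrite /kap /form_add /form_scale big_split /= -mulr_suml r1 mul1r -mulr_sumr.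
suff -> : \sum_i \sum_j tau i j c y v = 0 by rewrite mulr0 addr0.
have : \sum_i \sum_j tau i j c y v = - \sum_i \sum_j tau i j c y v.
  rewrite {1}exchange_big /= -sumrN; apply: eq_bigr => i _; rewrite -sumrN.
  by apply: eq_bigr => j _; exact: tauC.
lra.
Qed.

End Period.
End Nontrivial.

Theorem codim1_exact : exact_form eta.
Proof.
have [x _] := M0; have [C0 _] := exists_cube (@filterT _ (nbhs x) _).
have [e|ne] := pselect (exact_form (cube_form C0)).
  by apply: vol_exact; exact: (top_exact M0 cM coM e).
by have [q qP] := period_exists C0; exact: (eta_exact ne qP).
Qed.

End Duality.

(** * Integrals over contractible orbits *)

Section Squares.
Context {R : realType} {T : topologicalType}.

(** Existence of a Lebesgue number for the cover pulled back to the unit square, with [1 / N.+1] as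
    the mesh of a grid. *)
Lemma square_cover n (G : R * R -> T) (O : 'I_n -> set T) : continuous G ->
  (forall i, open (O i)) -> (forall x, exists i, O i x) ->
  exists N : nat, forall i j : nat, (i <= N)%N -> (j <= N)%N -> exists k, forall s t : R,
    i%:R / N.+1%:R <= s <= i.+1%:R / N.+1%:R -> j%:R / N.+1%:R <= t <= j.+1%:R / N.+1%:R -> O k (G (s, t)).
Proof.
move=> cG oO cO; pose I01 : set R := [set` `[0, 1]].
have cK : compact (I01 `*` I01) by apply: compact_setX; exact: segment_compact.
pose P (N : nat) (q : R * R) := exists k, forall s t : R,
  `|q.1 - s| <= N.+1%:R^-1 -> `|q.2 - t| <= N.+1%:R^-1 -> O k (G (s, t)).
have H : \forall N \near \oo, (I01 `*` I01) `<=` P N.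
  move/compact_near_coveringP: cK => /(_ nat \oo P _); apply => q _.
  have [k Ok] := cO (G q).
  have : nbhs q (G @^-1` O k) by apply: cG; apply: open_nbhs_nbhs; split.
  move=> /nbhs_ballP[e /= e0 He]; have e2 : 0 < e / 2 by rewrite divr_gt0.
  exists (ball q (e / 2), [set N : nat | N.+1%:R^-1 < e / 2]).
    by split; [exact: nbhsx_ballx|exact: near_infty_natSinv_lt (PosNum e2)].
  move=> [q' N] [[/= b1 b2] hN]; exists k => s t hs ht; apply: He; split => /=.
    have := b1; rewrite /ball /= => b; rewrite (splitr e).
    by apply: le_lt_trans (ler_distD q'.1 _ _) _; rewrite ltr_leD// (le_trans hs)// ltW.
  have := b2; rewrite /ball /= => b; rewrite (splitr e).
  by apply: le_lt_trans (ler_distD q'.2 _ _) _; rewrite ltr_leD// (le_trans ht)// ltW.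
have [N HN] := @filter_ex _ _ _ _ H; exists N => i j iN jN.
have n0 : 0 < N.+1%:R :> R by rewrite ltr0n.
have b01 (l : nat) : (l <= N)%N -> I01 (l%:R / N.+1%:R).
  move=> lN; rewrite /I01 /= in_itv /= divr_ge0 ?ler0n// ler_pdivrMr// mul1r ler_nat.
  exact: leqW.
have [k Hk] := HN (i%:R / N.+1%:R, j%:R / N.+1%:R) (conj (b01 i iN) (b01 j jN)).
have e (l : nat) : l.+1%:R / N.+1%:R = l%:R / N.+1%:R + N.+1%:R^-1 :> R.
  by rewrite -addn1 natrD mulrDl mul1r.
have h0 : 0 <= N.+1%:R^-1 :> R by rewrite invr_ge0.
have aux (a w s : R) : 0 <= w -> a <= s <= a + w -> `|a - s| <= w.
  by move=> w0 /andP[s1 s2]; rewrite ler_distlC; apply/andP; split; lra.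
by exists k => s t; rewrite !e => hs ht; apply: Hk; exact: aux.
Qed.

End Squares.

Section Local_primitives.
Context {R : realType} {T : Type} {n : nat}.
Variables (O : 'I_n -> set T) (f : 'I_n -> T -> R) (s : 'I_n -> 'I_n -> R).
Hypothesis fs : forall i j x, O i x -> O j x -> f i x - f j x = s i j.

(** Local primitives differ by the constants s, so their increments agree on common members of the
    cover. *)
Lemma exists_increment : exists E : T -> T -> R, forall k x y, O k x -> O k y -> E x y = f k x - f k y.
Proof.
have H (p : T * T) : exists r : R, forall k, O k p.1 -> O k p.2 -> r = f k p.1 - f k p.2.
  have [[k [k1 k2]]|no] := pselect (exists k, O k p.1 /\ O k p.2); last first.
    by exists 0 => k k1 k2; case: no; exists k.
  exists (f k p.1 - f k p.2) => l l1 l2.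
  by have := fs k1 l1; have := fs k2 l2; lra.
have [E HE] := choice H.
by exists (fun x y => E (x, y)) => k x y kx ky; exact: (HE (x, y)).
Qed.

(** Discrete Stokes formula: in each small square the increments of one local primitive cancel
    around the boundary, and the two outer sides agree by periodicity. The increment along a row is
    thus the same for all rows, and the last row is constant. *)
Lemma grid_increment N (P : nat -> nat -> T) :
  (forall i j, (i <= N)%N -> (j <= N)%N -> exists k,
     [/\ O k (P i j), O k (P i.+1 j), O k (P i j.+1) & O k (P i.+1 j.+1)]) ->
  (forall i, P i N.+1 = P i 0%N) -> (forall j, P N.+1 j = P N.+1 0%N) ->
  forall E : T -> T -> R, (forall k x y, O k x -> O k y -> E x y = f k x - f k y) ->
  \sum_(0 <= j < N.+1) E (P 0%N j.+1) (P 0%N j) = 0.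
Proof.
move=> HP per cst E HE.
pose row i := \sum_(0 <= j < N.+1) E (P i j.+1) (P i j).
have step i : (i <= N)%N -> row i.+1 = row i.
  move=> iN; apply/eqP; rewrite -subr_eq0 /row -sumrB.
  rewrite (eq_big_nat _ _ (F2 := fun j => E (P i.+1 j.+1) (P i j.+1) - E (P i.+1 j) (P i j))).
    by rewrite telescope_sumr// !per subrr.
  move=> j /andP[_ jN]; have [k [k1 k2 k3 k4]] := HP i j iN jN.
  by rewrite (HE k _ _ k4 k2) (HE k _ _ k3 k1) (HE k _ _ k4 k3) (HE k _ _ k2 k1); ring.
have E0 i : (i <= N.+1)%N -> row i = row 0%N.
  by elim: i => // i IH iN; rewrite step// IH// ltnW.
rewrite -/(row 0%N) -(E0 N.+1)// /row big_nat big1// => j /andP[_ jN].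
have [k [k1 k2 k3 k4]] := HP N j (leqnn N) jN.
by rewrite (HE k _ _ k4 k2) [P N.+1 j.+1]cst (cst j) subrr.
Qed.

End Local_primitives.

Section Functions.
Context {R : realType} {m : nat} {M : manifold R m}.
Variable act : R -> M -> M.
Hypothesis sact : smooth_circle_action act.
Notation X := (action_field act).
Implicit Types (u : M -> R) (c : chart R m M).

Lemma smooth_fun_comp (V : normedModType R) u (F : V -> M) p : smooth_fun u -> msmooth_at F p ->
  smooth_at (fun q => u (F q)) p.
Proof.
move=> su [cF sF]; pose c := chart_at (F p).
have ac : atlas c := chart_at_atlas (F p); have cp : chart_dom c (F p) := chart_at_dom (F p).
have n : \forall q \near p, u (chart_inv c (c (F q))) = u (F q).
  by apply: filterS (near_dom cF cp) => q cq; rewrite chart_funK.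
apply: smooth_at_near n _.
apply: (@smooth_at_comp _ _ _ _ (fun q => c (F q)) (fun y => u (chart_inv c y))).
- exact: fin_dim_mx.
- exact: sF.
- by apply: su => //; exact: chart_funP.
Qed.

Definition lie u x := 'D_1 (fun t : R => u (act t x)) 0.

Lemma smooth_fun_orbit u x (t : R) : smooth_fun u -> smooth_at (fun t : R => u (act t x)) t.
Proof. by move=> su; apply: smooth_fun_comp => //; exact: orbit_smooth. Qed.

Lemma lie_orbit u x (t : R) : smooth_fun u -> 'D_1 (fun t : R => u (act t x)) t = lie u (act t x).
Proof.
move=> su; rewrite /lie.
have E : (fun s : R => u (act s (act t x))) = (fun s : R => u (act (s + t) x)).
  by apply/funext => s; rewrite actD.
rewrite E (@derive_comp _ _ _ _ (fun s : R => u (act s x)) (fun s : R => s + t)) ?add0r.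
- by rewrite deriveD// derive_id derive_cst addr0.
- apply: smooth_at_differentiable; apply: smooth_atD; [exact: smooth_at_id|exact: smooth_at_cst].
- by apply: smooth_at_differentiable; exact: smooth_fun_orbit.
Qed.

Lemma lieE u c y : smooth_fun u -> atlas c -> chart_img c y ->
  lie u (chart_inv c y) = 'D_(X c y) (fun y => u (chart_inv c y)) y.
Proof.
move=> su ac cy; rewrite /lie /action_field derive1E.
have cx : chart_dom c (act 0 (chart_inv c y)) by rewrite act0//; exact: chart_invP.
have [cO sO] := orbit_smooth sact (chart_inv c y) 0.
have n : \forall t \near (0 : R), u (chart_inv c (c (act t (chart_inv c y)))) = u (act t (chart_inv c y)).
  by apply: filterS (near_dom cO cx) => q cq; rewrite chart_funK.
rewrite -(near_eq_derive _ n).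
rewrite (@derive_comp _ _ _ _ (fun y => u (chart_inv c y)) (fun t : R => c (act t (chart_inv c y)))).
- by rewrite act0// chart_invK.
- by apply: smooth_at_differentiable; exact: sO.
- by apply: smooth_at_differentiable; rewrite act0// chart_invK//; exact: su.
Qed.

Lemma lie_smooth u : smooth_fun u -> smooth_fun (lie u).
Proof.
move=> su c ac y cy.
pose G (p : R^o * 'rV[R]_m) := u (flow act c p).
have sG p : chart_img c p.2 -> smooth_at G p.
  by move=> cp; apply: smooth_fun_comp => //; exact: flow_smooth.
have n : \forall z \near y, 'D_(1, 0) G ((0 : R^o), z) = lie u (chart_inv c z).
  have nI : nbhs y (chart_img c) by apply: open_nbhs_nbhs; split=> //; exact: chart_img_open.
  by apply: filterS nI => z cz; apply: (esym (slice_time (sG _ _)).2).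
apply: smooth_at_near n _.
apply: (@smooth_at_comp _ _ _ _ (fun z => ((0 : R^o), z)) ('D_(1, 0) G)).
- exact: fin_dim_V.
- by apply: smooth_at_pair; [exact: smooth_at_cst|exact: smooth_at_id].
- by apply: smooth_at_derive; exact: sG.
Qed.

Lemma lie_sum n (u : 'I_n -> M -> R) (s : 'I_n -> R) x : (forall i, smooth_fun (u i)) ->
  lie (fun x => \sum_i s i * u i x) x = \sum_i s i * lie (u i) x.
Proof.
move=> su; rewrite /lie derive_fsum => [|i]; last first.
  apply: smooth_at_differentiable; apply: smooth_atM; first exact: smooth_at_cst.
  exact: smooth_fun_orbit.
apply: eq_bigr => i _.
rewrite (deriveM (smooth_at_derivable (smooth_at_cst (s i) (0 : R))) (smooth_at_derivable (smooth_fun_orbit x 0 (su i)))).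
by rewrite derive_cst scaler0 addr0.
Qed.

Lemma lie_near u w x : (\forall z \near x, u z = w z) -> lie u x = lie w x.
Proof.
move=> n; apply: near_eq_derive; have [cO _] := orbit_smooth sact x 0.
by move: cO; rewrite /prop_for /continuous_at act0// => /(_ _ n).
Qed.

Lemma lie_cst (s : R) x : lie (fun=> s) x = 0.
Proof. exact: derive_cst. Qed.

(* Integration by parts in [t]. *)
Lemma lie_average g : smooth_fun g ->
  smooth_fun (fun x => pint 0 1 (fun t => t * g (act t x))) /\
  forall x, lie (fun x => pint 0 1 (fun t => t * g (act t x))) x = g x - pint 0 1 (fun t => g (act t x)).
Proof.
move=> sg; split.
  move=> c ac y cy.
  have sF (t : R) z : 0 <= t <= 1 -> chart_img c z ->
      smooth_at (fun p : R^o * 'rV[R]_m => p.1 * g (flow act c p)) ((t : R^o), z).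
    move=> _ cz; apply: smooth_atM; first exact: smooth_fstV.
    by apply: smooth_fun_comp => //; exact: flow_smooth.
  have [s _] := pint_smooth (@fin_dim_mx R 1 m) (@ler01 R) (@chart_img_open _ _ _ c) sF.
  exact: (smooth_on_at (@chart_img_open _ _ _ c) cy s).
move=> x; pose G (t : R) := g (act t x).
have sG (t : R) : smooth_at G t by exact: smooth_fun_orbit.
have sF (t s : R) : 0 <= t <= 1 -> [set: R] s ->
    smooth_at (fun p : R^o * R^o => p.1 * G (p.1 + p.2)) ((t : R^o), (s : R^o)).
  move=> _ _; apply: smooth_atM; first exact: smooth_fst.
  apply: (@smooth_at_comp _ _ _ _ (fun p : R^o * R^o => p.1 + p.2 : R) G) => //.
    exact: fin_dim_scalar.
  by apply: smooth_atD; [exact: smooth_fst|exact: smooth_snd].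
have [_ d] := pint_smooth (@fin_dim_scalar R) (@ler01 R) (@openT R) sF.
rewrite /lie (_ : (fun s : R => _) = fun s : R => pint 0 1 (fun t => t * G (t + s))); last first.
  by apply/funext => s; apply: eq_pint => t _; rewrite /G actD.
apply: etrans (d 0 1 I) _.
pose F (t : R) := t * G t.
have sFF (t : R) : smooth_at F t by apply: smooth_atM; [exact: smooth_at_id|exact: sG].
have cont (h : R -> R) : (forall t : R, smooth_at h t) -> cont_on 0 1 h.
  by move=> sh t _; exact: smooth_at_continuous.
rewrite (eq_pint (g := fun t => 'D_1 F t - G t)) => [|t _].
  rewrite pintB; [|by apply: cont => t; exact: smooth_at_derive|exact: cont].
  rewrite (pint_FTC ler01 _ (fun (t : R) _ => @smooth_is_derive R R^o R^o F t 1 (sFF t))).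
    by rewrite /F mul1r mul0r subr0 /G act1.
  by apply: cont => t; exact: smooth_at_derive.
have s1 : smooth_at (fun p : R^o * R^o => p.1 : R) ((t : R^o), (0 : R^o)) by exact: smooth_fst.
have s0 : smooth_at (fun p : R^o * R^o => p.2 : R) ((t : R^o), (0 : R^o)) by exact: smooth_snd.
have s2 : smooth_at (fun p : R^o * R^o => p.1 + p.2 : R) ((t : R^o), (0 : R^o)) by exact: smooth_atD.
have s3 : smooth_at (fun p : R^o * R^o => G (p.1 + p.2)) ((t : R^o), (0 : R^o)).
  by apply: (@smooth_at_comp _ _ _ _ (fun p : R^o * R^o => p.1 + p.2 : R) G) => //; exact: fin_dim_scalar.
have d2 : 'D_(0, 1) (fun p : R^o * R^o => p.1 + p.2 : R) ((t : R^o), (0 : R^o)) = 1.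
  apply: etrans (deriveD (smooth_at_derivable s1) (smooth_at_derivable s0)) _.
  by rewrite derive_fst derive_snd add0r.
have d3 : 'D_(0, 1) (fun p : R^o * R^o => G (p.1 + p.2)) ((t : R^o), (0 : R^o)) = 'D_1 G t.
  rewrite (@derive_comp _ _ _ _ G (fun p : R^o * R^o => p.1 + p.2 : R)).
  - by rewrite d2 /= addr0.
  - exact: smooth_at_differentiable.
  - by apply: smooth_at_differentiable; exact: sG.
apply: etrans (deriveM (smooth_at_derivable s1) (smooth_at_derivable s3)) _.
rewrite d3 derive_fst scaler0 addr0.
have dF : 'D_1 F t = t *: 'D_1 G t + G t *: 1.
  apply: etrans (deriveM (smooth_at_derivable (smooth_at_id t)) (smooth_at_derivable (sG t))) _.
  by rewrite derive_id.
rewrite dF; have alg (a b : R) : a = a + b * 1 - b by ring.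
exact: alg.
Qed.

(* [g] is the value on [X] of the closed 1-form with local primitives [f i]. *)
Lemma contractible_integral0 n (C : 'I_n -> ccube M) (f : 'I_n -> M -> R) (s : 'I_n -> 'I_n -> R)
    (g : M -> R) x :
  (forall x, exists i, cin 1 (C i) x) -> (forall i, smooth_fun (f i)) -> smooth_fun g ->
  (forall i j x, cin 1 (C i) x -> cin 1 (C j) x -> f i x - f j x = s i j) ->
  (forall i x, cin 1 (C i) x -> lie (f i) x = g x) ->
  contractible_orbit act x -> pint 0 1 (fun t => g (act t x)) = 0.
Proof.
move=> cov sf sg fs Lf [H [p [cH pH H0 H1]]].
pose G (q : R * R) := H (clamp q.1, q.2).
have cG : continuous G.
  move=> q; apply: (within_comp (g := fun q : R * R => (clamp q.1, q.2)) cH) => [|v /=]; last exact: clamp_itv.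
  apply: (@cont_pair _ R R (fun q : R * R => clamp q.1)); last exact: cvg_snd.
  by apply: (@continuous_comp _ _ _ (fun q : R * R => q.1) clamp); [exact: cvg_fst|exact: clamp_cont].
have [N HN] := square_cover cG (fun i => @cin_open _ _ _ 1 (C i)) cov.
have n0 : 0 < N.+1%:R :> R by rewrite ltr0n.
pose tm (j : nat) : R := j%:R / N.+1%:R.
have tm1 : tm N.+1 = 1 by rewrite /tm divff// gt_eqF.
have tm0 : tm 0%N = 0 by rewrite /tm mul0r.
have tmle j : tm j <= tm j.+1 by rewrite /tm ler_pM2r ?invr_gt0// ler_nat.
pose P i j := G (tm i, tm j).
have [E HE] := exists_increment fs.
have per i : P i N.+1 = P i 0%N by rewrite /P /G /= tm1 tm0 -(add0r 1) pH// clamp_itv.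
have cst j : P N.+1 j = P N.+1 0%N by rewrite /P /G /= tm1 clamp_ge1// !H1.
have HP i j : (i <= N)%N -> (j <= N)%N -> exists k,
     [/\ cin 1 (C k) (P i j), cin 1 (C k) (P i.+1 j), cin 1 (C k) (P i j.+1) & cin 1 (C k) (P i.+1 j.+1)].
  move=> iN jN; have [k Hk] := HN i j iN jN; exists k.
  by split; apply: Hk; rewrite -/(tm _) -/(tm _) ?lexx ?tmle.
have S0 := grid_increment HP per cst HE.
have [T dT] := exists_primitive (fun t : R => smooth_at_continuous (smooth_fun_orbit x t sg)).
have cg (a b : R) : cont_on a b (fun t => g (act t x)).
  by move=> t _; apply: smooth_at_continuous; exact: smooth_fun_orbit.
(* On a small arc of the orbit the local primitive f k has derivative g, so its increment is the
   integral of g over that arc. *)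
have EP j : (j <= N)%N -> E (P 0%N j.+1) (P 0%N j) = T (tm j.+1) - T (tm j).
  move=> jN; have [k Hk] := HN 0%N j (leq0n N) jN.
  have Hk' t : tm j <= t <= tm j.+1 -> cin 1 (C k) (act t x).
    move=> tj; have := Hk 0 t; rewrite /G /= clamp_le0// H0; apply=> //.
    by rewrite mul0r lexx divr_ge0// ler0n.
  have e l : P 0%N l = act (tm l) x by rewrite /P /G /= tm0 clamp_le0// H0.
  have k1 : cin 1 (C k) (act (tm j) x) by apply: Hk'; rewrite lexx tmle.
  have k2 : cin 1 (C k) (act (tm j.+1) x) by apply: Hk'; rewrite lexx tmle.
  rewrite !e (HE k)// -(pint_FTC (tmle j) (cg _ _) (fun t _ => dT t)).
  apply/esym; apply: (pint_FTC (F := fun t : R => f k (act t x)) (tmle j) (cg _ _)) => t /Hk' kt.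
  by rewrite -(Lf k _ kt) -lie_orbit//; apply: (@smooth_is_derive R R^o R^o); exact: smooth_fun_orbit.
transitivity (T (tm N.+1) - T (tm 0%N)).
  by rewrite tm1 tm0; exact: (pint_FTC ler01 (cg _ _) (fun t _ => dT t)).
rewrite -(telescope_sumr (fun j => T (tm j)) (leq0n N.+1)) -[RHS]S0.
by apply: esym; apply: eq_big_nat => j /andP[_ jN]; rewrite EP.
Qed.

Lemma contractible_lie_exact n (C : 'I_n -> ccube M) (f : 'I_n -> M -> R) (s : 'I_n -> 'I_n -> R)
    (g : M -> R) : (forall x, contractible_orbit act x) ->
  (forall x, exists i, cin 1 (C i) x) -> (forall i, smooth_fun (f i)) -> smooth_fun g ->
  (forall i j x, cin 1 (C i) x -> cin 1 (C j) x -> f i x - f j x = s i j) ->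
  (forall i x, cin 1 (C i) x -> lie (f i) x = g x) ->
  exists2 phi, smooth_fun phi & forall x, lie phi x = g x.
Proof.
move=> contr cov sf sg fs Lf; have [sp lp] := lie_average sg.
exists (fun x => pint 0 1 (fun t => t * g (act t x))) => // x.
by rewrite lp (contractible_integral0 cov sf sg fs Lf (contr x)) subr0.
Qed.

End Functions.

Section Contraction.
Context {R : realType} {m : nat} {M : manifold R m.+2}.
Variable act : R -> M -> M.
Hypothesis sact : smooth_circle_action act.
Notation X := (action_field act).

Definition contract_top (a : preform M m.+2) : preform M m.+1 := fun c y v => a c y (cons_row (X c y) v).

(** The product of du with i_X vol is (X u) vol by [det_cons_identity]; the other term of the
    Leibniz rule drops out because i_X vol is closed. *)
Lemma ext_d_scale_contract (vol : preform M m.+2) u : is_form vol -> is_form (contract_top vol) ->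
  closed_form (contract_top vol) -> smooth_fun u ->
  form_eq (ext_d (form_scale u (contract_top vol))) (form_scale (lie act u) vol).
Proof.
move=> fv fi di su c ac y cy v; rewrite ext_d_scale// di// /form_zero mulr0 add0r.
rewrite /form_scale (lieE sact su ac cy).
have [ma aa] : multilinear (vol c y) /\ alternating (vol c y) by have [H _ _] := fv c ac; exact: H.
rewrite (top_form_det ma aa v) (derive_coords _ (su c ac y cy)) mulrCA det_cons_identity mulr_sumr.
apply: eq_bigr => i _; rewrite (derive_coords _ (su c ac y cy)) /contract_top (top_form_det ma aa).
have alg (a b d e : R) : a * (b * (d * e)) = d * (a * (b * e)) by ring.
exact: alg.
Qed.

End Contraction.

(** * Powers of a 2-form *)

Section Lifting.

Lemma lift0_perm_inj n : injective (@lift0_perm n).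
Proof.
move=> s t e; apply/permP => k; apply: (@lift_inj _ (0 : 'I_n.+1)).
by rewrite -!lift0_perm_lift e.
Qed.

Lemma lift0_perm_surj n (s : 'S_n.+1) : s 0 = 0 -> exists t, s = lift0_perm t.
Proof.
move=> s0; pose f k := odflt k (unlift 0 (s (lift 0 k))).
have fK k : lift 0 (f k) = s (lift 0 k).
  rewrite /f; case: unliftP => [j ->//|/= e].
  by have := perm_inj (etrans e (esym s0)) => /eqP; rewrite eq_sym (negbTE (neq_lift _ _)).
have fi : injective f.
  by move=> k l e; apply: (@lift_inj _ (0 : 'I_n.+1)); apply: (@perm_inj _ s); rewrite -!fK e.
exists (perm fi); apply/permP => k; case: (unliftP 0 k) => [j ->|->].
  by rewrite lift0_perm_lift permE fK.
by rewrite lift0_perm0.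
Qed.

Lemma sum_lift0_perm (R : realType) n (F : 'S_n.+1 -> R) :
  \sum_(s : 'S_n.+1 | s 0 == 0) F s = \sum_t F (lift0_perm t).
Proof.
rewrite (reindex (@lift0_perm n)).
  by apply: eq_bigl => t; rewrite lift0_perm0 eqxx.
exists (fun s => odflt 1%g [pick t | lift0_perm t == s]) => [t _|s]; case: pickP => [t'|H] /=.
- by move=> /eqP /lift0_perm_inj.
- by have := H t; rewrite eqxx.
- by move=> /eqP.
- by rewrite inE => /eqP /lift0_perm_surj[t e]; have := H t; rewrite e eqxx.
Qed.

Lemma odd_lift0_perm n (s : 'S_n) : lift0_perm s = s :> bool.
Proof. by rewrite odd_lift_perm. Qed.

(** Fixing the first p indices embeds the inner antisymmetrisation of a tensor product in the outer
    one. *)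
Fixpoint liftn p q : 'S_q -> 'S_(p + q) :=
  match p return 'S_q -> 'S_(p + q) with
  | 0 => fun s => s
  | p'.+1 => fun s => @lift0_perm (p' + q) (@liftn p' q s)
  end.

Lemma odd_liftn p q (s : 'S_q) : liftn p s = s :> bool.
Proof. by elim: p => //= p IH; rewrite odd_lift0_perm. Qed.

Lemma liftn_lshift p q (s : 'S_q) (i : 'I_p) : liftn p s (lshift q i) = lshift q i.
Proof.
elim: p i => [[]//|p IH] i /=; case: (unliftP ord0 i) => [j ->|->].
  have e : lshift q (lift ord0 j) = lift ord0 (lshift q j) :> 'I_(p + q).+1 by apply: val_inj.
  rewrite e; apply: etrans (lift0_perm_lift (liftn p s) (lshift q j)) _; rewrite IH; exact: val_inj.
have e : lshift q ord0 = 0 :> 'I_(p + q).+1 by apply: val_inj.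
by rewrite e lift0_perm0.
Qed.

Lemma liftn_rshift p q (s : 'S_q) (i : 'I_q) : liftn p s (rshift p i) = rshift p (s i).
Proof.
elim: p => [|p IH] /=; first by apply: val_inj => /=; congr (nat_of_ord (s _)); apply: val_inj.
have e (j : 'I_q) : rshift p.+1 j = lift ord0 (rshift p j) :> 'I_(p + q).+1 by apply: val_inj.
by rewrite !e; apply: etrans (lift0_perm_lift (liftn p s) (rshift p i)) _; rewrite IH.
Qed.

End Lifting.

Section Alternation.
Context {R : realType} {m : nat}.

Lemma row_row_perm k (s : 'S_k) (V : 'M[R]_(k, m)) i : row i (row_perm s V) = row (s i) V.
Proof. by apply/rowP => j; rewrite !mxE. Qed.

Lemma row_perm_mul k (s : 'S_k) (V : 'M[R]_(k, m)) (N : 'M[R]_m) : row_perm s V *m N = row_perm s (V *m N).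
Proof. by rewrite !row_permE mulmxA. Qed.

Lemma row_perm_set_row k (s : 'S_k) l x (V : 'M[R]_(k, m)) :
  row_perm s (set_row l x V) = set_row ((s^-1)%g l) x (row_perm s V).
Proof.
apply/row_matrixP => i; rewrite row_row_perm !row_set_row row_row_perm.
have -> // : (i == (s^-1)%g l) = (s i == l) by rewrite -[LHS](inj_eq (@perm_inj _ s)) permKV.
Qed.

Definition alt k (T : 'M[R]_(k, m) -> R) (V : 'M[R]_(k, m)) : R :=
  \sum_(s : 'S_k) (-1) ^+ s * T (row_perm s V).

Lemma alt_multilinear k (T : 'M[R]_(k, m) -> R) : multilinear T -> multilinear (alt T).
Proof.
move=> mT; apply: multilinear_of_set_row => l a b x y V.
rewrite /alt !mulr_sumr -big_split; apply: eq_bigr => s _ /=.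
rewrite (row_perm_set_row s l (a *: x + b *: y) V) (row_perm_set_row s l x V) (row_perm_set_row s l y V).
rewrite (multilinear_set_row mT); have alg (e p q : R) : e * (a * p + b * q) = a * (e * p) + b * (e * q) by ring.
exact: alg.
Qed.

Lemma alt_alternating k (T : 'M[R]_(k, m) -> R) : alternating (alt T).
Proof.
move=> V i j ij e.
have E : alt T V = - alt T V.
  rewrite {1}/alt (reindex_inj (mulIg (tperm i j))) /= /alt -sumrN; apply: eq_bigr => s _.
  rewrite odd_permM odd_tperm ij addbT signrN mulNr row_permM; congr (- (_ * T (row_perm s _))).
  apply/row_matrixP => l; rewrite row_row_perm; case: tpermP => // ->//.
lra.
Qed.

Lemma alt_mul k (T T' : 'M[R]_(k, m) -> R) (N : 'M[R]_m) V : (forall W, T W = T' (W *m N)) ->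
  alt T V = alt T' (V *m N).
Proof. by move=> e; apply: eq_bigr => s _; rewrite e row_perm_mul. Qed.

Lemma usubmx_liftn p q (s : 'S_q) (V : 'M[R]_(p + q, m)) : usubmx (row_perm (liftn p s) V) = usubmx V.
Proof. by apply/matrixP => i j; rewrite !mxE liftn_lshift. Qed.

Lemma dsubmx_liftn p q (s : 'S_q) (V : 'M[R]_(p + q, m)) :
  dsubmx (row_perm (liftn p s) V) = row_perm s (dsubmx V).
Proof. by apply/matrixP => i j; rewrite !mxE liftn_rshift. Qed.

(** A permutation of the last q arguments, lifted by [liftn], is absorbed in the outer sum by
    translation, so each of the q! inner terms contributes the same. *)
Lemma alt_alt p q (f : 'M[R]_(p, m) -> R) (T : 'M[R]_(q, m) -> R) (V : 'M[R]_(p + q, m)) :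
  alt (fun V => f (usubmx V) * alt T (dsubmx V)) V =
  q`!%:R * alt (fun V => f (usubmx V) * T (dsubmx V)) V.
Proof.
rewrite {1}/alt /alt.
under eq_bigr do rewrite mulr_sumr mulr_sumr.
rewrite exchange_big /=.
rewrite (eq_bigr (fun=> alt (fun V => f (usubmx V) * T (dsubmx V)) V)) => [|t _].
  by rewrite sumr_const card_Sn mulr_natl.
rewrite /alt [RHS](reindex_inj (mulgI (liftn p t))) /=; apply: eq_bigr => s _.
rewrite odd_permM odd_liftn signr_addb row_permM usubmx_liftn dsubmx_liftn.
have alg (e1 e2 e3 e4 : R) : e1 * (e2 * (e3 * e4)) = e3 * e1 * (e2 * e4) by ring.
exact: alg.
Qed.

(** The tensor power of w. Wedge powers are multiples of its alternation, where the symmetries are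
    easier to use than in the iterated wedge. *)
Fixpoint pairings (w : 'M[R]_(2, m) -> R) k : 'M[R]_(k.*2, m) -> R :=
  match k return 'M[R]_(k.*2, m) -> R with
  | 0 => fun _ => 1
  | k'.+1 => fun V : 'M[R]_(2 + k'.*2, m) => w (usubmx V) * @pairings w k' (dsubmx V)
  end.

Lemma usubmx_set_row p q (i : 'I_p) x (V : 'M[R]_(p + q, m)) :
  usubmx (set_row (lshift q i) x V) = set_row i x (usubmx V) /\
  dsubmx (set_row (lshift q i) x V) = dsubmx V.
Proof.
by split; apply/matrixP => l j; rewrite !mxE ?(inj_eq (@lshift_inj _ _)) ?eq_rlshift.
Qed.

Lemma dsubmx_set_row p q (i : 'I_q) x (V : 'M[R]_(p + q, m)) :
  usubmx (set_row (rshift p i) x V) = usubmx V /\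
  dsubmx (set_row (rshift p i) x V) = set_row i x (dsubmx V).
Proof.
by split; apply/matrixP => l j; rewrite !mxE ?(inj_eq (@rshift_inj _ _)) ?eq_lrshift.
Qed.

Lemma multilinear_tensor p q (f : 'M[R]_(p, m) -> R) (T : 'M[R]_(q, m) -> R) :
  multilinear f -> multilinear T -> multilinear (fun V : 'M[R]_(p + q, m) => f (usubmx V) * T (dsubmx V)).
Proof.
move=> mf mT; apply: multilinear_of_set_row => i a b x y V; case: (split_ordP i) => j ->.
  by rewrite !(usubmx_set_row j _ V).1 !(usubmx_set_row j _ V).2 (multilinear_set_row mf); ring.
by rewrite !(dsubmx_set_row j _ V).1 !(dsubmx_set_row j _ V).2 (multilinear_set_row mT); ring.
Qed.

Lemma pairings_multilinear w k : multilinear w -> multilinear (@pairings w k).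
Proof.
move=> mw; elim: k => [|k IH] /=; first by case.
exact: (multilinear_tensor mw IH).
Qed.

Lemma pairings_mul (w w' : 'M[R]_(2, m) -> R) (N : 'M[R]_m) k V : (forall v, w v = w' (v *m N)) ->
  @pairings w k V = pairings w' (V *m N).
Proof.
move=> e; elim: k V => //= k IH V; by rewrite e IH mul_usub_mx mul_dsub_mx.
Qed.

(* Permutations of the arguments under which the pairings are antisymmetric,
   e.g. those that permute the pairs. *)
Definition pairing_sym w k (s : 'S_(k.*2)) :=
  forall V, (-1) ^+ s * @pairings w k (row_perm s V) = pairings w V.

Lemma pairing_symM w k (s t : 'S_(k.*2)) : pairing_sym w s -> pairing_sym w t -> pairing_sym w (s * t)%g.
Proof.
by move=> hs ht V; rewrite odd_permM signr_addb row_permM -mulrA mulrCA hs ht.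
Qed.

Lemma pairing_sym_liftn w k (s : 'S_(k.*2)) : pairing_sym w s -> @pairing_sym w k.+1 (liftn 2 s).
Proof.
move=> hs V; apply: etrans (f_equal (fun b : bool => (-1) ^+ b * _) (odd_liftn 2 s)) _.
by rewrite /= usubmx_liftn dsubmx_liftn mulrCA hs.
Qed.

Lemma pairing_sym1 w k : @pairing_sym w k 1%g.
Proof. by move=> V; rewrite odd_perm1 mul1r row_perm1. Qed.

Lemma pairing_sym_pair w k : multilinear w -> alternating w ->
  @pairing_sym w k.+1 (tperm (lshift k.*2 (0 : 'I_2)) (lshift k.*2 1)).
Proof.
move=> mw aw V; set t := tperm _ _.
have o : t = true :> bool by rewrite odd_tperm (inj_eq (@lshift_inj _ _)).
apply: etrans (f_equal (fun b : bool => (-1) ^+ b * _) o) _.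
rewrite expr1 mulN1r /=.
have -> : dsubmx (row_perm t V : 'M[R]_(2 + k.*2, m)) = dsubmx (V : 'M[R]_(2 + k.*2, m)).
  by apply/matrixP => i j; rewrite !mxE tpermD// eq_lrshift.
have -> : usubmx (row_perm t V : 'M[R]_(2 + k.*2, m)) =
    col_mx (row 1 (usubmx (V : 'M[R]_(2 + k.*2, m)))) (row 0 (usubmx (V : 'M[R]_(2 + k.*2, m)))) :> 'M[R]_(2, m).
  apply/row_matrixP => i; have [->|->] : i = 0 \/ i = 1 by case: i => [[|[|]]]// H; [left|right]; apply: val_inj.
    by rewrite row0_col_mx; apply/rowP => j; rewrite !mxE tpermL.
  by rewrite row1_col_mx; apply/rowP => j; rewrite !mxE tpermR.
rewrite (alternating2C mw aw) mulNr opprK; congr (w _ * _).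
by rewrite -mx2_rows.
Qed.

Definition ord4 k (i : nat) (H : (i < 4)%N) : 'I_(k.+2.*2) := Ordinal (leq_trans H (isT : (4 <= k.+2.*2)%N)).

(** Exchanging the first two pairs is an even permutation and only commutes two factors. *)
Lemma pairing_sym_swap w k :
  @pairing_sym w k.+2 (tperm (@ord4 k 0 isT) (@ord4 k 2 isT) * tperm (@ord4 k 1 isT) (@ord4 k 3 isT))%g.
Proof.
move=> V; set t := (_ * _)%g.
have o : t = false :> bool by rewrite odd_permM !odd_tperm.
apply: etrans (f_equal (fun b : bool => (-1) ^+ b * _) o) _; rewrite expr0 mul1r.
have tE (i : 'I_(k.+2.*2)) : t i = if i == 0%N :> nat then ord4 k (isT : 2 < 4)%N else
   if i == 1%N :> nat then ord4 k (isT : 3 < 4)%N else if i == 2%N :> nat then ord4 k (isT : 0 < 4)%N else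
   if i == 3%N :> nat then ord4 k (isT : 1 < 4)%N else i.
  by case: i => [[|[|[|[|i]]]] H] /=; apply: val_inj; rewrite permM !permE.
pose U : 'M[R]_(2 + k.+1.*2, m) := V; pose U' : 'M[R]_(2 + k.+1.*2, m) := row_perm t V.
pose D : 'M[R]_(2 + k.*2, m) := dsubmx U; pose D' : 'M[R]_(2 + k.*2, m) := dsubmx U'.
have e1 : usubmx U' = usubmx D.
  by apply/matrixP => i j; rewrite !mxE; congr (V _ _); apply: val_inj; rewrite tE; case: i => [[|[|]]].
have e2 : usubmx D' = usubmx U.
  by apply/matrixP => i j; rewrite !mxE; congr (V _ _); apply: val_inj; rewrite tE; case: i => [[|[|]]].
have e3 : dsubmx D' = dsubmx D.
  by apply/matrixP => i j; rewrite !mxE; congr (V _ _); apply: val_inj; rewrite tE.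
have -> : pairings w (row_perm t V) = w (usubmx U') * (w (usubmx D') * pairings w (dsubmx D')) by [].
by rewrite e1 e2 e3 mulrCA.
Qed.

(** Swaps inside a pair and of neighbouring pairs, propagated by [liftn], bring any slot to the
    front. *)
Lemma pairing_sym_transitive w k (p : 'I_(k.+1.*2)) : multilinear w -> alternating w ->
  exists s : 'S_(k.+1.*2), s p = ord0 /\ pairing_sym w s.
Proof.
move=> mw aw; elim: k p => [|k IH] p.
  case: p => [[|[|]]]// H.
    by exists 1%g; split; [rewrite perm1; apply: val_inj|exact: pairing_sym1].
  exists (tperm (lshift 0 (0 : 'I_2)) (lshift 0 1)); split; last exact: pairing_sym_pair.
  rewrite (_ : Ordinal H = lshift 0 (1 : 'I_2)); last exact: val_inj.
  by rewrite tpermR; apply: val_inj.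
case: (@split_ordP 2 k.+1.*2 p) => i ->.
  have [->|->] : i = 0 \/ i = 1 by case: i => [[|[|]]]// H; [left|right]; apply: val_inj.
    by exists 1%g; split; [rewrite perm1; apply: val_inj|exact: pairing_sym1].
  exists (tperm (lshift _ (0 : 'I_2)) (lshift _ 1)); split; last exact: pairing_sym_pair.
  by rewrite tpermR; apply: val_inj.
have [s [s0 hs]] := IH i.
exists ((liftn 2 s : 'S_(k.+2.*2)) * (tperm (@ord4 k 0 isT) (@ord4 k 2 isT) * tperm (@ord4 k 1 isT) (@ord4 k 3 isT)))%g.
split; last by apply: pairing_symM; [exact: pairing_sym_liftn|exact: pairing_sym_swap].
rewrite permM (liftn_rshift 2 s i) s0 permM.
rewrite (_ : rshift 2 ord0 = @ord4 k 2 isT); last exact: val_inj.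
by rewrite tpermR tpermD//; apply: val_inj.
Qed.

Lemma usubmx_cons_row k x (V : 'M[R]_(1 + k, m)) :
  usubmx (cons_row x V : 'M[R]_(2 + k, m)) = col_mx x (usubmx V) :> 'M[R]_(2, m).
Proof.
apply/row_matrixP => i; have [->|->] : i = 0 \/ i = 1 by case: i => [[|[|]]]// H; [left|right]; apply: val_inj.
  rewrite row0_col_mx -[RHS](row_cons_row0 x V); apply/rowP => j; rewrite !mxE; congr (match unlift ord0 _ with Some l => V l j | None => _ end).
  exact: val_inj.
rewrite row1_col_mx; transitivity (row (lift ord0 (ord0 : 'I_(1 + k))) (cons_row x V)).
  by apply/rowP => j; rewrite [LHS]mxE [LHS]mxE [RHS]mxE; congr (cons_row x V _ j); apply: val_inj.
by rewrite row_cons_rowS; apply/rowP => j; rewrite !mxE; congr (V _ j); apply: val_inj.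
Qed.

Lemma dsubmx_cons_row k x (V : 'M[R]_(1 + k, m)) :
  dsubmx (cons_row x V : 'M[R]_(2 + k, m)) = dsubmx V.
Proof.
apply/matrixP => i j; rewrite mxE [RHS]mxE.
rewrite (_ : rshift 2 i = lift ord0 (rshift 1 i)); last exact: val_inj.
by rewrite cons_row_entryS.
Qed.

Lemma row_perm_cons_row k (s : 'S_k) x (V : 'M[R]_(k, m)) :
  row_perm (lift0_perm s) (cons_row x V) = cons_row x (row_perm s V).
Proof.
apply/row_matrixP => i; rewrite row_row_perm; case: (unliftP ord0 i) => [j ->|->].
  by rewrite (lift0_perm_lift s j) !row_cons_rowS row_row_perm.
by rewrite (lift0_perm0 s) !row_cons_row0.
Qed.

(* Every slot of [pairings w] contributes equally, by [pairing_sym_transitive]. *)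
Lemma alt_pairings_cons w k x (V : 'M[R]_(1 + k.*2, m)) : multilinear w -> alternating w ->
  alt (@pairings w k.+1) (cons_row x V) =
  k.+1.*2%:R * alt (fun V : 'M[R]_(1 + k.*2, m) => w (col_mx x (usubmx V)) * pairings w (dsubmx V)) V.
Proof.
move=> mw aw; pose F (s : 'S_(k.+1.*2)) := (-1) ^+ s * pairings w (row_perm s (cons_row x V)).
have FM s t : pairing_sym w s -> F (s * t)%g = F t.
  by move=> hs; rewrite /F odd_permM signr_addb row_permM -mulrA mulrCA hs.
have E (p : 'I_(k.+1.*2)) : \sum_(s : 'S_(k.+1.*2) | s p == ord0) F s = \sum_(s : 'S_(k.+1.*2) | s ord0 == ord0) F s.
  have [t [t0 ht]] := pairing_sym_transitive p mw aw.
  rewrite (reindex_inj (mulgI t)) /=; apply: eq_big => [s|s _]; first by rewrite permM t0.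
  exact: FM.
rewrite /alt (partition_big (fun s : 'S_(k.+1.*2) => (s^-1)%g ord0) xpredT)//=.
rewrite (eq_bigr (fun=> \sum_(s : 'S_(k.+1.*2) | s ord0 == ord0) F s)) => [|p _].
  rewrite sumr_const card_ord mulr_natl; congr (_ *+ _).
  apply: etrans (sum_lift0_perm F) _; apply: eq_bigr => s _.
  rewrite /F; apply: etrans (f_equal (fun b : bool => (-1) ^+ b * _) (odd_lift0_perm s)) _.
  congr (_ * _); apply: etrans (f_equal (fun W => @pairings w k.+1 W) (row_perm_cons_row s x V)) _.
  by rewrite /= usubmx_cons_row dsubmx_cons_row.
rewrite -(E p); apply: eq_bigl => s; rewrite -[LHS](inj_eq (@perm_inj _ s)) permKV eq_sym.
by [].
Qed.

End Alternation.

Section Wedge_powers.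
Context {R : realType} {m : nat} {M : manifold R m}.

Lemma wedge_alt p q (a : preform M p) (b : preform M q) (T : 'M[R]_(q, m) -> R) (s : R) c y V :
  (forall W, b c y W = s * alt T W) ->
  wedge a b c y V = (p`!%:R * q`!%:R)^-1 * s * q`!%:R *
    alt (fun V : 'M[R]_(p + q, m) => a c y (usubmx V) * T (dsubmx V)) V.
Proof.
move=> hb; rewrite /wedge -!mulrA -alt_alt; congr (_ * _).
rewrite /alt mulr_sumr; apply: eq_bigr => t _; rewrite hb /alt.
have alg (e1 e2 e3 : R) : e1 * (e2 * (s * e3)) = s * (e1 * (e2 * e3)) by ring.
exact: alg.
Qed.

Lemma wedge_powE (w : preform M 2) k : exists s : R, forall c y V,
  wedge_pow w k c y V = s * alt (@pairings R m (w c y) k) V.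
Proof.
elim: k => [|k [s IH]].
  exists 1 => c y V; rewrite mul1r /alt /= (big_pred1 1%g) ?odd_perm1 ?mulr1// => t.
  by rewrite /= eq_sym; apply/esym/eqP/permP; case.
exists ((2`!%:R * (k.*2)`!%:R)^-1 * s * (k.*2)`!%:R) => c y V.
exact: (wedge_alt w V (IH c y)).
Qed.

Lemma is_form_eq k (a b : preform M k) : form_eq a b -> is_form a -> is_form b.
Proof.
move=> e fa c ac; have [H1 _ H3] := fa c ac; split.
- move=> y cy; have -> : b c y = a c y by apply/funext => v; rewrite e.
  exact: H1.
- move=> v; apply/smooth_onP; first exact: chart_img_open.
  move=> y cy; have n : nbhs y (chart_img c) by apply: open_nbhs_nbhs; split=> //; exact: chart_img_open.
  have n' : \forall z \near y, a c z v = b c z v by apply: filterS n => z cz; exact: e.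
  by apply: smooth_at_near n' _; exact: form_smooth.
- move=> c' ac' y H v; have [cy _] := H.
  by rewrite -e// -e//; [exact: H3|exact: overlap_img].
Qed.

Definition power_form (w : preform M 2) k : preform M k.*2 := fun c y V => alt (@pairings R m (w c y) k) V.

Arguments power_form w k : clear implicits.

Lemma power_form_form w k : is_form w -> is_form (power_form w k).
Proof.
move=> fw c ac; have [H1 H2 H3] := fw c ac; split.
- move=> y cy; have [mw aw] := H1 y cy.
  by split; [apply: alt_multilinear; exact: pairings_multilinear|exact: alt_alternating].
- move=> v; apply/smooth_onP; first exact: chart_img_open.
  move=> y cy; apply: smooth_at_sum => s _; apply: smooth_atM; first exact: smooth_at_cst.
  elim: k {v} s (row_perm s v) => [|k IH] s W; first exact: smooth_at_cst.
  by apply: smooth_atM; [exact: form_smooth|exact: (IH 1%g)].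
- move=> c' ac' y H v; apply: alt_mul => W; apply: pairings_mul => u; exact: H3.
Qed.

Variable act : R -> M -> M.
Hypothesis sact : smooth_circle_action act.

Lemma power_form_shift w k t c y V : (forall u, shift act t w c y u = w c y u) ->
  atlas c -> chart_img c y -> shift act t (power_form w k) c y V = power_form w k c y V.
Proof.
move=> hw ac cy.
have [N HN] := flow_jac sact ac cy (chart_at_atlas _) (chart_at_dom (flow act c (t, y))).
have E j (a : preform M j) W : shift act t a c y W =
    a (chart_at (flow act c (t, y))) (chart_at (flow act c (t, y)) (flow act c (t, y))) (W *m N).
  by rewrite /shift /mpull (HN _ _).1.
rewrite E; apply/esym; apply: alt_mul => W; apply: pairings_mul => u.
by rewrite -E hw.
Qed.

End Wedge_powers.

Arguments power_form {R m M} w k.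

Section Invariant_volume.
Context {R : realType} {m : nat} {M : manifold R m.+2}.
Variable act : R -> M -> M.
Hypothesis sact : smooth_circle_action act.
Variable vol : preform M m.+2.
Hypothesis vol_form : is_form vol.
Hypothesis vol_inv : forall t c y V, atlas c -> chart_img c y -> shift act t vol c y V = vol c y V.

(** A top form is its coefficient times the determinant, and the differential of the coefficient
    times the determinant is 0 by [det_cofactor_identity]. *)
Lemma top_closed : closed_form vol.
Proof.
move=> c ac y cy V.
have H z : chart_img c z -> multilinear (vol c z) /\ alternating (vol c z).
  by move=> cz; have [G _ _] := vol_form ac; exact: G.
rewrite /form_zero -[RHS](det_cofactor_identity (\col_j 'D_('e_j) (fun z => vol c z 1%:M) y) V).
have s1 := form_smooth 1%:M vol_form ac cy.
apply: eq_bigr => i _; congr (_ * _); rewrite -derive_coords//.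
have n : nbhs y (chart_img c) by apply: open_nbhs_nbhs; split=> //; exact: chart_img_open.
have n' : \forall z \near y, vol c z 1%:M * \det (row' i V) = vol c z (row' i V).
  by apply: filterS n => z cz; have [ma aa] := H z cz; rewrite [RHS](top_form_det ma aa).
rewrite -(near_eq_derive _ n').
rewrite (deriveM (smooth_at_derivable s1) (smooth_at_derivable (smooth_at_cst _ _))).
by rewrite derive_cst scaler0 add0r; exact: mulrC.
Qed.

(** Invariance makes the integrand constant in time. The contraction thereby inherits its regularity
    from [fib_form] and its closedness from [fib_ext_d]. *)
Lemma contract_fib : form_eq (fib act 0 1 vol) (contract_top act vol).
Proof.
move=> c ac y cy v; rewrite fibE//.
rewrite (@eq_pint _ _ _ _ (fun=> contract_top act vol c y v)) => [|r _]; last exact: vol_inv.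
have d (t : R) : 0 <= t <= 1 -> is_derive t 1 (fun t : R => t * contract_top act vol c y v) (contract_top act vol c y v).
  move=> _; have := @line_is_derive R R R id 0 (contract_top act vol c y v) t (smooth_at_differentiable (smooth_at_id _)).
  by rewrite derive_id (_ : (fun s : R => _) = fun t : R => t * contract_top act vol c y v)//; apply/funext => s; rewrite add0r.
by rewrite (pint_FTC ler01 _ d) ?mul1r ?mul0r ?subr0//; exact: cont_on_cst.
Qed.

Lemma contract_form : is_form (contract_top act vol).
Proof. by apply: is_form_eq contract_fib _; exact: fib_form. Qed.

Lemma fib_eq k (a b : preform M k.+1) c y v : form_eq a b -> fib act 0 1 a c y v = fib act 0 1 b c y v.
Proof.
move=> e; apply: eq_pint => r _; apply: e; first exact: chart_at_atlas.
by apply: chart_funP; exact: chart_at_dom.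
Qed.

Lemma fib_zero k c y v : fib act 0 1 (@form_zero R _ M k.+1) c y v = 0.
Proof. exact: pint0. Qed.

Lemma contract_closed : closed_form (contract_top act vol).
Proof.
move=> c ac y cy v; rewrite -(ext_d_eq contract_fib ac cy) fib_ext_d//.
by rewrite !vol_inv// subrr (fib_eq _ _ _ top_closed) fib_zero subr0.
Qed.

(** The two end terms of [fib_ext_d] cancel over a full period, so the fibre integral anticommutes
    with d; hence the sign of the primitive. *)
Lemma contract_exact : exact_form vol -> exact_form (contract_top act vol).
Proof.
move=> [z fz ez]; exists (form_scale (fun=> -1) (fib act 0 1 z)).
  by apply: is_form_scale; [exact: smooth_fun_cst|exact: fib_form].
move=> c ac y cy v; have ff : is_form (fib act 0 1 z) by exact: fib_form.
apply/esym; apply: etrans (ext_d_scale v (smooth_fun_cst (-1)) ff ac cy) _.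
rewrite big1 ?addr0 => [|i _]; last by rewrite derive_cst mul0r mulr0.
rewrite -(contract_fib ac cy) (fib_eq _ _ _ ez) fib_ext_d// shift0// shift1// subrr sub0r.
by rewrite mulN1r opprK.
Qed.

Hypothesis M0 : [set: M] !=set0.
Hypothesis cM : compact [set: M].
Hypothesis coM : connected [set: M].
Hypothesis contr : forall x, contractible_orbit act x.

Lemma contract_top_exact : exact_form (contract_top act vol).
Proof.
apply: (codim1_exact M0 cM coM (L := lie act) (vol := vol)).
- by move=> u; exact: lie_smooth.
- by move=> n u s x; exact: lie_sum.
- by move=> u w x; exact: lie_near.
- by move=> s x; exact: lie_cst.
- exact: vol_form.
- exact: contract_form.
- by move=> u su; apply: ext_d_scale_contract => //; [exact: contract_form|exact: contract_closed].
- exact: contract_exact.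
- by move=> n C f s g; exact: contractible_lie_exact.
Qed.

End Invariant_volume.

Section Lefschetz.
Context {R : realType} {k : nat} {M : manifold R k.*2.+2}.
Variables (w : preform M 2) (act : R -> M -> M).
Hypothesis sact : smooth_circle_action act.
Hypothesis M0 : [set: M] !=set0.
Hypothesis cM : compact [set: M].
Hypothesis coM : connected [set: M].
Hypothesis sw : symplectic_form w.
Hypothesis aw : symplectic_action w act.
Hypothesis contr : forall x, contractible_orbit act x.
Notation al := (contraction (action_field act) w).

Lemma alpha_power_exact : exact_form (wedge al (wedge_pow w k) : preform M (k.*2).+1).
Proof.
have [fw dw _] := sw.
pose vol : preform M k.*2.+2 := power_form w k.+1.
have fv : is_form vol := power_form_form k.+1 fw.
have iv t c y V : atlas c -> chart_img c y -> shift act t vol c y V = vol c y V.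
  by move=> ac cy; apply: (@power_form_shift _ _ _ _ sact w k.+1) => // u; exact: shift_invariant.
have ev := contract_top_exact sact fv iv M0 cM coM contr.
have [s Hs] := wedge_powE w k.
(* The normalisation of the wedge product of alpha with the alternated pairings; the further
   division by 2 (k + 1) accounts for the slots into which X may be inserted. *)
pose d : R := (1`!%:R * (k.*2)`!%:R)^-1 * s * (k.*2)`!%:R.
apply: exact_eq (exact_scale (d / k.+1.*2%:R) ev) => c ac y cy V.
have [mw aw'] : multilinear (w c y) /\ alternating (w c y) by have [H _ _] := fw c ac; exact: H.
apply: etrans (wedge_alt al V (Hs c y)) _; rewrite /form_scale -/d.
have -> : contract_top act vol c y V = k.+1.*2%:R *
    alt (fun V : 'M[R]_(1 + k.*2, k.*2.+2) => w c y (col_mx (action_field act c y) (usubmx V)) * pairings (w c y) (dsubmx V)) V.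
  exact: (alt_pairings_cons (action_field act c y) (V : 'M[R]_(1 + k.*2, k.*2.+2)) mw aw').
by rewrite mulrA divfK// pnatr_eq0.
Qed.

Lemma lefschetz_absurd : free_circle_action act -> weak_lefschetz k.+1 w -> False.
Proof.
move=> fr wl; have [fw dw _] := sw.
have fal : is_form al := contraction_form sact fw.
have z0 : closed_form (@form_zero R _ M 1).
  move=> c ac y cy v; apply: big1 => i _.
  by rewrite [X in 'D__ X _](_ : _ = cst 0) ?derive_cst ?mulr0//; exact/funext.
have [b fb eb] := alpha_power_exact.
have [|g fg eg] := wl al (@form_zero R _ M 1) fal aw (@is_form_zero R _ M 1) z0.
  exists b => // c ac y cy v; rewrite /form_sub [X in _ - X](_ : _ = 0) ?subr0; first exact: eb.
  by rewrite /wedge big1 ?mulr0// => t _; rewrite /form_zero mul0r mulr0.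
apply: (exact_alpha_absurd sact M0 cM sw fr fg) => c ac y cy v.
by rewrite -(eg c ac y cy v) /form_sub /form_zero subr0.
Qed.

End Lefschetz.

(** The dimension is a variable m tied to n by an equation, so that it can be replaced by [k.*2.+2]
    in the type of M. *)
Lemma weak_lefschetz_absurd (R : realType) (n m : nat) (M : manifold R m) (w : preform M 2)
    (act : R -> M -> M) : m = (2 * n)%N ->
  [set: M] !=set0 -> connected [set: M] -> compact [set: M] -> symplectic_form w ->
  weak_lefschetz n w -> smooth_circle_action act -> symplectic_action w act ->
  free_circle_action act -> (forall x, contractible_orbit act x) -> False.
Proof.
move=> mn M0 coM cM sw wl sact aw fr contr.
case: n mn wl => [|k] mn wl.
  (* In dimension 0 tangent vectors have no coordinates, so X vanishes, against freeness. *)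
  have [x _] := M0.
  have /negP := action_field_neq0 sact fr (chart_at_atlas x) (chart_at_dom x); apply; apply/eqP/rowP => j.
  by have := ltn_ord j; rewrite {2}mn.
have e : m = k.*2.+2 by rewrite mn mul2n.
clear mn; subst m; exact: (lefschetz_absurd sact M0 cM coM sw aw contr fr wl).
Qed.

Theorem theorem1p9 (R : realType) (n : nat) (M : manifold R (2 * n))
    (omega : preform M 2) (act : R -> M -> M) :
  [set: M] !=set0 -> connected [set: M] -> compact [set: M] ->
  symplectic_form omega ->
  symplectically_aspherical omega \/ spherically_monotone omega \/
    weak_lefschetz n omega ->
  smooth_circle_action act ->
  symplectic_action omega act ->
  free_circle_action act ->
  exists x : M, ~ contractible_orbit act x.
Proof.
move=> M0 coM cM sw cases sact aw fr; apply: contrapT => no.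
have contr x : contractible_orbit act x by apply: contrapT => nx; apply: no; exists x.
have [fw dw _] := sw.
case: cases => [asph|[[l l0 [s [J [G [cJ cG ->]]] mono]]|wl]].
(* Here sigma is 0, encoded as l = 0 with omega itself as the form s. *)
- apply: (contractible_absurd sact (s := omega) (l := 0) (k := fun=> 0) M0 cM sw aw fr fw _ _ contr).
    by move=> u su; rewrite mul0r; exact: asph.
  by move=> c ac y cy; split=> [|v]; [exact: smooth_at_cst|rewrite derive_cst mul0r].
- have [k Hk] := chern_potential sact fw dw aw cJ cG.
  apply: (contractible_absurd sact (s := chern_form J G) (l := l) (k := fun x => l * k x)
    M0 cM sw aw fr (chern_is_form cJ cG) mono _ contr) => c ac y cy.
  have [sk dk] := Hk c ac y cy; split=> [|v].
    by apply: smooth_atM => //; exact: smooth_at_cst.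
  rewrite (deriveM (smooth_at_derivable (smooth_at_cst l _)) (smooth_at_derivable sk)) derive_cst scaler0 addr0.
  by rewrite dk.
- exact: (weak_lefschetz_absurd (erefl _) M0 coM cM sw wl sact aw fr contr).
Qed.
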